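(* Let $K_0$ be a finite separable extension of $F$, let $n$ be a positive integer, and let $r=r_0p^\nu$ with $\nu\ge0$ and $r_0>1$ prime to $p$. Suppose $r_0$ does not divide $n$. Then there is a constant $C>0$ depending only on $K_0$, $q$, $r$ and $n$ such that for every monic irreducible $\pi\in A$ with $\deg(\pi)>C$ and every finite extension $K$ of $K_0$ with $[K:K_0]=n$, the set $\mathscr{D}(K,r,\pi)$ is empty; i.e. $\bigcup_{[K:K_0]=n}\mathscr{D}(K,r,\pi)=\varnothing$.
   Context: Let $p$ be a prime, $q$ a power of $p$, $A=\mathbb{F}_q[t]$, $F=\mathbb{F}_q(t)$; all extensions lie in a fixed algebraic closure of $F$. For a monic irreducible $\pi\in A$ let $\mathbb{F}_\pi=A/\pi A$, $q_\pi=\#\mathbb{F}_\pi$. For a finite extension $K$ of $F$, $K\{\tau\}$ is the twisted polynomial ring with $\tau c=c^q\tau$. A Drinfeld module of rank $r$ over $K$ is an $\mathbb{F}_q$-algebra homomorphism $\phi:A\to K\{\tau\}$ with $\phi_t=t+c_1\tau+\cdots+c_r\tau^r$, $c_r\ne0$; isomorphisms over $L\supseteq K$ are $\psi_a=c\phi_ac^{-1}$, $c\in L^\times$. $\phi[\pi]=\{\lambda\in K^{\rm sep}:\phi_\pi(\lambda)=0\}$ is an $r$-dimensional $\mathbb{F}_\pi$-vector space with $G_K$-action, giving $\bar\rho_{\phi,\pi}:G_K\to\mathrm{GL}_r(\mathbb{F}_\pi)$. $\phi$ has good reduction at a finite place $v$ if it is isomorphic over $K_v$ to some $\psi$ with $\psi_t=t+\sum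 c_i'\tau^i$, $c_i'\in\mathcal{O}_{K_v}$, $c_r'\in\mathcal{O}_{K_v}^\times$. The Carlitz module is $\mathcal{C}_t=t+\tau$ and $\chi_\pi:G_F\to\mathrm{Aut}(\mathcal{C}[\pi])=\mathbb{F}_\pi^\times$ is the mod $\pi$ Carlitz character. $\mathscr{D}(K,r,\pi)$ is the set of $K$-isomorphism classes of rank-$r$ Drinfeld modules $\phi$ over $K$ such that (D1) $\phi$ has good reduction at every finite place of $K$ not above $\pi$, and (D2) $\bar\rho_{\phi,\pi}$ is isomorphic to an upper triangular representation with diagonal characters $\chi_\pi^{i_1},\dots,\chi_\pi^{i_r}$, $0\le i_s\le q_\pi-1$. *)

(* Defs.v *)
From HB Require Import structures.
From mathcomp Require Import all_boot all_order all_algebra.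
From mathcomp Require Import fraction separable.
Set Implicit Arguments. Unset Strict Implicit. Unset Printing Implicit Defensive.
Import Order.TTheory GRing.Theory Num.Theory.
Local Open Scope ring_scope.

Section Drinfeld.
(* Fq : the finite field F_q ; A = {poly Fq} ; F = {fraction {poly Fq}} ;
   Om : a fixed algebraic closure of F, via the embedding iota. *)
Variables (Fq : finFieldType) (Om : closedFieldType)
          (iota : {rmorphism {fraction {poly Fq}} -> Om}).

Definition qq : nat := #|Fq|.

Definition iA (a : {poly Fq}) : Om := iota (tofrac a).

Definition is_alg_closure : Prop :=
  forall x : Om, exists f : {poly {fraction {poly Fq}}},
    f != 0 /\ root (map_poly iota f) x.

Definition is_subfield (K : Om -> Prop) : Prop :=
  [/\ forall f, K (iota f),
      forall x y, K x -> K y -> K (x + y),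
      forall x, K x -> K (- x),
      forall x y, K x -> K y -> K (x * y)
    & forall x, K x -> x != 0 -> K x^-1].

Definition finite_over_F (K : Om -> Prop) : Prop :=
  exists s : seq Om, (forall x, x \in s -> K x) /\
    forall x, K x -> exists c : nat -> {fraction {poly Fq}},
      x = \sum_(k < size s) iota (c k) * s`_k.

Definition separable_over_F (K : Om -> Prop) : Prop :=
  forall x, K x -> exists f : {poly {fraction {poly Fq}}},
    f != 0 /\ separable_poly f /\ root (map_poly iota f) x.

Definition ext_degree (K0 K : Om -> Prop) (n : nat) : Prop :=
  (forall x, K0 x -> K x) /\
  exists b : 'I_n -> Om, (forall k, K (b k)) /\
    (forall x, K x -> exists c : 'I_n -> Om,
         (forall k, K0 (c k)) /\ x = \sum_k c k * b k) /\
    (forall c : 'I_n -> Om, (forall k, K0 (c k)) ->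
         \sum_k c k * b k = 0 -> forall k, c k = 0).

(* A Drinfeld module phi over K is given by phi_t = t + c_1 tau + ... + c_r tau^r,
   encoded by the list [:: c_1; ...; c_r]. *)
Definition is_drinfeld (K : Om -> Prop) (r : nat) (c : seq Om) : Prop :=
  [/\ size c = r, forall x, x \in c -> K x & last 0 c != 0].

Definition phi_t (c : seq Om) (x : Om) : Om :=
  iA 'X * x + \sum_(i < size c) c`_i * x ^+ (qq ^ i.+1).

Definition phi_a (c : seq Om) (a : {poly Fq}) (x : Om) : Om :=
  \sum_(j < size a) iA (a`_j)%:P * iter j (phi_t c) x.

Definition carlitz : seq Om := [:: 1].

(* normalized discrete valuation of K corresponding to a finite place
   (nonnegative on A, i.e. not above the infinite place) *)
Definition finite_place (K : Om -> Prop) (v : Om -> int) : Prop :=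
  [/\ forall x y, K x -> K y -> x != 0 -> y != 0 -> v (x * y) = v x + v y,
      forall x y, K x -> K y -> x != 0 -> y != 0 -> x + y != 0 ->
        Num.min (v x) (v y) <= v (x + y),
      exists x, [/\ K x, x != 0 & v x = 1]
    & forall a : {poly Fq}, a != 0 -> 0 <= v (iA a)].

Definition v_integral (v : Om -> int) (x : Om) : Prop := x = 0 \/ 0 <= v x.

(* good reduction at v: isomorphic (psi = u phi u^-1) to a module with
   v-integral coefficients and v-unit leading coefficient *)
Definition good_reduction (K : Om -> Prop) (c : seq Om) (v : Om -> int) : Prop :=
  exists u, [/\ K u, u != 0,
    forall i, (i < size c)%N -> v_integral v (u * c`_i * u^-1 ^+ (qq ^ i.+1))
    & v (u * last 0 c * u^-1 ^+ (qq ^ size c)) = 0].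

(* elements of G_K = Gal(K^sep/K), acting through automorphisms of Om fixing K *)
Definition in_GK (K : Om -> Prop) (s : {rmorphism Om -> Om}) : Prop :=
  bijective s /\ forall x, K x -> s x = x.

Definition D1 (K : Om -> Prop) (c : seq Om) (pi : {poly Fq}) : Prop :=
  forall v, finite_place K v -> ~ (0 < v (iA pi)) -> good_reduction K c v.

(* (D2) the mod pi representation on phi[pi] is isomorphic to an upper
   triangular one with diagonal chi_pi^(i_1), ..., chi_pi^(i_r),
   0 <= i_s <= q_pi - 1, q_pi = q^deg pi. *)
Definition D2 (K : Om -> Prop) (r : nat) (c : seq Om) (pi : {poly Fq}) : Prop :=
  exists i : 'I_r -> nat, (forall s, (i s < qq ^ (size pi).-1)%N) /\
  exists lam : 'I_r -> Om,
  [/\ (* lam is an F_pi-basis of phi[pi] *)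
      forall k, phi_a c pi (lam k) = 0,
      forall x, phi_a c pi x = 0 ->
        exists a : 'I_r -> {poly Fq}, x = \sum_k phi_a c (a k) (lam k),
      forall a : 'I_r -> {poly Fq}, \sum_k phi_a c (a k) (lam k) = 0 ->
        forall k, pi %| a k
    & (* in this basis every sigma in G_K acts upper-triangularly with the
         prescribed diagonal; b represents chi_pi(sigma) in F_pi *)
      forall s, in_GK K s ->
        exists b : {poly Fq},
          (forall mu, phi_a carlitz pi mu = 0 -> s mu = phi_a carlitz b mu) /\
        exists m : 'I_r -> 'I_r -> {poly Fq},
          [/\ forall j, s (lam j) = \sum_k phi_a c (m k j) (lam k),
              forall k j : 'I_r, (j < k)%N -> pi %| m k j
            & forall j, pi %| m j j - b ^+ i j]].

(* phi (over K, rank r) represents a class of D(K, r, pi) *)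
Definition in_D (K : Om -> Prop) (r : nat) (pi : {poly Fq}) (c : seq Om) : Prop :=
  [/\ is_drinfeld K r c, D1 K c pi & D2 K r c pi].

End Drinfeld.

(* Main.v *)
(* Let q_l be a monic irreducible of degree m, with m small against d = deg pi, and s an
   element of Gal(Om/K) inducing the k-th power of the q_l-Frobenius on the residue field
   of a place above q_l.  At a place above pi, comparing valuations of Gauss sums built
   from torsion points shows that for a constant H0 each H0 i_s is congruent modulo
   q^d - 1 to some j_s <= H0.  At q_l good reduction makes tau^(m k H0) - phi_(q_l^(k j_s))
   act nilpotently on phi[pi] along the given flag; its degree is smaller than the size of
   the torsion, so it vanishes identically for the reduction, whence H0 = r j_s.  If moreover
   q_l is a suitable power residue modulo pi, all the eigenvalues coincide and the same
   degree argument gives tau^(m k p^a) = phi_gamma, so that r divides k p^a.  Applied to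
   the stabiliser in an orbit of a Frobenius over K0 acting on the embeddings of K, with k
   at most n and not divisible by the power of some prime dividing r0, this is a
   contradiction.

   It remains to produce a small q_l that splits completely in K0 and is a power residue
   modulo pi.  By reciprocity the latter is a splitting condition in a Kummer extension
   u^(q^g - 1) = D(T) of the constant field extension, and the Bombieri-Stepanov method
   finds a point of exact degree m on the composite: otherwise every point falls in one of
   the nontrivial Frobenius classes, and a product of auxiliary functions, one per class,
   has more zeros than its degree allows. *)
Require Import Defs.
From HB Require Import structures.
From mathcomp Require Import all_boot all_order all_algebra.
From mathcomp Require Import fraction separable.
From mathcomp Require Import perm cyclic.
From mathcomp Require Import finfield generic_quotient.
From mathcomp Require Import boolp classical_sets filter.
From mathcomp Require Import zify ring lra.
Set Implicit Arguments. Unset Strict Implicit. Unset Printing Implicit Defensive.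
Import Order.TTheory GRing.Theory Num.Theory.
Local Open Scope ring_scope.

(** The ramification of [K] above [pi] and the field over which the module acquires stable reduction
    are controlled only up to divisors of a constant, so the exponents are seen only through
    [H0 i_s], and Frobenius eigenvalues only up to [H0]-th roots of unity. Hence the power residue
    condition on [q_l]. It costs a Kummer extension of degree [q^g - 1] with [g = gcd(h, d)], where
    [h] depends on [H0] alone: the degree is bounded independently of [pi], although the degree of
    [D] grows with [d]. The weights of the auxiliary functions are linear in [d], while the number
    of candidate points is exponential in [m]; so [m] is taken to be a fixed small fraction of [d],
    which the degree argument at [q_l] still tolerates. A single point is needed, so a contradiction
    against the other Frobenius classes replaces an equidistribution estimate. Everything happens
    inside [Om]: residue maps take values in [Om] itself, valuations are rational-valued on all of
    [Om], and dimension counts stand in for Riemann-Roch. As [K] may be inseparable over [K0],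
    orbits are counted through distinct roots. *)

Ltac sznorm := repeat match goal with
  | |- context [@size ?T (@polyseq ?R ?p)] =>
      let t := constr:(size p) in progress change (@size T (@polyseq R p)) with t
  | H : context [@size ?T (@polyseq ?R ?p)] |- _ =>
      let t := constr:(size p) in progress change (@size T (@polyseq R p)) with t in H
  end.
Ltac plia := sznorm; lia.

(** * Places and extension of isomorphisms (Chevalley) *)

(** A subring of the square of [Om] meeting the second axis only in 0, i.e. the graph of a ring
    homomorphism from a subring of [Om] to [Om]. Graphs make unions of chains and one-element
    extensions immediate. *)
Record rgraph (Om : fieldType) (G : Om -> Om -> Prop) : Prop := RGraph {
  rg1 : G 1 1;
  rgB : forall x y x' y', G x y -> G x' y' -> G (x - x') (y - y');
  rgM : forall x y x' y', G x y -> G x' y' -> G (x * x') (y * y');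
  rgF : forall y, G 0 y -> y = 0 }.

(** A valuation ring [pO] with a residue map [pf] into [Om] itself, so that points, reductions and
    constants can be compared directly. [pf] is total; its values off [pO] carry no information. *)
Record place (Om : fieldType) := Place {
  pO : Om -> Prop;
  pf : Om -> Om;
  pO1 : pO 1;
  pf1 : pf 1 = 1;
  pOB : forall x y, pO x -> pO y -> pO (x - y);
  pfB : forall x y, pO x -> pO y -> pf (x - y) = pf x - pf y;
  pOM : forall x y, pO x -> pO y -> pO (x * y);
  pfM : forall x y, pO x -> pO y -> pf (x * y) = pf x * pf y;
  pOV : forall x, ~ pO x -> pO x^-1;
  pfV0 : forall x, ~ pO x -> pf x^-1 = 0 }.

Section RGraphTheory.
Variables (Om : fieldType) (G : Om -> Om -> Prop).
Hypothesis HG : rgraph G.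

Lemma rg0 : G 0 0. Proof. by rewrite -(subrr 1); apply: rgB => //; exact: rg1. Qed.
Lemma rgN x y : G x y -> G (- x) (- y).
Proof. by move=> h; rewrite -(sub0r x) -(sub0r y); apply: rgB => //; exact: rg0. Qed.
Lemma rgD x y x' y' : G x y -> G x' y' -> G (x + x') (y + y').
Proof. by move=> h h'; rewrite -(opprK x') -(opprK y'); apply: rgB => //; exact: rgN. Qed.
Lemma rgX x y n : G x y -> G (x ^+ n) (y ^+ n).
Proof.
by move=> h; elim: n => [|n IH]; rewrite ?expr0 ?exprS; [exact: rg1|exact: rgM].
Qed.
Lemma rg_sum (I : Type) (r : seq I) (P : pred I) (E E' : I -> Om) :
  (forall i, P i -> G (E i) (E' i)) -> G (\sum_(i <- r | P i) E i) (\sum_(i <- r | P i) E' i).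
Proof.
move=> h; elim/big_rec2: _ => [|i y1 y2 Pi IH]; first exact: rg0.
by apply: rgD => //; exact: h.
Qed.
Lemma rg_fun x y y' : G x y -> G x y' -> y = y'.
Proof.
move=> h h'; apply/eqP; rewrite -subr_eq0; apply/eqP; apply: (rgF HG).
by rewrite -(subrr x); exact: rgB.
Qed.

Definition rpoly (p p' : {poly Om}) := forall i, G p`_i p'`_i.

Lemma rpolyB p p' q q' : rpoly p p' -> rpoly q q' -> rpoly (p - q) (p' - q').
Proof. by move=> h h' i; rewrite !coefB; apply: rgB. Qed.
Lemma rpolyM p p' q q' : rpoly p p' -> rpoly q q' -> rpoly (p * q) (p' * q').
Proof. by move=> h h' i; rewrite !coefM; apply: rg_sum => j _; apply: rgM. Qed.
Lemma rpolyC x y : G x y -> rpoly x%:P y%:P.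
Proof. by move=> h i; rewrite !coefC; case: eqP => // _; exact: rg0. Qed.
Lemma rpolyX n : rpoly 'X^n 'X^n.
Proof. by move=> i; rewrite !coefXn; case: eqP => _; [exact: rg1|exact: rg0]. Qed.
Lemma rpolyZ x y p p' : G x y -> rpoly p p' -> rpoly (x *: p) (y *: p').
Proof. by move=> h h' i; rewrite !coefZ; apply: rgM. Qed.

(** The candidate extension of the homomorphism to the ring generated by [x], sending [x] to [y]. *)
Definition gext (x y : Om) (u v : Om) :=
  exists p p', [/\ rpoly p p', u = p.[x] & v = p'.[y]].

Lemma gext_rgraph x y :
  (forall p p', rpoly p p' -> p.[x] = 0 -> p'.[y] = 0) -> rgraph (gext x y).
Proof.
move=> h; split.
- by exists 1, 1; split; rewrite ?hornerC //; apply: rpolyC; exact: rg1.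
- move=> u v u' v' [p [p' [pp' -> ->]]] [q [q' [qq' -> ->]]].
  by exists (p - q), (p' - q'); split; rewrite ?hornerD ?hornerN //; apply: rpolyB.
- move=> u v u' v' [p [p' [pp' -> ->]]] [q [q' [qq' -> ->]]].
  by exists (p * q), (p' * q'); split; rewrite ?hornerM //; apply: rpolyM.
- by move=> v [p [p' [pp' /esym e ->]]]; apply: h pp' e.
Qed.

Lemma gext_sub x y u v : G u v -> gext x y u v.
Proof. by move=> h; exists u%:P, v%:P; rewrite !hornerC; split=> //; apply: rpolyC. Qed.

Lemma gext_x x y : gext x y x y.
Proof. by exists 'X, 'X; rewrite !hornerX; split=> //; exact: (rpolyX 1). Qed.

(** The candidate extension to the localisation at [a], whose image is [b]. *)
Definition gloc (a b : Om) (u v : Om) :=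
  exists n x y, [/\ G x y, u = x / a ^+ n & v = y / b ^+ n].

Lemma gloc_rgraph a b : G a b -> b != 0 -> rgraph (gloc a b).
Proof.
move=> hab b0.
have a0 : a != 0.
  by apply: contra_neq b0 => a0; apply: (rgF HG); rewrite -a0.
split.
- by exists 0%N, 1, 1; split; rewrite ?expr0 ?divr1 //; exact: rg1.
- move=> u v u' v' [n [x [y [h -> ->]]]] [m [x' [y' [h' -> ->]]]].
  exists (n + m)%N, (x * a ^+ m - x' * a ^+ n), (y * b ^+ m - y' * b ^+ n); split.
  + by apply: rgB => //; apply: rgM => //; apply: rgX.
  + by rewrite exprD; field; rewrite !expf_neq0.
  + by rewrite exprD; field; rewrite !expf_neq0.
- move=> u v u' v' [n [x [y [h -> ->]]]] [m [x' [y' [h' -> ->]]]].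
  exists (n + m)%N, (x * x'), (y * y'); split.
  + by apply: rgM.
  + by rewrite exprD; field; rewrite !expf_neq0.
  + by rewrite exprD; field; rewrite !expf_neq0.
- move=> v [n [x [y [h /esym/eqP e ->]]]].
  move: e; rewrite mulf_eq0 invr_eq0 expf_eq0 (negPf a0) andbF orbF => /eqP e.
  by rewrite e in h; rewrite (rgF HG h) mul0r.
Qed.

Lemma gloc_sub a b u v : G u v -> gloc a b u v.
Proof. by move=> h; exists 0%N, u, v; rewrite !expr0 !divr1. Qed.

Lemma gloc_V a b : gloc a b a^-1 b^-1.
Proof. by exists 1%N, 1, 1; rewrite !expr1 !div1r; split=> //; exact: rg1. Qed.

End RGraphTheory.

Section Chevalley.
Variable Om : closedFieldType.
Implicit Types (G : Om -> Om -> Prop).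

Lemma rgraph_max G : rgraph G -> exists A, [/\ rgraph A, forall x y, G x y -> A x y
  & forall B, rgraph B -> (forall x y, A x y -> B x y) -> forall x y, B x y -> A x y].
Proof.
move=> HG.
pose P (S : set (Om * Om)) := S = set0 \/
  (rgraph (fun x y => S (x, y)) /\ forall x y, G x y -> S (x, y)).
have [|A [PA mA]] := @Zorn_bigcup _ P.
  move=> F FP Ft.
  have [[S FS S0]|nS] := pselect (exists2 S, F S & S <> set0); last first.
    left; apply/seteqP; split => // z [S FS Sz].
    by apply: nS; exists S => // S0; rewrite S0 in Sz.
  right.
  have good S' : F S' -> S' <> set0 ->
     rgraph (fun x y => S' (x, y)) /\ forall x y, G x y -> S' (x, y).
    by move=> /FP [].
  have [gS GS] := good _ FS S0.
  have ub S1 S2 : F S1 -> F S2 -> exists S3, [/\ F S3, S1 `<=` S3 & S2 `<=` S3]%classic.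
    by move=> F1 F2; case: (Ft _ _ F1 F2) => h; [exists S2|exists S1]; split.
  have inh (S1 : set (Om * Om)) (z : Om * Om) : S1 z -> S1 <> set0 by move=> h e; rewrite e in h.
  split; last by move=> x y /GS h; exists S.
  split.
  + by exists S => //; exact: (rg1 gS).
  + move=> x y x' y' [S1 F1 s1] [S2 F2 s2].
    have [S3 [F3 s13 s23]] := ub _ _ F1 F2; exists S3 => //.
    have X := (rgB (good _ F3 (inh _ _ (s13 _ s1))).1 (s13 _ s1) (s23 _ s2)). exact: X.
  + move=> x y x' y' [S1 F1 s1] [S2 F2 s2].
    have [S3 [F3 s13 s23]] := ub _ _ F1 F2; exists S3 => //.
    exact: (rgM (good _ F3 (inh _ _ (s13 _ s1))).1 (s13 _ s1) (s23 _ s2)).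
  + by move=> y [S1 F1 s1]; exact: (rgF (good _ F1 (inh _ _ s1)).1 s1).
have A0 : A <> set0.
  move=> A0; apply: (mA (fun z => G z.1 z.2)); last by right; split => //; case: HG.
  rewrite A0; split; last by move=> h; apply: (h (1, 1)); exact: (rg1 HG).
  by [].
case: PA => // -[gA GA]; exists (fun x y => A (x, y)); split=> // B gB AB x y Bxy.
apply: contrapT => nA; apply: (mA (fun z => B z.1 z.2)).
  by split=> [[u v] /AB//|h]; apply: nA; exact: (h (x, y)).
by right; split; [case: gB|move=> u v /GA /AB].
Qed.

Variables (A : Om -> Om -> Prop).
Hypotheses (gA : rgraph A)
  (mA : forall B, rgraph B -> (forall x y, A x y -> B x y) -> forall x y, B x y -> A x y).

Let Ainv a b : A a b -> b != 0 -> A a^-1 b^-1.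
Proof.
move=> hab b0; apply: (mA (gloc_rgraph gA hab b0)); last exact: gloc_V.
by move=> x y; exact: gloc_sub.
Qed.

(** [x] is bad when the kernel of the residue homomorphism generates the unit ideal after adjoining
    [x]: some relation of [x] reduces to a nonzero constant. *)
Let bad x := exists p p', [/\ rpoly A p p', p.[x] = 0, p'`_0 != 0
   & forall i, (0 < i)%N -> p'`_i = 0].

(** The reductions of the relations of [x] form an ideal. A nonzero element [p'] of least degree
    divides all others, the division being lifted to the relations themselves, and it is not
    constant. A root of [p'] is then an admissible image of [x]. *)
Let not_bad x : ~ bad x -> exists y, A x y.
Proof.
move=> nb.
suff [y hy] : exists y, forall p p', rpoly A p p' -> p.[x] = 0 -> p'.[y] = 0.
  exists y; apply: (mA (gext_rgraph gA hy)); last exact: gext_x.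
  by move=> u v; exact: gext_sub.
pose I p' := exists2 p, rpoly A p p' & p.[x] = 0.
have [[p' Ip' p'0]|nI] := pselect (exists2 p', I p' & p' != 0); last first.
  exists 0 => p p' pp' px; have [->|p'0] := eqVneq p' 0; first by rewrite horner0.
  by case: nI; exists p' => //; exists p.
have [n] := ubnP (size p'); elim: n p' Ip' p'0 => // n IHn p' Ip' p'0 sp'.
have [[q' [Iq' q'0 sq']]|nq'] :=
    pselect (exists q', [/\ I q', q' != 0 & (size q' < size p')%N]).
  by apply: IHn Iq' q'0 _; plia.
have s1 : (1 < size p')%N.
  rewrite ltnNge; apply/negP => s1; case: nb; case: Ip' => p pp' px.
  exists p, p'; split => //; last by move=> i i0; rewrite nth_default //; exact: leq_trans s1 i0.
  by move: p'0; rewrite (size1_polyC s1) polyC_eq0 coefC eqxx.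
have [y ry] : exists y, root p' y by apply/closed_rootP; rewrite neq_ltn s1 orbT.
exists y => q q' qq' qx.
have [m] := ubnP (size q'); elim: m q q' qq' qx => // m IHm q q' qq' qx sq'.
have [->|q'0] := eqVneq q' 0; first by rewrite horner0.
have [lt|le] := ltnP (size q') (size p').
  by case: nq'; exists q'; split => //; exists q.
case: Ip' => p pp' px.
pose k := (size q' - size p')%N.
have lp : lead_coef p' != 0 by rewrite lead_coef_eq0.
pose a := q`_(size q').-1 / p`_(size p').-1.
pose a' := lead_coef q' / lead_coef p'.
have aa' : A a a'.
  by apply: (rgM gA); [exact: qq'|apply: Ainv => //; exact: pp'].
have e : q'.[y] = (q' - a' *: ('X^k * p')).[y].
  by rewrite hornerD hornerN hornerZ hornerM (rootP ry) !mulr0 subr0.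
rewrite e; apply: (IHm (q - a *: ('X^k * p))).
- apply: (rpolyB gA) => //; apply: (rpolyZ gA) => //.
  by apply: (rpolyM gA) => //; exact: rpolyX.
- by rewrite hornerD hornerN hornerZ hornerM qx px !mulr0 subr0.
- have [->|nz] := eqVneq (q' - a' *: ('X^k * p')) 0.
    by rewrite size_poly0; move: sq'; rewrite -size_poly_gt0 in q'0; plia.
  have sz : (size (q' - a' *: ('X^k * p'))%R <= (size q').-1)%N.
    apply/leq_sizeP => j hj; rewrite coefB coefZ coefXnM.
    have [lt|le'] := ltnP j k; first by move: lt; rewrite /k; plia.
    have [ej|nj] := eqVneq j (size q').-1.
      have -> : (j - k)%N = (size p').-1 by rewrite /k ej; plia.
      by rewrite ej /a' -/(lead_coef p') divfK // /lead_coef subrr.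
    rewrite !nth_default ?mulr0 ?subr0 //.
      by rewrite /k; plia.
    by plia.
  have : (0 < size q')%N by rewrite size_poly_gt0.
  by plia.
Qed.

(** The classical exchange: of two relations showing [x] and [x^-1] bad, the longer one loses its
    leading term to a multiple of the reversed shorter one. The multiplier reduces to 0, so the
    nonzero constant survives; the total size is the induction measure. *)
Let badV x : x != 0 -> bad x -> bad x^-1 -> False.
Proof.
move=> x0.
suff H n x1 : x1 != 0 -> forall p p' q q',
   [/\ rpoly A p p', p.[x1] = 0, p'`_0 != 0 & forall i, (0 < i)%N -> p'`_i = 0] ->
   [/\ rpoly A q q', q.[x1^-1] = 0, q'`_0 != 0 & forall i, (0 < i)%N -> q'`_i = 0] ->
   (size p + size q < n)%N -> False.
  move=> [p [p' h]] [q [q' h']]; apply: (H (size p + size q).+1 x x0 p p' q q') => //.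
elim: n x1 => // n IHn x1 x10.
suff H' x2 : x2 != 0 -> forall p p' q q',
   [/\ rpoly A p p', p.[x2] = 0, p'`_0 != 0 & forall i, (0 < i)%N -> p'`_i = 0] ->
   [/\ rpoly A q q', q.[x2^-1] = 0, q'`_0 != 0 & forall i, (0 < i)%N -> q'`_i = 0] ->
   (size q <= size p)%N -> (size p + size q < n.+1)%N -> False.
  move=> p p' q q' h h' hs; have [le|lt] := leqP (size q) (size p).
    by apply: (H' x1 x10 p p' q q').
  apply: (H' x1^-1 _ q q' p p'); rewrite ?invr_eq0 ?invrK //; [exact: ltnW|by rewrite addnC].
move=> x20 p p' q q' [pp' px p0 pi] [qq' qx q0 qi] le hs.
have qn0 : q`_0 != 0.
  by apply: contra_neq q0 => e; have := qq' 0%N; rewrite e => /(rgF gA).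
have pn0 : p`_0 != 0.
  by apply: contra_neq p0 => e; have := pp' 0%N; rewrite e => /(rgF gA).
have sq0 : (0 < size q)%N by rewrite size_poly_gt0; apply: contra_neq qn0 => ->; rewrite coef0.
have sq1 : (1 < size q)%N.
  rewrite ltnNge; apply/negP => s1; move: qx; rewrite (size1_polyC s1) hornerC => e.
  by rewrite e eqxx in qn0.
pose m := (size q).-1; pose N := (size p).-1.
pose rq : {poly Om} := \poly_(i < m.+1) q`_(m - i).
have rqx : rq.[x2] = 0.
  rewrite horner_poly.
  have : x2 ^+ m * q.[x2^-1] = 0 by rewrite qx mulr0.
  rewrite horner_coef mulr_sumr.
  have -> : size q = m.+1 by rewrite /m; plia.
  rewrite (reindex_inj rev_ord_inj) /= => e; rewrite -[RHS]e; apply: eq_bigr => i _.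
  have hi := ltn_ord i; rewrite subSS mulrCA; congr (_ * _).
  have -> : x2 ^+ m = x2 ^+ i * x2 ^+ (m - i) by rewrite -exprD; congr (_ ^+ _); plia.
  by rewrite exprVn mulfK // expf_neq0.
pose a := p`_N / q`_0.
have Aa : A a 0.
  have -> : 0 = p'`_N * (q'`_0)^-1 by rewrite pi ?mul0r // /N; plia.
  by apply: (rgM gA); [exact: pp'|apply: Ainv].
pose rq' : {poly Om} := \poly_(i < m.+1) q'`_(m - i).
have rqq' : rpoly A rq rq'.
  by move=> i; rewrite !coef_poly; case: ifP => _; [exact: qq'|exact: rg0].
pose k := (N - m)%N.
apply: (IHn x2 x20 (p - a *: ('X^k * rq)) (p' - 0 *: ('X^k * rq')) q q').
- split.
  + by apply: (rpolyB gA) => //; apply: (rpolyZ gA) => //; apply: (rpolyM gA) => //; exact: rpolyX.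
  + by rewrite hornerD hornerN hornerZ hornerM px rqx !mulr0 subr0.
  + by rewrite scale0r subr0.
  + by rewrite scale0r subr0.
- by split.
- have : (size (p - a *: ('X^k * rq))%R <= N)%N; last by rewrite /N; plia.
  apply/leq_sizeP => j hj; rewrite coefB coefZ coefXnM.
  have [lt|le'] := ltnP j k; first by move: lt; rewrite /k; plia.
  rewrite coef_poly; have [ej|nj] := eqVneq j N.
    rewrite ej ifT; last by rewrite /k; plia.
    have -> : (m - (N - k) = 0)%N by rewrite /k /N /m; plia.
    by rewrite /a divfK // subrr.
  rewrite nth_default; last by rewrite /N in nj hj; plia.
  rewrite ifF ?mulr0 ?subr0 //; apply/negbTE; rewrite -leqNgt /k /N /m; rewrite /N in nj hj; plia.
Qed.

Lemma place_of_max : exists P : place Om, forall x y, A x y <-> (pO P x /\ pf P x = y).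
Proof.
pose O x := exists y, A x y.
pose f x := if pselect (O x) is left h then sval (cid h) else 0.
have fP x : O x -> A x (f x).
  by move=> h; rewrite /f; case: pselect => // h'; case: cid.
have fE x y : A x y -> f x = y.
  by move=> h; exact: (rg_fun gA (fP _ (ex_intro _ y h)) h).
have V x : ~ O x -> A x^-1 0.
  move=> nO.
  have bx : bad x by apply: contrapT => /not_bad.
  have x0 : x != 0 by apply/eqP => e; apply: nO; rewrite e; exists 0; exact: rg0.
  have [y Ay] : O x^-1 by apply: not_bad => bx'; apply: badV bx bx'.
  have [<-//|y0] := eqVneq y 0.
  by case: nO; exists y^-1; rewrite -(invrK x); apply: Ainv.
have O1 : O 1 by exists 1; exact: rg1.
have f1 : f 1 = 1 by apply: fE; exact: rg1.
have OB x y : O x -> O y -> O (x - y).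
  by move=> /fP hx /fP hy; exists (f x - f y); apply: rgB.
have fB x y : O x -> O y -> f (x - y) = f x - f y.
  by move=> /fP hx /fP hy; apply: fE; apply: rgB.
have OM x y : O x -> O y -> O (x * y).
  by move=> /fP hx /fP hy; exists (f x * f y); apply: rgM.
have fM x y : O x -> O y -> f (x * y) = f x * f y.
  by move=> /fP hx /fP hy; apply: fE; apply: rgM.
have OV x : ~ O x -> O x^-1 by move=> /V h; exists 0.
have fV x : ~ O x -> f x^-1 = 0 by move=> /V h; apply: fE.
exists (Place O1 f1 OB fB OM fM OV fV).
move=> x y /=; split; first by move=> h; split; [exists y|exact: fE].
by case=> /fP h <-.
Qed.

End Chevalley.

(** Besides producing places from evaluation maps, this also extends isomorphisms of subfields: an
    element algebraic over a field on which the residue map is the identity is automatically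
    integral. *)
Theorem chevalley (Om : closedFieldType) (G : Om -> Om -> Prop) :
  rgraph G -> exists P : place Om, forall x y, G x y -> pO P x /\ pf P x = y.
Proof.
move=> /rgraph_max [A [gA GA mA]]; have [P hP] := place_of_max gA mA.
by exists P => x y /GA /hP.
Qed.

Section PlaceTheory.
Variables (Om : fieldType) (P : place Om).
Local Notation O := (pO P).
Local Notation f := (pf P).

Lemma pO0 : O 0. Proof. by rewrite -(subrr 1); apply: pOB; exact: pO1. Qed.
Lemma pf0 : f 0 = 0.
Proof. by rewrite -(subrr 1) pfB ?subrr //; exact: pO1. Qed.
Lemma pON x : O x -> O (- x).
Proof. by move=> h; rewrite -sub0r; apply: pOB => //; exact: pO0. Qed.
Lemma pfN x : O x -> f (- x) = - f x.
Proof. by move=> h; rewrite -sub0r pfB ?pf0 ?sub0r //; exact: pO0. Qed.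
Lemma pOD x y : O x -> O y -> O (x + y).
Proof. by move=> hx hy; rewrite -(opprK y); apply: pOB => //; exact: pON. Qed.
Lemma pfD x y : O x -> O y -> f (x + y) = f x + f y.
Proof. by move=> hx hy; rewrite -{1}(opprK y) pfB ?pfN ?opprK //; exact: pON. Qed.
Lemma pOX x n : O x -> O (x ^+ n).
Proof.
by move=> h; elim: n => [|n IH]; rewrite ?expr0 ?exprS; [exact: pO1|exact: pOM].
Qed.
Lemma pfX x n : O x -> f (x ^+ n) = f x ^+ n.
Proof.
move=> h; elim: n => [|n IH]; rewrite ?expr0 ?exprS ?pf1 //.
by rewrite pfM ?IH //; exact: pOX.
Qed.
Lemma pO_sum (I : Type) (r : seq I) (Q : pred I) (E : I -> Om) :
  (forall i, Q i -> O (E i)) -> O (\sum_(i <- r | Q i) E i).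
Proof. by move=> h; elim/big_rec: _ => [|i x Qi]; [exact: pO0|apply: pOD; exact: h]. Qed.
Lemma pf_sum (I : Type) (r : seq I) (Q : pred I) (E : I -> Om) :
  (forall i, Q i -> O (E i)) -> f (\sum_(i <- r | Q i) E i) = \sum_(i <- r | Q i) f (E i).
Proof.
move=> h; suff [] : O (\sum_(i <- r | Q i) E i) /\
  f (\sum_(i <- r | Q i) E i) = \sum_(i <- r | Q i) f (E i) by [].
elim/big_rec2: _ => [|i y1 y2 Qi [h1 h2]]; first by rewrite pf0; split => //; exact: pO0.
by split; [apply: pOD => //; exact: h|rewrite pfD ?h2 //; exact: h].
Qed.
Lemma pf_prod (I : Type) (r : seq I) (Q : pred I) (E : I -> Om) :
  (forall i, Q i -> O (E i)) -> f (\prod_(i <- r | Q i) E i) = \prod_(i <- r | Q i) f (E i).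
Proof.
move=> h; suff [] : O (\prod_(i <- r | Q i) E i) /\
  f (\prod_(i <- r | Q i) E i) = \prod_(i <- r | Q i) f (E i) by [].
elim/big_rec2: _ => [|i y1 y2 Qi [h1 h2]]; first by rewrite pf1; split => //; exact: pO1.
by split; [apply: pOM => //; exact: h|rewrite pfM ?h2 //; exact: h].
Qed.
Lemma pOunit x : O x -> f x != 0 -> O x^-1.
Proof.
move=> hx; case: (pselect (O x^-1)) => // nx /negP[].
by rewrite -(invrK x) pfV0.
Qed.
Lemma pfV x : O x -> f x != 0 -> f x^-1 = (f x)^-1.
Proof.
move=> hx fx; have hV := pOunit hx fx.
have x0 : x != 0 by apply: contra_neq fx => ->; rewrite pf0.
by apply: (mulfI fx); rewrite -pfM // !mulfV // pf1.
Qed.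

Definition pfp (p : {poly Om}) : {poly Om} := \poly_(i < size p) f p`_i.
Definition Op (p : {poly Om}) := forall i, O p`_i.

Lemma coef_pfp p i : (pfp p)`_i = f p`_i.
Proof.
rewrite coef_poly; case: ltnP => // h; first by rewrite nth_default ?pf0.
Qed.
Lemma pfpB p q : Op p -> Op q -> pfp (p - q) = pfp p - pfp q.
Proof. by move=> hp hq; apply/polyP => i; rewrite !(coefB, coef_pfp) pfB. Qed.
Lemma OpM p q : Op p -> Op q -> Op (p * q).
Proof. by move=> hp hq i; rewrite coefM; apply: pO_sum => j _; apply: pOM. Qed.
Lemma pfpM p q : Op p -> Op q -> pfp (p * q) = pfp p * pfp q.
Proof.
move=> hp hq; apply/polyP => i; rewrite coef_pfp !coefM pf_sum; last by move=> j _; apply: pOM.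
by apply: eq_bigr => j _; rewrite pfM // !coef_pfp.
Qed.
Lemma pf_horner p x : Op p -> O x -> f p.[x] = (pfp p).[f x].
Proof.
move=> hp hx; rewrite horner_coef pf_sum; last by move=> i _; apply: pOM => //; exact: pOX.
rewrite (@horner_coef_wide _ (size p)) ?size_poly //.
by apply: eq_bigr => i _; rewrite pfM ?pfX ?coef_pfp //; exact: pOX.
Qed.

(** If [x] were not integral, dividing the equation by the top power of [x] and reducing would make
    the residue of the leading coefficient 0. *)
Lemma pO_root p x : Op p -> f (lead_coef p) != 0 -> root p x -> O x.
Proof.
move=> hp hl /rootP r; apply: contrapT => nx.
have x0 : x != 0 by apply/eqP => e; apply: nx; rewrite e; exact: pO0.
have y0 := pfV0 nx; have Oy := pOV nx.
have p0 : p != 0 by apply: contra_neq hl => ->; rewrite lead_coef0 pf0.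
have e : \sum_(i < size p) p`_i * x^-1 ^+ ((size p).-1 - i) = 0.
  transitivity (p.[x] * x^-1 ^+ (size p).-1); last by rewrite r mul0r.
  rewrite horner_coef mulr_suml; apply: eq_bigr => i _.
  rewrite -mulrA; congr (_ * _).
  have -> : x^-1 ^+ (size p).-1 = x^-1 ^+ i * x^-1 ^+ ((size p).-1 - i).
    by rewrite -exprD; congr (_ ^+ _); have := ltn_ord i; plia.
  by rewrite mulrA -exprMn mulfV // expr1n mul1r.
move: e; rewrite (polySpred p0) big_ord_recr /= subnn expr0 mulr1 => /eqP.
rewrite addr_eq0 => /eqP /(congr1 f) e; move: hl; rewrite lead_coefE.
rewrite -[p`__]opprK pfN; last exact: pON.
rewrite -e pf_sum; last by move=> i _; apply: pOM => //; exact: pOX.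
rewrite big1 ?oppr0 ?eqxx // => i _.
rewrite pfM //; last exact: pOX.
by rewrite pfX // y0 expr0n; have := ltn_ord i; case: eqP => /=; [lia|rewrite mulr0].
Qed.
End PlaceTheory.

(** * Subfields of [Om], minimal polynomials and automorphisms *)

Record sfield (Om : fieldType) := SField {
  sf_pred :> Om -> Prop;
  sf1 : sf_pred 1;
  sfB : forall x y, sf_pred x -> sf_pred y -> sf_pred (x - y);
  sfM : forall x y, sf_pred x -> sf_pred y -> sf_pred (x * y);
  sfV : forall x, sf_pred x -> sf_pred x^-1 }.

Section SFieldType.
Variables (Om : fieldType) (L : sfield Om).

Definition sfb : pred Om := fun x => `[< L x >].
Lemma sfb_divring : divring_closed sfb.
Proof.
split; rewrite /sfb ?unfold_in; first by apply/asboolP; exact: sf1.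
- by move=> x y; rewrite !unfold_in => /asboolP hx /asboolP hy; apply/asboolP; exact: sfB.
- move=> x y; rewrite !unfold_in => /asboolP hx /asboolP hy; apply/asboolP.
  by apply: sfM => //; exact: sfV.
Qed.
HB.instance Definition _ := GRing.isDivringClosed.Build Om sfb sfb_divring.

Record sft := SFT { sfv : Om; _ : sfv \in sfb }.
HB.instance Definition _ := [isSub for sfv].
HB.instance Definition _ := [Choice of sft by <:].
HB.instance Definition _ := [SubChoice_isSubIntegralDomain of sft by <:].
HB.instance Definition _ := [SubIntegralDomain_isSubField of sft by <:].
End SFieldType.

Section SFieldTheory.
Variables (Om : fieldType) (L : sfield Om).
Lemma sf0 : L 0. Proof. by rewrite -(subrr 1); apply: sfB; exact: sf1. Qed.
Lemma sfN x : L x -> L (- x).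
Proof. by move=> h; rewrite -sub0r; apply: sfB => //; exact: sf0. Qed.
Lemma sfD x y : L x -> L y -> L (x + y).
Proof. by move=> hx hy; rewrite -(opprK y); apply: sfB => //; exact: sfN. Qed.
Lemma sfX x n : L x -> L (x ^+ n).
Proof. by move=> h; elim: n => [|n IH]; rewrite ?expr0 ?exprS; [exact: sf1|exact: sfM]. Qed.
Lemma sf_sum (I : Type) (r : seq I) (Q : pred I) (E : I -> Om) :
  (forall i, Q i -> L (E i)) -> L (\sum_(i <- r | Q i) E i).
Proof. by move=> h; elim/big_rec: _ => [|i x Qi]; [exact: sf0|apply: sfD; exact: h]. Qed.
Lemma sf_nat n : L n%:R.
Proof. by elim: n => [|n IH]; [exact: sf0|rewrite -addn1 natrD; apply: sfD => //; exact: sf1]. Qed.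

Lemma sfvP (x : sft L) : L (sfv x).
Proof. by case: x => x /= h; apply/asboolP. Qed.
Lemma sft_ex x : L x -> exists y : sft L, sfv y = x.
Proof. by move=> /asboolP h; exists (SFT (L:=L) (sfv:=x) h). Qed.

Definition sfm : {rmorphism sft L -> Om} := GRing.RMorphism.clone _ _ (val : sft L -> Om) _.
Lemma sfmE x : sfm x = sfv x. Proof. by []. Qed.

Definition Lp (p : {poly Om}) := forall i, L p`_i.
Lemma Lp_map (p : {poly sft L}) : Lp (map_poly sfm p).
Proof. by move=> i; rewrite coef_map; exact: sfvP. Qed.
Lemma Lp_ex p : Lp p -> exists p' : {poly sft L}, map_poly sfm p' = p.
Proof.
move=> h; pose g i := sval (cid (sft_ex (h i))).
have gP i : sfv (g i) = p`_i by rewrite /g; case: cid.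
exists (\poly_(i < size p) g i); apply/polyP => i; rewrite coef_map coef_poly.
case: ltnP => hi /=; first exact: gP.
by rewrite nth_default // rmorph0.
Qed.
Lemma LpB p q : Lp p -> Lp q -> Lp (p - q).
Proof. by move=> hp hq i; rewrite coefB; apply: sfB. Qed.
Lemma LpD p q : Lp p -> Lp q -> Lp (p + q).
Proof. by move=> hp hq i; rewrite coefD; apply: sfD. Qed.
Lemma LpM p q : Lp p -> Lp q -> Lp (p * q).
Proof. by move=> hp hq i; rewrite coefM; apply: sf_sum => j _; apply: sfM. Qed.
Lemma LpC c : L c -> Lp c%:P.
Proof. by move=> h i; rewrite coefC; case: eqP => // _; exact: sf0. Qed.
Lemma LpX : Lp 'X.
Proof. by move=> i; rewrite coefX; exact: sf_nat. Qed.
Lemma Lp_horner p x : Lp p -> L x -> L p.[x].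
Proof. by move=> hp hx; rewrite horner_coef; apply: sf_sum => i _; apply: sfM => //; exact: sfX. Qed.
End SFieldTheory.

Section RMorphOf.
Variables (R S : nzRingType) (f : R -> S).
Hypotheses (fB : forall x y, f (x - y) = f x - f y) (fM : forall x y, f (x * y) = f x * f y)
  (f1 : f 1 = 1).
Lemma rmorph_of : exists g : {rmorphism R -> S}, g =1 f.
Proof.
have fa : zmod_morphism f by [].
have fm : monoid_morphism f by split.
pose fA := GRing.isZmodMorphism.Build R S f fa.
pose fMm := GRing.isMonoidMorphism.Build R S f fm.
by exists (HB.pack f fA fMm : {rmorphism R -> S}).
Qed.
End RMorphOf.

Definition algo (Om : fieldType) (L : sfield Om) :=
  forall z : Om, exists p : {poly sft L}, p != 0 /\ root (map_poly (sfm L) p) z.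

Lemma algo_sub (Om : fieldType) (L L' : sfield Om) :
  (forall x, L x -> L' x) -> algo L -> algo L'.
Proof.
move=> LL' h z; have [p [p0 r]] := h z.
have /Lp_ex [p' e] : Lp L' (map_poly (sfm L) p) by move=> i; apply: LL'; exact: Lp_map.
by exists p'; rewrite e; split=> //; rewrite -(map_poly_eq0 (sfm L')) e map_poly_eq0.
Qed.

Definition autL (Om : fieldType) (L : sfield Om) (s : {rmorphism Om -> Om}) :=
  bijective s /\ forall x, L x -> s x = x.

Lemma root_dvd (R : fieldType) (p q : {poly R}) x : p %| q -> root p x -> root q x.
Proof. by move=> /dvdpP [w ->] r; rewrite rootM r orbT. Qed.

Section MinPoly.
Variables (Om : fieldType) (L : sfield Om) (z : Om).
Local Notation j := (sfm L).
Hypothesis az : exists p : {poly sft L}, p != 0 /\ root (map_poly j p) z.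

Lemma minpoly_ex : exists m : {poly sft L}, [/\ m \is monic, root (map_poly j m) z
  & forall h, root (map_poly j h) z -> m %| h].
Proof.
case: az => p [p0 rp].
have [n] := ubnP (size p); elim: n p p0 rp => // n IH p p0 rp sp.
have [[q [q0 rq sq]]|nq] := pselect (exists q : {poly sft L},
   [/\ q != 0, root (map_poly j q) z & (size q < size p)%N]).
  by apply: (IH q) => //; plia.
have lp : lead_coef p != 0 by rewrite lead_coef_eq0.
have i0 : (lead_coef p)^-1 != 0 by rewrite invr_eq0.
exists ((lead_coef p)^-1 *: p); split.
- by rewrite monicE lead_coefZ mulVf.
- by rewrite linearZ /= rootZ // fmorph_eq0.
move=> h rh; rewrite dvdpZl //; apply/eqP.
have [//|hm] := eqVneq (h %% p) 0.
case: nq; exists (h %% p); split => //; last by rewrite ltn_modp.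
have e : h %% p = h - h %/ p * p by rewrite {2}(divp_eq h p) addrC addKr.
rewrite /root e rmorphB rmorphM /= hornerD hornerN hornerM.
by rewrite (rootP rp) (rootP rh) mulr0 subr0.
Qed.
End MinPoly.

Section Aut.
Variables (Om : closedFieldType).
Implicit Types (L : sfield Om).

(** Being injective, an endomorphism over [L] permutes the finite root set of each polynomial over
    [L], so every element is attained. *)
Lemma endo_bij L (s : {rmorphism Om -> Om}) : algo L -> (forall x, L x -> s x = x) -> bijective s.
Proof.
move=> aL sL.
have surj y : exists x, s x = y.
  have [p [p0 rp]] := aL y.
  set P := map_poly (sfm L) p.
  have P0 : P != 0 by rewrite map_poly_eq0.
  have [r er] := closed_field_poly_normal P.
  have lP : lead_coef P != 0 by rewrite lead_coef_eq0.
  have rE x : (x \in undup r) = root P x.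
    by rewrite mem_undup er rootZ // root_prod_XsubC.
  have sP : map_poly s P = P.
    by apply/polyP => i; rewrite coef_map /= sL // coef_map; exact: sfvP.
  have sr x : x \in undup r -> s x \in undup r.
    by rewrite !rE => h; rewrite -sP fmorph_root.
  have us : uniq (map s (undup r)).
    by rewrite map_inj_uniq ?undup_uniq //; exact: fmorph_inj.
  have ss : {subset map s (undup r) <= undup r} by move=> _ /mapP [x hx ->]; exact: sr.
  have [_ ee] := uniq_min_size us ss (eq_leq (esym (size_map s (undup r)))).
  have /mapP [x _ ->] : y \in map s (undup r) by rewrite ee rE.
  by exists x.
exists (fun y => sval (cid (surj y))) => [x|y]; last by case: cid.
by apply: (fmorph_inj s); case: cid.
Qed.

(** The hypothesis makes evaluation at [z] and [z'] the graph of a homomorphism. A place extending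
    it is the identity on [L]; as [Om] is algebraic over [L] it is finite everywhere, hence an
    endomorphism of [Om]. *)
Lemma iso_ext0 L z z' : algo L ->
  (forall p : {poly sft L}, root (map_poly (sfm L) p) z -> root (map_poly (sfm L) p) z') ->
  exists s, autL L s /\ s z = z'.
Proof.
move=> aL zz'.
pose G u v := exists p : {poly sft L},
  u = (map_poly (sfm L) p).[z] /\ v = (map_poly (sfm L) p).[z'].
have gG : rgraph G.
  split.
  - by exists 1; rewrite rmorph1 !hornerC.
  - move=> _ _ _ _ [p [-> ->]] [q [-> ->]]; exists (p - q).
    by rewrite rmorphB !hornerD !hornerN.
  - move=> _ _ _ _ [p [-> ->]] [q [-> ->]]; exists (p * q).
    by rewrite rmorphM !hornerM.
  - by move=> v [p [/esym/rootP/zz'/rootP h ->]].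
have [P hP] := chevalley gG.
have PL x : L x -> pO P x /\ pf P x = x.
  move=> Lx; apply: hP; have [y <-] := sft_ex Lx.
  by exists y%:P; rewrite map_polyC !hornerC.
have PO x : pO P x.
  have [p [p0 rp]] := aL x; apply: pO_root rp.
    by move=> i; apply: (PL _ _).1; exact: Lp_map.
  rewrite (PL _ _).2; first by rewrite lead_coef_eq0 map_poly_eq0.
  by rewrite lead_coefE; exact: Lp_map.
have [s hs] : exists g : {rmorphism Om -> Om}, g =1 pf P.
  apply: rmorph_of; first by move=> x y; apply: pfB.
  - by move=> x y; apply: pfM.
  - exact: pf1.
have sL x : L x -> s x = x by move=> /PL [_]; rewrite hs.
exists s; split; first by split => //; apply: endo_bij sL.
rewrite hs; apply: (hP z z' _).2; exists 'X.
by rewrite map_polyX !hornerX.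
Qed.

Lemma iso_ext L z z' (m : {poly sft L}) : algo L ->
  (forall h, root (map_poly (sfm L) h) z -> m %| h) ->
  root (map_poly (sfm L) m) z' -> exists s, autL L s /\ s z = z'.
Proof.
move=> aL mz rz'; apply: iso_ext0 => // p /mz dv.
by apply: root_dvd rz'; rewrite dvdp_map.
Qed.

Lemma aut_root L (s : {rmorphism Om -> Om}) p z : autL L s -> Lp L p -> root p z -> root p (s z).
Proof.
move=> [_ sL] hp; have {2}<- : map_poly s p = p; last by rewrite fmorph_root.
by apply/polyP => i; rewrite coef_map /= sL.
Qed.

Definition adj_pred L (z y : Om) := exists p q : {poly sft L},
  (map_poly (sfm L) q).[z] != 0 /\ y = (map_poly (sfm L) p).[z] / (map_poly (sfm L) q).[z].

Lemma adj1 L z : adj_pred L z 1.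
Proof. by exists 1, 1; rewrite rmorph1 hornerC divr1 oner_eq0. Qed.
Lemma adjB L z x y : adj_pred L z x -> adj_pred L z y -> adj_pred L z (x - y).
Proof.
move=> [p [q [q0 ->]]] [p' [q' [q'0 ->]]].
exists (p * q' - p' * q), (q * q').
rewrite rmorphB !rmorphM /= hornerD hornerN !hornerM mulf_neq0 //; split=> //.
by rewrite -mulNr addf_div // mulNr.
Qed.
Lemma adjM L z x y : adj_pred L z x -> adj_pred L z y -> adj_pred L z (x * y).
Proof.
move=> [p [q [q0 ->]]] [p' [q' [q'0 ->]]].
exists (p * p'), (q * q').
rewrite !rmorphM /= !hornerM mulf_neq0 //; split=> //.
by rewrite mulf_div.
Qed.
Lemma adjV L z x : adj_pred L z x -> adj_pred L z x^-1.
Proof.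
move=> [p [q [q0 ->]]]; have [e|p0] := eqVneq (map_poly (sfm L) p).[z] 0.
  by exists 0, 1; rewrite e mul0r invr0 rmorph0 rmorph1 horner0 !hornerC mul0r oner_neq0.
by exists q, p; split=> //; rewrite invf_div.
Qed.
Definition adj L z := SField (adj1 L z) (@adjB L z) (@adjM L z) (@adjV L z).

Lemma adj_sub L z x : L x -> adj L z x.
Proof.
move=> /sft_ex [y <-]; exists y%:P, 1.
by rewrite rmorph1 hornerC divr1 oner_neq0 map_polyC hornerC.
Qed.
Lemma adj_gen L z : adj L z z.
Proof. by exists 'X, 1; rewrite map_polyX rmorph1 hornerX hornerC divr1 oner_neq0. Qed.
Lemma adj_min L (L' : sfield Om) z : (forall x, L x -> L' x) -> L' z -> forall y, adj L z y -> L' y.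
Proof.
move=> LL' Lz y [p [q [_ ->]]]; apply: sfM; last apply: sfV; apply: Lp_horner => // i;
  by apply: LL'; exact: Lp_map.
Qed.

(** A denominator that is nonzero at [z] is coprime to the minimal polynomial of [z], so Bezout
    inverts it polynomially. *)
Lemma adj_poly L z y : algo L -> adj L z y ->
  exists p : {poly sft L}, y = (map_poly (sfm L) p).[z].
Proof.
move=> aL [p [q [q0 ->]]].
have [m [mm rm mz]] := minpoly_ex (aL z).
have cop : coprimep m q.
  have gm : gcdp m q %| m by exact: dvdp_gcdl.
  have gz : (map_poly (sfm L) (gcdp m q)).[z] != 0.
    apply: contra_neq q0 => /rootP h; apply/rootP; apply: root_dvd h.
    by rewrite dvdp_map dvdp_gcdr.
  have [w ew] := dvdpP _ _ gm.
  have /mz mw : root (map_poly (sfm L) w) z.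
    move: rm; rewrite {1}ew rmorphM rootM => /orP [//|/rootP h].
    by rewrite h eqxx in gz.
  have m0 : m != 0 by rewrite monic_neq0.
  have w0 : w != 0 by apply: contra_neq m0 => w0; rewrite ew w0 mul0r.
  have g0 : gcdp m q != 0 by apply: contra_neq m0 => w0'; rewrite ew w0' mulr0.
  have := dvdp_leq w0 mw; rewrite {1}ew size_mul // /coprimep.
  have : (0 < size w)%N by rewrite size_poly_gt0.
  have : (0 < size (gcdp m q))%N by rewrite size_poly_gt0.
  by move=> h1 h2 h3; apply/eqP; move: h1 h2 h3; set a := size _; set b := size _; plia.
have [[u v] /= e] := Bezout_eq1_coprimepP _ _ cop.
have {u v e} [u [v e]] : exists u v : {poly sft L}, u * m + v * q = 1 by exists u, v.
exists (p * v); rewrite (rmorphM (map_poly (sfm L))) hornerM; congr (_ * _).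
apply: (mulIf q0); rewrite mulVf // -hornerM -rmorphM /=.
have -> : v * q = 1 - u * m by rewrite -e addrC addKr.
by rewrite (rmorphB (map_poly (sfm L))) (rmorphM (map_poly (sfm L))) rmorph1 /= hornerD hornerN hornerM (rootP rm) mulr0 subr0 hornerC.
Qed.

Definition sepe L (z : Om) := exists p : {poly Om}, [/\ Lp L p, separable_poly p & root p z].

(** Write [y = h(z)] with [h] reduced modulo the minimal polynomial of [z]. The conjugates of [y]
    are the values of [h] at the distinct roots of that polynomial; if they all agree, [h] minus a
    constant has more roots than its degree allows. *)
Lemma sep_step L z y : algo L -> sepe L z -> adj L z y ->
  (forall s, autL L s -> s y = y) -> L y.
Proof.
move=> aL [p [Lpp sp rp]] /(adj_poly aL) [h ->] hy.
have [m [mm rm mz]] := minpoly_ex (aL z).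
have [p' ep'] := Lp_ex Lpp.
have m0 : m != 0 by rewrite monic_neq0.
have dm : m %| p' by apply: mz; rewrite ep'.
have sm : separable_poly (map_poly (sfm L) m).
  by apply: dvdp_separable sp; rewrite -ep' dvdp_map.
set M := map_poly (sfm L) m in rm sm *.
have [r er] := closed_field_poly_normal M.
have lM : lead_coef M = 1 by apply/eqP; rewrite -monicE map_monic.
rewrite lM scale1r in er.
have ur : uniq r by rewrite -separable_prod_XsubC -er.
pose h' := h %% m.
have eh x : root M x -> (map_poly (sfm L) h).[x] = (map_poly (sfm L) h').[x].
  move=> /rootP rx; rewrite (divp_eq h m) rmorphD rmorphM /= hornerD hornerM -/M rx.
  by rewrite mulr0 add0r.
have hr x : root M x -> (map_poly (sfm L) h').[x] = (map_poly (sfm L) h').[z].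
  move=> rx; have [s [sL sz]] := iso_ext aL mz rx.
  rewrite -[RHS]eh // -(hy s sL) eh // -sz -(horner_map s) /=; congr _.[_].
  rewrite -map_poly_comp /=; apply: eq_map_poly => c /=.
  by rewrite sL.2 //; exact: sfvP.
have : (map_poly (sfm L) h') - (map_poly (sfm L) h').[z]%:P = 0.
  apply/eqP; apply: contraT => nz.
  have : (size r < size (map_poly (sfm L) h' - (map_poly (sfm L) h').[z]%:P)%R)%N.
    apply: max_poly_roots => //; apply/allP => x xr.
    rewrite /root hornerD hornerN hornerC hr ?subrr //.
    by rewrite er root_prod_XsubC.
  have sr : size r = (size m).-1.
    by rewrite -(size_map_poly (sfm L)) -/M er size_prod_XsubC.
  have szm : (0 < size m)%N by rewrite size_poly_gt0.
  have szh : (size h' < size m)%N by rewrite ltn_modp.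
  have := size_polyD (map_poly (sfm L) h') (- (map_poly (sfm L) h').[z]%:P).
  rewrite size_polyN size_map_poly => le lt.
  have := leq_trans lt le; rewrite sr size_polyC.
  have smm : (1 < size m)%N.
    by rewrite -(size_map_poly (sfm L)); apply: root_size_gt1 rm; rewrite map_poly_eq0.
  by clear -szm szh smm; case: (_ != 0) => /=; plia.
move=> /eqP; rewrite subr_eq0 => /eqP e.
rewrite eh //.
by have -> : (map_poly (sfm L) h').[z] = (map_poly (sfm L) h')`_0; [rewrite {2}e coefC|exact: Lp_map].
Qed.

Fixpoint adjs L (S : seq Om) := if S is z :: S' then adjs (adj L z) S' else L.

Lemma adjs_sub L S x : L x -> adjs L S x.
Proof. by elim: S L => //= z S IH L h; apply: IH; exact: adj_sub. Qed.
Lemma adjs_gen L S x : x \in S -> adjs L S x.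
Proof.
elim: S L => //= z S IH L; rewrite inE => /orP [/eqP ->|]; last exact: IH.
by apply: adjs_sub; exact: adj_gen.
Qed.
Lemma adjs_min L (L' : sfield Om) S : (forall x, L x -> L' x) -> (forall z, z \in S -> L' z) ->
  forall y, adjs L S y -> L' y.
Proof.
elim: S L => //= z S IH L LL' SL' y; apply: IH.
  by apply: adj_min => //; apply: SL'; rewrite mem_head.
by move=> x xS; apply: SL'; rewrite inE xS orbT.
Qed.

Lemma autL_sub L L' s : (forall x, L x -> L' x) -> autL L' s -> autL L s.
Proof. by move=> h [b hs]; split => // x /h; exact: hs. Qed.

Lemma sepe_sub L L' z : (forall x, L x -> L' x) -> sepe L z -> sepe L' z.
Proof. by move=> h [p [hp sp rp]]; exists p; split => // i; exact: h. Qed.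

Lemma sep_fixed L S y : algo L -> (forall z, z \in S -> sepe L z) -> adjs L S y ->
  (forall s, autL L s -> s y = y) -> L y.
Proof.
elim: S L => //= z S IH L aL sS ay hy.
have sub x : L x -> adj L z x by exact: adj_sub.
apply: (sep_step aL (sS z (mem_head _ _))) => //.
apply: IH ay _ => //; first exact: algo_sub sub aL.
  by move=> x xS; apply: sepe_sub sub _; apply: sS; rewrite inE xS orbT.
by move=> s hs; apply: hy; exact: autL_sub sub hs.
Qed.

(** If [p] does not divide [N], the subleading coefficient is [- N y]. Otherwise the power is a
    polynomial in ['X^p], and [y ^+ p] with exponent [N / p] takes over. *)
Lemma Xsub_exp_insep L (p : nat) y N : p \in [pchar Om] -> (0 < N)%N ->
  Lp L (('X - y%:P) ^+ N) -> exists k, L (y ^+ (p ^ k)).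
Proof.
move=> chp; have pp := pcharf_prime chp.
have [n] := ubnP N; elim: n N y => // n IH N y lN N0 LN.
have [/dvdnP [N' eN]|ndv] := boolP (p %| N)%N; last first.
  exists 0%N; rewrite expn0 expr1.
  have := LN N.-1.
  have -> : ('X - y%:P) ^+ N = \prod_(z <- nseq N y) ('X - z%:P).
    by rewrite big_nseq; elim: (N) => //= k <-; rewrite exprS.
  have e := coefPn_prod_XsubC (ps := nseq N y); rewrite size_nseq in e.
  rewrite e -?lt0n // big_nseq.
  have -> : iter N (+%R y) 0 = y *+ N by elim: (N) => //= k ->; rewrite mulrS.
  move=> /sfN; rewrite opprK -mulr_natr => h.
  have nz : N%:R != 0 :> Om by rewrite -(dvdn_pcharf chp).
  by rewrite -(mulfK nz y); apply: sfM => //; apply: sfV; exact: sf_nat.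
have N'0 : (0 < N')%N by move: N0; rewrite eN muln_gt0 => /andP[].
have p1 := prime_gt1 pp.
have chpp : p \in [pchar {poly Om}] by rewrite pchar_poly.
have e : ('X - y%:P) ^+ N = (('X - (y ^+ p)%:P) ^+ N') \Po 'X^p.
  rewrite eN mulnC exprM rmorphXn /= rmorphB /= comp_polyX comp_polyC; congr (_ ^+ _).
  by rewrite rmorphXn -!(pFrobenius_autE chpp) pFrobenius_autB_comm //; exact: mulrC.
have [||k hk] := IH N' (y ^+ p) _ N'0.
- by move: lN; rewrite eN ltnS => h; apply: leq_trans h; rewrite ltn_Pmulr.
- move=> i; have := LN (i * p)%N; rewrite e coef_comp_poly_Xn ?prime_gt0 //.
  by rewrite dvdn_mull // mulnK // prime_gt0.
by exists k.+1; rewrite expnS exprM.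
Qed.

(** All roots of the minimal polynomial are conjugate, hence equal to [y]. Without separability only
    a [p]-power of [y] is reached. *)
Lemma fixed_insep L (p : nat) y : p \in [pchar Om] -> algo L ->
  (forall s, autL L s -> s y = y) -> exists k, L (y ^+ (p ^ k)).
Proof.
move=> chp aL hy; have [m [mm rm mz]] := minpoly_ex (aL y).
set M := map_poly (sfm L) m in rm.
have [r er] := closed_field_poly_normal M.
have lM : lead_coef M = 1 by apply/eqP; rewrite -monicE map_monic.
rewrite lM scale1r in er.
have ry x : x \in r -> x = y.
  move=> xr; have rx : root M x by rewrite er root_prod_XsubC.
  by have [s [sL <-]] := iso_ext aL mz rx; exact: hy.
have er' : r = nseq (size r) y.
  by elim: (r) ry => //= x r' IH h; rewrite {1}(h x (mem_head _ _)) -IH // => x' hx'; apply: h; rewrite inE hx' orbT.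
have : Lp L (('X - y%:P) ^+ size r).
  have <- : M = ('X - y%:P) ^+ size r; last exact: Lp_map.
  rewrite er {1}er' big_nseq; elim: (size r) => //= k ->; by rewrite exprS.
apply: Xsub_exp_insep => //.
by case: (r) er => [|//]; rewrite big_nil => e; move: rm; rewrite e /root hornerC oner_eq0.
Qed.
End Aut.

(** * Orbits of automorphisms *)

Section LinAlg.
Variables (Om : fieldType) (L : sfield Om).

Definition spans (J : finType) (b : J -> Om) (x : Om) :=
  exists c : J -> Om, (forall k, L (c k)) /\ x = \sum_k c k * b k.
Definition indep (I : finType) (E : I -> Om) :=
  forall c : I -> Om, (forall k, L (c k)) -> \sum_k c k * E k = 0 -> forall k, c k = 0.

(** Steinitz: the coordinate matrix would have more rows than columns, and a vector of its left
    kernel is a relation. *)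
Lemma indep_le (I J : finType) (E : I -> Om) (b : J -> Om) :
  (forall i, spans b (E i)) -> indep E -> (#|I| <= #|J|)%N.
Proof.
move=> sp ind; rewrite leqNgt; apply/negP => lt.
pose c i := sval (cid (sp i)).
have cP i : (forall k, L (c i k)) /\ E i = \sum_k c i k * b k by rewrite /c; case: cid.
have cL i k : exists y : sft L, sfv y = c i k by apply: sft_ex; exact: (cP i).1.
pose m i k := sval (cid (cL i k)).
have mP i k : sfv (m i k) = c i k by rewrite /m; case: cid.
pose M : 'M[sft L]_(#|I|, #|J|) := \matrix_(i, k) m (enum_val i) (enum_val k).
have /rowV0Pn [v /sub_kermxP vM v0] : kermx M != 0.
  by rewrite -mxrank_eq0 mxrank_ker -lt0n subn_gt0; apply: leq_ltn_trans lt; exact: rank_leq_col.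
case/rV0Pn: v0 => i0; apply/negP; rewrite negbK.
have h := ind (fun i => sfv (v 0 (enum_rank i))) (fun i => sfvP _) _ (enum_val i0).
apply/eqP; apply: val_inj => /=; rewrite -[RHS]h ?enum_valK //.
under eq_bigr do rewrite (cP _).2 mulr_sumr.
rewrite exchange_big /= big1 // => k _.
have := congr1 (fun N : 'rV_ _ => N 0 (enum_rank k)) vM; rewrite !mxE => /(congr1 (sfm L)).
rewrite rmorph_sum rmorph0 /= => e.
have {}e := congr1 (fun y => y * b k) e; rewrite mul0r mulr_suml in e.
apply: etrans e; rewrite [RHS](reindex enum_rank) /=; last first.
  by apply: onW_bij; exact: enum_rank_bij.
by apply: eq_bigr => i _; rewrite !mxE !enum_rankK mulrA -mP.
Qed.

Lemma indep_dep (I J : finType) (E : I -> Om) (b : J -> Om) :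
  (forall i, spans b (E i)) -> (#|J| < #|I|)%N ->
  exists c : I -> Om, [/\ forall k, L (c k), \sum_k c k * E k = 0 & exists k, c k != 0].
Proof.
move=> sp lt; apply: contrapT => no.
have : (#|I| <= #|J|)%N; last by rewrite leqNgt lt.
apply: indep_le sp _ => c cL cE k; apply/eqP; apply: contrapT => /negP ck.
by apply: no; exists c; split => //; exists k.
Qed.

Lemma basis_ex (K : Om -> Prop) (J : finType) (b : J -> Om) :
  (forall x, K x -> spans b x) ->
  exists k, exists e : 'I_k -> Om, [/\ (k <= #|J|)%N, forall i, K (e i), indep e & forall x, K x -> spans e x].
Proof.
move=> sp.
pose Q k := `[< exists e : 'I_k -> Om, (forall i, K (e i)) /\ indep e >].
have Q0 : exists k, Q k.
  exists 0%N; apply/asboolP; exists (fun _ => 0); split; first by case.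
  by move=> c _ _; case.
have Qle k : Q k -> (k <= #|J|)%N.
  move=> /asboolP [e [Ke ie]]; rewrite -[k]card_ord; apply: indep_le ie => i; exact: sp.
have [k /asboolP [e [Ke ie]] kmax] := ex_maxnP Q0 Qle.
exists k, e; split => //; first by apply: Qle; apply/asboolP; exists e.
move=> x Kx; apply: contrapT => nsp.
suff /kmax : Q k.+1 by rewrite ltnn.
apply/asboolP; exists (fun i : 'I_k.+1 => if unlift ord_max i is Some j then e j else x).
split; first by move=> i; case: unliftP => // j _; exact: Ke.
move=> c cL; rewrite (bigD1_ord ord_max) //= unlift_none.
under eq_bigr do rewrite liftK.
move=> s0.
have co : c ord_max = 0.
  apply/eqP; apply: contrapT => /negP c0; apply: nsp.
  exists (fun i => - (c ord_max)^-1 * c (lift ord_max i)); split.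
    by move=> i; apply: sfM => //; apply: sfN; exact: sfV.
  apply: (mulfI c0); rewrite mulr_sumr; move/eqP: s0; rewrite addr_eq0 => /eqP ->.
  rewrite -sumrN; apply: eq_bigr => i _.
  by rewrite mulNr mulNr mulrN !mulrA mulfV // mul1r.
rewrite co mul0r add0r in s0.
move=> i; case: (unliftP ord_max i) => [j ->|-> //].
exact: (ie (fun i => c (lift ord_max i)) (fun i => cL _) s0).
Qed.
End LinAlg.

Section Tower.
Variable (Om : closedFieldType).
Implicit Types (L K : sfield Om).

Definition degr L (K : Om -> Prop) n := (forall x, L x -> K x) /\
  exists b : 'I_n -> Om, [/\ forall k, K (b k), forall x, K x -> spans L b x & indep L b].

(** The products [z ^+ i * e j] form a second basis; [indep_le] in both directions compares it with
    [b]. *)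
Lemma tower L K n z (m : {poly sft L}) : algo L -> degr L K n -> K z ->
  m \is monic -> root (map_poly (sfm L) m) z ->
  (forall h, root (map_poly (sfm L) h) z -> m %| h) ->
  exists n1, degr (adj L z) K n1 /\ n = ((size m).-1 * n1)%N.
Proof.
move=> aL [LK [b [Kb sb ib]]] Kz mm rm mz.
have sub x : L x -> adj L z x by exact: adj_sub.
have LK1 x : adj L z x -> K x by apply: adj_min.
have sb1 x : K x -> spans (adj L z) b x.
  by move=> /sb [c [cL ->]]; exists c; split => // k; exact: sub.
have [k [e [kn Ke ie se]]] := basis_ex sb1.
exists k; split; first by split => //; exists e; split.
set d := (size m).-1.
have m0 : m != 0 by rewrite monic_neq0.
pose E (ij : 'I_d * 'I_k) := z ^+ ij.1 * e ij.2.
have iE : indep L E.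
  move=> c cL.
  have -> : \sum_ij c ij * E ij = \sum_i \sum_j c (i, j) * E (i, j).
    by rewrite pair_bigA; apply: eq_bigr => -[].
  rewrite exchange_big /= => s0.
  have h := ie (fun j => \sum_(i < d) c (i, j) * z ^+ i) _ _.
  have {}h j : \sum_(i < d) c (i, j) * z ^+ i = 0.
    apply: h; first by move=> j'; apply: sf_sum => i _; apply: sfM; [exact: sub|apply: sfX; exact: adj_gen].
    apply: etrans s0; apply: eq_bigr => j' _; rewrite mulr_suml; apply: eq_bigr => i _.
    by rewrite /E /= mulrA.
  move=> [i j].
  have cLp : Lp L (\poly_(i < d) (if insub i is Some i' then c (i', j) else 0)).
    by move=> l; rewrite coef_poly; case: ifP => _; [case: insub => [l'|]; [exact: cL|exact: sf0]|exact: sf0].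
  have [p ep] := Lp_ex cLp.
  have rp : root (map_poly (sfm L) p) z.
    rewrite ep /root horner_poly -[X in _ == X](h j); apply/eqP; apply: eq_bigr => l _.
    by rewrite valK.
  have : p = 0.
    apply/eqP; apply: contraT => p0; have := dvdp_leq p0 (mz _ rp).
    rewrite -(size_map_poly (sfm L) p) ep leqNgt => /negP[].
    have sm0 : (0 < size m)%N by rewrite size_poly_gt0.
    by apply: leq_ltn_trans (size_poly _ _) _; rewrite /d; plia.
  move=> p0; have := congr1 (fun q : {poly Om} => q`_i) ep; rewrite p0 rmorph0 coef0 coef_poly ltn_ord valK.
  by move=> /esym.
have KE ij : K (E ij) by apply: sfM => //; exact: sfX.
have sE x : K x -> spans L E x.
  move=> /se [c [cL ->]].
  have cp j : exists p : {poly sft L}, c j = (map_poly (sfm L) p).[z] /\ (size p <= d)%N.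
    have [p ->] := adj_poly aL (cL j); exists (p %% m); split.
      rewrite {1}(divp_eq p m) (rmorphD (map_poly (sfm L))) (rmorphM (map_poly (sfm L))) /=.
      by rewrite hornerD hornerM (rootP rm) mulr0 add0r.
    have sm1 : (size (p %% m)%R < size m)%N by rewrite ltn_modp.
    by rewrite /d; plia.
  pose p j := sval (cid (cp j)).
  have pP j : c j = (map_poly (sfm L) (p j)).[z] /\ (size (p j) <= d)%N by rewrite /p; case: cid.
  exists (fun ij : 'I_d * 'I_k => (map_poly (sfm L) (p ij.2))`_ij.1); split; first by move=> ij; exact: Lp_map.
  have -> : \sum_(k0 : 'I_d * 'I_k) (map_poly (sfm L) (p k0.2))`_k0.1 * E k0 =
      \sum_(i < d) \sum_(j < k) (map_poly (sfm L) (p j))`_i * E (i, j).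
    by rewrite pair_bigA; apply: eq_bigr => -[].
  rewrite exchange_big /=.
  apply: eq_bigr => j _; rewrite (pP j).1 (@horner_coef_wide _ d) ?size_map_poly ?(pP j).2 // mulr_suml.
  by apply: eq_bigr => i _; rewrite /E /= mulrA.
apply/eqP; rewrite eqn_leq; apply/andP; split.
  have := indep_le (fun i => sE _ (Kb i)) ib; by rewrite card_prod !card_ord.
have := indep_le (fun i => sb _ (KE i)) iE; by rewrite card_prod !card_ord.
Qed.

Lemma aut_inv L (s : {rmorphism Om -> Om}) : autL L s ->
  exists s', [/\ autL L s', cancel s s' & cancel s' s].
Proof.
move=> [bs sL]; have [g sg gs] := bs.
have [s' es'] : exists s' : {rmorphism Om -> Om}, s' =1 g.
  apply: rmorph_of.
  - by move=> x y; apply: (can_inj sg); rewrite gs rmorphB !gs.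
  - by move=> x y; apply: (can_inj sg); rewrite gs rmorphM !gs.
  - by apply: (can_inj sg); rewrite gs rmorph1.
have c1 : cancel s s' by move=> x; rewrite es' sg.
have c2 : cancel s' s by move=> x; rewrite es' gs.
exists s'; split => //; split; first by exists s.
by move=> x Lx; rewrite -{1}(sL x Lx) c1.
Qed.

Lemma aut_comp L (s s' : {rmorphism Om -> Om}) : autL L s -> autL L s' ->
  exists t, autL L t /\ t =1 s \o s'.
Proof.
move=> [b h] [b' h']; exists (s \o s'); split=> //; split; first exact: bij_comp.
by move=> x Lx /=; rewrite h' // h.
Qed.

Lemma aut_iter L (s : {rmorphism Om -> Om}) n : autL L s ->
  exists t, autL L t /\ t =1 iter n s.
Proof.
move=> hs; elim: n => [|n [t [ht et]]].
  by exists idfun; split => //; split => //; exists idfun.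
have [u [hu eu]] := aut_comp hs ht; exists u; split=> // x; by rewrite eu /= et.
Qed.

(** The roots of [m] are conjugate and have equal multiplicity, so the number of distinct roots
    divides the degree, also in the inseparable case. The orbits of [s] partition them, so some
    orbit length has [l]-adic valuation at most that of their number. *)
Lemma orbit_step L (s : {rmorphism Om -> Om}) z (m : {poly sft L}) (l : nat) :
  algo L -> autL L s -> prime l ->
  m \is monic -> root (map_poly (sfm L) m) z ->
  (forall h, root (map_poly (sfm L) h) z -> m %| h) ->
  exists x k, [/\ root (map_poly (sfm L) m) x, (0 < k <= (size m).-1)%N, iter k s x = x
     & (logn l k <= logn l (size m).-1)%N].
Proof.
move=> aL hs pl mm rm mz; set M := map_poly (sfm L) m in rm *.
have [r er] := closed_field_poly_normal M.
have lM : lead_coef M = 1 by apply/eqP; rewrite -monicE map_monic.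
rewrite lM scale1r in er.
have sr : size r = (size m).-1 by rewrite -(size_map_poly (sfm L)) -/M er size_prod_XsubC.
have rE x : (x \in r) = root M x by rewrite er root_prod_XsubC.
have perm_r t : autL L t -> perm_eq (map t r) r.
  move=> ht; apply: prod_XsubC_eq; rewrite -er.
  have <- : map_poly t M = M.
    by apply/polyP => i; rewrite coef_map /= ht.2 // coef_map; exact: sfvP.
  rewrite er rmorph_prod big_map /=; apply: eq_bigr => x _.
  by rewrite rmorphB /= map_polyX map_polyC.
have cnt x : x \in r -> count_mem x r = count_mem z r.
  move=> xr; have [t [ht tz]] := iso_ext aL mz (etrans (esym (rE x)) xr).
  have /seq.permP/(_ (pred1 x)) <- := perm_r t ht.
  rewrite count_map; apply: eq_count => y /=.
  by rewrite -tz (inj_eq (fmorph_inj t)).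
set R := undup r.
have szR : size r = (size R * count_mem z r)%N.
  rewrite -(perm_size (perm_count_undup r)) size_flatten /shape -map_comp sumnE big_map.
  rewrite (eq_big_seq (fun _ => count_mem z r)) => [|x].
    by rewrite big_const_seq count_predT iter_addn_0 mulnC.
  by rewrite mem_undup /= size_nseq => /cnt.
have zr : z \in r by rewrite rE.
have sR0 : (0 < size R)%N by rewrite -has_predT; apply/hasP; exists z => //; rewrite mem_undup.
have c0 : (0 < count_mem z r)%N by rewrite -has_count; apply/hasP; exists z => //=.
pose T : finType := seq_sub R.
have sT (x : T) : s (val x) \in R.
  have := valP x; rewrite !mem_undup !rE => h; apply: (aut_root hs) => //; exact: Lp_map.
pose g (x : T) : T := SeqSub (sT x).
have ginj : injective g.
  by move=> x y /(congr1 val) /= /(fmorph_inj s) /val_inj.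
pose G := perm ginj.
have itG k (x : T) : iter k s (val x) = val (iter k G x).
  by elim: k => //= k ->; rewrite permE.
have cT : #|T| = size R by rewrite card_seq_sub // undup_uniq.
have part : #|T| = (\sum_(A in porbits G) #|A|)%N.
  rewrite -cardsT; apply: card_partition.
  apply/and3P; split.
  - apply/eqP/setP => x; rewrite [RHS]inE; apply/bigcupP.
    by exists (porbit G x); [apply: imset_f|exact: porbit_id].
  - apply/finset.trivIsetP => _ _ /imsetP [x _ ->] /imsetP [y _ ->] ne.
    rewrite -finset.setI_eq0; apply/eqP/setP => u; rewrite !inE; apply/negbTE/negP => /andP [h1 h2].
    by case/negP: ne; move: h1 h2; rewrite -!eq_porbit_mem => /eqP -> /eqP ->.
  - by apply/negP => /imsetP [x _ e]; have := porbit_id G x; rewrite -e inE.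
have [A [AG lA]] : exists A, A \in porbits G /\ (logn l #|A| <= logn l #|T|)%N.
  apply: contrapT => no.
  have : (l ^ (logn l #|T|).+1 %| #|T|)%N.
    rewrite {2}part; apply: dvdn_sum => A AG.
    have A0 : (0 < #|A|)%N by case/imsetP: AG => x _ ->; apply/card_gt0P; exists x; exact: porbit_id.
    rewrite pfactor_dvdn // ltnNge; apply/negP => h; apply: no; by exists A.
  by rewrite pfactor_dvdn ?cT // ltnn.
case/imsetP: AG lA => x _ -> lx.
exists (val x), #|porbit G x|; split.
- by have := valP x; rewrite mem_undup rE.
- rewrite -sr; apply/andP; split; first by apply/card_gt0P; exists x; exact: porbit_id.
  by apply: leq_trans (max_card _) _; rewrite cT size_undup.
- by rewrite itG iter_porbit.
- by apply: leq_trans lx _; rewrite -sr szR cT; apply: dvdn_leq_log; rewrite ?muln_gt0 ?sR0 // dvdn_mulr.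
Qed.

(** Induction along simple steps: move the generator [z] into an orbit of [s] of suitable length
    [k1], and conjugate [s^k1] back so that it fixes [z]; then continue over [L(z)] with this
    automorphism. Orbit lengths and degrees multiply along the tower, and [l]-adic valuations
    add. *)
Theorem orbit_conj (l : nat) : prime l -> forall n L K (s : {rmorphism Om -> Om}),
  algo L -> degr L (sf_pred K) n -> autL L s ->
  exists (g : {rmorphism Om -> Om}) k, [/\ autL L g, (0 < k <= n)%N, (logn l k <= logn l n)%N
    & forall y, K y -> iter k s (g y) = g y].
Proof.
move=> pl n; have [N] := ubnP n; elim: N n => // N IH n nN L K s aL dK hs.
have n0 : (0 < n)%N.
  case: n dK {nN} => // -[_ [b [_ sb _]]]; have [c [_]] := sb _ (sf1 K).
  by rewrite big_ord0 => /eqP; rewrite oner_eq0.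
have [[z [Kz Lz]]|KL] := pselect (exists z, K z /\ ~ L z); last first.
  exists idfun, 1%N; split => //; first by split => //; exists idfun.
    by rewrite logn1.
  move=> y Ky /=; apply: hs.2; apply: contrapT => nLy; apply: KL; by exists y.
have [m [mm rm mz]] := minpoly_ex (aL z).
have [n1 [dK1 en]] := tower aL dK Kz mm rm mz.
have d1 : (1 < (size m).-1)%N.
  rewrite ltnNge; apply/negP => le; apply: Lz.
  have m0 : map_poly (sfm L) m != 0 by rewrite map_poly_eq0 monic_neq0.
  have := root_size_gt1 m0 rm; rewrite size_map_poly => s1.
  have s2 : size m = 2 by plia.
  have : (map_poly (sfm L) m).[z] = (map_poly (sfm L) m)`_0 + z.
    have m1 : (map_poly (sfm L) m)`_1 = 1.
      by rewrite coef_map; move/monicP: mm; rewrite lead_coefE s2 => ->; exact: (rmorph1 (sfm L)).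
    rewrite horner_coef size_map_poly s2 !big_ord_recl big_ord0 addr0 expr0 mulr1.
    congr (_ + _); exact: (etrans (congr1 (fun u => u * z) m1) (mul1r z)).
  rewrite (rootP rm) => /esym/eqP; rewrite addrC addr_eq0 => /eqP ->.
  by apply: sfN; exact: Lp_map.
have [x [k1 [rx k1b k1x lk1]]] := orbit_step aL hs pl mm rm mz.
have [g1 [hg1 g1z]] := iso_ext aL mz rx.
have [g1' [hg1' c1 c1']] := aut_inv hg1.
have [sk [hsk esk]] := aut_iter k1 hs.
have [t [ht et]] := aut_comp hsk hg1; have [s1 [hs1 es1]] := aut_comp hg1' ht.
have sub y : L y -> adj L z y by exact: adj_sub.
have s1z : s1 z = z by rewrite es1 /= et /= esk g1z k1x -g1z c1.
have hs1' : autL (adj L z) s1.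
  split; first by case: hs1.
  move=> y [p [q [_ ->]]]; rewrite fmorph_div -!horner_map /= s1z.
  have e p' : map_poly s1 (map_poly (sfm L) p') = map_poly (sfm L) p'.
    by apply/polyP => i; rewrite !coef_map /= hs1.2 //; exact: sfvP.
  by rewrite !e.
have n10 : (0 < n1)%N by move: n0; rewrite en muln_gt0 => /andP[].
have lt1 : (n1 < N)%N.
  apply: leq_trans (_ : (n1 < n)%N) _; last by rewrite -ltnS.
  by rewrite en -[X in (X < _)%N]mul1n ltn_pmul2r.
have [g2 [k2 [hg2 k2b lk2 h2]]] := IH n1 lt1 (adj L z) K s1 (algo_sub sub aL) dK1 hs1'.
have [g [hg eg]] := aut_comp hg1 (autL_sub sub hg2).
exists g, (k1 * k2)%N; split => //.
- by move: k1b k2b => /andP [a b] /andP [c d]; rewrite muln_gt0 a c en leq_mul.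
- move: k1b k2b => /andP [a b] /andP [c d].
  rewrite en !lognM //; first by apply: leq_add.
  exact: ltn_trans d1.
move=> y /h2 e2; rewrite eg /= -[in RHS]e2.
have conj k u : iter (k1 * k) s (g1 u) = g1 (iter k s1 u).
  elim: k => [|k IHk]; first by rewrite muln0.
  by rewrite mulnS iterD IHk /= es1 /= et /= c1' esk.
by rewrite conj.
Qed.
End Tower.

(** * Valuations *)

Lemma expzN (R : unitRingType) (x : R) (n : int) : x ^ (- n) = (x ^ n)^-1.
Proof. by rewrite invr_expz. Qed.

Section Units.
Variables (Om : fieldType) (P : place Om).
Local Notation O := (pO P).
Local Notation f := (pf P).

Definition punit x := O x /\ f x != 0.
Lemma punit_neq0 x : punit x -> x != 0.
Proof. by case=> _; apply: contra_neq => ->; rewrite pf0. Qed.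
Lemma punit1 : punit 1.
Proof. by split; [exact: pO1|rewrite pf1 oner_neq0]. Qed.
Lemma punitM x y : punit x -> punit y -> punit (x * y).
Proof. by move=> [hx ux] [hy uy]; split; [exact: pOM|rewrite pfM // mulf_neq0]. Qed.
Lemma punitV x : punit x -> punit x^-1.
Proof. by move=> [hx ux]; split; [exact: pOunit|rewrite pfV // invr_eq0]. Qed.
Lemma punitX x n : punit x -> punit (x ^+ n).
Proof. by move=> h; elim: n => [|n IH]; rewrite ?expr0 ?exprS; [exact: punit1|exact: punitM]. Qed.
Lemma punitP x : x != 0 -> O x -> O x^-1 -> punit x.
Proof.
move=> x0 h h'; split=> //; apply/eqP => e.
have := oner_neq0 Om; rewrite -(pf1 P) -(mulfV x0) pfM // e mul0r eqxx //.
Qed.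
Lemma pO_tot x : O x \/ (O x^-1 /\ f x^-1 = 0).
Proof. by case: (pselect (O x)) => h; [left|right; split; [exact: pOV|exact: pfV0]]. Qed.

Lemma max_term (s : seq Om) : (exists2 x, x \in s & x != 0) ->
  exists y, [/\ y \in s, y != 0 & forall z, z \in s -> O (z / y)].
Proof.
elim: s => [[x]//|a s IH] H.
have [[x xs x0]|ns] := pselect (exists2 x, x \in s & x != 0).
  have [y [ys y0 hy]] := IH (ex_intro2 _ _ x xs x0).
  have [h|[h _]] := pO_tot (a / y).
    exists y; split; rewrite ?inE ?ys ?orbT // => z; rewrite inE => /orP [/eqP ->//|]; exact: hy.
  have [a0|a0] := eqVneq a 0.
    exists y; split; rewrite ?inE ?ys ?orbT // => z; rewrite inE => /orP [/eqP ->|]; last exact: hy.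
    by rewrite a0 mul0r; exact: pO0.
  exists a; split; rewrite ?mem_head // => z; rewrite inE => /orP [/eqP ->|/hy hz].
    by rewrite mulfV //; exact: pO1.
  have -> : z / a = (z / y) * (a / y)^-1 by rewrite invf_div mulrA divfK.
  exact: pOM.
have s0 z : z \in s -> z = 0.
  by move=> zs; apply/eqP; apply: contrapT => /negP z0; apply: ns; exists z.
have [a0|a0] := eqVneq a 0.
  case: H => x; rewrite inE a0 => /orP [/eqP ->|/s0 ->]; by rewrite eqxx.
exists a; split; rewrite ?mem_head // => z; rewrite inE => /orP [/eqP ->|/s0 ->].
  by rewrite mulfV //; exact: pO1.
by rewrite mul0r; exact: pO0.
Qed.

(** In a vanishing sum the terms of least valuation must cancel, so there are at least two of them.
    This plays the role of Newton polygons below. *)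
Lemma two_max n (E : 'I_n -> Om) : (exists i, E i != 0) -> \sum_i E i = 0 ->
  exists i j, [/\ i != j, E i != 0, E j != 0, punit (E i / E j) & forall k, O (E k / E j)].
Proof.
move=> [i0 Ei0] s0.
have [|y [/mapP [j _ ->] y0 hy]] := @max_term [seq E i | i <- enum 'I_n].
  by exists (E i0) => //; apply: map_f; rewrite mem_enum.
have hE k : O (E k / E j) by apply: hy; apply: map_f; rewrite mem_enum.
have [[i [ij ui]]|no] := pselect (exists i, i != j /\ f (E i / E j) != 0).
  exists i, j; split => //; apply: contra_neq ui => ->; by rewrite mul0r pf0.
have : f (\sum_i E i / E j) = 0 by rewrite -mulr_suml s0 mul0r pf0.
rewrite pf_sum // (bigD1 j) //= mulfV // pf1 big1 ?addr0 => [/eqP|i ij].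
  by rewrite oner_eq0.
by apply/eqP; apply: contrapT => /negP h; apply: no; exists i.
Qed.
End Units.

(** Rational values suffice because [Om] is algebraic over a field on which the valuation is
    discrete. Nothing is said about [w 0]. *)
Record valn (Om : fieldType) (P : place Om) (w : Om -> rat) : Prop := Valn {
  wM : forall x y, x != 0 -> y != 0 -> w (x * y) = w x + w y;
  wO : forall x, x != 0 -> (pO P x <-> 0 <= w x);
  wU : forall x, x != 0 -> (punit P x <-> w x = 0) }.

Section Val.
Variables (Om : fieldType) (P : place Om) (w : Om -> rat).
Hypothesis hw : valn P w.

Lemma w1 : w 1 = 0.
Proof. by apply/(wU hw); rewrite ?oner_neq0 //; exact: punit1. Qed.
Lemma wV x : x != 0 -> w x^-1 = - w x.
Proof.
move=> x0; have := wM hw x0; move=> /(_ x^-1); rewrite mulfV // w1 invr_eq0 => /(_ x0).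
by move=> /esym/eqP; rewrite addrC addr_eq0 => /eqP.
Qed.
Lemma wX x n : x != 0 -> w (x ^+ n) = w x *+ n.
Proof.
move=> x0; elim: n => [|n IH]; rewrite ?expr0 ?w1 // exprS (wM hw) ?expf_neq0 // IH mulrS //.
Qed.
Lemma wdiv x y : x != 0 -> y != 0 -> w (x / y) = w x - w y.
Proof. by move=> x0 y0; rewrite (wM hw) ?invr_eq0 // wV. Qed.
Lemma wgt0 x : x != 0 -> (0 < w x <-> (pO P x /\ pf P x = 0)).
Proof.
move=> x0; have hO := wO hw x0; have hU := wU hw x0; split.
  move=> h; have Ox : pO P x by apply/hO; exact: ltW.
  split=> //; apply/eqP; apply: contraT => fx; have /hU : punit P x by [].
  by move=> e; rewrite e ltxx in h.
move=> [/hO h e]; rewrite lt_def h andbT; apply/eqP => /hU [_]; by rewrite e eqxx.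
Qed.
Lemma wle x y : x != 0 -> y != 0 -> (w x <= w y <-> pO P (y / x)).
Proof.
by move=> x0 y0; rewrite (wO hw) ?mulf_neq0 ?invr_eq0 // wdiv // subr_ge0.
Qed.
Lemma wlt x y : x != 0 -> y != 0 -> (w x < w y <-> (pO P (y / x) /\ pf P (y / x) = 0)).
Proof.
by move=> x0 y0; rewrite -wgt0 ?mulf_neq0 ?invr_eq0 // wdiv // subr_gt0.
Qed.
Lemma weq x y : x != 0 -> y != 0 -> (w x = w y <-> punit P (x / y)).
Proof.
move=> x0 y0; rewrite (wU hw) ?mulf_neq0 ?invr_eq0 // wdiv //; split=> [->|/eqP]; first by rewrite subrr.
by rewrite subr_eq0 => /eqP.
Qed.
Lemma w_ge_sum (I : Type) (r : seq I) (Q : pred I) (E : I -> Om) (c : rat) :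
  (forall i, Q i -> E i != 0 -> c <= w (E i)) ->
  \sum_(i <- r | Q i) E i != 0 -> c <= w (\sum_(i <- r | Q i) E i).
Proof.
move=> h; elim/big_rec: _ => [|i x Qi IH]; first by rewrite eqxx.
have [->|x0] := eqVneq x 0; first by rewrite addr0; exact: h.
have [->|E0] := eqVneq (E i) 0; first by rewrite add0r => _; exact: IH.
move=> s0; have [le|/ltW le] := lerP (w (E i)) (w x).
  apply: le_trans (h i Qi E0) _; apply/wle => //.
  by rewrite mulrDl mulfV //; apply: pOD; [exact: pO1|apply/wle].
apply: le_trans (IH x0) _; apply/wle => //.
by rewrite mulrDl mulfV //; apply: pOD; [apply/wle|exact: pO1].
Qed.
Lemma wD_eq x y : x != 0 -> (y != 0 -> w x < w y) -> x + y != 0 /\ w (x + y) = w x.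
Proof.
move=> x0 h; have [->|y0] := eqVneq y 0; first by rewrite addr0.
have [hO h0] := (wlt x0 y0).1 (h y0).
have u : punit P ((x + y) / x).
  rewrite mulrDl mulfV //; split; first by apply: pOD => //; exact: pO1.
  by rewrite pfD //; [rewrite pf1 h0 addr0 oner_neq0|exact: pO1].
have s0 : x + y != 0 by have := punit_neq0 u; apply: contra_neq => ->; rewrite mul0r.
by split=> //; apply/weq.
Qed.
End Val.

Section ValEx.
Variables (Om : fieldType) (P : place Om) (pi : Om) (E0 : sfield Om).
Hypotheses (aE : algo E0) (pi0 : pi != 0) (Opi : pO P pi) (fpi : pf P pi = 0)
  (hE : forall c, E0 c -> c != 0 -> exists a : int, punit P (c / pi ^ a)).

Let Upi (k : int) : punit P (pi ^ k) -> k = 0.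
Proof.
have pos n : punit P (pi ^+ n) -> n = 0%N.
  by move=> [_]; rewrite pfX // fpi expr0n; case: n => [|n]//=; rewrite eqxx.
case: k => n; first by move/pos => ->.
rewrite NegzE -exprnN => /punitV; rewrite invrK => /pos //.
Qed.

(** Two terms of equal valuation in an equation of [x] over [E0] show that a power of [x] is a power
    of [pi] up to a unit. *)
Let ex x : x != 0 -> exists (n : nat) (a : int), (0 < n)%N /\ punit P (x ^+ n / pi ^ a).
Proof.
move=> x0; have [p [p0 /rootP rp]] := aE x.
set M := map_poly (sfm E0) p in rp.
have M0 : M != 0 by rewrite map_poly_eq0.
rewrite horner_coef in rp.
have lM : lead_coef M != 0 by rewrite lead_coef_eq0.
have sM : (0 < size M)%N by rewrite size_poly_gt0.
have [|i [j [ij Ei Ej u _]]] := two_max P _ rp.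
  have hs : ((size M).-1 < size M)%N by plia.
  by exists (Ordinal hs) => /=; rewrite mulf_neq0 // expf_neq0.
have ci : M`_i != 0 by apply: contra_neq Ei => ->; rewrite mul0r.
have cj : M`_j != 0 by apply: contra_neq Ej => ->; rewrite mul0r.
have EM k : E0 M`_k by exact: Lp_map.
have [a ua] : exists a : int, punit P ((M`_i / M`_j) / pi ^ a).
  by apply: hE; [apply: sfM => //; exact: sfV|rewrite mulf_neq0 ?invr_eq0].
wlog lt : i j ij Ei Ej u ci cj a ua / (j < i)%N.
  move=> W; have [lt|lt|e] := ltngtP i j.
  - apply: (W j i _ _ _ _ _ _ (- a)) => //; first by rewrite eq_sym.
    + by move/punitV: u; rewrite invf_div.
    + by move/punitV: ua; rewrite invfM invf_div expzN invrK mulrC.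
  - exact: (W i j ij _ _ _ _ _ a).
  - by case/negP: ij; apply/eqP; apply: val_inj.
exists (i - j)%N, (- a); split; first by rewrite subn_gt0.
have -> : x ^+ (i - j) / pi ^ (- a) = (M`_i * x ^+ i / (M`_j * x ^+ j)) / (M`_i / M`_j / pi ^ a).
  rewrite expzN invrK; have -> : x ^+ i = x ^+ (i - j) * x ^+ j by rewrite -exprD subnK // ltnW.
  have h1 : x ^+ j != 0 by rewrite expf_neq0.
  have h2 : pi ^ a != 0 by rewrite expfz_neq0.
  by field; rewrite ci cj h1 h2.
by apply: punitM => //; exact: punitV.
Qed.

Let uniq_w x n m (a b : int) : x != 0 -> punit P (x ^+ n / pi ^ a) -> punit P (x ^+ m / pi ^ b) ->
  a * m%:Z = b * n%:Z.
Proof.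
move=> x0 /(punitX m) u /(punitX n) v; apply/eqP; rewrite -subr_eq0; apply/eqP; apply: Upi.
have hp k : pi ^ k != 0 by rewrite expfz_neq0.
rewrite expfzDr // expzN -!exprz_exp.
move: u v; rewrite !exprMn !exprVn -!exprM mulnC => u v.
have -> : (pi ^ a) ^ m%:Z / (pi ^ b) ^ n%:Z =
   (x ^+ (m * n) / (pi ^ b) ^+ n) / (x ^+ (m * n) / (pi ^ a) ^+ m).
  have h1 : x ^+ (m * n) != 0 by rewrite expf_neq0.
  by rewrite -!exprnP; field; rewrite !expf_neq0.
by apply: punitM => //; exact: punitV.
Qed.

(** [w x] is the slope [a / n] of any relation making [x^n] equal to [pi^a] up to a unit;
    cross-multiplication shows that the slope does not depend on the relation. *)
Theorem valuation_ex : exists w : Om -> rat, [/\ valn P w, w pi = 1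
  & forall c, E0 c -> c != 0 -> exists a : int, w c = a%:~R].
Proof.
pose T x := exists z : nat * int, (0 < z.1)%N /\ punit P (x ^+ z.1 / pi ^ z.2).
have TP x : x != 0 -> T x by move=> /ex [n [a h]]; exists (n, a).
pose w x : rat := if pselect (T x) is left h then let z := sval (cid h) in z.2%:~R / z.1%:R else 0.
have wE x n (a : int) : x != 0 -> (0 < n)%N -> punit P (x ^+ n / pi ^ a) -> w x = a%:~R / n%:R.
  move=> x0 n0 u; rewrite /w; case: pselect => [h|]; last by move=> /(_ (TP _ x0)).
  case: (cid h) => -[m b] /= [m0 v].
  have e := uniq_w x0 u v.
  have n1 : n%:R != 0 :> rat by rewrite pnatr_eq0 -lt0n.
  have m1 : m%:R != 0 :> rat by rewrite pnatr_eq0 -lt0n.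
  apply/eqP; rewrite eqr_div //; apply/eqP.
  have := congr1 (fun k : int => k%:~R : rat) e.
  by rewrite !rmorphM /= => ->.
have wE' x : x != 0 -> exists n (a : int), [/\ (0 < n)%N, punit P (x ^+ n / pi ^ a) & w x = a%:~R / n%:R].
  by move=> x0; have [n [a [n0 u]]] := ex x0; exists n, a; split => //; exact: wE.
have hp k : pi ^ k != 0 by rewrite expfz_neq0.
have Opz k : 0 <= k -> pO P (pi ^ k).
  by case: k => // k _; exact: pOX.
have OX x n : (0 < n)%N -> pO P (x ^+ n) -> pO P x.
  move=> n0 h; case: (pO_tot P x) => // -[h1 h2].
  have [->|x0] := eqVneq x 0; first exact: pO0.
  have : pf P (x^-1 ^+ n * x ^+ n) = 0.
    rewrite pfM //; last exact: pOX.
    by rewrite (pfX _ h1) h2 expr0n gtn_eqF // mul0r.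
  by rewrite exprVn mulVf ?expf_neq0 // pf1 => /eqP; rewrite oner_eq0.
have wge x : x != 0 -> 0 <= w x -> pO P x.
  move=> x0; have [n [a [n0 u ->]]] := wE' x x0.
  rewrite pmulr_lge0 ?invr_gt0 ?ltr0n // ler0z => a0.
  apply: (OX _ n n0); rewrite -(divfK (hp a) (x ^+ n)); apply: pOM; [by case: u|exact: Opz].
have wgt x : x != 0 -> 0 < w x -> pf P x = 0.
  move=> x0 h; have Ox := wge _ x0 (ltW h); move: h; have [n [a [n0 u ->]]] := wE' x x0.
  rewrite pmulr_lgt0 ?invr_gt0 ?ltr0n // ltr0z => a0.
  have : pf P (x ^+ n) = 0.
    rewrite -(divfK (hp a) (x ^+ n)) pfM; [|by case: u|by apply: Opz; exact: ltW].
    by case: (a) a0 => // -[|k] // _; rewrite -exprnP pfX // fpi expr0n /= mulr0.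
  by rewrite pfX // => /eqP; rewrite expf_eq0 => /andP [_ /eqP].
have wMM x y : x != 0 -> y != 0 -> w (x * y) = w x + w y.
  move=> x0 y0; have [n [a [n0 u ->]]] := wE' x x0; have [m [b [m0 v ->]]] := wE' y y0.
  rewrite (@wE _ (n * m)%N (a * m%:Z + b * n%:Z)) ?mulf_neq0 ?muln_gt0 ?n0 //.
    have n1 : n%:R != 0 :> rat by rewrite pnatr_eq0 -lt0n.
    have m1 : m%:R != 0 :> rat by rewrite pnatr_eq0 -lt0n.
    by rewrite natrM rmorphD !rmorphM /= -!pmulrn; field; rewrite n1 m1.
  have := punitM (punitX m u) (punitX n v).
  rewrite !exprMn !exprVn -!exprM expfzDr // -!exprz_exp -!exprnP invfM.
  by rewrite [(m * n)%N]mulnC mulrACA.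
have wVV x : x != 0 -> w x^-1 = - w x.
  move=> x0; have e : w 1 = 0 by rewrite (@wE 1 1%N 0) ?oner_neq0 ?mul0r // expr0z expr1n divr1; exact: punit1.
  by apply/eqP; rewrite -addr_eq0 addrC -wMM ?invr_eq0 // mulfV // e.
exists w; split.
- split => // x x0.
    split; last exact: wge.
    move=> h; rewrite leNgt; apply/negP => lt.
    have := wgt x^-1; rewrite invr_eq0 wVV // oppr_gt0 => /(_ x0 lt) e.
    have h' : pO P x^-1 by apply: wge; rewrite ?invr_eq0 // wVV // oppr_ge0 ltW.
    have : pf P (x * x^-1) = 0 by rewrite pfM // e mulr0.
    by rewrite mulfV // pf1 => /eqP; rewrite oner_eq0.
  split; last first.
    move=> e; apply: punitP => //; apply: wge; rewrite ?invr_eq0 ?wVV // e ?oppr0 //.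
  by move=> u; rewrite (@wE x 1%N 0) ?mul0r // expr0z divr1 expr1.
- rewrite (@wE pi 1%N 1) ?divr1 // expr1 expr1z mulfV //; exact: punit1.
- move=> c Ec c0; have [a u] := hE Ec c0; exists a.
  by rewrite (@wE c 1%N a) ?divr1 // expr1.
Qed.
End ValEx.

Section Denominators.
Variables (Om : fieldType) (P : place Om) (w : Om -> rat) (E0 : sfield Om).
Hypotheses (hw : valn P w) (iE0 : forall c, E0 c -> c != 0 -> exists a : int, w c = a%:~R).

(** The powers of [y] up to exponent [#|J|] are dependent over [E0]; two terms of equal valuation
    make [(i - j) w y] an integer with [0 < i - j <= #|J|]. The factorial serves all [y] at once, in
    place of a ramification index. *)
Lemma denom (L : Om -> Prop) (J : finType) (b : J -> Om) :
  (forall x n, L x -> L (x ^+ n)) -> (forall x, L x -> spans E0 b x) ->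
  forall y, L y -> y != 0 -> exists a : int, (#|J|)`!%:R * w y = a%:~R.
Proof.
move=> LX sp y Ly y0.
have [|c [cE c0 [k ck]]] := @indep_dep _ E0 'I_(#|J|.+1) J (fun i => y ^+ i) b (fun i => sp _ (LX _ _ Ly)).
  by rewrite card_ord.
have [|i [j [ij ci cj u _]]] := two_max P _ c0.
  by exists k; rewrite mulf_neq0 // expf_neq0.
have ci0 : c i != 0 by apply: contra_neq ci => ->; rewrite mul0r.
have cj0 : c j != 0 by apply: contra_neq cj => ->; rewrite mul0r.
have e : w (c i) + w y *+ i = w (c j) + w y *+ j.
  by rewrite -!(wX hw) // -!(wM hw) ?expf_neq0 //; apply/(weq hw ci cj).
have [a ea] := iE0 (cE i) ci0; have [a' ea'] := iE0 (cE j) cj0.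
wlog lt : i j ij ci cj u ci0 cj0 e a a' ea ea' / (j < i)%N.
  move=> W; have [lt|lt|e'] := ltngtP i j.
  - apply: (W j i _ _ _ _ _ _ _ a' a) => //; first by rewrite eq_sym.
    by move/punitV: u; rewrite invf_div.
  - exact: (W i j ij _ _ _ _ _ _ a a').
  - by case/negP: ij; apply/eqP; apply: val_inj.
have /dvdnP [q eq] : ((i - j) %| (#|J|)`!)%N.
  apply: dvdn_fact; rewrite subn_gt0 lt /=.
  by apply: leq_trans (leq_subr _ _) _; rewrite -ltnS; exact: ltn_ord.
exists (q%:Z * (a' - a)); rewrite eq natrM -mulrA.
have -> : (i - j)%:R * w y = w (c j) - w (c i).
  rewrite natrB; last exact: ltnW.
  rewrite mulrBl !mulr_natl; apply/eqP; rewrite subr_eq addrAC -e; apply/eqP; ring.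
by rewrite ea ea' rmorphM rmorphB /=.
Qed.
End Denominators.

(** * The rational function field, its constants and its points *)

Lemma fracE_div (R : idomainType) (x : {fraction R}) : exists a b : R, b != 0 /\ x = tofrac a / tofrac b.
Proof.
elim/quotW: x => r; exists (frac r).1, (frac r).2.
have d0 : (frac r).2 != 0 by exact: denom_ratioP.
split=> //; have d1 : tofrac (frac r).2 != 0 by rewrite tofrac_eq0.
apply: (mulIf d1); rewrite divfK //.
rewrite -[LHS]/(FracField.mul _ _) !piE.
apply/eqmodP; rewrite /= FracField.equivfE /FracField.mulf.
by rewrite !numden_Ratio ?oner_neq0 ?mulr1 ?mulf_neq0 // mulrC.
Qed.

Section Base.
Variables (Fq : finFieldType) (p : nat) (Om : closedFieldType)
          (iota : {rmorphism {fraction {poly Fq}} -> Om}).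
Hypotheses (chp : p \in [pchar Fq]) (ac : is_alg_closure iota).
Local Notation q := #|Fq|.
Local Notation iA := (iA iota).
Local Notation T := (iA 'X).

Definition kc (c : Fq) : Om := iA c%:P.
Definition iAm : {rmorphism {poly Fq} -> Om} := GRing.RMorphism.clone _ _ (iota \o @tofrac {poly Fq}) _.
Lemma iAmE a : iA a = iAm a. Proof. by []. Qed.
Lemma iA_eq0 a : (iA a == 0) = (a == 0).
Proof. by rewrite /Defs.iA fmorph_eq0 tofrac_eq0. Qed.
Definition kcm : {rmorphism Fq -> Om} := GRing.RMorphism.clone _ _ (iAm \o @polyC Fq) _.
Lemma kcE c : kc c = kcm c. Proof. by []. Qed.
Lemma iA_horner a : iA a = (map_poly kcm a).[T].
Proof.
rewrite iAmE -[in LHS](coefK a) poly_def rmorph_sum horner_coef size_map_poly.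
apply: eq_bigr => i _; rewrite -mul_polyC rmorphM rmorphXn coef_map //=.
Qed.

Lemma pchar_Om : p \in [pchar Om].
Proof. by rewrite (fmorph_pchar kcm). Qed.
Lemma q_pow : exists2 e, (0 < e)%N & q = (p ^ e)%N.
Proof.
have h := card_pprimeChar (R0 := Fq) chp.
have e : q = (p ^ logn p q)%N by exact: h.
exists (logn p q) => //; rewrite lt0n; apply/eqP => e0; move: e; rewrite e0 expn0 => e1.
by have := finNzRing_gt1 Fq; rewrite e1.
Qed.
Lemma q_gt1 : (1 < q)%N. Proof. exact: finNzRing_gt1. Qed.
Lemma q_gt0 : (0 < q)%N. Proof. exact: ltnW q_gt1. Qed.
Lemma qpnat k : [pchar Om].-nat (q ^ k)%N.
Proof.
have [e _ ->] := q_pow; rewrite -expnM; apply/pnatP => [|l pl].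
  by rewrite expn_gt0 prime_gt0 // (pcharf_prime chp).
rewrite Euclid_dvdX // => /andP [/prime_nt_dvdP h _].
by rewrite h ?pchar_Om ?(pcharf_prime chp) //; apply/eqP => e1; rewrite e1 in pl.
Qed.
Lemma FrD k (x y : Om) : (x + y) ^+ (q ^ k) = x ^+ (q ^ k) + y ^+ (q ^ k).
Proof. by apply: exprDn_pchar; exact: qpnat. Qed.
Lemma FrN k (x : Om) : (- x) ^+ (q ^ k) = - x ^+ (q ^ k).
Proof.
apply/eqP; rewrite -addr_eq0 -FrD addNr expr0n expn_eq0.
by have := q_gt0; case: q => //=; rewrite eqxx.
Qed.
Lemma FrB k (x y : Om) : (x - y) ^+ (q ^ k) = x ^+ (q ^ k) - y ^+ (q ^ k).
Proof. by rewrite FrD FrN. Qed.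
Lemma Fr0 k : (0 : Om) ^+ (q ^ k) = 0.
Proof. by have := FrB k 0 0; rewrite !subrr. Qed.
Lemma Fr_sum k (I : Type) (r : seq I) (Q : pred I) (E : I -> Om) :
  (\sum_(i <- r | Q i) E i) ^+ (q ^ k) = \sum_(i <- r | Q i) E i ^+ (q ^ k).
Proof. by elim/big_rec2: _ => [|i y1 y2 _ <-]; rewrite ?Fr0 ?FrD. Qed.
Lemma Fr_inj k : injective (fun x : Om => x ^+ (q ^ k)).
Proof.
move=> x y /= e; apply/eqP; rewrite -subr_eq0; apply/eqP.
have : (x - y) ^+ (q ^ k) = 0 by rewrite FrB e subrr.
by move/eqP; rewrite expf_eq0 => /andP [_ /eqP].
Qed.
Lemma Fr_kc k c : kc c ^+ (q ^ k) = kc c.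
Proof.
rewrite kcE -rmorphXn; congr (kcm _).
by elim: k => [|k IH]; rewrite ?expr1 // expnS exprM expf_card.
Qed.

(* the field of constants: the algebraic closure of Fq in Om *)
Definition kap_pred (x : Om) := exists2 k, (0 < k)%N & x ^+ (q ^ k) = x.
Lemma Fr_iter k l (x : Om) : x ^+ (q ^ k) = x -> x ^+ (q ^ (k * l)) = x.
Proof. by move=> h; elim: l => [|l IH]; rewrite ?muln0 ?expr1 // mulnS expnD exprM h. Qed.
Lemma kap1 : kap_pred 1. Proof. by exists 1%N => //; rewrite expr1n. Qed.
Lemma kapB x y : kap_pred x -> kap_pred y -> kap_pred (x - y).
Proof.
move=> [k k0 hx] [l l0 hy]; exists (k * l)%N; rewrite ?muln_gt0 ?k0 // FrB.
by rewrite (Fr_iter _ hx) mulnC (Fr_iter _ hy).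
Qed.
Lemma kapM x y : kap_pred x -> kap_pred y -> kap_pred (x * y).
Proof.
move=> [k k0 hx] [l l0 hy]; exists (k * l)%N; rewrite ?muln_gt0 ?k0 // exprMn.
by rewrite (Fr_iter _ hx) mulnC (Fr_iter _ hy).
Qed.
Lemma kapV x : kap_pred x -> kap_pred x^-1.
Proof. by move=> [k k0 hx]; exists k => //; rewrite exprVn hx. Qed.
Definition kap := SField kap1 kapB kapM kapV.
Lemma kap_kc c : kap (kc c). Proof. by exists 1%N => //; rewrite Fr_kc. Qed.

Definition F_pred (x : Om) := exists a, x = iota a.
Lemma F1 : F_pred 1. Proof. by exists 1; rewrite rmorph1. Qed.
Lemma F_B x y : F_pred x -> F_pred y -> F_pred (x - y).
Proof. by move=> [a ->] [b ->]; exists (a - b); rewrite rmorphB. Qed.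
Lemma F_M x y : F_pred x -> F_pred y -> F_pred (x * y).
Proof. by move=> [a ->] [b ->]; exists (a * b); rewrite rmorphM. Qed.
Lemma F_V x : F_pred x -> F_pred x^-1.
Proof. by move=> [a ->]; exists a^-1; rewrite fmorphV. Qed.
Definition Fsf := SField F1 F_B F_M F_V.
Lemma F_iA a : Fsf (iA a). Proof. by exists (tofrac a). Qed.
Lemma F_div x : Fsf x -> exists a b, b != 0 /\ x = iA a / iA b.
Proof.
move=> [c ->]; have [a [b [b0 ->]]] := fracE_div c; exists a, b; split => //.
by rewrite fmorph_div.
Qed.
Lemma algoF : algo Fsf.
Proof.
move=> z; have [f [f0 rf]] := ac z.
have /Lp_ex [f' e] : Lp Fsf (map_poly iota f) by move=> i; rewrite coef_map; exists f`_i.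
by exists f'; rewrite e; split => //; rewrite -(map_poly_eq0 (sfm Fsf)) e map_poly_eq0.
Qed.

(** At a place at infinity, where [T^-1] reduces to 0, nonzero constants are units, so the leading
    term of a nonzero polynomial in [T] cannot be cancelled by the others. *)
Lemma T_transc (a : {poly Om}) : Lp kap a -> a.[T] = 0 -> a = 0.
Proof.
have T0 : T != 0 by rewrite iA_eq0 polyX_eq0.
pose G u v := exists a : {poly Fq}, u = (map_poly kcm a).[T^-1] /\ v = kcm a`_0.
have gG : rgraph G.
  split.
  - by exists 1; rewrite rmorph1 hornerC coefC eqxx rmorph1.
  - by move=> _ _ _ _ [b [-> ->]] [c [-> ->]]; exists (b - c); rewrite rmorphB hornerD hornerN coefB rmorphB.
  - move=> _ _ _ _ [b [-> ->]] [c [-> ->]]; exists (b * c).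
    by rewrite rmorphM hornerM coefM big_ord1 subnn rmorphM.
  - move=> v [b [e ->]].
    suff -> : b = 0 by rewrite coef0 rmorph0.
    pose n := (size b).-1; pose r : {poly Fq} := \poly_(i < n.+1) b`_(n - i).
    have /eqP : iA r = 0.
      rewrite iA_horner -(mulr0 (T ^+ n)) e.
      rewrite (@horner_coef_wide _ n.+1) ?size_map_poly ?size_poly //.
      rewrite (@horner_coef_wide _ n.+1 (map_poly _ b)) ?size_map_poly /n ?leqSpred // -/n.
      rewrite mulr_sumr (reindex_inj rev_ord_inj) /=; apply: eq_bigr => i _.
      have hi := ltn_ord i; rewrite !coef_map coef_poly subSS ltnS leq_subr subKn //.
      rewrite mulrCA; congr (_ * _).
      have -> : T ^+ n = T ^+ (n - i) * T ^+ i by rewrite -exprD subnK.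
      by rewrite exprVn mulfK // expf_neq0.
    rewrite iA_eq0 => /eqP r0; apply/polyP => i; rewrite coef0.
    have [lt|le] := ltnP i n.+1; last by rewrite nth_default //; apply: leq_trans le; exact: leqSpred.
    have := congr1 (fun s : {poly Fq} => s`_(n - i)) r0.
    by rewrite coef0 coef_poly ltnS leq_subr subKn.
have [P hP] := chevalley gG.
have [OT fT] : pO P T^-1 /\ pf P T^-1 = 0.
  by apply: hP; exists 'X; rewrite map_polyX hornerX coefX rmorph0.
have ku c : kap c -> c != 0 -> punit P c.
  have kO x : kap x -> pO P x.
    move=> [k k0 hx]; have [e e0 eq] := q_pow.
    apply: (@pO_root _ P ('X^(q ^ k) - 'X)).
    - move=> i; rewrite coefB coefXn coefX; apply: pOB; case: eqP => _; try exact: pO0; exact: pO1.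
    - have l1 : (1 < q ^ k)%N by rewrite -{1}(exp1n k) ltn_exp2r // q_gt1.
      by rewrite lead_coefDl ?size_polyN ?size_polyX ?size_polyXn // lead_coefXn pf1 oner_neq0.
    - by rewrite /root hornerD hornerN hornerX hornerXn hx subrr.
  by move=> kc0 c0; apply: punitP; [|exact: kO|apply: kO; exact: kapV].
move=> La ra; apply/eqP; apply: contraT => a0.
have la : lead_coef a != 0 by rewrite lead_coef_eq0.
have [] := ku _ (La (size a).-1) la; rewrite -lead_coefE => Ol /negP[].
have e : a.[T] * T^-1 ^+ (size a).-1 = 0 by rewrite ra mul0r.
move: e; rewrite horner_coef mulr_suml (polySpred a0) big_ord_recr /= -mulrA exprVn mulfV ?expf_neq0 // mulr1.
move=> /eqP; rewrite addrC addr_eq0 -lead_coefE => /eqP ->.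
have Oi i : pO P a`_i.
  by have [->|ai] := eqVneq a`_i 0; [exact: pO0|case: (ku _ (La i) ai)].
have ei (i : 'I_(size a).-1) : a`_i * T ^+ i * (T ^+ (size a).-1)^-1 = a`_i * T^-1 ^+ ((size a).-1 - i).
  rewrite -mulrA; congr (_ * _); have hi := ltn_ord i.
  have -> : T ^+ (size a).-1 = T ^+ ((size a).-1 - i) * T ^+ i by rewrite -exprD subnK // ltnW.
  by rewrite invfM mulrCA mulfV ?expf_neq0 // mulr1 exprVn.
under eq_bigr do rewrite ei.
rewrite pfN; last by apply: pO_sum => i _; apply: pOM => //; exact: pOX.
rewrite pf_sum; last by move=> i _; apply: pOM => //; exact: pOX.
rewrite big1 ?oppr0 // => i _; rewrite pfM //; last exact: pOX.
rewrite (pfX _ OT) fT expr0n.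
have hi := ltn_ord i; rewrite -subn_gt0 in hi.
by rewrite gtn_eqF // mulr0.
Qed.
End Base.

Lemma irred_coprime (F : fieldType) (pi a : {poly F}) :
  irreducible_poly pi -> ~~ (pi %| a) -> coprimep pi a.
Proof.
move=> [s1 h] nd; rewrite /coprimep; apply/eqP.
have [//|sg] := eqVneq (size (gcdp pi a)) 1%N.
case/negP: nd; apply: dvdp_trans (dvdp_gcdr pi a).
by have := h _ sg (dvdp_gcdl _ _); rewrite /eqp => /andP[].
Qed.

Lemma irred_mul (F : fieldType) (pi a b : {poly F}) :
  irreducible_poly pi -> pi %| a * b -> (pi %| a) || (pi %| b).
Proof.
move=> ir; have [//|na] := boolP (pi %| a); rewrite Gauss_dvdpr //=.
exact: irred_coprime.
Qed.

Section SpecialPlaces.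
Variables (Fq : finFieldType) (p : nat) (Om : closedFieldType)
          (iota : {rmorphism {fraction {poly Fq}} -> Om}).
Hypotheses (chp : p \in [pchar Fq]) (ac : is_alg_closure iota).
Local Notation q := #|Fq|.
Local Notation iA := (iA iota).
Local Notation T := (iA 'X).
Local Notation kcm := (kcm iota).
Local Notation Fsf := (Fsf iota).
Local Notation kap := (kap iota chp).

(** Reduction of [A] at the point [x]; for a root [x] of [pi] it embeds [A / pi] into [Om]. *)
Definition evq (a : {poly Fq}) (x : Om) : Om := (map_poly kcm a).[x].
Lemma evqD a b x : evq (a + b) x = evq a x + evq b x.
Proof. by rewrite /evq rmorphD hornerD. Qed.
Lemma evqB a b x : evq (a - b) x = evq a x - evq b x.
Proof. by rewrite /evq rmorphB hornerD hornerN. Qed.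
Lemma evqM a b x : evq (a * b) x = evq a x * evq b x.
Proof. by rewrite /evq rmorphM hornerM. Qed.
Lemma evq0 x : evq 0 x = 0. Proof. by rewrite /evq rmorph0 horner0. Qed.
Lemma evq1 x : evq 1 x = 1. Proof. by rewrite /evq rmorph1 hornerC. Qed.
Lemma evqX a x n : evq (a ^+ n) x = evq a x ^+ n.
Proof. by elim: n => [|n IH]; rewrite ?expr0 ?evq1 // !exprS evqM IH. Qed.
Lemma evqT x : evq 'X x = x. Proof. by rewrite /evq map_polyX hornerX. Qed.
Lemma evqC c x : evq c%:P x = kc iota c. Proof. by rewrite /evq map_polyC hornerC. Qed.
Lemma evq_Fr a x k : evq a x ^+ (q ^ k) = evq a (x ^+ (q ^ k)).
Proof.
rewrite /evq !horner_coef (Fr_sum iota chp); apply: eq_bigr => i _.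
by rewrite coef_map exprMn -!exprM mulnC; congr (_ * _); exact: Fr_kc.
Qed.

Section Irr.
Variables (pi : {poly Fq}) (x0 : Om).
Hypotheses (ir : irreducible_poly pi) (r0 : evq pi x0 = 0).
Let d := (size pi).-1.
Let N := (q ^ d).-1.

Lemma evq_eq0 a : evq a x0 = 0 <-> pi %| a.
Proof.
split; last by move=> /dvdpP [b ->]; rewrite evqM r0 mulr0.
move=> ea; apply: contraT => nd.
have [[u v] /= e] := Bezout_eq1_coprimepP _ _ (irred_coprime ir nd).
have := evq1 x0; rewrite -e evqD !evqM r0 ea !mulr0 addr0 => /eqP.
by rewrite eq_sym oner_eq0.
Qed.

Lemma irr_d_gt0 : (0 < d)%N.
Proof. by case: ir => s1 _; rewrite /d; plia. Qed.
Lemma N_gt0 : (0 < N)%N.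
Proof.
have : (1 < q ^ d)%N by rewrite -{1}(exp1n d) ltn_exp2r ?irr_d_gt0 // q_gt1.
by rewrite /N; lia.
Qed.
Lemma N_S : N.+1 = (q ^ d)%N.
Proof. by rewrite /N prednK // expn_gt0 q_gt0. Qed.

Definition res_list := [seq evq (rVpoly v) x0 | v : 'rV[Fq]_d].
Lemma res_list_inj : injective (fun v : 'rV[Fq]_d => evq (rVpoly v) x0).
Proof.
move=> u v /eqP; rewrite -subr_eq0 -evqB => /eqP/evq_eq0.
rewrite -linearB /= => dv; apply/eqP; rewrite -subr_eq0; apply/eqP.
apply: (can_inj rVpolyK); rewrite linear0.
apply/eqP; apply: contraT => nz; have := dvdp_leq nz dv.
have h2 : (size (rVpoly (u - v)) <= d)%N by exact: size_poly.
by move=> h1; have := leq_trans h1 h2; have := irr_d_gt0; rewrite /d; case: (size pi) => // n _ /=; rewrite ltnn.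
Qed.
Lemma uniq_res_list : uniq res_list.
Proof. by rewrite map_inj_uniq ?enum_uniq //; exact: res_list_inj. Qed.
Lemma size_res_list : size res_list = (q ^ d)%N.
Proof. by rewrite size_map -cardE card_mx mul1n. Qed.
Lemma mem_res_list a : evq a x0 \in res_list.
Proof.
apply/mapP; exists (poly_rV (a %% pi)); first by rewrite mem_enum.
rewrite poly_rV_K; last first.
  have pi0 : pi != 0 by apply: contraPneq ir => ->; case; rewrite size_poly0.
  have : (size (a %% pi)%R < size pi)%N by rewrite ltn_modp.
  by rewrite /d; plia.
rewrite {1}(divp_eq a pi) evqD evqM r0 mulr0 add0r //.
Qed.
Definition nz_list := rem 0 res_list.
Lemma uniq_nz : uniq nz_list. Proof. by apply: rem_uniq; exact: uniq_res_list. Qed.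
Lemma res0 : 0 \in res_list. Proof. by rewrite -(evq0 x0); exact: mem_res_list. Qed.
Lemma size_nz : size nz_list = N.
Proof. by rewrite size_rem ?res0 // size_res_list. Qed.
Lemma mem_nz a : ~~ (pi %| a) -> evq a x0 \in nz_list.
Proof.
move=> h; rewrite mem_rem_uniq ?uniq_res_list // inE mem_res_list andbT.
by apply: contra h => /eqP/evq_eq0.
Qed.
Lemma nz_ex y : y \in nz_list -> exists2 a, ~~ (pi %| a) & y = evq a x0.
Proof.
rewrite mem_rem_uniq ?uniq_res_list // inE => /andP [y0 /mapP [v _ e]].
by exists (rVpoly v) => //; apply: contra y0 => /evq_eq0; rewrite -e => ->.
Qed.

(** Fermat: multiplication by the residue of [a] permutes the nonzero residues, so their product is
    unchanged by the factor [evq a x0 ^+ N]. *)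
Lemma evq_unity a : ~~ (pi %| a) -> evq a x0 ^+ N = 1.
Proof.
move=> na; have a0 : evq a x0 != 0 by apply: contra na => /eqP/evq_eq0.
have pe : perm_eq (map ( *%R (evq a x0)) nz_list) nz_list.
  have us : uniq (map ( *%R (evq a x0)) nz_list).
    by rewrite map_inj_uniq ?uniq_nz //; exact: mulfI.
  apply: uniq_perm => //; first exact: uniq_nz.
  have ss : {subset map ( *%R (evq a x0)) nz_list <= nz_list}.
    move=> _ /mapP [y /nz_ex [b nb ->] ->]; rewrite -evqM; apply: mem_nz.
    by apply/negP => /(irred_mul ir); rewrite (negPf na) (negPf nb).
  by have [] := uniq_min_size us ss (eq_leq (esym (size_map _ _))).
have : \prod_(i <- map ( *%R (evq a x0)) nz_list) i = \prod_(i <- nz_list) i by exact: perm_big.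
rewrite big_map big_split /= big_const_seq count_predT size_nz => e.
have nz : \prod_(i <- nz_list) i != 0.
  rewrite prodf_seq_neq0; apply/allP => y; rewrite mem_rem_uniq ?uniq_res_list //.
  by rewrite inE => /andP [].
apply: (mulIf nz); rewrite mul1r -[RHS]e; congr (_ * _).
by elim: (N) => //= n <-; rewrite exprS.
Qed.

Lemma evq_FrN a : evq a x0 ^+ (q ^ d) = evq a x0.
Proof.
rewrite -N_S exprS; have [/evq_eq0 ->|h] := boolP (pi %| a); first by rewrite mul0r.
by rewrite evq_unity // mulr1.
Qed.
Lemma x0_Fr : x0 ^+ (q ^ d) = x0. Proof. by have := evq_FrN 'X; rewrite evqT. Qed.
Lemma kap_x0 : kap x0. Proof. by exists d; [exact: irr_d_gt0|exact: x0_Fr]. Qed.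

Lemma gen_ex : exists g, [/\ ~~ (pi %| g), N.-primitive_root (evq g x0)
  & forall b, ~~ (pi %| b) -> exists2 l, (l < N)%N & pi %| b - g ^+ l].
Proof.
have /hasP [z /nz_ex [g ng ->] pr] : has N.-primitive_root nz_list.
  apply: has_prim_root; rewrite ?N_gt0 ?uniq_nz ?size_nz //.
  by apply/allP => _ /nz_ex [a na ->]; rewrite unity_rootE evq_unity.
exists g; split=> // b nb.
have [i e] := prim_rootP pr (evq_unity nb).
exists i => //; apply/evq_eq0; rewrite evqB evqX e subrr //.
Qed.
End Irr.

Lemma evq_root_ex (pi : {poly Fq}) : irreducible_poly pi -> exists x0, evq pi x0 = 0.
Proof.
move=> [s1 _]; have [x /rootP rx] : exists x, root (map_poly kcm pi) x.
  by apply/closed_rootP; rewrite size_map_poly neq_ltn s1 orbT.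
by exists x.
Qed.

(** [qplace] prescribes the reduction on [F_q[T]] only, [kplace] on [kap[T]], so that constants
    reduce to themselves. The second form is needed where residues are used again as constants. *)
Definition qplace (P : place Om) (x0 : Om) := forall a, pO P (iA a) /\ pf P (iA a) = evq a x0.
Definition kplace (P : place Om) (x0 : Om) :=
  forall a, Lp kap a -> pO P a.[T] /\ pf P a.[T] = a.[x0].

Lemma Lp_kap_map (a : {poly Fq}) : Lp kap (map_poly kcm a).
Proof. by move=> i; rewrite coef_map; exact: kap_kc. Qed.

Lemma kplace_q P x0 : kplace P x0 -> qplace P x0.
Proof. by move=> h a; rewrite iA_horner; apply: h; exact: Lp_kap_map. Qed.

Lemma kplace_ex x0 : kap x0 -> exists P, kplace P x0.
Proof.
move=> kx; pose G u v := exists a, [/\ Lp kap a, u = a.[T] & v = a.[x0]].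
have gG : rgraph G.
  split.
  - by exists 1; rewrite !hornerC; split => //; apply: LpC; exact: sf1.
  - move=> _ _ _ _ [b [hb -> ->]] [c [hc -> ->]]; exists (b - c).
    by rewrite !hornerD !hornerN; split => //; exact: LpB.
  - move=> _ _ _ _ [b [hb -> ->]] [c [hc -> ->]]; exists (b * c).
    by rewrite !hornerM; split => //; exact: LpM.
  - by move=> v [b [hb /esym/(T_transc hb) -> ->]]; rewrite horner0.
have [P hP] := chevalley gG; exists P => a ha; apply: hP; by exists a.
Qed.

Lemma mult_decomp (pi a : {poly Fq}) : irreducible_poly pi -> a != 0 ->
  exists k b, a = pi ^+ k * b /\ ~~ (pi %| b).
Proof.
move=> ir; have s1 : (1 < size pi)%N by case: ir.
have [n] := ubnP (size a); elim: n a => // n IH a sa a0.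
have [/dvdpP [b eb]|nd] := boolP (pi %| a); last by exists 0%N, a; rewrite expr0 mul1r.
have b0 : b != 0 by apply: contra_neq a0 => b0; rewrite eb b0 mul0r.
have pi0 : pi != 0 by rewrite -size_poly_gt0 ltnW.
have [|k [c [ec nc]]] := IH b _ b0.
  move: sa; rewrite eb size_mul // => sa.
  have sb : (0 < size b)%N by rewrite size_poly_gt0.
  by plia.
by exists k.+1, c; split => //; rewrite eb ec exprS mulrC mulrA.
Qed.

Lemma qplace_val P x0 pi : irreducible_poly pi -> evq pi x0 = 0 -> qplace P x0 ->
  exists w, [/\ valn P w, w (iA pi) = 1 & forall c, Fsf c -> c != 0 -> exists a : int, w c = a%:~R].
Proof.
move=> ir r0 hP; have pi0 : pi != 0 by apply: contraPneq ir => ->; case; rewrite size_poly0.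
have ip0 : iA pi != 0 by rewrite iA_eq0.
have uA a : ~~ (pi %| a) -> punit P (iA a).
  move=> na; have [h1 h2] := hP a; split => //; rewrite h2.
  by apply: contra na => /eqP /(evq_eq0 ir r0).
apply: valuation_ex; rewrite ?(hP pi).2 //.
- exact: algoF.
- exact: (hP pi).1.
move=> c /F_div [a [b [b0 ->]]]; rewrite mulf_eq0 invr_eq0 !iA_eq0 negb_or => /andP [a0 _].
have [k [a' [ea na]]] := mult_decomp ir a0; have [l [b' [eb nb]]] := mult_decomp ir b0.
exists (k%:Z - l%:Z); rewrite expfzDr // expzN -!exprnP.
have -> : iA a / iA b / (iA pi ^+ k / iA pi ^+ l) = iA a' / iA b'.
  rewrite ea eb !iAmE !rmorphM !rmorphXn.
  have h1 : iAm iota b' != 0 by rewrite -iAmE iA_eq0; apply: contraNneq nb => ->; rewrite dvdp0.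
  by field; rewrite h1 !expf_neq0.
by apply: punitM; [|apply: punitV]; exact: uA.
Qed.

Lemma kplace_unit P x0 c : kplace P x0 -> kap c -> pO P c /\ pf P c = c.
Proof. by move=> h kcc; have := h c%:P (LpC kcc); rewrite !hornerC. Qed.
End SpecialPlaces.

(** * Lifting Frobenius to the algebraic closure *)

Section UltraLimit.
Variables (Om : closedFieldType) (L : sfield Om) (aL : algo L).
Variables (I : Type) (G : set_system I) (UG : UltraFilter G) (s : I -> {rmorphism Om -> Om}).
Hypothesis hs : forall i, autL L (s i).

(** The values at [x] lie among the finitely many roots of a polynomial over [L], and an ultrafilter
    selects one member of a finite cover. *)
Lemma ultra_value x : exists y, G [set i | s i x = y]%classic.
Proof.
have [p [p0 rp]] := aL x; set M := map_poly (sfm L) p in rp.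
have M0 : M != 0 by rewrite map_poly_eq0.
have [r er] := closed_field_poly_normal M.
have lM : lead_coef M != 0 by rewrite lead_coef_eq0.
have cover : G [set i | s i x \in r]%classic.
  apply: filterS filterT => i _ /=.
  have : root M (s i x) by apply: (aut_root (hs i)) => //; exact: Lp_map.
  by rewrite er rootZ // root_prod_XsubC.
move: cover; elim: (r) => [|y r' IH] cover.
  by have [i] := filter_ex cover.
have [h|h] := in_ultra_setVsetC [set i | s i x = y]%classic UG; first by exists y.
apply: IH; apply: filterS (filterI cover h) => i [/=]; rewrite inE => /orP [/eqP|//].
by move=> e /(_ e).
Qed.

Lemma ultra_lim : exists t, autL L t /\ forall x, G [set i | s i x = t x]%classic.
Proof.
pose t x := sval (cid (ultra_value x)).
have tP x : G [set i | s i x = t x]%classic by rewrite /t; case: cid.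
have [t' et] : exists t' : {rmorphism Om -> Om}, t' =1 t.
  apply: rmorph_of.
  - move=> x y; have [i [[h1 h2] h3]] := filter_ex (filterI (filterI (tP x) (tP y)) (tP (x - y))).
    by rewrite -h1 -h2 -h3 rmorphB.
  - move=> x y; have [i [[h1 h2] h3]] := filter_ex (filterI (filterI (tP x) (tP y)) (tP (x * y))).
    by rewrite -h1 -h2 -h3 rmorphM.
  - by have [i h] := filter_ex (tP 1); rewrite -h rmorph1.
have tL x : L x -> t' x = x.
  by move=> Lx; rewrite et; have [i <-] := filter_ex (tP x); exact: (hs i).2.
exists t'; split; first by split => //; exact: endo_bij tL.
by move=> x; rewrite et.
Qed.
End UltraLimit.

Section FrobLift.
Variables (Om : closedFieldType) (p : nat) (chp : p \in [pchar Om]).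
Variables (L : sfield Om) (aL : algo L) (P : place Om) (Q : nat).
Hypotheses (Qp : [pchar Om].-nat Q) (Q1 : (1 < Q)%N).
Local Notation f := (pf P).
Hypothesis fL : forall y, L y -> pO P y -> f y ^+ Q = f y.

(** Elements integral at every conjugate of the place; unlike [pO P], this ring is stable under the
    automorphisms. *)
Let B y := forall s, autL L s -> pO P (s y).
Let id_aut : autL L idfun. Proof. by split => //; exists idfun. Qed.
Let BO y : B y -> pO P y. Proof. by move=> /(_ _ id_aut). Qed.
Let Baut s y : autL L s -> B y -> B (s y).
Proof.
move=> hs h t ht; have [u [hu eu]] := aut_comp ht hs.
by have := h u hu; rewrite eu.
Qed.

Let frob : exists phi : {rmorphism Om -> Om}, forall x, phi x = x ^+ Q.
Proof.
apply: rmorph_of.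
- move=> x y; rewrite exprDn_pchar //; congr (_ + _).
  apply/eqP; rewrite -addr_eq0 -exprDn_pchar // addNr expr0n; by case: (Q) Q1.
- by move=> x y; rewrite exprMn.
- by rewrite expr1n.
Qed.

(** An invariant element lies in [L] up to a [p]-power; as the [p]-power map is injective, its
    residue is itself fixed by the [Q]-th power. *)
Let fixed_f c : pO P c -> (forall s, autL L s -> s c = c) -> f c ^+ Q = f c.
Proof.
move=> Oc hc; have [k Lk] := fixed_insep chp aL hc.
have := fL Lk (pOX _ Oc); rewrite (pfX _ Oc) -!exprM mulnC exprM => e.
have pk : [pchar Om].-nat (p ^ k)%N.
  have pp := pcharf_prime chp.
  apply/pnatP => [|l pl]; first by rewrite expn_gt0 prime_gt0.
  rewrite Euclid_dvdX // => /andP [/prime_nt_dvdP h _].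
  by rewrite h ?chp //; apply/eqP => e1; rewrite e1 in pl.
apply/eqP; rewrite -subr_eq0.
have : (f c ^+ Q - f c) ^+ (p ^ k) = 0.
  rewrite exprDn_pchar // e.
  have -> : (- f c) ^+ (p ^ k) = - f c ^+ (p ^ k).
    apply/eqP; rewrite -addr_eq0 -exprDn_pchar // addNr expr0n expn_eq0.
    by have := prime_gt0 (pcharf_prime chp); case: (p) => //=; rewrite eqxx.
  by rewrite subrr.
by move/eqP; rewrite expf_eq0 => /andP [].
Qed.

(** A tuple is encoded as the polynomial with its entries as coefficients, so that one product over
    conjugate tuples treats all entries simultaneously. *)
Let P2 (A : seq {poly Om}) : {poly {poly Om}} := \prod_(a <- A) ('X - a%:P).
Let P2_spec (A : seq {poly Om}) : (forall a, a \in A -> Op P a) ->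
  (forall i, Op P (P2 A)`_i) /\
  (\poly_(i < size (P2 A)) pfp P (P2 A)`_i) = \prod_(a <- A) ('X - (pfp P a)%:P).
Proof.
rewrite /P2; elim: A => [|a A IH] hA.
  rewrite !big_nil; split.
    by move=> i j; rewrite coef1; case: eqP => _; rewrite ?coef1 ?coef0; [case: eqP => _; [exact: pO1|exact: pO0]|exact: pO0].
  apply/polyP => i; rewrite coef_poly size_poly1 !coef1; case: i => //=.
  apply/polyP => j; rewrite coef_pfp !coef1; case: eqP => _; rewrite ?pf1 ?pf0 //.
have [|h1 h2] := IH; first by move=> b bA; apply: hA; rewrite inE bA orbT.
rewrite !big_cons; set R := \prod_(j <- A) ('X - j%:P) in h1 h2 *.
have Oa : Op P a by apply: hA; exact: mem_head.
have e i : (('X - a%:P) * R)`_i = (if i is i'.+1 then R`_i' else 0) - a * R`_i.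
  by rewrite mulrBl coefB coefXM coefCM; case: i.
have O1 i : Op P (if i is i'.+1 then R`_i' else 0).
  case: i => [|i]; [by move=> j; rewrite coef0; exact: pO0|]. exact: h1.
have O2 i : Op P (('X - a%:P) * R)`_i.
  by rewrite e => j; rewrite coefB; apply: pOB; [exact: O1|exact: OpM].
split => //; rewrite -h2; apply/polyP => i.
transitivity (pfp P (('X - a%:P) * R)`_i).
  rewrite coef_poly; case: ltnP => // le; rewrite nth_default //.
  by apply/polyP => j; rewrite coef_pfp !coef0 pf0.
rewrite e pfpB //; last exact: OpM.
rewrite pfpM // mulrBl coefB coefXM coefCM !coef_poly; congr (_ - _ * _).
  case: i => [|i] /=; first by apply/polyP => j; rewrite coef_pfp !coef0 pf0.
  by case: ltnP => // le; rewrite nth_default //; apply/polyP => j; rewrite coef_pfp !coef0 pf0.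
by case: ltnP => // le; rewrite nth_default //; apply/polyP => j; rewrite coef_pfp !coef0 pf0.
Qed.

Let conj_ex y : exists r : seq Om, forall s, autL L s -> s y \in r.
Proof.
have [m [m0 rm]] := aL y; set M := map_poly (sfm L) m in rm.
have M0 : M != 0 by rewrite map_poly_eq0.
have [r er] := closed_field_poly_normal M.
have lM : lead_coef M != 0 by rewrite lead_coef_eq0.
exists r => s hs; have : root M (s y) by apply: (aut_root hs) => //; exact: Lp_map.
by rewrite er rootZ // root_prod_XsubC.
Qed.

Let conjs_ex ys : exists C : seq (seq Om), forall s, autL L s -> map s ys \in C.
Proof.
elim: ys => [|y ys [C hC]]; first by exists [:: [::]].
have [r hr] := conj_ex y.
exists [seq x :: xs | x <- r, xs <- C] => s hs.
by apply/allpairsP; exists (s y, map s ys) => /=; split; [exact: hr|exact: hC|].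
Qed.

(** The product over the distinct conjugates of the tuple has invariant coefficients, whose residues
    are fixed by the [Q]-th power. Hence the reduced tuple with entries raised to the [Q]-th power
    is again a root of the reduced product, i.e. the reduction of a conjugate tuple. *)
Let lift_list (ys : seq Om) : (forall y, y \in ys -> B y) ->
  exists s, autL L s /\ forall y, y \in ys -> f (s y) = f y ^+ Q.
Proof.
move=> hB; have [C hC] := conjs_ex ys.
pose good t := `[< exists s, autL L s /\ t = map s ys >].
pose Ts := undup (seq.filter good C).
have TsP t : reflect (exists s, autL L s /\ t = map s ys) (t \in Ts).
  rewrite mem_undup mem_filter; apply: (iffP andP) => [[/asboolP //]|[s [hs e]]].
  split; first by apply/asboolP; exists s.
  by rewrite e; exact: hC.
pose A := [seq Poly t | t <- Ts].
have BA t : t \in Ts -> forall y, y \in t -> B y.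
  by move=> /TsP [s [hs ->]] _ /mapP [y yy ->]; apply: Baut => //; exact: hB.
have BA' a : a \in A -> forall i, B a`_i.
  move=> /mapP [t tT ->] i; rewrite coef_Poly.
  have [lt|le] := ltnP i (size t); first by apply: (BA t) => //; exact: mem_nth.
  by rewrite nth_default // => s _; rewrite rmorph0; exact: pO0.
have OA a : a \in A -> Op P a by move=> /BA' h i; apply: BO; exact: h.
have [O2 e2] := P2_spec OA.
have stab g : autL L g -> perm_eq (map (map g) Ts) Ts.
  move=> hg; have us : uniq (map (map g) Ts).
    by rewrite map_inj_uniq ?undup_uniq //; apply: inj_map; exact: fmorph_inj.
  have ss : {subset map (map g) Ts <= Ts}.
    move=> _ /mapP [t /TsP [s [hs ->]] ->]; apply/TsP.
    have [u [hu eu]] := aut_comp hg hs; exists u; split => //.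
    by rewrite -map_comp; apply: eq_map => y; rewrite eu.
  apply: uniq_perm => //; first exact: undup_uniq.
  by have [] := uniq_min_size us ss (eq_leq (esym (size_map _ _))).
have fixP g i j : autL L g -> g (P2 A)`_i`_j = (P2 A)`_i`_j.
  move=> hg; have mP : map_poly (map_poly g) (P2 A) = P2 A.
    rewrite /P2 /A rmorph_prod !big_map -[RHS](perm_big _ (stab g hg)) [RHS]big_map /=.
    apply: eq_bigr => t _; rewrite rmorphB /= map_polyX map_polyC /=; congr (_ - _%:P).
    apply/polyP => k; rewrite coef_map !coef_Poly /=.
    have [lt|le] := ltnP k (size t); first by rewrite (nth_map 0).
    by rewrite !nth_default ?size_map // rmorph0.
  by rewrite -{2}mP !coef_map.
have fc i j : f (P2 A)`_i`_j ^+ Q = f (P2 A)`_i`_j.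
  by apply: fixed_f; [exact: O2|move=> s hs; exact: fixP].
have [phi ephi] := frob.
pose Z := map_poly phi (pfp P (Poly ys)).
have ysT : ys \in Ts by apply/TsP; exists idfun; rewrite map_id.
have root0 : (P2 A).[Poly ys] = 0.
  apply/rootP; rewrite /P2 root_prod_XsubC; exact: map_f.
have OY : Op P (Poly ys) by apply: OA; exact: map_f.
have OYX k : Op P (Poly ys ^+ k).
  by elim: k => [|k IH]; rewrite ?expr0 ?exprS; [move=> i; rewrite coef1; case: eqP => _; [exact: pO1|exact: pO0]|exact: OpM].
have pfpX k : pfp P (Poly ys ^+ k) = pfp P (Poly ys) ^+ k.
  elim: k => [|k IH]; rewrite ?expr0 ?exprS ?pfpM ?IH //.
  by apply/polyP => i; rewrite coef_pfp !coef1; case: eqP => _; rewrite ?pf1 ?pf0.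
have sumE : \sum_(i < size (P2 A)) pfp P (P2 A)`_i * pfp P (Poly ys) ^+ i = 0.
  apply/polyP => j; rewrite coef_sum coef0.
  have := congr1 (fun u : {poly Om} => f u`_j) root0; rewrite horner_coef coef_sum coef0 pf0 => e0.
  apply: etrans e0; rewrite pf_sum; last by move=> i _; apply: OpM.
  by apply: eq_bigr => i _; rewrite -pfpX -pfpM // coef_pfp.
have : \prod_(a <- A) (Z - pfp P a) = 0.
  have -> : \prod_(a <- A) (Z - pfp P a) = (\prod_(a <- A) ('X - (pfp P a)%:P)).[Z].
    by rewrite horner_prod; apply: eq_bigr => a _; rewrite hornerXsubC.
  rewrite -e2 horner_poly.
  have := congr1 (map_poly phi) sumE; rewrite rmorph_sum rmorph0 => e; apply: etrans e.
  apply: eq_bigr => i _; rewrite rmorphM rmorphXn /= -/Z; congr (_ * _).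
  by apply/polyP => j; rewrite coef_map /= ephi !coef_pfp fc.
move=> /eqP; rewrite prodf_seq_eq0 => /hasP [a /mapP [t /TsP [s [hs et]] ea]] /=.
rewrite subr_eq0 => /eqP eZ; exists s; split=> // y yy.
have hi : (index y ys < size ys)%N by rewrite index_mem.
have := congr1 (fun u : {poly Om} => u`_(index y ys)) eZ.
rewrite /Z coef_map /= ephi !coef_pfp coef_Poly nth_index // ea coef_Poly et (nth_map 0) //.
by rewrite nth_index // => ->.
Qed.

Let BD x y : B x -> B y -> B (x - y).
Proof. by move=> hx hy s hs; rewrite rmorphB; apply: pOB; [exact: hx|exact: hy]. Qed.

(** Normalise an equation of [y] so that its coefficients are integral and one of them is 1. Its
    Horner tails [bb y j] are integral at all conjugate places, and [bb y j = a j + y * bb y j.+1].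
    Some tail is a unit, since otherwise the coefficient 1 would reduce to 0; this exhibits [y] as a
    quotient. *)
Let frac_B y : pO P y -> exists a b, [/\ B a, B b, f b != 0 & y = a / b].
Proof.
move=> Oy; have [m [m0 /rootP rm]] := aL y; set M := map_poly (sfm L) m in rm.
have M0 : M != 0 by rewrite map_poly_eq0.
have LM i : L M`_i by exact: Lp_map.
have [|c [/mapP [i0 _ ec] c0 hc]] := @max_term _ P [seq M`_i | i <- iota 0 (size M)].
  exists (lead_coef M); rewrite ?lead_coef_eq0 // lead_coefE; apply: map_f.
  by rewrite mem_iota add0n /= prednK // size_poly_gt0.
pose a i := M`_i / c.
have La i : L (a i) by apply: sfM => //; apply: sfV; rewrite ec.
have Oa i : pO P (a i).
  have [lt|le] := ltnP i (size M).
    by apply: hc; apply: map_f; rewrite mem_iota.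
  by rewrite /a nth_default // mul0r; exact: pO0.
have s0 : \sum_(i < size M) a i * y ^+ i = 0.
  have e := congr1 (fun u => u / c) rm; rewrite mul0r horner_coef mulr_suml in e.
  by apply: etrans e; apply: eq_bigr => i _; rewrite /a mulrAC.
set n := size M in s0.
pose bb z j := \sum_(j <= i < n) a i * z ^+ (i - j).
have bS z j : (j < n)%N -> bb z j = a j + z * bb z j.+1.
  move=> lt; rewrite /bb big_ltn // subnn expr0 mulr1; congr (_ + _).
  rewrite mulr_sumr big_nat [RHS]big_nat; apply: eq_bigr => i /andP [h _].
  by rewrite mulrCA -exprS subnSK.
have Bb j : B (bb y j).
  move=> s hs; have -> : s (bb y j) = bb (s y) j.
    rewrite /bb rmorph_sum; apply: eq_bigr => i _; rewrite rmorphM rmorphXn /=.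
    by rewrite (hs.2 _ (La i)).
  have sz : \sum_(0 <= i < n) a i * (s y) ^+ i = 0.
    have e := congr1 s s0; rewrite rmorph_sum rmorph0 in e; rewrite big_mkord.
    by apply: etrans e; apply: eq_bigr => i _; rewrite rmorphM rmorphXn /= (hs.2 _ (La i)).
  have [Oz|[Oz _]] := pO_tot P (s y).
    by apply: pO_sum => i _; apply: pOM => //; exact: pOX.
  have [le|lt] := leqP n j; first by rewrite /bb big_geq //; exact: pO0.
  have [z0|z0] := eqVneq (s y) 0.
    by apply: pO_sum => i _; apply: pOM => //; apply: pOX; rewrite z0; exact: pO0.
  (* When [s y] is not integral, the tail is minus the head of the equation, rewritten in powers of
     the integral element [(s y)^-1]. *)
  have -> : bb (s y) j = - \sum_(0 <= i < j) a i * (s y)^-1 ^+ (j - i).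
    rewrite (@big_cat_nat _ _ _ j) //= in sz; last exact: ltnW.
    move/eqP: sz; rewrite addrC addr_eq0 => /eqP sz.
    have e1 : s y ^+ j * bb (s y) j = \sum_(j <= i < n) a i * s y ^+ i.
      rewrite /bb mulr_sumr big_nat [RHS]big_nat; apply: eq_bigr => i /andP [h _].
      by rewrite mulrCA -exprD subnKC.
    apply: (mulfI (expf_neq0 j z0)); rewrite e1 mulrN [in RHS]mulr_sumr.
    rewrite sz; congr (- _); rewrite big_nat [RHS]big_nat; apply: eq_bigr => i /andP [_ h].
    rewrite mulrCA; congr (_ * _).
    have -> : s y ^+ j = s y ^+ i * s y ^+ (j - i) by rewrite -exprD subnKC // ltnW.
    by rewrite -mulrA -exprMn mulfV // expr1n mulr1.
  by apply: pON; apply: pO_sum => i _; apply: pOM => //; exact: pOX.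
have b0 : bb y 0%N = 0.
  by rewrite /bb big_mkord; apply: etrans s0; apply: eq_bigr => i _; rewrite subn0.
have Ba j : B (a j) by move=> s hs; rewrite hs.2.
have [[j fj]|nj] := pselect (exists j, f (bb y j) != 0); last first.
  have f0 j : f (bb y j) = 0 by apply/eqP; apply: contrapT => /negP h; apply: nj; exists j.
  have i0n : exists2 i, (i < n)%N & a i = 1.
    exists i0; last by rewrite /a -ec mulfV.
    rewrite ltnNge; apply/negP => le; move: c0; by rewrite ec nth_default // eqxx.
  have [i lt ai] := i0n; have := congr1 f (bS y i lt).
  rewrite f0 ai pfD ?pf1; [|exact: pO1|by apply: pOM => //; exact: BO].
  rewrite pfM //; last exact: BO.
  by rewrite f0 mulr0 addr0 => /esym/eqP; rewrite oner_eq0.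
case: j fj => [|j] fj; first by rewrite b0 pf0 eqxx in fj.
have lt : (j < n)%N.
  rewrite ltnNge; apply/negP => le; move: fj; rewrite /bb big_geq ?pf0 ?eqxx //.
  exact: leq_trans le (leqnSn _).
exists (bb y j - a j), (bb y j.+1); split => //; first exact: BD.
rewrite bS // addrAC subrr add0r mulfK //; apply: contra_neq fj => ->; exact: pf0.
Qed.

(** Each finite list is handled by [lift_list]; an ultralimit along the finite lists gives one
    automorphism for all of [B], and [frac_B] passes from [B] to the valuation ring. *)
Theorem frob_lift : exists s, autL L s /\
  forall y, pO P y -> pO P (s y) /\ f (s y) = f y ^+ Q.
Proof.
pose FF (A : set (seq Om)) := exists l0 : seq Om, forall l, {subset l0 <= l} -> A l.
have PF : ProperFilter FF.
  split; first by move=> [l0 h]; exact: (h l0).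
  split.
  - by exists [::].
  - move=> A A' [l0 h] [l1 h']; exists (l0 ++ l1) => l hl; split.
      by apply: h => x xl; apply: hl; rewrite mem_cat xl.
    by apply: h' => x xl; apply: hl; rewrite mem_cat xl orbT.
  - by move=> A A' AA' [l0 h]; exists l0 => l /h; exact: AA'.
have [G [UG FG]] := ultraFilterLemma PF.
have sl (l : seq Om) : exists s, autL L s /\ forall y, y \in l -> B y -> f (s y) = f y ^+ Q.
  have [|s [hs h]] := @lift_list (seq.filter (fun y => `[< B y >]) l).
    by move=> y; rewrite mem_filter => /andP [/asboolP].
  exists s; split => // y yl By; apply: h; rewrite mem_filter yl andbT; exact/asboolP.
pose s l := sval (cid (sl l)).
have sP l : autL L (s l) /\ forall y, y \in l -> B y -> f (s l y) = f y ^+ Q.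
  by rewrite /s; case: cid.
have [t [ht tG]] := ultra_lim aL UG (fun l => (sP l).1).
have tB y : B y -> f (t y) = f y ^+ Q.
  move=> By; have h : G [set l : seq Om | y \in l]%classic.
    by apply: FG; exists [:: y] => l; apply; exact: mem_head.
  have [l [/= h1 h2]] := filter_ex (filterI (tG y) h).
  by rewrite -h1; apply: (sP l).2.
exists t; split=> // y Oy; have [a [b [Ba Bb fb ->]]] := frac_B Oy.
have Ob : pO P (t b) by apply: Bb.
have Oa : pO P (t a) by apply: Ba.
have fb' : f (t b) != 0 by rewrite tB // expf_neq0.
have -> : t (a / b) = t a / t b by exact: fmorph_div.
have ub : punit P (t b) by [].
have ub0 : punit P b by split => //; exact: BO.
have [hV _] := punitV ub; have [hV0 _] := punitV ub0.
split; first exact: pOM.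
by rewrite (pfM Oa hV) (pfM (BO Ba) hV0) (pfV Ob fb') (pfV (BO Bb) fb) (tB _ Ba) (tB _ Bb) exprMn exprVn.
Qed.
End FrobLift.

(** * Twisted polynomials *)

Section TauPoly.
Variables (Fq : finFieldType) (p : nat) (Om : closedFieldType)
          (iota : {rmorphism {fraction {poly Fq}} -> Om}).
Hypotheses (chp : p \in [pchar Fq]).
Local Notation q := #|Fq|.
Local Notation iA := (iA iota).
Local Notation kc := (kc iota).
Local Notation kcm := (kcm iota).
Let FrD' k := FrD iota chp k.
Let Fr0' k : (0 : Om) ^+ (q ^ k) = 0. Proof. exact: Fr0 iota chp k. Qed.
Implicit Types (P Q : {poly Om}) (a b : {poly Fq}) (x y z : Om).
Let qk0 k : (0 < q ^ k)%N. Proof. by rewrite expn_gt0 q_gt0. Qed.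

(* A tau-polynomial sum P_i tau^i is encoded by the ordinary polynomial with the same
   coefficients; ev is its action on Om. *)
Definition ev (P : {poly Om}) (x : Om) := \sum_(i < size P) P`_i * x ^+ (q ^ i).

Lemma evE P x : ev P x = \sum_(i < size P) P`_i * x ^+ (q ^ i). Proof. by []. Qed.
Lemma ev_wide n P x : (size P <= n)%N -> ev P x = \sum_(i < n) P`_i * x ^+ (q ^ i).
Proof.
move=> le; rewrite /ev (big_ord_widen _ (fun i => P`_i * x ^+ (q ^ i)) le) big_mkcond /=.
apply: eq_bigr => i _; case: ltnP => // h; by rewrite nth_default // mul0r.
Qed.
Lemma evD P Q x : ev (P + Q) x = ev P x + ev Q x.
Proof.
pose n := maxn (size P) (size Q).
rewrite !(@ev_wide n) ?leq_maxl ?leq_maxr ?size_polyD // -big_split /=.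
by apply: eq_bigr => i _; rewrite coefD mulrDl.
Qed.
Lemma evZ c P x : ev (c *: P) x = c * ev P x.
Proof.
rewrite !(@ev_wide (size P)) ?size_scale_leq // mulr_sumr.
by apply: eq_bigr => i _; rewrite coefZ mulrA.
Qed.
Lemma ev0 x : ev 0 x = 0. Proof. by rewrite /ev size_poly0 big_ord0. Qed.
Lemma evN P x : ev (- P) x = - ev P x.
Proof. by rewrite -scaleN1r evZ mulN1r. Qed.
Lemma evB P Q x : ev (P - Q) x = ev P x - ev Q x.
Proof. by rewrite evD evN. Qed.
Lemma ev_sum (I : Type) (r : seq I) (R : pred I) (E : I -> {poly Om}) x :
  ev (\sum_(i <- r | R i) E i) x = \sum_(i <- r | R i) ev (E i) x.
Proof. by elim/big_rec2: _ => [|i y1 y2 _ <-]; rewrite ?ev0 ?evD. Qed.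
Lemma evXn k x : ev 'X^k x = x ^+ (q ^ k).
Proof.
rewrite /ev size_polyXn big_ord_recr /= big1 ?add0r ?coefXn ?eqxx ?mul1r // => i _.
by rewrite coefXn ltn_eqF ?mul0r.
Qed.
Lemma ev1 x : ev 1 x = x. Proof. by rewrite -(expr0 'X) evXn expn0 expr1. Qed.
Lemma ev_add P x y : ev P (x + y) = ev P x + ev P y.
Proof. by rewrite /ev -big_split /=; apply: eq_bigr => i _; rewrite FrD' mulrDr. Qed.
Lemma ev_0 P : ev P 0 = 0.
Proof. by rewrite /ev big1 // => i _; rewrite Fr0' mulr0. Qed.
Lemma ev_opp P x : ev P (- x) = - ev P x.
Proof. by apply/eqP; rewrite -addr_eq0 -ev_add addNr ev_0. Qed.
Lemma ev_subx P x y : ev P (x - y) = ev P x - ev P y.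
Proof. by rewrite ev_add ev_opp. Qed.
Lemma ev_sumx P (I : Type) (r : seq I) (R : pred I) (E : I -> Om) :
  ev P (\sum_(i <- r | R i) E i) = \sum_(i <- r | R i) ev P (E i).
Proof. by elim/big_rec2: _ => [|i y1 y2 _ <-]; rewrite ?ev_0 ?ev_add. Qed.
Lemma ev_kc P c x : ev P (kc c * x) = kc c * ev P x.
Proof. by rewrite /ev mulr_sumr; apply: eq_bigr => i _; rewrite exprMn Fr_kc mulrCA. Qed.

(** The twist in the commutation rule [tau^k Q = (frp k Q) tau^k]. *)
Definition frp k (Q : {poly Om}) : {poly Om} := \poly_(i < size Q) Q`_i ^+ (q ^ k).
Lemma coef_frp k Q i : (frp k Q)`_i = Q`_i ^+ (q ^ k).
Proof. by rewrite coef_poly; case: ltnP => // le; rewrite nth_default // Fr0'. Qed.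
Lemma ev_frp k Q x : ev (frp k Q) (x ^+ (q ^ k)) = ev Q x ^+ (q ^ k).
Proof.
rewrite (@ev_wide (size Q)) ?size_poly // /ev (Fr_sum iota chp); apply: eq_bigr => i _.
by rewrite coef_frp exprMn -!exprM mulnC.
Qed.
Lemma size_frp k Q : size (frp k Q) = size Q.
Proof.
have [->|Q0] := eqVneq Q 0; first by rewrite /frp size_poly0 poly_def big_ord0 size_poly0.
by apply: size_poly_eq; rewrite expf_neq0 // -lead_coefE lead_coef_eq0.
Qed.

Definition tmul (P Q : {poly Om}) := \sum_(i < size P) P`_i *: ('X^i * frp i Q).
Lemma tmul_wide n P Q : (size P <= n)%N -> tmul P Q = \sum_(i < n) P`_i *: ('X^i * frp i Q).
Proof.
move=> le; rewrite /tmul (big_ord_widen _ (fun i => P`_i *: ('X^i * frp i Q)) le) big_mkcond /=.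
apply: eq_bigr => i _; case: ltnP => // h; by rewrite nth_default // scale0r.
Qed.
Lemma coef_tmul P Q k : (tmul P Q)`_k = \sum_(i < k.+1) P`_i * Q`_(k - i) ^+ (q ^ i).
Proof.
rewrite (@tmul_wide (maxn (size P) k.+1)) ?leq_maxl // coef_sum.
rewrite (big_ord_widen _ (fun i => P`_i * Q`_(k - i) ^+ (q ^ i)) (leq_maxr (size P) k.+1)).
rewrite [RHS]big_mkcond /=; apply: eq_bigr => i _.
rewrite coefZ coefXnM coef_frp ltnS; by case: ltnP => h; rewrite ?mulr0.
Qed.
Lemma ev_tmul P Q x : ev (tmul P Q) x = ev P (ev Q x).
Proof.
rewrite /tmul ev_sum /ev -/(ev _ _); apply: eq_bigr => i _; rewrite -/(ev _ _) evZ; congr (_ * _).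
rewrite -/(ev Q x) -ev_frp (@ev_wide (i + size Q)); last first.
  apply: leq_trans (size_polyMleq _ _) _; rewrite size_polyXn size_frp addSn //=.
rewrite (@ev_wide (size Q)) ?size_frp // big_split_ord /= big1 ?add0r => [|j _].
  apply: eq_bigr => j _; rewrite coefXnM ltnNge leq_addr /= addKn; congr (_ * _).
  by rewrite expnD exprM.
by rewrite coefXnM ltn_ord mul0r.
Qed.
Lemma tmulDl P P' Q : tmul (P + P') Q = tmul P Q + tmul P' Q.
Proof.
pose n := maxn (size P) (size P').
rewrite !(@tmul_wide n) ?leq_maxl ?leq_maxr ?size_polyD // -big_split /=.
by apply: eq_bigr => i _; rewrite coefD scalerDl.
Qed.
Lemma tmulZl c P Q : tmul (c *: P) Q = c *: tmul P Q.
Proof.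
rewrite !(@tmul_wide (size P)) ?size_scale_leq // scaler_sumr.
by apply: eq_bigr => i _; rewrite coefZ scalerA.
Qed.
Lemma tmul0l Q : tmul 0 Q = 0. Proof. by rewrite /tmul size_poly0 big_ord0. Qed.
Lemma tmul_suml (I : Type) (r : seq I) (R : pred I) (E : I -> {poly Om}) Q :
  tmul (\sum_(i <- r | R i) E i) Q = \sum_(i <- r | R i) tmul (E i) Q.
Proof. by elim/big_rec2: _ => [|i y1 y2 _ <-]; rewrite ?tmul0l ?tmulDl. Qed.

Lemma size_tmul P Q : P != 0 -> Q != 0 -> size (tmul P Q) = (size P + size Q).-1 /\
  lead_coef (tmul P Q) = lead_coef P * lead_coef Q ^+ (q ^ (size P).-1).
Proof.
move=> P0 Q0; have sP : (0 < size P)%N by rewrite size_poly_gt0.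
have sQ : (0 < size Q)%N by rewrite size_poly_gt0.
set n := ((size P).-1 + (size Q).-1)%N.
have hk k : (k < size P)%N -> k != (size P).-1 -> (size Q <= n - k)%N by rewrite /n; plia.
have hk' j k : (k < size P)%N -> (n.+1 <= j)%N -> (size Q <= j - k)%N by rewrite /n; plia.
have top : (tmul P Q)`_n = lead_coef P * lead_coef Q ^+ (q ^ (size P).-1).
  rewrite coef_tmul (bigD1 (inord (size P).-1)) //= inordK ?ltnS ?leq_addr // big1 ?addr0.
    by rewrite /n addKn.
  move=> i ni; have [lt|le] := ltnP i (size P).
    have nei : (i : nat) != (size P).-1.
      by apply: contra ni => /eqP e; apply/eqP; apply: val_inj; rewrite /= inordK ?ltnS ?leq_addr.
    by rewrite (nth_default _ (hk _ lt nei)) Fr0' mulr0.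
  by rewrite nth_default // mul0r.
have tn0 : (tmul P Q)`_n != 0 by rewrite top mulf_neq0 ?expf_neq0 ?lead_coef_eq0.
have sz : size (tmul P Q) = n.+1.
  apply/eqP; rewrite eqn_leq; apply/andP; split; last first.
    by rewrite ltnNge; apply/negP => le; move: tn0; rewrite nth_default ?eqxx.
  apply/leq_sizeP => j hj; rewrite coef_tmul big1 // => i _.
  have [lt|le] := ltnP i (size P); last by rewrite nth_default // mul0r.
  by rewrite (nth_default _ (hk' _ _ lt hj)) Fr0' mulr0.
split; first by rewrite sz /n; plia.
by rewrite [LHS]lead_coefE sz.
Qed.
Lemma tmul_neq0 P Q : P != 0 -> Q != 0 -> tmul P Q != 0.
Proof.
move=> P0 Q0; rewrite -lead_coef_eq0 (size_tmul P0 Q0).2.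
by rewrite mulf_neq0 ?expf_neq0 ?lead_coef_eq0.
Qed.

(** The additive polynomial behind a tau-polynomial, which makes ordinary roots, degrees and
    derivatives available. *)
Definition evp (P : {poly Om}) : {poly Om} := \sum_(i < size P) P`_i *: 'X^(q ^ i).
Lemma evp_horner P x : (evp P).[x] = ev P x.
Proof. by rewrite /evp horner_sum; apply: eq_bigr => i _; rewrite hornerZ hornerXn. Qed.
Lemma size_evp P : P != 0 -> size (evp P) = (q ^ (size P).-1).+1.
Proof.
move=> P0; rewrite /evp (polySpred P0) big_ord_recr /= addrC size_polyDl.
  by rewrite size_scale ?size_polyXn // -lead_coefE lead_coef_eq0.
rewrite size_scale ?size_polyXn -?lead_coefE ?lead_coef_eq0 //.
rewrite ltnS; apply: leq_trans (size_sum _ _ _) _; apply/bigmax_leqP => i _.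
apply: leq_trans (size_scale_leq _ _) _; rewrite size_polyXn ltn_exp2l // q_gt1 //.
Qed.
(** The degree bound through [evp]. The later arguments that a tau-polynomial vanishes compare its
    degree with a number of torsion points in this way. *)
Lemma ev_roots P (s : seq Om) : P != 0 -> uniq s -> (forall x, x \in s -> ev P x = 0) ->
  (size s <= q ^ (size P).-1)%N.
Proof.
move=> P0 us hs; rewrite -ltnS -size_evp //; apply: max_poly_roots => //.
  by rewrite -size_poly_gt0 size_evp.
by apply/allP => x /hs h; rewrite /root evp_horner h.
Qed.
Lemma ev_inj P Q : (forall x, ev P x = ev Q x) -> P = Q.
Proof.
move=> h; apply/eqP; rewrite -subr_eq0; apply: contraT => nz.
pose N := (q ^ (size (P - Q)).-1).+1.
have := @ev_roots _ (mkseq (fun i => iA 'X ^+ i) N) nz.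
rewrite size_mkseq ltnn => H; have : false; last by [].
apply: H; last by move=> x _; rewrite evB h subrr.
rewrite map_inj_uniq ?iota_uniq // => i j e0.
have /eqP : iA ('X^i - 'X^j) = 0.
  by rewrite iAmE rmorphB !rmorphXn; apply/eqP; rewrite subr_eq0; apply/eqP; exact: e0.
rewrite iA_eq0 subr_eq0 => /eqP e.
by have := congr1 (fun u : {poly Fq} => size u) e; rewrite !size_polyXn => -[].
Qed.

(* the A-action attached to a tau-polynomial Pt (the image of t) *)
Section Action.
Variable Pt : {poly Om}.
Definition titer j := iter j (fun Q => tmul Q Pt) 1.
Definition tp (a : {poly Fq}) : {poly Om} := \sum_(j < size a) kc a`_j *: titer j.
Definition act a x := ev (tp a) x.

Lemma tp_wide n a : (size a <= n)%N -> tp a = \sum_(j < n) kc a`_j *: titer j.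
Proof.
move=> le; rewrite /tp (big_ord_widen _ (fun j => kc a`_j *: titer j) le) big_mkcond /=.
apply: eq_bigr => i _; case: ltnP => // h; by rewrite nth_default // kcE rmorph0 scale0r.
Qed.
Lemma tpD a b : tp (a + b) = tp a + tp b.
Proof.
pose n := maxn (size a) (size b).
rewrite !(@tp_wide n) ?leq_maxl ?leq_maxr ?size_polyD // -big_split /=.
by apply: eq_bigr => i _; rewrite coefD kcE rmorphD scalerDl.
Qed.
Lemma tp0 : tp 0 = 0. Proof. by rewrite /tp size_poly0 big_ord0. Qed.
Lemma tpMX a : tp (a * 'X) = tmul (tp a) Pt.
Proof.
have [->|a0] := eqVneq a 0; first by rewrite mul0r tp0 tmul0l.
rewrite (@tp_wide (size a).+1) ?size_mulX // big_ord_recl coefMX eqxx kcE rmorph0 scale0r add0r.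
rewrite /tp tmul_suml; apply: eq_bigr => i _; rewrite tmulZl coefMX //.
Qed.
Lemma tpC c : tp c%:P = kc c *: 1.
Proof. by rewrite (@tp_wide 1) ?size_polyC_leq1 // big_ord1 coefC eqxx. Qed.
Lemma actD a b x : act (a + b) x = act a x + act b x.
Proof. by rewrite /act tpD evD. Qed.
Lemma act0 x : act 0 x = 0. Proof. by rewrite /act tp0 ev0. Qed.
Lemma actN a x : act (- a) x = - act a x.
Proof. by apply/eqP; rewrite -addr_eq0 -actD addNr act0. Qed.
Lemma actB a b x : act (a - b) x = act a x - act b x.
Proof. by rewrite actD actN. Qed.
Lemma actC c x : act c%:P x = kc c * x.
Proof. by rewrite /act tpC evZ ev1. Qed.
Lemma act1 x : act 1 x = x.
Proof. by rewrite -(polyC1) actC kcE rmorph1 mul1r. Qed.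
Lemma actMX a x : act (a * 'X) x = act a (ev Pt x).
Proof. by rewrite /act tpMX ev_tmul. Qed.
Lemma actX x : act 'X x = ev Pt x.
Proof. by rewrite -(mul1r 'X) actMX act1. Qed.
Lemma act_add a x y : act a (x + y) = act a x + act a y.
Proof. exact: ev_add. Qed.
Lemma act_sub a x y : act a (x - y) = act a x - act a y.
Proof. exact: ev_subx. Qed.
Lemma act_0 a : act a 0 = 0. Proof. exact: ev_0. Qed.
Lemma act_sum a (I : Type) (r : seq I) (R : pred I) (E : I -> Om) :
  act a (\sum_(i <- r | R i) E i) = \sum_(i <- r | R i) act a (E i).
Proof. exact: ev_sumx. Qed.
Lemma act_ev a x : act a (ev Pt x) = ev Pt (act a x).
Proof.
elim/poly_ind: a x => [|a c IH] x; first by rewrite !act0 ev_0.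
by rewrite !actD !actC !actMX IH ev_add ev_kc.
Qed.
Lemma actM a b x : act (a * b) x = act a (act b x).
Proof.
elim/poly_ind: b x => [|b c IH] x; first by rewrite mulr0 !act0 act_0.
rewrite mulrDr actD mulrA actMX IH actD actMX act_add; congr (_ + _).
elim/poly_ind: a {IH} x => [|a c' IH] x; first by rewrite mul0r !act0.
rewrite mulrDl mulrAC -polyCM !actD !actMX IH !actC ev_kc.
by congr (_ + _); rewrite mulrA; congr (_ * _); exact: (rmorphM kcm).
Qed.
Lemma actAC a b x : act a (act b x) = act b (act a x).
Proof. by rewrite -!actM mulrC. Qed.

Lemma act_iter a x : act a x = \sum_(j < size a) kc a`_j * iter j (ev Pt) x.
Proof.
rewrite /act /tp ev_sum; apply: eq_bigr => j _; rewrite evZ; congr (_ * _).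
elim: (nat_of_ord j) x => [|k IH] x; first by rewrite ev1.
by rewrite iterSr -IH /titer /= ev_tmul.
Qed.

Lemma tp_comm a : tmul (tp a) Pt = tmul Pt (tp a).
Proof. by apply: ev_inj => x; rewrite !ev_tmul; exact: act_ev. Qed.

Lemma tp_coef0 a : (tp a)`_0 = (map_poly kcm a).[Pt`_0].
Proof.
elim/poly_ind: a => [|a c IH]; first by rewrite tp0 coef0 rmorph0 horner0.
rewrite tpD tpMX tpC coefD coef_tmul big_ord1 subnn expn0 expr1 IH coefZ coef1 mulr1.
by rewrite rmorphD rmorphM /= map_polyX map_polyC hornerD hornerMX hornerC.
Qed.

(** [U] stands for a multiplicatively closed set containing the nonzero constants, later the units
    at a place. *)
Lemma size_tp r a : size Pt = r.+2 -> a != 0 ->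
  size (tp a) = (r.+1 * (size a).-1).+1 /\
  forall U : Om -> Prop, (forall x y, U x -> U y -> U (x * y)) -> (forall c : Fq, c != 0 -> U (kc c)) ->
     U (lead_coef Pt) -> U (lead_coef (tp a)).
Proof.
move=> sPt; have Pt0 : Pt != 0 by rewrite -size_poly_gt0 sPt.
elim/poly_ind: a => [|a c IH] ; first by rewrite eqxx.
have [->|a0] := eqVneq a 0.
  rewrite mul0r add0r polyC_eq0 => c0; rewrite tpC size_polyC c0 muln0.
  have k0 : kc c != 0 by rewrite kcE fmorph_eq0.
  split; first by rewrite size_scale // size_poly1.
  by move=> U _ Uc _; rewrite lead_coefZ lead_coefC mulr1; exact: Uc.
move=> _; have [s1 l1] := IH a0.
have ta0 : tp a != 0 by rewrite -size_poly_gt0 s1.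
have [s2 l2] := size_tmul ta0 Pt0.
have sa : (0 < size a)%N by rewrite size_poly_gt0.
have big : (size (kc c *: (1 : {poly Om})) < size (tmul (tp a) Pt))%N.
  apply: leq_ltn_trans (size_scale_leq _ _) _; rewrite size_poly1 s2 s1 sPt; move: (r.+1 * _)%N => k; lia.
rewrite tpD tpMX tpC size_polyDl // lead_coefDl // s2 s1 sPt l2; split.
  rewrite size_MXaddC (negPf a0) /=.
  have [k ek] : exists k, size a = k.+1 by exists (size a).-1; rewrite prednK.
  by rewrite ek /= mulnS; move: (r.+1 * k)%N => l; lia.
move=> U UM Uc Ul; apply: (UM); first exact: (l1 U UM Uc Ul).
have UX n : U (lead_coef Pt ^+ n.+1).
  by elim: n => [|n IHn]; rewrite ?expr1 // exprS; exact: (UM _ _ Ul IHn).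
by rewrite -(prednK (qk0 _)).
Qed.
End Action.

Lemma phi_act c a x : phi_a iota c a x = act (Poly (iA 'X :: c)) a x.
Proof.
have h y : phi_t iota c y = ev (Poly (iA 'X :: c)) y.
  rewrite /phi_t (@ev_wide (size c).+1); last exact: (size_Poly (iA 'X :: c)).
  rewrite big_ord_recl coef_Poly /= expn0 expr1; congr (_ + _).
  by apply: eq_bigr => i _; rewrite -[cons_poly _ _]/(Poly (iA 'X :: c)) coef_Poly.
rewrite act_iter /phi_a; apply: eq_bigr => j _; congr (_ * _).
by elim: (nat_of_ord j) => // k IH; rewrite !iterS IH h.
Qed.
End TauPoly.

(** * Quotients by finite Galois-stable submodules *)

Section Quotient.
Variables (Fq : finFieldType) (p : nat) (Om : closedFieldType)
          (iota : {rmorphism {fraction {poly Fq}} -> Om}).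
Hypotheses (chp : p \in [pchar Fq]).
Local Notation q := #|Fq|.
Local Notation iA := (iA iota).
Local Notation kc := (kc iota).
Local Notation kcm := (kcm iota).
Local Notation ev := (@ev Fq Om).
Local Notation tmul := (@tmul Fq Om).
Local Notation act := (act iota).
Implicit Types (P Q e : {poly Om}) (a b : {poly Fq}) (x y z : Om).

Lemma Fq_root y : y ^+ q = y -> exists c, y = kc c.
Proof.
move=> hy; apply: contrapT => no.
pose s := y :: [seq kc c | c <- enum Fq].
have us : uniq s.
  rewrite /= map_inj_uniq ?enum_uniq ?andbT; last exact: (fmorph_inj kcm).
  by apply/negP => /mapP [c _ e]; apply: no; exists c.
have q1 := q_gt1 Fq.
have P0 : 'X^q - 'X != 0 :> {poly Om}.
  by rewrite -size_poly_gt0 size_polyDl ?size_polyN ?size_polyX size_polyXn.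
have := max_poly_roots P0 _ us; rewrite size_polyDl ?size_polyN ?size_polyX size_polyXn // /s /= size_map -cardE ltnn.
have rt z : root ('X^q - 'X) z = (z ^+ q == z).
  by rewrite /root hornerD hornerN hornerXn hornerX subr_eq0.
move=> H; have : false; last by []; apply: H; rewrite /= rt hy eqxx /=.
by apply/allP => _ /mapP [c _ ->]; rewrite rt; apply/eqP; have := Fr_kc iota 1 c; rewrite expn1.
Qed.

Lemma endoM (s : {rmorphism Om -> Om}) x y : s (x * y) = s x * s y.
Proof. exact: rmorphM. Qed.
Lemma endoX (s : {rmorphism Om -> Om}) x n : s (x ^+ n) = s x ^+ n.
Proof. exact: rmorphXn. Qed.
Lemma endo_sum (s : {rmorphism Om -> Om}) (I : Type) (r : seq I) (R : pred I) (E : I -> Om) :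
  s (\sum_(i <- r | R i) E i) = \sum_(i <- r | R i) s (E i).
Proof. exact: raddf_sum. Qed.
Lemma coef_endo (s : {rmorphism Om -> Om}) P i : (map_poly s P)`_i = s P`_i.
Proof. exact: coef_map. Qed.
Lemma map_tmul (s : {rmorphism Om -> Om}) P Q : map_poly s (tmul P Q) = tmul (map_poly s P) (map_poly s Q).
Proof.
apply/polyP => i; rewrite coef_endo !(coef_tmul iota chp). rewrite endo_sum; apply: eq_bigr => j _.
by rewrite !coef_endo endoM endoX.
Qed.
Lemma map_ev (s : {rmorphism Om -> Om}) P x : s (ev P x) = ev (map_poly s P) (s x).
Proof.
rewrite (@ev_wide _ _ (size P) (map_poly s P)); last exact: size_poly.
rewrite endo_sum; apply: eq_bigr => i _; by rewrite endoM endoX coef_endo.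
Qed.

(** The additive polynomial with the [F_q]-span of [ws] as kernel, built one vector at a time by
    replacing [e] with [(tau - e(w)^(q-1)) e]. The fourth clause bounds the kernel by any
    [F_q]-space [W] containing [ws], the last one bounds the field of coefficients. *)
Lemma vanish_ex (ws : seq Om) : exists e, [/\ e \is monic, e`_0 != 0,
  forall w, w \in ws -> ev e w = 0,
  forall W : Om -> Prop, W 0 -> (forall c x y, W x -> W y -> W (x + kc c * y)) ->
    (forall w, w \in ws -> W w) -> forall x, ev e x = 0 -> W x
  & forall L : sfield Om, (forall w, w \in ws -> L w) -> Lp L e].
Proof.
elim: ws => [|w ws [e [me e0 ve ke Le]]].
  exists 1; split => //; rewrite ?monic1 ?coef1 ?oner_neq0 //.
    by move=> W W0 _ _ x; rewrite ev1 => ->.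
  by move=> L _; apply: LpC; exact: sf1.
have [ew|ew] := eqVneq (ev e w) 0.
  exists e; split => //.
  - by move=> x; rewrite inE => /orP [/eqP ->|/ve].
  - move=> W W0 Wc Ww; apply: ke => // x xw; apply: Ww; by rewrite inE xw orbT.
  - by move=> L Lw; apply: Le => x xw; apply: Lw; rewrite inE xw orbT.
pose u : {poly Om} := 'X - (ev e w ^+ q.-1)%:P.
have q1 := q_gt1 Fq.
have qS : q.-1.+1 = q by rewrite prednK // ltnW.
have mu : u \is monic by exact: monicXsubC.
have u0 : u != 0 by exact: monic_neq0.
have ee0 : e != 0 by exact: monic_neq0.
have [szu lu] := size_tmul iota chp u0 ee0.
have evu y : ev u y = y ^+ q - ev e w ^+ q.-1 * y.
  rewrite /u evB -[('X : {poly Om})]expr1 evXn expn1; congr (_ - _).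
  by rewrite -mul_polyC mulr1 || rewrite -alg_polyC evZ ev1.
have evue x : ev (tmul u e) x = ev e x ^+ q - ev e w ^+ q.-1 * ev e x.
  by rewrite (ev_tmul iota chp) evu.
exists (tmul u e); split.
- by rewrite monicE lu (monicP mu) (monicP me) expr1n mulr1.
- rewrite (coef_tmul iota chp) big_ord1 subnn expn0 expr1 mulf_neq0 //.
  by rewrite coefB coefX coefC sub0r oppr_eq0 expf_neq0.
- move=> x; rewrite inE evue => /orP [/eqP ->|/ve ->]; last by rewrite mulr0 subr0 expr0n gtn_eqF // ltnW.
  by rewrite -exprSr qS subrr.
- move=> W W0 Wc Ww x; rewrite evue => h.
  have /Fq_root [c ec] : (ev e x / ev e w) ^+ q = ev e x / ev e w.
    move/eqP: h; rewrite subr_eq0 => /eqP h; rewrite expr_div_n h.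
    rewrite -{2}qS exprS; field; by rewrite ew expf_neq0.
  have : W (x - kc c * w).
    apply: ke => // [y yw|]; first by apply: Ww; rewrite inE yw orbT.
    rewrite (ev_subx iota chp) ev_kc -ec divfK // subrr //.
  move=> h1; rewrite -(subrK (kc c * w) x); apply: Wc => //; apply: Ww; exact: mem_head.
- move=> L Lw; have Lee : Lp L e by apply: Le => x xw; apply: Lw; rewrite inE xw orbT.
  move=> i; rewrite (coef_tmul iota chp); apply: sf_sum => j _; apply: sfM; last exact: sfX.
  rewrite coefB coefX coefC; apply: sfB; first exact: sf_nat.
  case: eqP => _; last exact: sf0.
  apply: sfX; rewrite evE; apply: sf_sum => k _; apply: sfM => //; apply: sfX; apply: Lw; exact: mem_head.
Qed.

(** The derivative of an additive polynomial is its linear coefficient, here a nonzero constant. *)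
Lemma evp_separable e : e`_0 != 0 -> e != 0 -> separable_poly (evp Fq e).
Proof.
move=> e0 ne0; rewrite separable_poly.unlock.
have -> : (evp Fq e)^`() = (e`_0)%:P.
  rewrite /evp raddf_sum /= (polySpred ne0) big_ord_recl /= big1 ?addr0.
    by rewrite derivZ expn0 expr1 derivX alg_polyC.
  move=> i _; rewrite derivZ derivXn -mulr_natr; have -> : (q ^ bump 0 i)%:R = 0 :> {poly Om}.
    rewrite -polyC_natr; have -> : (q ^ bump 0 i)%:R = 0 :> Om; last by rewrite polyC0.
    have [k k0 ->] := q_pow chp; rewrite -expnM; apply/eqP; rewrite -(dvdn_pcharf (pchar_Om iota chp)).
    by rewrite dvdn_exp // muln_gt0 k0.
  by rewrite mulr0 scaler0.
by rewrite -alg_polyC coprimepZr // coprimep1.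
Qed.

Lemma size_ker e : e`_0 != 0 -> e != 0 -> exists s, [/\ uniq s, size s = (q ^ (size e).-1)%N
  & forall x, x \in s -> ev e x = 0].
Proof.
move=> e0 ne0; have [r er] := closed_field_poly_normal (evp Fq e).
have z0 : evp Fq e != 0 by rewrite -size_poly_gt0 size_evp.
have lz : lead_coef (evp Fq e) != 0 by rewrite lead_coef_eq0.
exists r; split.
- rewrite -separable_prod_XsubC; apply: dvdp_separable (evp_separable e0 ne0).
  by rewrite er dvdpZr.
- have := congr1 (fun u : {poly Om} => size u) er.
  by rewrite size_evp // size_scale // size_prod_XsubC => -[].
- move=> x xr; rewrite -evp_horner; apply/rootP; rewrite er rootZ // root_prod_XsubC //.
Qed.

Lemma tdiv e P (L : sfield Om) : e \is monic -> Lp L e -> Lp L P ->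
  exists Q R, [/\ P = tmul Q e + R, (size R < size e)%N & Lp L Q].
Proof.
move=> me Le; have e0 : e != 0 by exact: monic_neq0.
have se : (0 < size e)%N by rewrite size_poly_gt0.
have [n] := ubnP (size P); elim: n P => // n IH P sP LP.
have [lt|le] := ltnP (size P) (size e).
  exists 0, P; rewrite tmul0l add0r; split => // i; rewrite coef0; exact: sf0.
have P0 : P != 0 by rewrite -size_poly_gt0 (leq_trans se).
pose k := (size P - size e)%N; pose M := lead_coef P *: 'X^k : {poly Om}.
have M0 : M != 0 by rewrite -lead_coef_eq0 lead_coefZ lead_coefXn mulr1 lead_coef_eq0.
have sM : size M = k.+1 by rewrite size_scale ?size_polyXn // lead_coef_eq0.
have [s1 l1] := size_tmul iota chp M0 e0.
have lM : lead_coef (tmul M e) = lead_coef P.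
  by rewrite l1 (monicP me) expr1n mulr1 lead_coefZ lead_coefXn mulr1.
have s2 : size (tmul M e) = size P by rewrite s1 sM /k; plia.
have LM : Lp L M by move=> i; rewrite coefZ coefXn; apply: sfM; [exact: LP|exact: sf_nat].
have Lt : Lp L (tmul M e).
  by move=> i; rewrite (coef_tmul iota chp); apply: sf_sum => j _; apply: sfM => //; apply: sfX.
have lt : (size (P - tmul M e)%R < size P)%N.
  have [->|nz] := eqVneq (P - tmul M e) 0; first by rewrite size_poly0 size_poly_gt0.
  have sz : (size (P - tmul M e)%R <= (size P).-1)%N.
    apply/leq_sizeP => j hj; rewrite coefB.
    have [ej|nj] := eqVneq j (size P).-1.
      by move: lM; rewrite !lead_coefE s2 ej => ->; rewrite subrr.
    by rewrite !nth_default ?subrr //; rewrite ?s2; plia.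
  have : (0 < size P)%N by rewrite size_poly_gt0.
  by move: sz; plia.
have [Q [R [e1 sR LQ]]] := IH (P - tmul M e) (leq_trans lt sP) (LpB LP Lt).
exists (M + Q), R; split => //; last exact: LpD.
by rewrite tmulDl -addrA -e1 addrC subrK.
Qed.

(** Right division of [e Pt] by [e] leaves a remainder that kills [ws] but has smaller degree than
    [e], hence is 0. The coefficients lie at first in the field generated by the separable elements
    [ws]; being Galois invariant they descend to [K]. The quotient turns one step of a flag into a
    line of torsion points. *)
Theorem quotient_ex (K : sfield Om) Pt r (ws : seq Om) :
  algo K -> (forall c, K (kc c)) -> Lp K Pt -> size Pt = r.+2 ->
  (forall w, w \in ws -> sepe K w) ->
  0 \in ws -> (forall c x y, x \in ws -> y \in ws -> x + kc c * y \in ws) ->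
  (forall x, x \in ws -> ev Pt x \in ws) ->
  (forall s, autL K s -> forall x, x \in ws -> s x \in ws) ->
  exists e psi, [/\ Lp K e, forall x, ev e x = 0 <-> x \in ws,
    Lp K psi, size psi = r.+2 & psi`_0 = Pt`_0 /\
    forall a x, ev e (act Pt a x) = act psi a (ev e x)].
Proof.
move=> aK Kc KPt sPt sw w0 wc wPt ws_s.
have [e [me e0 ve ke Le]] := vanish_ex ws.
have kerE x : ev e x = 0 <-> x \in ws by split; [apply: (ke (fun x => x \in ws))|exact: ve].
have ne0 : e != 0 by exact: monic_neq0.
have Pt0 : Pt != 0 by rewrite -size_poly_gt0 sPt.
have [sk [uk szk vk]] := size_ker e0 ne0.
pose KS := adjs K ws.
have KSe : Lp KS e by apply: Le => w; exact: adjs_gen.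
have KSPt : Lp KS Pt by move=> i; apply: adjs_sub.
have killed (R : {poly Om}) : (size R < size e)%N -> (forall x, x \in ws -> ev R x = 0) -> R = 0.
  move=> sR hR; apply/eqP; apply: contraT => R0.
  have h1 : forall x, x \in sk -> ev R x = 0 by move=> x /vk /kerE; exact: hR.
  have := ev_roots R0 uk h1; rewrite szk leq_exp2l ?q_gt1 //.
  have : (0 < size R)%N by rewrite size_poly_gt0.
  by move: sR; plia.
have LeP : Lp KS (tmul e Pt).
  by move=> i; rewrite (coef_tmul iota chp); apply: sf_sum => j _; apply: sfM => //; apply: sfX.
have [psi [R [eP sR KSp]]] := tdiv me KSe LeP.
have R0 : R = 0.
  apply: killed => // x xw.
  have : ev (tmul e Pt) x = 0 by rewrite (ev_tmul iota chp) ve // wPt.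
  by rewrite eP evD (ev_tmul iota chp) ve // (ev_0 iota chp) add0r.
rewrite R0 addr0 in eP.
have p0 : psi != 0.
  apply/eqP => p0; have := tmul_neq0 iota chp ne0 Pt0; by rewrite eP p0 tmul0l eqxx.
have fe s : autL K s -> map_poly s e = e.
  move=> hs; apply/eqP; rewrite -subr_eq0; apply/eqP; apply: killed.
    have [->|nz] := eqVneq (map_poly s e - e) 0; first by rewrite size_poly0 size_poly_gt0.
    have sz : (size (map_poly s e - e)%R <= (size e).-1)%N.
      apply/leq_sizeP => j hj; rewrite coefB coef_endo.
      have [ej|nj] := eqVneq j (size e).-1.
        have l1 : e`_(size e).-1 = 1 by have := monicP me; rewrite lead_coefE.
        by rewrite ej l1 rmorph1 subrr.
      by rewrite !nth_default ?rmorph0 ?subrr //; plia.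
    have : (0 < size e)%N by rewrite size_poly_gt0.
    by move=> se0; apply: (leq_ltn_trans sz); rewrite prednK.
  move=> x xw; rewrite evB (ve x xw) subr0.
  have [s' [hs' c1 c2]] := aut_inv hs.
  by rewrite -(c2 x) -map_ev ve ?rmorph0 // ws_s.
have fpsi s : autL K s -> map_poly s psi = psi.
  move=> hs; apply/eqP; rewrite -subr_eq0; apply: contraT => nz.
  have := tmul_neq0 iota chp nz ne0.
  have -> : tmul (map_poly s psi - psi) e = 0; last by rewrite eqxx.
  rewrite tmulDl -scaleN1r tmulZl scaleN1r -eP -{1}(fe s hs) -map_tmul -eP map_tmul fe //.
  have -> : map_poly s Pt = Pt; last by rewrite subrr.
  by apply/polyP => i; rewrite coef_endo /= hs.2.
have Ke : Lp K e.
  move=> i; apply: (sep_fixed aK sw (KSe i)) => s hs.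
  by rewrite -{2}(fe s hs) coef_endo.
have Kp : Lp K psi.
  move=> i; apply: (sep_fixed aK sw (KSp i)) => s hs.
  by rewrite -{2}(fpsi s hs) coef_endo.
have [s1 _] := size_tmul iota chp ne0 Pt0; have [s2 _] := size_tmul iota chp p0 ne0.
exists e, psi; split => //.
- have : (0 < size e)%N by rewrite size_poly_gt0.
  have : (0 < size psi)%N by rewrite size_poly_gt0.
  by move: s1 s2; rewrite eP sPt; plia.
split.
  have := congr1 (fun u : {poly Om} => u`_0) eP.
  rewrite !(coef_tmul iota chp) !big_ord1 !subnn expn0 !expr1 mulrC => /(mulIf e0) //.
have h1 x : ev e (ev Pt x) = ev psi (ev e x) by rewrite -!(ev_tmul iota chp) eP.
move=> a x; rewrite !(act_iter iota chp) (ev_sumx iota chp); apply: eq_bigr => j _.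
rewrite ev_kc; congr (_ * _); elim: (nat_of_ord j) => // k IH.
by rewrite !iterS h1 IH.
Qed.
End Quotient.

(** * Torsion points at a place of integrality *)

Section Torsion.
Variables (Fq : finFieldType) (p : nat) (Om : closedFieldType)
          (iota : {rmorphism {fraction {poly Fq}} -> Om}).
Hypotheses (chp : p \in [pchar Fq]).
Local Notation q := #|Fq|.
Local Notation iA := (iA iota).
Local Notation kc := (kc iota).
Local Notation kcm := (kcm iota).
Local Notation ev := (@ev Fq Om).
Local Notation tmul := (@tmul Fq Om).
Local Notation act := (act iota).
Local Notation tp := (tp iota).
Implicit Types (Pt Q e : {poly Om}) (a b : {poly Fq}) (x y z : Om).

Lemma actE Pt a x : act Pt a x = ev (tp Pt a) x. Proof. by []. Qed.

Lemma Lp_tp (K : sfield Om) Pt a : (forall c, K (kc c)) -> Lp K Pt -> Lp K (tp Pt a).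
Proof.
move=> Kc KPt; elim/poly_ind: a => [|a c IH].
  by rewrite tp0 => i; rewrite coef0; exact: sf0.
rewrite tpD tpMX tpC; apply: LpD.
  by move=> i; rewrite (coef_tmul iota chp); apply: sf_sum => j _; apply: sfM => //; apply: sfX.
by move=> i; rewrite coefZ coef1; apply: sfM => //; exact: sf_nat.
Qed.

Lemma act_K (K : sfield Om) Pt a x : (forall c, K (kc c)) -> Lp K Pt -> K x -> K (act Pt a x).
Proof.
move=> Kc KPt Kx; rewrite actE evE; apply: sf_sum => i _; apply: sfM; last exact: sfX.
exact: Lp_tp.
Qed.

Lemma Op_tp (P : place Om) Pt a : (forall c, pO P (kc c)) -> Op P Pt -> Op P (tp Pt a).
Proof.
move=> Oc OPt; elim/poly_ind: a => [|a c IH].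
  by rewrite tp0 => i; rewrite coef0; exact: pO0.
rewrite tpD tpMX tpC => i; rewrite coefD; apply: pOD.
  by rewrite (coef_tmul iota chp); apply: pO_sum => j _; apply: pOM => //; apply: pOX.
rewrite coefZ coef1; apply: pOM => //; case: eqP => _; [exact: pO1|exact: pO0].
Qed.

Lemma aut_act (K : sfield Om) s Pt a x : (forall c, K (kc c)) -> Lp K Pt -> autL K s ->
  s (act Pt a x) = act Pt a (s x).
Proof.
move=> Kc KPt hs; rewrite !actE map_ev; congr (ev _ _).
by apply/polyP => i; rewrite coef_endo hs.2 //; exact: Lp_tp.
Qed.

Lemma tp_coef0_T Pt a : Pt`_0 = iA 'X -> (tp Pt a)`_0 = iA a.
Proof. by move=> h; rewrite (tp_coef0 iota chp) h -iA_horner. Qed.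

Lemma tors_sep (K : sfield Om) Pt a x : (forall c, K (kc c)) -> Lp K Pt -> Pt`_0 = iA 'X ->
  a != 0 -> act Pt a x = 0 -> sepe K x.
Proof.
move=> Kc KPt h0 a0 ax; exists (evp Fq (tp Pt a)).
have c0 : (tp Pt a)`_0 != 0 by rewrite tp_coef0_T // iA_eq0.
split.
- rewrite /evp => i; rewrite coef_sum; apply: sf_sum => j _; rewrite coefZ coefXn.
  by apply: sfM; [exact: Lp_tp|exact: sf_nat].
- apply: (evp_separable iota chp c0); by apply: contraNneq c0 => ->; rewrite coef0.
- by rewrite /root evp_horner; apply/eqP.
Qed.

(** The isomorphic module [u^-1 Pt u]; its torsion is that of [Pt] divided by [u]. *)
Definition tscale (u : Om) Pt : {poly Om} := \poly_(k < size Pt) (Pt`_k * u ^+ (q ^ k) / u).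
Lemma coef_tscale u Pt k : (tscale u Pt)`_k = Pt`_k * u ^+ (q ^ k) / u.
Proof. by rewrite coef_poly; case: ltnP => // le; rewrite nth_default // !mul0r. Qed.
Lemma act_tscale u Pt a x : u != 0 -> act (tscale u Pt) a x = act Pt a (u * x) / u.
Proof.
move=> u0.
have h y : ev (tscale u Pt) y = ev Pt (u * y) / u.
  rewrite (@ev_wide _ _ (size Pt)) ?size_poly // evE mulr_suml; apply: eq_bigr => i _.
  by rewrite coef_tscale exprMn; ring.
rewrite !(act_iter iota chp) mulr_suml; apply: eq_bigr => j _; rewrite -mulrA; congr (_ * _).
elim: (nat_of_ord j) => [|k IH]; first by rewrite /= mulrC mulKf.
by rewrite !iterS IH h mulrCA divff ?mulr1.
Qed.

Definition cP : {poly Om} := Poly [:: iA 'X; 1].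
Lemma cP_seq : cP = [:: iA 'X; 1] :> seq Om.
Proof. by apply: (@PolyK _ 0) => /=; exact: oner_neq0. Qed.
Lemma size_cP : size cP = 2. Proof. by rewrite cP_seq. Qed.
Lemma cP0 : cP`_0 = iA 'X. Proof. by rewrite cP_seq. Qed.
Lemma lead_cP : lead_coef cP = 1. Proof. by rewrite lead_coefE size_cP cP_seq. Qed.
Lemma LpcP (K : sfield Om) : K (iA 'X) -> Lp K cP.
Proof.
move=> KT i; rewrite cP_seq; case: i => [|[|i]] //=; first exact: sf1.
by rewrite nth_nil; exact: sf0.
Qed.

Section AtPlace.
Hypothesis ac : is_alg_closure iota.
Variables (pi : {poly Fq}) (x0 : Om) (P : place Om).
Hypotheses (ir : irreducible_poly pi) (r0 : evq iota pi x0 = 0) (qP : qplace iota P x0).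
Local Notation evq := (evq iota).
Let d := (size pi).-1.
Let N := (q ^ d).-1.

Lemma act_evq Pt a b v : act Pt pi v = 0 -> evq a x0 = evq b x0 -> act Pt a v = act Pt b v.
Proof.
move=> hv e; have /dvdpP [c ec] : pi %| a - b by apply/(evq_eq0 ir r0); rewrite evqB e subrr.
by apply/eqP; rewrite -subr_eq0 -actB // ec (actM iota chp) hv (act_0 iota chp).
Qed.

Lemma kc_O c : pO P (kc c). Proof. exact: (qP c%:P).1. Qed.
Lemma pi_neq0 : pi != 0. Proof. exact: irredp_neq0. Qed.

(** Otherwise all [q^d] residues, being polynomials in [x0], would be roots of ['X^(q^k) - 'X]. *)
Lemma x0_order k : (0 < k < d)%N -> x0 ^+ (q ^ k) != x0.
Proof.
case/andP => k0 kd; apply/negP => /eqP e.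
have q1 := q_gt1 Fq; have qk : (1 < q ^ k)%N by rewrite -[1%N](expn0 q) ltn_exp2l.
have sz : size ('X^(q ^ k) - 'X : {poly Om}) = (q ^ k).+1.
  by rewrite size_polyDl size_polyXn // size_polyN size_polyX ltnS.
have P0 : 'X^(q ^ k) - 'X != 0 :> {poly Om} by rewrite -size_poly_gt0 sz.
have := max_poly_roots P0 _ (uniq_res_list chp ir r0).
rewrite sz (size_res_list iota) ltnS leq_exp2l // leqNgt kd => H; have : false; last by [].
apply: H; apply/allP => _ /mapP [v _ ->]; rewrite /root hornerD hornerN hornerXn hornerX.
by rewrite (evq_Fr iota chp) e subrr.
Qed.

(* Comparing coefficients in phi_pi phi_t = phi_t phi_pi, the unit t^(q^k) - t appears. *)
Lemma tp_low Pt : Op P Pt -> Pt`_0 = iA 'X ->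
  forall k, (k < d)%N -> pO P ((tp Pt pi)`_k / iA pi).
Proof.
move=> OPt h0; set Q := tp Pt pi.
have ip0 : iA pi != 0 by rewrite iA_eq0 pi_neq0.
have OPT := (qP 'X).
elim/ltn_ind => k IH kd; have [->|k0] := posnP k.
  by rewrite tp_coef0_T // divff //; exact: pO1.
have := congr1 (fun u : {poly Om} => u`_k) (tp_comm iota chp Pt pi); rewrite -/Q /=.
rewrite !(coef_tmul iota chp) big_ord_recr /= subnn h0 [RHS]big_ord_recl /= subn0 expn0 expr1 h0.
move=> /(congr1 (fun y => y / iA pi)); rewrite !mulrDl => e.
have u1 : punit P (iA 'X ^+ (q ^ k) - iA 'X).
  split; first by apply: pOB; [apply: pOX|]; exact: (qP 'X).1.
  rewrite (pfB (pOX _ (qP 'X).1) (qP 'X).1) (pfX _ (qP 'X).1) (qP 'X).2 evqT subr_eq0.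
  by apply: x0_order; rewrite k0.
have -> : Q`_k / iA pi = (\sum_(i < k) Pt`_(bump 0 i) * Q`_(k - bump 0 i) ^+ (q ^ bump 0 i) / iA pi
    - \sum_(i < k) Q`_i * Pt`_(k - i) ^+ (q ^ i) / iA pi) / (iA 'X ^+ (q ^ k) - iA 'X).
  apply: (canRL (mulfK (punit_neq0 u1))); rewrite -!mulr_suml.
  by apply/eqP; rewrite eq_sym subr_eq; apply/eqP; apply: (addrI (iA 'X * Q`_k / iA pi)); rewrite -e; ring.
apply: pOM; last exact: (punitV u1).1.
apply: pOB; apply: pO_sum => i _.
  have lt1 : (k - bump 0 i < k)%N by rewrite /bump /= -subSn ?ltn_ord // subSS leq_subr.
  have lt2 : (k - bump 0 i < d)%N by apply: leq_trans lt1 (ltnW kd).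
  have h := IH _ lt1 lt2; rewrite -mulrA; apply: pOM => //.
  have -> : Q`_(k - bump 0 i) ^+ (q ^ bump 0 i) / iA pi =
     (Q`_(k - bump 0 i) / iA pi) ^+ (q ^ bump 0 i) * iA pi ^+ (q ^ bump 0 i).-1.
    have : (0 < q ^ bump 0 i)%N by rewrite expn_gt0 q_gt0.
    case: (q ^ _)%N => // m _; rewrite expr_div_n [iA pi ^+ m.+1]exprS /=; field.
    by rewrite ip0 expf_neq0.
  by apply: pOM; apply: pOX => //; exact: (qP pi).1.
rewrite mulrAC; apply: pOM; first by apply: IH => //; apply: ltn_trans kd.
by apply: pOX.
Qed.

(** For a point reducing to 0 only the linear term of [phi_a(v) / v] survives reduction: on the
    kernel of reduction, [a] acts on leading terms by its residue. *)
Lemma act_lin Pt a v : Op P Pt -> Pt`_0 = iA 'X -> v != 0 -> pO P v -> pf P v = 0 ->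
  pO P (act Pt a v / v) /\ pf P (act Pt a v / v) = evq a x0.
Proof.
move=> OPt h0 v0 Ov fv; rewrite actE.
have e1 : ev (tp Pt a) v / v = \sum_(i < (size (tp Pt a)).+1) (tp Pt a)`_i * v ^+ (q ^ i).-1.
  rewrite (@ev_wide _ _ (size (tp Pt a)).+1) // mulr_suml; apply: eq_bigr => i _.
  have : (0 < q ^ i)%N by rewrite expn_gt0 q_gt0.
  by case: (q ^ i)%N => // m _; rewrite exprS /= -mulrA mulrAC divff // mul1r.
have Ot := Op_tp a kc_O OPt.
have Oi i : pO P ((tp Pt a)`_i * v ^+ (q ^ i).-1) by apply: pOM => //; apply: pOX.
rewrite e1; split; first exact: pO_sum.
rewrite pf_sum // big_ord_recl big1 ?addr0.
  by rewrite expn0 expr0 mulr1 tp_coef0_T // (qP a).2.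
move=> i _; rewrite pfM //; last exact: pOX.
rewrite pfX // fv expr0n.
have : (1 < q ^ lift ord0 i)%N by rewrite -{1}(expn0 q) ltn_exp2l // q_gt1.
by case: (q ^ _)%N => [|[|m]] // _; rewrite mulr0.
Qed.

(** Divide [phi_pi(v) = 0] by [v]. The coefficients below index [d] are divisible by [pi], and these
    terms sum to [pi U] with [U] a unit coming from the linear term; the other terms carry the
    factor [v^N]. So [N w(v) <= w(pi)], with equality in rank one when the leading coefficient is a
    unit. *)
Lemma tors_eq Pt v : Op P Pt -> Pt`_0 = iA 'X -> (d < size (tp Pt pi))%N ->
  v != 0 -> pO P v -> pf P v = 0 -> act Pt pi v = 0 ->
  exists U S, [/\ punit P U, pO P S, iA pi * U = v ^+ N * S
    & size (tp Pt pi) = d.+1 -> S = - lead_coef (tp Pt pi)].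
Proof.
move=> OPt h0 sz v0 Ov fv.
have ip0 : iA pi != 0 by rewrite iA_eq0 pi_neq0.
have d0 : (0 < d)%N := irr_d_gt0 chp ir.
set Q := tp Pt pi; have OQ : Op P Q by apply: Op_tp => //; exact: kc_O.
have qk i : v ^+ (q ^ i) = v * v ^+ (q ^ i).-1.
  by rewrite -exprS prednK // expn_gt0 q_gt0.
rewrite actE -/Q evE.
have es : size Q = (d + (size Q - d))%N by rewrite subnKC // ltnW.
rewrite es big_split_ord /= => e.
pose U := \sum_(i < d) (Q`_i / iA pi) * v ^+ (q ^ i).-1.
pose S := - \sum_(i < size Q - d) Q`_(d + i) * v ^+ (q ^ (d + i) - q ^ d).
have Oi (i : 'I_d) : pO P ((Q`_i / iA pi) * v ^+ (q ^ i).-1).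
  by apply: pOM; [exact: tp_low|exact: pOX].
exists U, S; split.
- split; first exact: pO_sum.
  rewrite pf_sum //; move: Oi; rewrite -(prednK d0) => Oi; rewrite big_ord_recl big1 ?addr0.
    rewrite expn0 expr0 mulr1 /Q tp_coef0_T // divff // pf1; exact: oner_neq0.
  move=> i _; rewrite pfM; first last.
  + by apply: pOX.
  + apply: tp_low => //; rewrite /lift /= /bump /=; have := ltn_ord i; lia.
  rewrite pfX // fv expr0n.
  have : (1 < q ^ lift ord0 i)%N by rewrite -{1}(expn0 q) ltn_exp2l // q_gt1.
  by case: (q ^ _)%N => [|[|m]] // _; rewrite mulr0.
- apply: pON; apply: pO_sum => i _; apply: pOM => //; exact: pOX.
- apply: (mulfI v0); rewrite /S mulrN mulrN; apply/eqP; rewrite -addr_eq0; apply/eqP.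
  rewrite -{}[RHS]e; congr (_ + _).
    rewrite /U !mulr_sumr; apply: eq_bigr => i _; rewrite qk; field; exact: ip0.
  rewrite !mulr_sumr; apply: eq_bigr => i _; transitivity (Q`_(d + i) * (v * (v ^+ N * v ^+ (q ^ (d + i) - q ^ d)))); first by ring.
  congr (_ * _); rewrite -exprD -exprS; congr (_ ^+ _); rewrite /N -addSn prednK ?expn_gt0 ?q_gt0 //.
  by rewrite subnKC // leq_exp2l ?leq_addr // q_gt1.
- rewrite -es => sz1; rewrite /S lead_coefE sz1 subSnn big_ord1 addn0 subnn expr0 mulr1 //.
Qed.

Lemma lead_tp_unit Pt r : size Pt = r.+2 -> punit P (lead_coef Pt) -> punit P (lead_coef (tp Pt pi)).
Proof.
move=> sPt hl; have [_ H] := size_tp iota chp sPt pi_neq0; apply: H => //.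
- by move=> x y; exact: punitM.
- move=> c c0; split; first exact: kc_O.
  by rewrite (qP c%:P).2 evqC kcE fmorph_eq0.
Qed.

Lemma OpcP : Op P cP.
Proof.
move=> i; rewrite cP_seq; case: i => [|[|i]] /=; [exact: (qP 'X).1|exact: pO1|].
by rewrite nth_nil; exact: pO0.
Qed.

(** The point satisfies [N w(mu) = w(pi)], so that valuations of expressions in [mu] detect
    exponents modulo [N]. *)
Lemma carlitz_tors : exists mu, [/\ mu != 0, act cP pi mu = 0, pO P mu, pf P mu = 0
   & punit P (mu ^+ N / iA pi)].
Proof.
have ip0 : iA pi != 0 by rewrite iA_eq0 pi_neq0.
have d0 : (0 < d)%N := irr_d_gt0 chp ir.
have [sz _] := size_tp iota chp size_cP pi_neq0; rewrite mul1n in sz.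
set Q := tp cP pi in sz.
have c0 : Q`_0 != 0 by rewrite tp_coef0_T ?cP0.
have Q0 : Q != 0 by rewrite -size_poly_gt0 sz.
have [s [us szs hs]] := size_ker iota chp c0 Q0; rewrite sz /= in szs.
have [mu mus mu0] : exists2 mu, mu \in s & mu != 0.
  case: s us szs hs => [|x [|y s]] us szs hs.
  - by move: szs => /= /esym/eqP; rewrite expn_eq0 -leqn0 leqNgt q_gt0.
  - by move: szs => /= /esym/eqP; rewrite -(expn0 q) eqn_exp2l ?q_gt1 // -/d gtn_eqF.
  have [x1|] := eqVneq x 0; last by exists x => //; exact: mem_head.
  exists y; first by rewrite !inE eqxx orbT.
  by move: us; rewrite x1 /= inE negb_or eq_sym => /andP [/andP []].
have amu : act cP pi mu = 0 by exact: hs.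
have OQ : Op P Q by apply: Op_tp; [exact: kc_O|exact: OpcP].
have lu : punit P (lead_coef Q).
  by apply: (lead_tp_unit size_cP); rewrite lead_cP; exact: punit1.
have lQ : lead_coef Q = Q`_d by rewrite lead_coefE sz.
have Omu : pO P mu.
  apply: (@pO_root _ _ (evp Fq Q)).
  - move=> i; rewrite /evp coef_sum; apply: pO_sum => j _; rewrite coefZ coefXn.
    by apply: pOM => //; case: eqP => _; [exact: pO1|exact: pO0].
  - have -> : lead_coef (evp Fq Q) = lead_coef Q; last by case: lu.
    rewrite [LHS]lead_coefE size_evp //= sz /= /evp coef_sum sz big_ord_recr /= coefZ coefXn eqxx mulr1.
    rewrite lQ big1 ?add0r // => i _; rewrite coefZ coefXn.
    by rewrite eqn_exp2l ?q_gt1 // gtn_eqF ?mulr0 // ltn_ord.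
  - by rewrite /root evp_horner; apply/eqP.
have fmu : pf P mu = 0.
  have := amu; rewrite actE evE -/Q sz -/d big_ord_recr /= => /eqP; rewrite addrC addr_eq0 => /eqP e.
  have : pf P (Q`_d * mu ^+ (q ^ d)) = 0.
    rewrite e pfN; last by apply: pO_sum => i _; apply: pOM => //; exact: pOX.
    apply/eqP; rewrite oppr_eq0; apply/eqP.
    rewrite pf_sum; last by move=> i _; apply: pOM => //; exact: pOX.
    rewrite big1 // => i _; rewrite pfM //; last exact: pOX.
    have h := tp_low OpcP cP0 (ltn_ord i).
    rewrite -/Q -(divfK ip0 Q`_i) (pfM h (qP pi).1) (qP pi).2 r0 mulr0 mul0r //.
  rewrite pfM //; last exact: pOX.
  rewrite pfX // -lQ => /eqP; rewrite mulf_eq0 (negPf lu.2) expf_eq0 => /andP [_ /eqP //].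
have [U [S [hU hS e1 e2]]] := tors_eq OpcP cP0 (eq_leq (esym sz)) mu0 Omu fmu amu.
exists mu; split => //.
have hS' : punit P S.
  rewrite (e2 sz); have := punitM (P := P) (x := -1) (y := lead_coef Q) _ lu; rewrite mulN1r; apply.
  split; first exact: pON (pO1 P).
  by rewrite pfN ?pf1 ?oppr_eq0 ?oner_neq0 //; exact: pO1.
have -> : mu ^+ N / iA pi = U / S; last by apply: punitM => //; exact: punitV.
have S0 := punit_neq0 hS'.
apply/eqP; rewrite eqr_div // -e1 mulrC //.
Qed.
End AtPlace.
End Torsion.

(** * The torsion at a place above pi *)

Lemma periodic_sum (V : nmodType) (h : nat -> V) N n : (forall m, h (m + N)%N = h m) ->
  \sum_(m < N) h (m + n)%N = \sum_(m < N) h m.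
Proof.
move=> per; elim: n => [|n <-]; first by apply: eq_bigr => m _; rewrite addn0.
case: N per => [|N] per; first by rewrite !big_ord0.
rewrite big_ord_recr [RHS]big_ord_recl /= addrC; congr (_ + _).
  by rewrite add0n -(per n); congr h; lia.
by apply: eq_bigr => m _; rewrite /bump /= addSnnS; congr h; lia.
Qed.

Lemma geom_vanish (R : fieldType) (y : R) N : y ^+ N = 1 -> y != 1 -> \sum_(k < N) y ^+ k = 0.
Proof.
move=> yN y1; apply: (mulfI (x := y - 1)); first by rewrite subr_eq0.
by rewrite -subrX1 yN subrr mulr0.
Qed.

(** Inversion of the finite Fourier transform, by orthogonality of the powers of [x]. *)
Lemma fourier_inj (R : fieldType) (x : R) N (D : nat -> R) : N.-primitive_root x -> N%:R != 0 :> R ->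
  (forall k, (k < N)%N -> \sum_(m < N) x ^+ (m * k) * D m = 0) -> forall m, (m < N)%N -> D m = 0.
Proof.
move=> px N0 h m lt; apply: (mulfI N0); rewrite mulr0.
have xN := prim_expr_order px.
have x0 : x != 0.
  apply: contraTneq lt => e; move: xN; rewrite e expr0n; case: (N) => // n /eqP.
  by rewrite eq_sym oner_eq0.
have : \sum_(k < N) (x ^- m) ^+ k * \sum_(l < N) x ^+ (l * k) * D l = 0.
  by apply: big1 => k _; rewrite h // mulr0.
have -> : \sum_(k < N) (x ^- m) ^+ k * \sum_(l < N) x ^+ (l * k) * D l =
   \sum_(l < N) (\sum_(k < N) (x ^+ l / x ^+ m) ^+ k) * D l.
  under eq_bigr do rewrite mulr_sumr; rewrite exchange_big; apply: eq_bigr => l _.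
  by rewrite mulr_suml; apply: eq_bigr => k _; rewrite exprM expr_div_n exprVn; ring.
move=> e; apply: etrans e; rewrite (bigD1 (Ordinal lt)) //= [X in _ + X]big1 ?addr0 => [|l nl].
  congr (_ * _); rewrite divff ?expf_neq0 //.
  by under eq_bigr do rewrite expr1n; rewrite sumr_const card_ord.
rewrite geom_vanish ?mul0r //.
  by rewrite expr_div_n -!exprM mulnC [(m * _)%N]mulnC !exprM xN !expr1n divr1.
apply: contra nl => /eqP e1; apply/eqP; apply: val_inj => /=.
have : x ^+ l == x ^+ m.
  by rewrite -(mul1r (x ^+ m)) -{1}e1 divfK ?expf_neq0.
by rewrite (eq_prim_root_expr px) !modn_small // => /eqP.
Qed.

Lemma nth_root_ex (Om : closedFieldType) (c : Om) n : (0 < n)%N -> exists u, u ^+ n = c.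
Proof.
move=> n0; have : size ('X^n - c%:P) != 1%N.
  by rewrite size_polyDl size_polyXn ?size_polyN ?(leq_ltn_trans (size_polyC_leq1 _)) //; case: n n0.
case/closed_rootP => u; rewrite /root hornerD hornerN hornerXn hornerC subr_eq0 => /eqP e.
by exists u.
Qed.

Lemma pO_root_exp (Om : fieldType) (P : place Om) y n : (0 < n)%N -> pO P (y ^+ n) -> pO P y.
Proof.
move=> n0 h; case: (pO_tot P y) => // -[Oy fy].
have [->|y0] := eqVneq y 0; first exact: pO0.
have := pfM h (pOX n Oy); rewrite -exprMn divff // expr1n pf1 (pfX n Oy) fy expr0n gtn_eqF // mulr0.
by move/eqP; rewrite oner_eq0.
Qed.

Section Local.
Variables (Fq : finFieldType) (p : nat) (Om : closedFieldType)
          (iota : {rmorphism {fraction {poly Fq}} -> Om}).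
Hypotheses (chp : p \in [pchar Fq]) (ac : is_alg_closure iota).
Local Notation q := #|Fq|.
Local Notation iA := (iA iota).
Local Notation kc := (kc iota).
Local Notation ev := (@ev Fq Om).
Local Notation act := (act iota).
Local Notation cP := (cP iota).
Local Notation evq := (evq iota).
Implicit Types (a b : {poly Fq}) (v : Om).
Variables (K : sfield Om) (pi : {poly Fq}) (x0 : Om) (P : place Om) (w : Om -> rat) (e0 : nat).
Hypotheses (aK : algo K) (KF : forall y, Fsf iota y -> K y)
  (ir : irreducible_poly pi) (r0 : evq pi x0 = 0) (qP : qplace iota P x0)
  (hw : valn P w) (wpi : w (iA pi) = 1) (e0_gt0 : (0 < e0)%N)
  (hK : forall y, K y -> y != 0 -> exists a : int, e0%:R * w y = a%:~R).
Variables (psi : {poly Om}) (r : nat) (z : Om) (i : nat).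
Hypotheses (KPt : Lp K psi) (sPt : size psi = r.+2) (h0 : psi`_0 = iA 'X)
  (z0 : z != 0) (hz : act psi pi z = 0)
  (hG : forall s, autL K s -> exists b,
     (forall mu, act cP pi mu = 0 -> s mu = act cP b mu) /\ s z = act psi (b ^+ i) z).
Let d := (size pi).-1.
Let N := (q ^ d).-1.
(** Divisible by every positive number up to [q^(r+1)], in particular by the denominators [q^k - 1]
    of the scaling and by the orders of roots of unity met in the two cases below. *)
Let E := (q ^ r.+1)`!.

Section Generator.
Variables (g : {poly Fq}) (mu : Om).
Hypotheses (pg : N.-primitive_root (evq g x0))
  (grep : forall b, ~~ (pi %| b) -> exists2 l, (l < N)%N & pi %| b - g ^+ l)
  (mu0 : mu != 0) (hmu : act cP pi mu = 0) (Omu : pO P mu) (fmu : pf P mu = 0)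
  (umu : punit P (mu ^+ N / iA pi)).
Local Notation x := (evq g x0).
Let N0 : (0 < N)%N. Proof. exact: (N_gt0 chp ir). Qed.
Let Kc c : K (kc c). Proof. by apply: KF; exact: F_iA. Qed.
Let KT : K (iA 'X). Proof. by apply: KF; exact: F_iA. Qed.
Let KcP : Lp K cP. Proof. exact: LpcP. Qed.
Let ip0 : iA pi != 0. Proof. by rewrite iA_eq0; exact: irredp_neq0. Qed.

Let NR : N%:R = -1 :> Om.
Proof.
have qd0 : (q ^ d)%:R = 0 :> Om.
  have [k k0 ->] := q_pow chp; rewrite -expnM; apply/eqP; rewrite -(dvdn_pcharf (pchar_Om iota chp)).
  by rewrite dvdn_exp // muln_gt0 k0 (irr_d_gt0 chp ir).
apply/eqP; rewrite -addr_eq0 -mulrSr /N prednK ?qd0 // expn_gt0 q_gt0 //.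
Qed.
Let NR0 : N%:R != 0 :> Om. Proof. by rewrite NR oppr_eq0 oner_neq0. Qed.

Definition tline v := exists a, v = act psi a z.
Let V_tors v : tline v -> act psi pi v = 0.
Proof. by case=> a ->; rewrite (actAC iota chp) hz (act_0 iota chp). Qed.
Let V_act b v : tline v -> tline (act psi b v).
Proof. by case=> a ->; exists (b * a); rewrite (actM iota chp). Qed.
Let V_sub v v' : tline v -> tline v' -> tline (v - v').
Proof. by case=> a -> [b ->]; exists (a - b); rewrite actB. Qed.
Let evq_g m : evq (g ^+ m) x0 = x ^+ m. Proof. exact: evqX. Qed.
Let xN m k : x ^+ (m + N * k) = x ^+ m.
Proof. by rewrite exprD exprM (prim_expr_order pg) expr1n mulr1. Qed.
Let pow_act v m m' : tline v -> x ^+ m = x ^+ m' -> act psi (g ^+ m) v = act psi (g ^+ m') v.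
Proof. by move=> hv e; apply: (act_evq chp ir r0 (V_tors hv)); rewrite !evq_g. Qed.
Let pow_cact m m' : x ^+ m = x ^+ m' -> act cP (g ^+ m) mu = act cP (g ^+ m') mu.
Proof. by move=> e; apply: (act_evq chp ir r0 hmu); rewrite !evq_g. Qed.

(** With everything written in powers of the generator [g], Galois acts as a shift of exponents, by
    [n] on [mu] and by [n i] on the line of [z]. *)
Let gal_shift s n := s mu = act cP (g ^+ n) mu /\
  forall v, tline v -> s v = act psi (g ^+ (n * i)) v.

Let gal_ex s : autL K s -> exists n, gal_shift s n.
Proof.
move=> hs; have [b [h1 h2]] := hG hs.
have nb : ~~ (pi %| b).
  apply/negP => /(evq_eq0 ir r0) eb; have := h1 _ hmu.
  rewrite (act_evq chp ir r0 hmu (b := 0)) ?evq0 // act0 => e.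
  by move: mu0; rewrite -(fmorph_eq0 s) e eqxx.
have [l _ dl] := grep nb.
have el : evq b x0 = evq (g ^+ l) x0.
  by apply/eqP; rewrite -subr_eq0 -evqB; apply/eqP/(evq_eq0 ir r0).
exists l; split; first by rewrite h1 //; exact: (act_evq chp ir r0).
move=> v Vv; case: (Vv) => a ev; rewrite ev (aut_act chp a z Kc KPt hs) h2 (actAC iota chp) -ev.
by apply: (act_evq chp ir r0 (V_tors Vv)); rewrite exprM !evqX el evqX.
Qed.

(** The Gauss sum principle: a full period of an expression which Galois merely shifts is invariant,
    hence in [K], so its valuation has denominator dividing [e0]. *)
Let sum_K (h : nat -> Om) : (forall m, h (m + N)%N = h m) ->
  (forall m, adjs K [:: mu; z] (h m)) ->
  (forall s n m, autL K s -> gal_shift s n -> s (h m) = h (m + n)%N) -> K (\sum_(m < N) h m).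
Proof.
move=> per hA hs; have pi0 : pi != 0 by exact: irredp_neq0.
apply: (sep_fixed aK (S := [:: mu; z])).
- move=> y; rewrite !inE => /orP [] /eqP ->.
    exact: (tors_sep chp Kc KcP (cP0 iota) pi0).
  exact: (tors_sep chp Kc KPt h0 pi0).
- by apply: sf_sum => m _.
- move=> s as_; have [n hn] := gal_ex as_.
  by rewrite endo_sum -(periodic_sum n per); apply: eq_bigr => m _; exact: hs.
Qed.

Let TC m := act cP (g ^+ m) mu.
Let TV v m := act psi (g ^+ (m * i)) v.
Let TC_per m : TC (m + N) = TC m.
Proof. by apply: pow_cact; rewrite -{1}(muln1 N) xN. Qed.
Let TV_per v m : tline v -> TV v (m + N) = TV v m.
Proof. by move=> Vv; apply: pow_act => //; rewrite mulnDl xN. Qed.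
Let TC_s s n m : autL K s -> gal_shift s n -> s (TC m) = TC (m + n).
Proof. by move=> as_ [h _]; rewrite /TC (aut_act chp _ _ Kc KcP as_) h -(actM iota chp) -exprD. Qed.
Let TV_s s n m v : autL K s -> gal_shift s n -> tline v -> s (TV v m) = TV v (m + n).
Proof.
by move=> as_ [_ h] Vv; rewrite /TV (aut_act chp _ _ Kc KPt as_) h // -(actM iota chp) -exprD -mulnDl.
Qed.
Let A := adjs K [:: mu; z].
Let Ac c : A (kc c). Proof. by apply: adjs_sub. Qed.
Let A_TC m : A (TC m).
Proof.
apply: (act_K chp) => //; first by move=> k; apply: adjs_sub; exact: KcP.
by apply: adjs_gen; rewrite inE eqxx.
Qed.
Let A_TV v m : tline v -> A (TV v m).
Proof.
have KA : Lp A psi by move=> k; apply: adjs_sub; exact: KPt.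
case=> a ->; apply: (act_K chp) => //; apply: (act_K chp) => //.
by apply: adjs_gen; rewrite !inE eqxx orbT.
Qed.
Let TC_lin m : pO P (TC m / mu) /\ pf P (TC m / mu) = x ^+ m.
Proof. by have := act_lin chp qP (g ^+ m) (OpcP qP) (cP0 iota) mu0 Omu fmu; rewrite evq_g. Qed.
Let w_mu : N%:R * w mu = 1.
Proof.
have m0 : mu ^+ N != 0 by rewrite expf_neq0.
have := (weq hw m0 ip0).2 umu; rewrite wpi (wX hw) // => e; by rewrite mulr_natl.
Qed.

Section Scaled.
Variables (u : Om) (k1 : nat).
Hypotheses (u0 : u != 0) (Opsi : Op P (tscale Fq u psi)) (hk1 : (0 < k1 <= r.+1)%N)
  (uk1 : punit P (psi`_k1 * u ^+ (q ^ k1) / u)).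

Let qk1 : (0 < q ^ k1 - 1 <= q ^ r.+1)%N.
Proof.
case/andP: hk1 => a b; have q1 := q_gt1 Fq.
have : (q ^ 0 < q ^ k1)%N by rewrite ltn_exp2l.
have : (q ^ k1 <= q ^ r.+1)%N by rewrite leq_exp2l.
rewrite expn0; move: (q ^ k1)%N (q ^ r.+1)%N => l l'; lia.
Qed.
Let ck0 : psi`_k1 != 0.
Proof. by have := punit_neq0 uk1; rewrite !mulf_eq0 !negb_or => /andP [/andP []]. Qed.
Let qkS k : (q ^ k = (q ^ k - 1).+1)%N.
Proof. by rewrite subn1 prednK // expn_gt0 q_gt0. Qed.
Let uk1' : punit P (psi`_k1 * u ^+ (q ^ k1 - 1)).
Proof. by move: uk1; rewrite {1}qkS exprSr mulrA mulfK. Qed.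

Let E_div m : (0 < m <= q ^ r.+1)%N -> (m %| E)%N.
Proof. by move=> h; apply: dvdn_fact. Qed.

Let sp' : size (tscale Fq u psi) = r.+2.
Proof.
rewrite /tscale sPt; apply: size_poly_eq; rewrite !mulf_neq0 ?invr_eq0 ?expf_neq0 //.
by rewrite -[r.+1]/(r.+2.-1) -sPt -lead_coefE lead_coef_eq0 -size_poly_gt0 sPt.
Qed.
Let h0' : (tscale Fq u psi)`_0 = iA 'X.
Proof. by rewrite (coef_tscale) h0 expn0 expr1 mulfK. Qed.

(** Connected case. Up to the common factor [mu^i / v], the terms of the Gauss sum [T] reduce to 1,
    and their number [N] is -1 in [Om]; so [w T = i / N - w v], and [e0] times it is an integer. As
    [0 < w (v / u) <= 1 / N], multiplying by [E e0 N] shows that [E e0 i] is congruent modulo [N] to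
    a number at most [E e0]. *)
Lemma local_pos v : tline v -> v != 0 -> pO P (v / u) -> pf P (v / u) = 0 ->
  exists2 j, (j <= E * e0)%N & E * e0 * i = j %[mod N].
Proof.
move=> Vv v0 Ov fv.
have vu0 : v / u != 0 by rewrite mulf_neq0 ?invr_eq0.
have TV_lin m : pO P (TV v m / v) /\ pf P (TV v m / v) = x ^+ (m * i).
  have := act_lin chp qP (g ^+ (m * i)) Opsi h0' vu0 Ov fv; rewrite evq_g.
  rewrite (act_tscale iota chp) // [u * _]mulrC divfK //.
  by have -> : act psi (g ^+ (m * i)) v / u / (v / u) = TV v m / v
    by rewrite /TV; field; rewrite u0 v0.
have x_neq0 m : x ^+ m != 0.
  by rewrite expf_neq0 //; apply: contraTneq N0 => e; move: (prim_expr_order pg);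
     rewrite e expr0n; case: (N) => // k /eqP; rewrite eq_sym oner_eq0.
pose T := \sum_(m < N) TC m ^+ i / TV v m.
have KT' : K T.
  apply: (sum_K (h := fun m => TC m ^+ i / TV v m)).
  - by move=> m; rewrite TC_per TV_per.
  - by move=> m; apply: sfM; [apply: sfX|apply: sfV]; [exact: A_TC|exact: A_TV].
  - by move=> s n m as_ hn; rewrite endoM fmorphV endoX (TC_s _ as_ hn) (TV_s _ as_ hn).
have term m : pO P ((TC m / mu) ^+ i / (TV v m / v)) /\ pf P ((TC m / mu) ^+ i / (TV v m / v)) = 1.
  have [c1 c2] := TC_lin m; have [t1 t2] := TV_lin m.
  have t3 : pf P (TV v m / v) != 0 by rewrite t2.
  have o1 := pOX i c1; have o2 := pOunit t1 t3.
  split; first exact: pOM.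
  by rewrite (pfM o1 o2) (pfX i c1) (pfV t1 t3) c2 t2 -exprM divff.
have eT : T = (mu ^+ i / v) * \sum_(m < N) (TC m / mu) ^+ i / (TV v m / v).
  rewrite mulr_sumr; apply: eq_bigr => m _; rewrite expr_div_n.
  have tv0 : TV v m != 0.
    have := TV_lin m; case: (eqVneq (TV v m) 0) => // -> [_]; rewrite mul0r pf0 => e.
    by have := x_neq0 (m * i)%N; rewrite -e eqxx.
  by field; rewrite expf_neq0 // v0 tv0.
have uS : punit P (\sum_(m < N) (TC m / mu) ^+ i / (TV v m / v)).
  split; first by apply: pO_sum => m _; exact: (term m).1.
  rewrite pf_sum; last by move=> m _; exact: (term m).1.
  by under eq_bigr do rewrite (term _).2; rewrite sumr_const card_ord.
have m0 : mu ^+ i / v != 0 by rewrite mulf_neq0 ?invr_eq0 ?expf_neq0.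
have T0 : T != 0 by rewrite eT mulf_neq0 // (punit_neq0 uS).
have wT : w T = i%:R * w mu - w v.
  rewrite eT (wM hw) ?(punit_neq0 uS) // ((wU hw (punit_neq0 uS)).1 uS) addr0.
  by rewrite (wdiv hw) ?expf_neq0 // (wX hw) // mulr_natl.
have [a ea] := hK KT' T0; rewrite wT in ea.
have [a2 ea2] := hK (KPt k1) ck0.
have ec : w psi`_k1 + (q ^ k1 - 1)%:R * w u = 0.
  have c0 : u ^+ (q ^ k1 - 1) != 0 by rewrite expf_neq0.
  by have := (wU hw (punit_neq0 uk1')).1 uk1'; rewrite (wM hw) // (wX hw) // mulr_natl.
have pos : 0 < w v - w u by rewrite -(wdiv hw) //; apply/(wgt0 hw).
have le1 : N%:R * (w v - w u) <= 1.
  have [s1 _] := size_tp iota chp sp' (irredp_neq0 ir).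
  have lt : (d < size (tp iota (tscale Fq u psi) pi))%N.
    by rewrite s1 ltnS -/d leq_pmull.
  have tv : act (tscale Fq u psi) pi (v / u) = 0.
    by rewrite (act_tscale iota chp) // [u * _]mulrC divfK // V_tors // mul0r.
  have [U [S [hU hS e1 _]]] := tors_eq chp ir r0 qP Opsi h0' lt vu0 Ov fv tv.
  have U0 := punit_neq0 hU.
  have pu : iA pi * U != 0 by rewrite mulf_neq0.
  have S0 : S != 0 by apply: contraNneq pu => e; rewrite e1 e mulr0.
  have vN : (v / u) ^+ N != 0 by rewrite expf_neq0.
  have := congr1 w e1; rewrite (wM hw ip0 U0) ((wU hw U0).1 hU) wpi addr0 (wM hw vN S0) (wX hw _ vu0).
  rewrite (wdiv hw) // mulr_natl => ->; rewrite lerDl; exact: ((wO hw S0).1 hS).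
have /dvdnP [E1 eE] := E_div qk1.
(* [X] equals [E e0 N w (v / u)] and is congruent to [E e0 i] modulo [N]; [E1] absorbs the
   denominator [q^k1 - 1] of [w u]. *)
pose X : int := (E * e0 * i)%:Z - N%:Z * (E%:Z * a - E1%:Z * a2).
have eX : X%:~R = (E * e0)%:R * (N%:R * (w v - w u)) :> rat.
  have e2 : (e0%:R * w v = e0%:R * i%:R * w mu - a%:~R) by rewrite -ea; ring.
  have e3 : (E%:R * e0%:R * w u = - (E1%:R * a2%:~R)).
    rewrite eE natrM -ea2; apply/eqP; rewrite -subr_eq0; apply/eqP.
    transitivity (E1%:R * e0%:R * (w psi`_k1 + (q ^ k1 - 1)%:R * w u)); first by ring.
    by rewrite ec mulr0.
  rewrite /X rmorphB /= (intrM _ N%:Z) rmorphB /= !intrM -!pmulrn !natrM.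
  transitivity (N%:R * (E%:R * (e0%:R * w v) - E%:R * e0%:R * w u)); last by ring.
  rewrite e2 e3; apply/eqP; rewrite -subr_eq0; apply/eqP.
  transitivity (E%:R * e0%:R * i%:R * (1 - N%:R * w mu)); first by ring.
  by rewrite w_mu subrr mulr0.
have X0 : 0 <= X.
  rewrite -(ler0z rat) eX; apply: mulr_ge0; rewrite ?ler0n //.
  by apply: mulr_ge0; rewrite ?ler0n // ltW.
have Xle : X <= (E * e0)%:Z.
  by rewrite -(ler_int rat) eX -pmulrn ler_piMr ?ler0n.
have eXj : X = (absz X)%:Z by rewrite gez0_abs.
exists (absz X); first by rewrite -lez_nat -eXj.
apply/eqP; rewrite -eqz_nat -!modz_nat -eXj /X; apply/eqP.
by rewrite addrC -mulrN mulrC modzMDl.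
Qed.

(** Etale case. For [v1] of least valuation on the line, some [rho * v1^E'] with [rho] in [K] is a
    unit. The sequence [F m = rho * TV v m ^+ E'] is shifted by Galois, and its residues have
    nonzero Fourier coefficients only at [k] with [N | e0 k], so they are [e0]-periodic. Hence
    [g^(e0 i)] preserves the [E']-th powers of residues, and its eigenvalue [y] has order at most
    [E']. *)
Lemma local_neg : (forall v, tline v -> v != 0 -> pO P (v / u) -> pf P (v / u) != 0) ->
  (N %| E * e0 * i)%N.
Proof.
move=> neg.
have [v1 [v1in v10 v1max]] : exists y, [/\ y \in [seq act psi (g ^+ m) z | m <- seq.iota 0 N], y != 0
    & forall t, t \in [seq act psi (g ^+ m) z | m <- seq.iota 0 N] -> pO P (t / y)].
  apply: max_term; exists z => //; apply/mapP; exists 0%N; first by rewrite mem_iota.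
  by rewrite expr0 act1.
have V1 : tline v1 by have /mapP [m _ ->] := v1in; exists (g ^+ m).
have OV v : tline v -> pO P (v / v1).
  case=> a ->; have [da|nd] := boolP (pi %| a).
    have -> : act psi a z = 0; last by rewrite mul0r; exact: pO0.
    by rewrite (act_evq chp ir r0 hz (b := 0)) ?act0 // evq0; apply/(evq_eq0 ir r0).
  have [l lN dl] := grep nd; apply: v1max; apply/mapP; exists l; first by rewrite mem_iota.
  by apply: (act_evq chp ir r0 hz); apply/eqP; rewrite -subr_eq0 -evqB; apply/eqP/(evq_eq0 ir r0).
have Ouv : pO P (u / v1).
  have e : u / v1 = (v1 / u)^-1 by rewrite invf_div.
  case: (pO_tot P (v1 / u)) => [o|[o _]]; last by rewrite e.
  by rewrite e; apply: pOunit => //; exact: neg.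
(* Among the terms of the equation for [act psi 'X v1], two are dominant. If the term of index 0 is
   one of them, [rho] is [psi_k1]; otherwise it is the ratio of the two coefficients. *)
have [rho [E' [Krho hE' urho]]] : exists rho E', [/\ K rho, (0 < E' <= q ^ r.+1)%N & punit P (rho * v1 ^+ E')].
  have [EE eE0 eE] : exists2 EE : 'I_r.+2 -> Om, EE ord0 = psi`_0 * v1 - act psi 'X v1
      & forall k, k != ord0 -> EE k = psi`_k * v1 ^+ (q ^ k).
    exists (fun k => if k == ord0 then psi`_0 * v1 - act psi 'X v1 else psi`_k * v1 ^+ (q ^ k)) => //.
    by move=> k /negPf ->.
  have kk : (k1 < r.+2)%N by rewrite ltnS; case/andP: hk1.
  pose K1 := Ordinal kk; have K1n : K1 != ord0 by rewrite -val_eqE /= -lt0n; case/andP: hk1.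
  have eK1 : EE K1 = psi`_k1 * v1 ^+ (q ^ k1) by rewrite eE.
  have K10 : EE K1 != 0 by rewrite eK1 mulf_neq0 ?expf_neq0.
  have sum0 : \sum_k EE k = 0.
    rewrite big_ord_recl eE0 (actX iota chp) evE sPt [X in _ - X + _]big_ord_recl /= expn0 expr1 opprD addrA subrr sub0r.
    by apply/eqP; rewrite addrC subr_eq0; apply/eqP; apply: eq_bigr => k _; rewrite eE.
  have [a [b [ab Ea Eb uab mx]]] := two_max P (ex_intro _ K1 K10) sum0.
  have [ab0|] := boolP ((a == ord0) || (b == ord0)).
    have o1 : pO P (EE K1 / EE ord0).
      case/orP: ab0 => /eqP e0'; last by rewrite -e0'; exact: mx.
      have -> : EE K1 / EE ord0 = (EE K1 / EE b) * (EE a / EE b)^-1.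
        by rewrite -e0'; field; rewrite Ea Eb.
      by apply: pOM => //; exact: (punitV uab).1.
    have E00 : EE ord0 != 0 by case/orP: ab0 => /eqP <-.
    have o2 : pO P (EE ord0 / v1).
      rewrite eE0 mulrBl mulfK // h0; apply: pOB; first exact: (qP 'X).1.
      by apply: OV; exact: V_act.
    have e1 : EE K1 / v1 = psi`_k1 * v1 ^+ (q ^ k1 - 1) by rewrite eK1 {1}qkS exprSr mulrA mulfK.
    exists psi`_k1, (q ^ k1 - 1)%N; split => //; rewrite -e1; apply: punitP.
    - by rewrite mulf_neq0 ?invr_eq0.
    - by have -> : EE K1 / v1 = EE K1 / EE ord0 * (EE ord0 / v1);
        [field; rewrite E00 v10|exact: pOM o1 o2].
    - have -> : (EE K1 / v1)^-1 = (psi`_k1 * u ^+ (q ^ k1 - 1))^-1 * (u / v1) ^+ (q ^ k1 - 1).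
        by rewrite e1 expr_div_n; field; rewrite ck0 !expf_neq0.
      by apply: pOM; [exact: (punitV uk1').1|exact: pOX].
  rewrite negb_or => /andP [a0 b0].
  have main (c e : 'I_r.+2) : c != ord0 -> e != ord0 -> (c < e)%N -> punit P (EE e / EE c) -> EE c != 0 ->
     exists rho E', [/\ K rho, (0 < E' <= q ^ r.+1)%N & punit P (rho * v1 ^+ E')].
    move=> nc ne ce ue c0; exists (psi`_e / psi`_c), (q ^ e - q ^ c)%N.
    have q1 := q_gt1 Fq.
    have lt : (q ^ c < q ^ e)%N by rewrite ltn_exp2l.
    have le : (q ^ e <= q ^ r.+1)%N by rewrite leq_exp2l // -ltnS ltn_ord.
    split; first by apply: sfM; [|apply: sfV]; exact: KPt.
      by rewrite subn_gt0 lt /= (leq_trans (leq_subr _ _) le).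
    have -> // : psi`_e / psi`_c * v1 ^+ (q ^ e - q ^ c) = EE e / EE c.
    have pc0 : psi`_c != 0 by move: c0; rewrite eE // mulf_eq0 negb_or => /andP [].
    rewrite !eE // -{2}(subnK (ltnW lt)) exprD; field.
    by rewrite pc0 expf_neq0.
  case: (ltngtP a b) => [lt|lt|e].
  - by apply: (main a b) => //; rewrite -invf_div; exact: punitV.
  - exact: (main b a).
  - by move: ab; rewrite -val_eqE /= e eqxx.
pose res v := pf P (v / v1).
have shift v : tline v -> res (act psi (g ^+ (e0 * i)) v) ^+ E' = res v ^+ E'.
  move=> Vv; pose F m := rho * TV v m ^+ E'.
  have eF m : F m = (rho * v1 ^+ E') * (TV v m / v1) ^+ E'.
    by rewrite /F expr_div_n; field; rewrite expf_neq0.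
  have OTV m : pO P (TV v m / v1) by apply: OV; exact: V_act.
  have OF m : pO P (F m) by rewrite eF; apply: pOM; [case: urho|exact: pOX].
  have fF m : pf P (F m) = pf P (rho * v1 ^+ E') * res (TV v m) ^+ E'.
    by rewrite eF pfM ?pfX //; [case: urho|exact: pOX].
  (* The Fourier coefficient is the residue of an element of [K] divided by [mu^k]; if it is
     nonzero, that element has valuation [k / N]. *)
  have hatE k : (k < N)%N -> \sum_(m < N) x ^+ (m * k) * pf P (F m) = 0 \/ x ^+ (e0 * k) = 1.
    move=> kN; have [->|nz] := eqVneq (\sum_(m < N) x ^+ (m * k) * pf P (F m)) 0; first by left.
    right; pose T := \sum_(m < N) TC m ^+ k * F m.
    have KT' : K T.
      apply: (sum_K (h := fun m => TC m ^+ k * F m)).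
      - by move=> m; rewrite /F TC_per TV_per.
      - move=> m; apply: sfM; first by apply: sfX; exact: A_TC.
        by apply: sfM; [exact: adjs_sub|apply: sfX; exact: A_TV].
      - move=> s n m as_ hn; rewrite endoM endoX (TC_s _ as_ hn); congr (_ * _).
        by rewrite /F endoM endoX (TV_s _ as_ hn) // as_.2.
    have eT : T = mu ^+ k * \sum_(m < N) (TC m / mu) ^+ k * F m.
      rewrite mulr_sumr; apply: eq_bigr => m _; rewrite expr_div_n; field.
      by rewrite expf_neq0.
    have term m : pO P ((TC m / mu) ^+ k * F m) /\ pf P ((TC m / mu) ^+ k * F m) = x ^+ (m * k) * pf P (F m).
      have [c1 c2] := TC_lin m; have o1 := pOX k c1.
      by split; [exact: pOM|rewrite (pfM o1 (OF m)) (pfX k c1) c2 exprM].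
    have uS : punit P (\sum_(m < N) (TC m / mu) ^+ k * F m).
      split; first by apply: pO_sum => m _; exact: (term m).1.
      rewrite pf_sum; last by move=> m _; exact: (term m).1.
      by under eq_bigr do rewrite (term _).2.
    have mk0 : mu ^+ k != 0 by rewrite expf_neq0.
    have T0 : T != 0 by rewrite eT mulf_neq0 // (punit_neq0 uS).
    have [a ea] := hK KT' T0.
    move: ea; rewrite eT (wM hw) ?(punit_neq0 uS) // ((wU hw (punit_neq0 uS)).1 uS) addr0 (wX hw) // => ea.
    have /eqP e1 : (e0 * k)%:Z%:~R == (N%:Z * a)%:~R :> rat.
      rewrite (intrM _ N%:Z a) -ea -!pmulrn natrM -[w mu *+ k]mulr_natl; apply/eqP.
      by rewrite mulrCA [X in _ = _ * X]mulrCA w_mu mulr1.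
    move/eqP: e1; rewrite eqr_int => /eqP e1.
    have : (N %| e0 * k)%N by rewrite -[N]/(`|N%:Z|%N) -[(e0 * k)%N]/(`|(e0 * k)%:Z|%N) e1 abszM dvdn_mulr.
    by case/dvdnP => c ->; rewrite mulnC exprM (prim_expr_order pg) expr1n.
  have per m : pf P (F (m + N)%N) = pf P (F m) by rewrite /F TV_per.
  have D0 : forall m, (m < N)%N -> pf P (F (m + e0)%N) - pf P (F m) = 0.
    apply: (fourier_inj (D := fun m => pf P (F (m + e0)%N) - pf P (F m)) pg NR0) => k kN.
    under eq_bigr do rewrite mulrBr; rewrite sumrB.
    have sh : x ^+ (e0 * k) * \sum_(m < N) x ^+ (m * k) * pf P (F (m + e0)%N) = \sum_(m < N) x ^+ (m * k) * pf P (F m).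
      rewrite -(periodic_sum (h := fun m => x ^+ (m * k) * pf P (F m)) e0); last first.
        by move=> m; rewrite per mulnDl xN.
      by rewrite mulr_sumr; apply: eq_bigr => m _; rewrite mulrA -exprD -mulnDl addnC.
    case: (hatE k kN) => [h|h]; last by rewrite -sh h mul1r subrr.
    rewrite h subr0; move: sh; rewrite h => /eqP; rewrite mulf_eq0 expf_eq0 => /orP [/andP [_ /eqP e]|/eqP //].
    have := prim_expr_order pg; rewrite e expr0n gtn_eqF // => /eqP; rewrite eq_sym oner_eq0 //.
  have /eqP := D0 0%N N0; rewrite subr_eq0 !fF add0n => /eqP /(mulfI urho.2).
  by rewrite /TV mul0n expr0 act1.
pose y := x ^+ (e0 * i).
have yN : y ^+ N = 1 by rewrite /y -exprM mulnC exprM (prim_expr_order pg) expr1n.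
have [o po oN] := prim_order_exists N0 yN.
have resM v v' : tline v -> tline v' -> res (v - v') = res v - res v'.
  by move=> a b; rewrite /res mulrBl pfB //; exact: OV.
have res1 : res v1 = 1 by rewrite /res divff // pf1.
have E'0 : (0 < E')%N by case/andP: hE'.
pose ga m := g ^+ (e0 * i * m).
have shiftm v m : tline v -> res (act psi (ga m) v) ^+ E' = res v ^+ E'.
  elim: m => [|m IH] Vv; first by rewrite /ga muln0 expr0 act1.
  by rewrite /ga mulnS exprD (actM iota chp) shift ?IH //; exact: V_act.
have ker0 v m : tline v -> res v = 0 -> res (act psi (ga m) v) = 0.
  move=> Vv rv; have := shiftm v m Vv; rewrite rv expr0n gtn_eqF // => /eqP.
  by rewrite expf_eq0 => /andP [_ /eqP].
(* If [(ga m - 1) v1] had residue 0, so would every power of [ga m - 1] applied to [v1]; but by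
   Fermat the [N]-th power acts as 1 when [y^m] is not 1. *)
have inj m : (y ^+ m != 1) -> res (act psi (ga m - 1) v1) != 0.
  move=> ym; apply/negP => /eqP rz.
  have kerk k : res (act psi ((ga m - 1) ^+ k.+1) v1) = 0.
    elim: k => [|k IH]; first by rewrite expr1.
    rewrite exprS (actM iota chp) actB act1; set t := act _ _ _ in IH *.
    have Vt : tline t by exact: V_act.
    by rewrite resM ?ker0 ?IH ?subrr //; exact: V_act.
  have := kerk N.-1; rewrite prednK // (act_evq chp ir r0 (V_tors V1) (b := 1)).
    by rewrite act1 res1 => /eqP; rewrite oner_eq0.
  rewrite evqX evq1 (evq_unity chp ir r0) //; apply/negP => /(evq_eq0 ir r0).
  by rewrite evqB evq1 evq_g exprM => /eqP; rewrite subr_eq0 (negPf ym).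
(* The residues of [ga m] applied to [v1], for [m < o], are distinct [E']-th roots of unity. *)
have oE : (o <= E')%N.
  pose s := [seq res (act psi (ga m) v1) | m <- seq.iota 0 o].
  have us : uniq s.
    rewrite map_inj_in_uniq ?iota_uniq // => a b; rewrite !mem_iota !add0n /= => la lb eab.
    wlog lab : a b la lb eab / (a <= b)%N.
      by move=> W; case/orP: (leq_total a b) => h; [exact: W|apply/esym; exact: W].
    apply/eqP; rewrite -(modn_small la) -(modn_small lb) -(eq_prim_root_expr po); apply: contraT => nab.
    have nab' : y ^+ (b - a) != 1.
      by apply: contra nab => /eqP e; rewrite -(subnK lab) exprD e mul1r.
    have := inj _ nab'; rewrite actB act1 resM //; last exact: V_act.
    have Vd : tline (act psi (ga (b - a)%N) v1 - v1) by apply: V_sub => //; exact: V_act.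
    rewrite -resM //; last exact: V_act.
    have := shiftm _ a Vd; rewrite (act_sub iota chp) -(actM iota chp) -exprD -mulnDr subnKC //.
    have h1 : res (act psi (ga b) v1 - act psi (ga a) v1) = 0.
      by rewrite resM ?eab ?subrr //; exact: V_act.
    rewrite -/(ga a) -/(ga b) h1.
    by rewrite expr0n gtn_eqF // => /esym/eqP; rewrite expf_eq0 => /andP [_ ->].
  have sz : size ('X^E' - 1 : {poly Om}) = E'.+1.
    by rewrite size_polyDl size_polyXn // size_polyN size_poly1.
  have P0 : 'X^E' - 1 != 0 :> {poly Om} by rewrite -size_poly_gt0 sz.
  have := max_poly_roots P0 _ us; rewrite sz size_map size_iota; apply.
  apply/allP => _ /mapP [m _ ->]; rewrite /root hornerD hornerN hornerXn hornerC.
  by rewrite shiftm // res1 expr1n subrr.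
have : (o %| E)%N.
  by apply: E_div; rewrite (prim_order_gt0 po) /=; apply: leq_trans oE _; case/andP: hE'.
case/dvdnP => c ->; rewrite (prim_order_dvd pg).
rewrite (_ : (c * o * e0 * i)%N = (e0 * i * o * c)%N); last by ring.
by rewrite exprM exprM -/y (prim_expr_order po) expr1n.
Qed.
End Scaled.
End Generator.
End Local.

(** Scaling by [u] gives integral coefficients with a unit among those of positive index, a stable
    model over an extension of [K]. Then either the line meets the kernel of reduction or it
    injects. *)
Theorem local_bound (Fq : finFieldType) (p : nat) (Om : closedFieldType)
  (iota : {rmorphism {fraction {poly Fq}} -> Om}) (K : sfield Om) (pi : {poly Fq}) (x0 : Om)
  (P : place Om) (w : Om -> rat) (e0 : nat) (psi : {poly Om}) (r : nat) (z : Om) (i : nat) :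
  p \in [pchar Fq] -> algo K -> (forall y, Fsf iota y -> K y) ->
  irreducible_poly pi -> evq iota pi x0 = 0 -> qplace iota P x0 ->
  valn P w -> w (iA iota pi) = 1 -> (0 < e0)%N ->
  (forall y, K y -> y != 0 -> exists a : int, e0%:R * w y = a%:~R) ->
  Lp K psi -> size psi = r.+2 -> psi`_0 = iA iota 'X ->
  z != 0 -> act iota psi pi z = 0 ->
  (forall s, autL K s -> exists b, (forall mu, act iota (cP iota) pi mu = 0 ->
     s mu = act iota (cP iota) b mu) /\ s z = act iota psi (b ^+ i) z) ->
  exists2 j, (j <= (#|Fq| ^ r.+1)`! * e0)%N &
    (#|Fq| ^ r.+1)`! * e0 * i = j %[mod (#|Fq| ^ (size pi).-1).-1].
Proof.
move=> chp aK KF ir r0 qP hw wpi e0_gt0 hK KPt sPt h0 z0 hz hG.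
have [g [_ pg grep]] := gen_ex chp ir r0.
have [mu [mu0 hmu Omu fmu umu]] := carlitz_tors chp ir r0 qP.
set q := #|Fq|; set E := ((q ^ r.+1)`!)%N.
have q1 : (1 < q)%N := q_gt1 Fq.
pose n k := (q ^ k - 1)%N; pose Ek k := (E %/ n k)%N.
have n0 k : (0 < k)%N -> (0 < n k)%N.
  by move=> k0; rewrite subn_gt0 -[1%N](expn0 q) ltn_exp2l.
have EkE k : (0 < k <= r.+1)%N -> (Ek k * n k)%N = E.
  case/andP=> k0 kr; apply: divnK; apply: dvdn_fact; rewrite n0 //=.
  by apply: leq_trans (leq_subr _ _) _; rewrite leq_exp2l.
have Ek0 k : (0 < k <= r.+1)%N -> (0 < Ek k)%N.
  move=> h; have := EkE k h; have : (0 < E)%N by apply: fact_gt0.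
  by case: (Ek k) => // + e; rewrite -e mul0n.
have lc0 : psi`_r.+1 != 0.
  by rewrite -[r.+1]/(r.+2.-1) -sPt -lead_coefE lead_coef_eq0 -size_poly_gt0 sPt.
(* [k1] maximises the absolute value of the [(q^k - 1)]-th root of [psi_k], compared after raising
   to the power [E]; the scaling [u] then makes this coefficient 1. *)
have [y [yin y0 ymax]] : exists y, [/\ y \in [seq psi`_k ^+ Ek k | k <- seq.iota 1 r.+1], y != 0
    & forall t, t \in [seq psi`_k ^+ Ek k | k <- seq.iota 1 r.+1] -> pO P (t / y)].
  apply: max_term; exists (psi`_r.+1 ^+ Ek r.+1); last by rewrite expf_neq0.
  by apply/mapP; exists r.+1 => //; rewrite mem_iota add1n ltnS leqnn.
have /mapP [k1 k1in ey] := yin.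
have hk1 : (0 < k1 <= r.+1)%N by move: k1in; rewrite mem_iota add1n ltnS.
have ck0 : psi`_k1 != 0.
  by apply: contraNneq y0 => e; rewrite ey e expr0n gtn_eqF // Ek0.
have k10 : (0 < n k1)%N by apply: n0; case/andP: hk1.
have [u eu] := nth_root_ex (psi`_k1)^-1 k10.
have u0 : u != 0.
  apply/eqP => e; move: eu; rewrite e expr0n gtn_eqF // => /esym/eqP.
  by rewrite invr_eq0 (negPf ck0).
have qkS k : (q ^ k = (n k).+1)%N by rewrite /n subn1 prednK // expn_gt0 (ltnW q1).
have e1 k : psi`_k * u ^+ (q ^ k) / u = psi`_k * u ^+ n k.
  by rewrite {1}qkS exprSr mulrA mulfK.
have uk1 : punit P (psi`_k1 * u ^+ (q ^ k1) / u).
  by rewrite e1 eu divff //; exact: punit1.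
have Opsi : Op P (tscale Fq u psi).
  move=> k; rewrite coef_tscale -/q e1.
  have [k0|k0] := posnP k; first by rewrite k0 h0 /n expn0 subnn expr0 mulr1; exact: (qP 'X).1.
  have [kr|kr] := leqP k r.+1; last by rewrite nth_default ?sPt // mul0r; exact: pO0.
  have hk : (0 < k <= r.+1)%N by rewrite k0.
  apply: (pO_root_exp (Ek0 k hk)); rewrite exprMn -exprM [(n k * _)%N]mulnC EkE //.
  rewrite -(EkE k1 hk1) mulnC exprM eu exprVn -ey; apply: ymax.
  by apply/mapP; exists k => //; rewrite mem_iota add1n ltnS.
have [[v [v1 v2 v3 v4]]|no] := pselect (exists v, [/\ tline iota psi z v, v != 0, pO P (v / u) & pf P (v / u) = 0]).
  exact: (local_pos chp aK KF ir r0 qP hw wpi e0_gt0 hK KPt sPt h0 z0 hz hG pg grep mu0 hmu Omu fmu umu u0 Opsi hk1 uk1 v1 v2 v3 v4).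
exists 0%N => //; apply/eqP; rewrite mod0n.
apply: (local_neg chp aK KF ir r0 qP hw wpi e0_gt0 hK KPt sPt h0 z0 hz hG pg grep mu0 hmu Omu fmu umu u0 hk1 uk1).
by move=> v v1 v2 v3; apply/negP => /eqP v4; apply: no; exists v.
Qed.

(** * Comparison with Frobenius at a small prime *)

Section ReductionTau.
Variables (Fq : finFieldType) (p : nat) (Om : closedFieldType)
          (iota : {rmorphism {fraction {poly Fq}} -> Om}).
Hypotheses (chp : p \in [pchar Fq]).
Local Notation q := #|Fq|.
Local Notation iA := (iA iota).
Local Notation kc := (kc iota).
Local Notation ev := (@ev Fq Om).
Local Notation tmul := (@tmul Fq Om).
Local Notation act := (act iota).
Local Notation tp := (tp iota).
Local Notation evq := (evq iota).
Local Notation cP := (cP iota).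
Implicit Types (Pt A B : {poly Om}) (a b : {poly Fq}) (x y z : Om).

Lemma lead_tp_cP a : a \is monic -> lead_coef (tp cP a) = 1.
Proof.
have c0 : cP != 0 by rewrite -size_poly_gt0 size_cP.
elim/poly_ind: a => [|a c IH]; first by rewrite monicE lead_coef0 eq_sym oner_eq0.
have [->|a0] := eqVneq a 0.
  by rewrite mul0r add0r tpC monicE lead_coefC => /eqP ->; rewrite kcE rmorph1 scale1r lead_coef1.
have lt : (size c%:P < size (a * 'X)%R)%N.
  apply: leq_ltn_trans (size_polyC_leq1 _) _; rewrite size_mulX //.
  by move: a0; rewrite -size_poly_gt0; plia.
move=> h; have ma : a \is monic by move: h; rewrite !monicE lead_coefDl // lead_coefMX.
have [s1 _] := size_tp iota chp (size_cP iota) a0.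
have t0 : tp cP a != 0 by rewrite -size_poly_gt0 s1.
have [s2 l2] := size_tmul iota chp t0 c0.
rewrite tpD tpMX tpC lead_coefDl; first by rewrite l2 lead_cP expr1n mulr1 IH.
apply: leq_ltn_trans (size_scale_leq _ _) _; rewrite size_poly1 s2 size_cP s1 addn2 /= ltnS.
by rewrite mul1n; move: a0; rewrite -size_poly_gt0; plia.
Qed.

Section Unipotent.
Variables (Pt : {poly Om}) (s : {rmorphism Om -> Om}).
Hypothesis sact : forall a x, s (act Pt a x) = act Pt a (s x).
(** Polynomials over [A] in an indeterminate that acts as [s]: a commutative ring in which the
    binomial formula of characteristic [p] can be applied. *)
Let actY (R : {poly {poly Fq}}) x := \sum_(i < size R) act Pt R`_i (iter i s x).
Let actY_wide n (R : {poly {poly Fq}}) x : (size R <= n)%N -> actY R x = \sum_(i < n) act Pt R`_i (iter i s x).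
Proof.
move=> le; rewrite /actY (big_ord_widen _ (fun i => act Pt R`_i (iter i s x)) le) big_mkcond /=.
apply: eq_bigr => i _; case: ltnP => // h; by rewrite nth_default // act0.
Qed.
Let iter_add i x y : iter i s (x + y) = iter i s x + iter i s y.
Proof. by elim: i => //= i ->; exact: rmorphD. Qed.
Let actY_add (R : {poly {poly Fq}}) x y : actY R (x + y) = actY R x + actY R y.
Proof.
by rewrite /actY -big_split /=; apply: eq_bigr => i _; rewrite iter_add (act_add iota chp).
Qed.
Let actYB (R R' : {poly {poly Fq}}) x : actY (R - R') x = actY R x - actY R' x.
Proof.
pose n := maxn (size R) (size R').
rewrite !(@actY_wide n) ?leq_maxl ?leq_maxr ?(leq_trans (size_polyD _ _)) ?size_polyN //.
by rewrite -sumrB; apply: eq_bigr => i _; rewrite coefB actB.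
Qed.
Let actYX (R : {poly {poly Fq}}) x : actY (R * 'X) x = actY R (s x).
Proof.
have sz : (size (R * 'X)%R <= (size R).+1)%N.
  by have [->|R0] := eqVneq R 0; rewrite ?mul0r ?size_poly0 // size_mulX.
rewrite (actY_wide x sz) big_ord_recl coefMX eqxx act0 add0r.
by apply: eq_bigr => i _; rewrite coefMX /= -iterS iterSr.
Qed.
Let actYC (R : {poly {poly Fq}}) c x : actY (R * c%:P) x = actY R (act Pt c x).
Proof.
have sz : (size (R * c%:P)%R <= size R)%N.
  by rewrite mulrC mul_polyC size_scale_leq.
rewrite (actY_wide x sz); apply: eq_bigr => i _; rewrite coefMC (actM iota chp); congr (act _ _ _).
by elim: (nat_of_ord i) => //= k <-; rewrite sact.
Qed.
Let L c x := s x - act Pt c x.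
Let actY_iter c n x : actY (('X - c%:P) ^+ n) x = iter n (L c) x.
Proof.
elim: n x => [|n IH] x.
  by rewrite expr0 (@actY_wide 1) ?size_poly1 // big_ord1 coef1 act1.
rewrite exprSr mulrBr actYB actYX actYC iterSr -IH /L actY_add.
congr (_ + _); apply/eqP; rewrite eq_sym -addr_eq0 -actY_add addNr.
by rewrite /actY big1 // => i _; have -> : iter i s 0 = 0;
   [elim: (nat_of_ord i) => //= k ->; exact: rmorph0|rewrite (act_0 iota chp)].
Qed.

(** The binomial has two terms only, so the unipotent part of [s] disappears after a [p]-power
    without being diagonalised. *)
Lemma frob_unip c n x : iter (p ^ n) (fun y => s y - act Pt c y) x
  = iter (p ^ n) s x - act Pt (c ^+ (p ^ n)) x.
Proof.
rewrite -/(L c) -actY_iter.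
have -> : ('X - c%:P) ^+ (p ^ n) = 'X^(p ^ n) - (c ^+ (p ^ n))%:P :> {poly {poly Fq}}.
  have chP : p \in [pchar {poly {poly Fq}}].
    exact: (rmorph_pchar (polyC : {rmorphism {poly Fq} -> {poly {poly Fq}}}) (rmorph_pchar (polyC : {rmorphism Fq -> {poly Fq}}) chp)).
  have pn : [pchar {poly {poly Fq}}].-nat (p ^ n)%N.
    by rewrite pnatX; apply/orP; left; rewrite pnatE //; exact: pcharf_prime chP.
  apply/eqP; rewrite -subr_eq0 opprB addrA -[X in _ + X]/(_) subr_eq0 rmorphXn /=; apply/eqP.
  by rewrite -exprDn_pchar // subrK.
rewrite actYB; congr (_ - _).
  rewrite (@actY_wide (p ^ n).+1) ?size_polyXn // big_ord_recr /= coefXn eqxx act1 big1 ?add0r // => i _.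
  by rewrite coefXn ltn_eqF // act0.
by rewrite (@actY_wide 1) ?size_polyC_leq1 // big_ord1 coefC.
Qed.
End Unipotent.

Section AtPlace.
Variables (ql : {poly Fq}) (x : Om) (P : place Om).
Hypotheses (irl : irreducible_poly ql) (rl : evq ql x = 0) (qP : qplace iota P x).
Local Notation f := (pf P).
Let m := (size ql).-1.

Lemma pf_ev A y : Op P A -> pO P y -> pO P (ev A y) /\ f (ev A y) = ev (pfp P A) (f y).
Proof.
move=> OA Oy; rewrite (@ev_wide _ _ (size A) (pfp P A)) ?size_poly // evE.
have o (i : 'I_(size A)) : pO P (A`_i * y ^+ (q ^ i)) by apply: pOM => //; exact: pOX.
split; first exact: pO_sum.
rewrite pf_sum //; apply: eq_bigr => i _; rewrite pfM //; last exact: pOX.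
by rewrite coef_pfp pfX.
Qed.
Lemma pfp_tmul A B : Op P A -> Op P B -> pfp P (tmul A B) = tmul (pfp P A) (pfp P B).
Proof.
move=> OA OB; apply/polyP => k; rewrite coef_pfp !(coef_tmul iota chp).
rewrite pf_sum; last by move=> i _; apply: pOM => //; exact: pOX.
apply: eq_bigr => i _; rewrite pfM //; last exact: pOX.
by rewrite !coef_pfp pfX.
Qed.
Lemma pf_kc c : f (kc c) = kc c. Proof. by rewrite (qP c%:P).2 evqC. Qed.
Lemma pfp_tp Pt a : Op P Pt -> pfp P (tp Pt a) = tp (pfp P Pt) a.
Proof.
move=> OPt; have Kc := kc_O qP.
elim/poly_ind: a => [|a c IH].
  by rewrite !tp0; apply/polyP => i; rewrite coef_pfp coef0 pf0.
rewrite !tpD !tpMX !tpC -IH -pfp_tmul //; last exact: (Op_tp chp).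
have Ot : Op P (tmul (tp Pt a) Pt).
  move=> k; rewrite (coef_tmul iota chp); apply: pO_sum => i _; apply: pOM; first exact: (Op_tp chp).
  exact: pOX.
apply/polyP => k; rewrite coefD !coef_pfp coefD !coefZ !coef1 pfD //; last first.
  by apply: pOM => //; case: eqP => _; [exact: pO1|exact: pO0].
congr (_ + _); case: eqP => _; first by rewrite !mulr1 pf_kc.
by rewrite !mulr0 pf0.
Qed.
Lemma pf_act Pt a y : Op P Pt -> pO P y ->
  pO P (act Pt a y) /\ f (act Pt a y) = act (pfp P Pt) a (f y).
Proof.
move=> OPt Oy; rewrite !actE -pfp_tp //; apply: pf_ev => //.
by apply: (Op_tp chp) => //; exact: (kc_O qP).
Qed.

(** The additive polynomial of [a] has integral coefficients and a unit as leading coefficient. *)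
Lemma tors_O Pt r a y : Op P Pt -> size Pt = r.+2 -> punit P (lead_coef Pt) -> a != 0 ->
  act Pt a y = 0 -> pO P y.
Proof.
move=> OPt sPt lu a0 ay; set Q := tp Pt a.
have OQ : Op P Q by apply: (Op_tp chp) => //; exact: (kc_O qP).
have [sQ lQ] := size_tp iota chp sPt a0; rewrite -/Q in sQ lQ.
have uQ : punit P (lead_coef Q).
  apply: lQ => //; first by move=> ? ?; exact: punitM.
  move=> c c0; split; first exact: (kc_O qP c).
  by rewrite pf_kc kcE fmorph_eq0.
have Q0 : Q != 0 by rewrite -size_poly_gt0 sQ.
apply: (@pO_root _ _ (evp Fq Q)).
- move=> i; rewrite /evp coef_sum; apply: pO_sum => j _; rewrite coefZ coefXn.
  by apply: pOM => //; case: eqP => _; [exact: pO1|exact: pO0].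
- have -> : lead_coef (evp Fq Q) = lead_coef Q; last by case: uQ.
  rewrite [LHS]lead_coefE size_evp //= /evp coef_sum (polySpred Q0) big_ord_recr /= coefZ coefXn eqxx mulr1.
  rewrite [RHS]lead_coefE big1 ?add0r // => i _; rewrite coefZ coefXn.
  by rewrite eqn_exp2l ?q_gt1 // gtn_eqF ?mulr0 // ltn_ord.
- by rewrite /root evp_horner; apply/eqP.
Qed.

(** By [act_lin], a nonzero torsion point reducing to 0 would force [a] to reduce to 0. *)
Lemma tors_inj Pt a y : Op P Pt -> Pt`_0 = iA 'X -> evq a x != 0 -> act Pt a y = 0 ->
  pO P y -> f y = 0 -> y = 0.
Proof.
move=> OPt h0 ax ay Oy fy; apply/eqP; apply: contraT => y0.
have [_] := act_lin chp qP a OPt h0 y0 Oy fy; rewrite ay mul0r pf0 => /esym/eqP.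
by rewrite (negPf ax).
Qed.

(** The tau-polynomial of [ql] is Eisenstein at [ql]: its lower coefficients are divisible by [ql]
    according to [tp_low] and the top one is 1, so it reduces to [tau^m]. *)
Lemma carlitz_frob mu : ql \is monic -> pO P mu ->
  pO P (act cP ql mu) /\ f (act cP ql mu) = f mu ^+ (q ^ m).
Proof.
move=> ml Om'; have OQ := Op_tp chp ql (kc_O qP) (OpcP qP).
have [o1 o2] := pf_ev OQ Om'; split; first exact: o1.
rewrite actE o2 -(evXn Fq); congr (ev _ _); apply/polyP => i; rewrite coef_pfp coefXn.
have ql0 : iA ql != 0 by rewrite iA_eq0; exact: irredp_neq0.
have [sz _] := size_tp iota chp (size_cP iota) (irredp_neq0 irl); rewrite mul1n in sz.
case: (ltngtP i m) => [lt|gt|->].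
- have h := tp_low chp irl rl qP (OpcP qP) (cP0 iota) lt.
  by rewrite -(divfK ql0 (tp cP ql)`_i) (pfM h (qP ql).1) (qP ql).2 rl mulr0.
- by rewrite nth_default ?pf0 // sz.
- by have := lead_tp_cP ml; rewrite lead_coefE sz /= => ->; exact: pf1.
Qed.
End AtPlace.
End ReductionTau.

(** * The Galois-stable flag in the torsion *)

Section Spans.
Variables (Fq : finFieldType) (p : nat) (Om : closedFieldType)
          (iota : {rmorphism {fraction {poly Fq}} -> Om}).
Hypotheses (chp : p \in [pchar Fq]).
Local Notation act := (act iota).
Local Notation evq := (evq iota).
Implicit Types (a b : {poly Fq}) (x y : Om).
Variables (Pt : {poly Om}) (r : nat) (lam : 'I_r -> Om) (pi : {poly Fq}) (x0 : Om).
Hypotheses (ir : irreducible_poly pi) (r0 : evq pi x0 = 0)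
  (hlam : forall k, act Pt pi (lam k) = 0)
  (ind : forall a : 'I_r -> {poly Fq}, \sum_k act Pt (a k) (lam k) = 0 -> forall k, pi %| a k).

(** Coefficients are kept in [A], though only their classes modulo [pi] matter; [flag r] is the
    whole span of [lam]. *)
Definition flag s x := exists a : 'I_r -> {poly Fq},
  (forall k : 'I_r, (s <= k)%N -> a k = 0) /\ x = \sum_k act Pt (a k) (lam k).

Lemma flag0 s : flag s 0.
Proof. by exists (fun=> 0); split=> //; rewrite big1 // => k _; rewrite act0. Qed.
Lemma flagD s x y : flag s x -> flag s y -> flag s (x + y).
Proof.
move=> [a [ha ->]] [b [hb ->]]; exists (fun k => a k + b k); split.
  by move=> k sk; rewrite ha ?hb ?addr0.
by rewrite -big_split /=; apply: eq_bigr => k _; rewrite actD.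
Qed.
Lemma flag_act s b x : flag s x -> flag s (act Pt b x).
Proof.
move=> [a [ha ->]]; exists (fun k => b * a k); split; first by move=> k sk; rewrite ha ?mulr0.
by rewrite (act_sum iota chp); apply: eq_bigr => k _; rewrite (actM iota chp).
Qed.
Lemma flagB s x y : flag s x -> flag s y -> flag s (x - y).
Proof.
move=> hx hy; apply: flagD => //.
by have := flag_act (-1) hy; rewrite actN act1.
Qed.
Lemma flag_sum s (I : Type) (t : seq I) (Q : pred I) (E : I -> Om) :
  (forall i, Q i -> flag s (E i)) -> flag s (\sum_(i <- t | Q i) E i).
Proof. by move=> h; apply: big_ind => //; [exact: flag0|move=> *; exact: flagD]. Qed.
Lemma flag_gen s (k : 'I_r) : (k < s)%N -> flag s (lam k).
Proof.
move=> ks; exists (fun l => if l == k then 1 else 0); split.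
  by move=> l sl; case: eqP => // e; move: ks; rewrite -e ltnNge sl.
rewrite (bigD1 k) //= eqxx act1 big1 ?addr0 // => l /negPf ->; exact: act0.
Qed.
Lemma flag_le s s' x : (s <= s')%N -> flag s x -> flag s' x.
Proof. by move=> le [a [ha ->]]; exists a; split => // k sk; apply: ha; apply: leq_trans sk. Qed.
Lemma flag_all s x : (r <= s)%N -> flag s x -> flag r x.
Proof. by move=> le [a [ha ->]]; exists a; split => // k sk; have := ltn_ord k; rewrite ltnNge sk. Qed.
Lemma flag_tors s x : flag s x -> act Pt pi x = 0.
Proof.
move=> [a [_ ->]]; rewrite (act_sum iota chp) big1 // => k _.
by rewrite (actAC iota chp) hlam (act_0 iota chp).
Qed.
Lemma flag_0 x : flag 0 x -> x = 0.
Proof. by move=> [a [ha ->]]; rewrite big1 // => k _; rewrite ha ?act0. Qed.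
Lemma dvd_act a x s : flag s x -> pi %| a -> act Pt a x = 0.
Proof. by move=> hx /dvdpP [c ->]; rewrite (actM iota chp) (flag_tors hx) (act_0 iota chp). Qed.
Lemma flag_ind (s : 'I_r) b : flag s (act Pt b (lam s)) -> pi %| b.
Proof.
move=> [a [ha e]].
pose a' k := (if k == s then b else 0) - a k.
have : \sum_k act Pt (a' k) (lam k) = 0.
  under eq_bigr do rewrite actB; rewrite sumrB -e (bigD1 s) //= eqxx big1 ?addr0 ?subrr //.
  by move=> k /negPf ->; exact: act0.
by move/ind/(_ s); rewrite /a' eqxx ha // subr0.
Qed.

(** One representative per residue vector, so that [ev_roots] can be applied to the full list of
    torsion points. *)
Definition flag_list : seq Om :=
  [seq \sum_k act Pt (rVpoly (v k)) (lam k) | v : {ffun 'I_r -> 'rV[Fq]_(size pi).-1}].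
Lemma flag_list_mem s x : flag s x -> x \in flag_list.
Proof.
move=> [a [_ ->]]; apply/mapP; exists [ffun k => poly_rV (a k %% pi)]; first by rewrite mem_enum.
apply: eq_bigr => k _; rewrite ffunE.
have d0 : (0 < (size pi).-1)%N := irr_d_gt0 chp ir.
have pi0 : pi != 0 by exact: irredp_neq0.
have sz : (size (a k %% pi)%R <= (size pi).-1)%N.
  by have := ltn_modp (a k) pi; rewrite pi0; move: d0; plia.
rewrite poly_rV_K //; apply/eqP; rewrite -subr_eq0 -actB; apply/eqP; apply: (dvd_act (flag_gen (ltn_ord k))).
by rewrite {1}(divp_eq (a k) pi) addrK dvdp_mull.
Qed.
Lemma flag_list_flag x : x \in flag_list -> flag r x.
Proof. by case/mapP => v _ ->; exists (fun k => rVpoly (v k)); split => // k; rewrite leqNgt ltn_ord. Qed.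

Lemma flag_list_uniq (f : Om -> Om) : (forall x y, flag r x -> flag r y -> f x = f y -> x = y) ->
  uniq (map f flag_list) /\ size (map f flag_list) = (#|Fq| ^ ((size pi).-1 * r))%N.
Proof.
move=> finj; split; last first.
  by rewrite size_map size_image card_ffun card_mx mul1n card_ord -expnM.
rewrite map_inj_in_uniq; last by move=> x y /flag_list_flag hx /flag_list_flag hy; exact: finj.
rewrite map_inj_uniq ?enum_uniq // => v v' /eqP; rewrite -subr_eq0 -sumrB => /eqP e.
apply/ffunP => k; apply: (res_list_inj (iota := iota) chp ir r0).
apply/eqP; rewrite -subr_eq0 -evqB; apply/eqP/(evq_eq0 ir r0).
by apply: (ind (a := fun k => rVpoly (v k) - rVpoly (v' k))); under eq_bigr do rewrite actB.
Qed.
Section Stable.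
Variables (s : {rmorphism Om -> Om}) (mm : 'I_r -> 'I_r -> {poly Fq}).
Hypotheses (sact : forall a y, s (act Pt a y) = act Pt a (s y))
  (slam : forall l, s (lam l) = \sum_u act Pt (mm u l) (lam u))
  (tri : forall u l : 'I_r, (l < u)%N -> pi %| mm u l).

Lemma flag_stable t y : flag t y -> flag t (s y).
Proof.
move=> [a [ha ->]]; rewrite endo_sum; apply: flag_sum => l _.
have [tl|lt] := leqP t l; first by rewrite ha // act0 rmorph0; exact: flag0.
rewrite sact slam; apply: flag_act; apply: flag_sum => u _.
have [tu|ut] := leqP t u; last by apply: flag_act; exact: flag_gen.
rewrite (dvd_act (flag_gen (ltn_ord u))); first exact: flag0.
by apply: tri; exact: leq_trans lt tu.
Qed.

Lemma flag_diag (t : 'I_r) b : pi %| mm t t - b -> flag t (s (lam t) - act Pt b (lam t)).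
Proof.
move=> db; rewrite slam (bigD1 t) //= addrAC -actB; apply: flagD.
  by rewrite (dvd_act (flag_gen (ltn_ord t))) //; exact: flag0.
apply: flag_sum => u ut; have [tu|ut'] := ltnP t u.
  by rewrite (dvd_act (flag_gen (ltn_ord u))); [exact: flag0|exact: tri].
apply: flag_act; apply: flag_gen; rewrite ltn_neqAle ut' andbT.
by apply: contra ut => /eqP e; apply/eqP; exact: val_inj.
Qed.

Lemma flag_step (t : 'I_r) b y : pi %| mm t t - b -> flag t.+1 y -> flag t (s y - act Pt b y).
Proof.
move=> db [a [ha ->]]; rewrite endo_sum (act_sum iota chp) -sumrB; apply: flag_sum => l _.
have [tl|lt] := ltnP t l; first by rewrite ha // !act0 rmorph0 (act_0 iota chp) subr0; exact: flag0.
rewrite sact (actAC iota chp) -(act_sub iota chp); apply: flag_act.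
move: lt; rewrite leq_eqVlt => /orP [/eqP /val_inj ->|lt]; first exact: flag_diag.
apply: flagB; first by apply: flag_stable; exact: flag_gen.
by apply: flag_act; exact: flag_gen.
Qed.
End Stable.
End Spans.

Section FrobContra.
Variables (Fq : finFieldType) (p : nat) (Om : closedFieldType)
          (iota : {rmorphism {fraction {poly Fq}} -> Om}).
Hypotheses (chp : p \in [pchar Fq]).
Local Notation q := #|Fq|.
Local Notation iA := (iA iota).
Local Notation kc := (kc iota).
Local Notation ev := (@ev Fq Om).
Local Notation act := (act iota).
Local Notation tp := (tp iota).
Local Notation evq := (evq iota).
Implicit Types (a b : {poly Fq}) (y : Om).
Variables (Pt : {poly Om}) (R : nat) (lam : 'I_R.+1 -> Om) (pi ql : {poly Fq}) (x0 x : Om) (P : place Om)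
  (s : {rmorphism Om -> Om}) (k H0 : nat) (i j : 'I_R.+1 -> nat) (mm : 'I_R.+1 -> 'I_R.+1 -> {poly Fq}).
Local Notation r := R.+1.
Local Notation f := (pf P).
Let d := (size pi).-1.
Let m := (size ql).-1.
Let M := (m * k)%N.
Let N := (q ^ d).-1.
Hypotheses (ir : irreducible_poly pi) (r0 : evq pi x0 = 0) (irl : irreducible_poly ql)
  (rl : evq ql x = 0) (qP : qplace iota P x) (pix : evq pi x != 0)
  (OPt : Op P Pt) (sPt : size Pt = R.+2) (h0 : Pt`_0 = iA 'X) (lPt : punit P (lead_coef Pt))
  (sact : forall a y, s (act Pt a y) = act Pt a (s y))
  (sfr : forall y, pO P y -> pO P (s y) /\ f (s y) = f y ^+ (q ^ M))
  (k0 : (0 < k)%N)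
  (hlam : forall l, act Pt pi (lam l) = 0)
  (ind : forall a : 'I_r -> {poly Fq}, \sum_l act Pt (a l) (lam l) = 0 -> forall l, pi %| a l)
  (slam : forall l, s (lam l) = \sum_u act Pt (mm u l) (lam u))
  (tri : forall u l : 'I_r, (l < u)%N -> pi %| mm u l)
  (dia : forall l, pi %| mm l l - ql ^+ (k * i l))
  (jH : forall l, (j l <= H0)%N) (jmod : forall l, H0 * i l = j l %[mod N])
  (H0p : (p ^ r <= H0)%N) (small : (r * (M * H0) < d)%N)
  (pow : forall e e', H0 * e = H0 * e' %[mod N] -> evq ql x0 ^+ e = evq ql x0 ^+ e').

Local Notation fl := (flag iota Pt lam).
(** The scalar by which [s] acts on the Carlitz torsion; the diagonal entries of [s] are the powers
    [bet ^+ i l]. *)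
Let bet := ql ^+ k.
Let Pb := pfp P Pt.
Let m0 : (0 < m)%N. Proof. exact: (irr_d_gt0 chp irl). Qed.
Let M0 : (0 < M)%N. Proof. by rewrite muln_gt0 m0. Qed.
Let pi0 : pi != 0. Proof. exact: irredp_neq0. Qed.
Let ql0 : ql != 0. Proof. exact: irredp_neq0. Qed.
Let sz_bet e : size (bet ^+ e) = (M * e).+1.
Proof. by rewrite (polySpred (expf_neq0 e (expf_neq0 k ql0))) !size_exp. Qed.
Let sPb : size Pb = R.+2.
Proof.
apply/eqP; rewrite eqn_leq; apply/andP; split; first by rewrite -sPt size_poly.
rewrite ltnNge; apply/negP => le; have := lPt.2; rewrite lead_coefE sPt /= -coef_pfp.
by rewrite nth_default ?eqxx.
Qed.

Let flO t y : fl t y -> pO P y.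
Proof. by move=> h; apply: (tors_O chp qP OPt sPt lPt pi0 (flag_tors chp hlam h)). Qed.
Let flinj t y : fl t y -> f y = 0 -> y = 0.
Proof.
move=> h; apply: (tors_inj chp qP OPt h0 pix (flag_tors chp hlam h)); exact: (flO h).
Qed.
Let flinj2 y z : fl r y -> fl r z -> f y = f z -> y = z.
Proof.
move=> hy hz e; apply/eqP; rewrite -subr_eq0; apply/eqP; apply: (flinj (t := r)).
  exact: (flagB chp).
by rewrite pfB ?e ?subrr //; [exact: (flO hy)|exact: (flO hz)].
Qed.
Let fl_s t y : fl t y -> fl t (s y).
Proof. exact: (flag_stable chp hlam sact slam tri). Qed.
Let fl_step (t : 'I_r) y : fl t.+1 y -> fl t (s y - act Pt (bet ^+ i t) y).
Proof. by apply: (flag_step chp hlam sact slam tri); rewrite /bet -exprM. Qed.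
Let fl_iter t n y : fl t y -> fl t (iter n s y).
Proof. by move=> h; elim: n => // n IH; rewrite iterS; exact: fl_s. Qed.
Let step_iter (t : 'I_r) n y : fl t.+1 y -> fl t (iter n s y - act Pt (bet ^+ (n * i t)) y).
Proof.
move=> h; elim: n => [|n IH]; first by rewrite expr0 act1 subrr; exact: flag0.
rewrite iterS mulSn exprD (actM iota chp).
rewrite -[X in X - _](subrK (act Pt (bet ^+ i t) (iter n s y))) -addrA -(act_sub iota chp).
by apply: flagD; [apply: fl_step; exact: fl_iter|exact: (flag_act chp)].
Qed.
Let f_iter n y : pO P y -> pO P (iter n s y) /\ f (iter n s y) = f y ^+ (q ^ (M * n)).
Proof.
move=> Oy; elim: n => [|n [o1 o2]]; first by rewrite muln0 expn0 expr1.
by have [o3 o4] := sfr o1; rewrite iterS o4 o2 -exprM -expnD mulnS addnC.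
Qed.
Let evq_bet e e' : (e = e' %[mod N]) -> evq bet x0 ^+ e = evq bet x0 ^+ e'.
Proof.
move=> h; have u : ~~ (pi %| bet).
  apply/negP => dv; have b0 : bet != 0 by rewrite expf_neq0.
  have := dvdp_leq b0 dv; rewrite -[bet]expr1 sz_bet.
  by move: small; rewrite -/d => h1; have := irr_d_gt0 chp ir; rewrite -/d;
     have : (M * 1 <= r * (M * H0))%N; [rewrite muln1 mulnCA leq_pmulr // muln_gt0 /=; apply: leq_trans H0p; rewrite expn_gt0 prime_gt0 // (pcharf_prime chp)|rewrite /d; plia].
have := evq_unity chp ir r0 u; rewrite -/N => u1.
rewrite (divn_eq e N) (divn_eq e' N) h !exprD; congr (_ * _).
by rewrite ![(_ * N)%N]mulnC !exprM u1 !expr1n.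
Qed.
Let act_bet e e' y : fl r y -> evq bet x0 ^+ e = evq bet x0 ^+ e' -> act Pt (bet ^+ e) y = act Pt (bet ^+ e') y.
Proof. by move=> hy h; apply: (act_evq chp ir r0 (flag_tors chp hlam hy)); move: h; rewrite /bet !evqX. Qed.
Let step_H (t : 'I_r) y : fl t.+1 y -> fl t (iter H0 s y - act Pt (bet ^+ j t) y).
Proof.
move=> h; rewrite -(@act_bet (H0 * i t)) //; first exact: step_iter.
- exact: flag_le h.
- by apply: evq_bet; exact: jmod.
Qed.
Let f_act a y : pO P y -> f (act Pt a y) = act Pb a (f y).
Proof. by move=> Oy; have [] := pf_act chp qP a OPt Oy. Qed.

(** Compares [s^H0], which is a power of [tau] on reductions, with its eigenvalue on the graded
    piece [t], the large exponent [H0 i_t] being replaced by the small [j_t]. *)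
Let Ps (t : 'I_r) := 'X^(M * H0) - tp Pb (bet ^+ j t).
Let Ps_ev (t : 'I_r) y : fl t.+1 y -> exists z, fl t z /\ ev (Ps t) (f y) = f z.
Proof.
move=> h; exists (iter H0 s y - act Pt (bet ^+ j t) y); split; first exact: step_H.
have Oy := flO h; have [o1 o2] := f_iter H0 Oy.
have [o3 o4] := pf_act chp qP (bet ^+ j t) OPt Oy.
by rewrite pfB // o2 o4 /Ps evB evXn.
Qed.
Let roots_full (Q : {poly Om}) : Q != 0 -> (forall y, fl r y -> ev Q (f y) = 0) -> (r * d <= (size Q).-1)%N.
Proof.
move=> Q0 hQ; have [u1 s1] := flag_list_uniq chp ir r0 ind flinj2.
have hz z : z \in map f (flag_list iota Pt lam pi) -> ev Q z = 0.
  by case/mapP => y /flag_list_flag hy ->; exact: hQ.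
by have := ev_roots Q0 u1 hz; rewrite s1 leq_exp2l ?q_gt1 // mulnC.
Qed.

(** Were all [Ps t] nonzero, their product would have tau-degree at most [r (r M H0)], less than
    [r d], and yet kill the reductions of all [q^(r d)] torsion points. *)
Let ex_t : exists t, Ps t = 0.
Proof.
apply: contrapT => no; have nz t : Ps t != 0 by apply/eqP => e; apply: no; exists t.
have szP t : (size (Ps t) <= (r * (M * H0)).+1)%N.
  have b0 : bet ^+ j t != 0 by rewrite !expf_neq0.
  have [s1 _] := size_tp iota chp sPb b0.
  apply: leq_trans (size_polyD _ _) _; rewrite size_polyN size_polyXn s1 sz_bet /= geq_max !ltnS.
  by rewrite leq_pmull // leq_mul2l leq_mul2l jH !orbT.
have key n : (n <= r)%N -> exists Q : {poly Om}, [/\ Q != 0, (size Q <= (n * (r * (M * H0))).+1)%N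
    & forall y, fl n y -> ev Q (f y) = 0].
  elim: n => [|n IH] hn.
    exists 1; rewrite oner_neq0 size_poly1; split => // y /flag_0 ->.
    by rewrite pf0 (ev_0 iota chp).
  have [Q [Q0 sQ hQ]] := IH (ltnW hn); pose t := Ordinal hn.
  exists (tmul Fq Q (Ps t)); have [s1 _] := size_tmul iota chp Q0 (nz t); split.
  - exact: (tmul_neq0 iota chp Q0 (nz t)).
  - have nat_le (a b c e : nat) : (a <= c.+1 -> b <= e.+1 -> (a + b).-1 <= (e + c).+1)%N by lia.
    by rewrite s1 mulSn; exact: nat_le sQ (szP t).
  - move=> y hy; rewrite (ev_tmul iota chp); have [z [hz ->]] := Ps_ev (t := t) hy.
    exact: hQ.
have [Q [Q0 sQ hQ]] := key r (leqnn _).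
have := roots_full Q0 hQ => le.
have : (r * d <= r * (r * (M * H0)))%N by apply: leq_trans le _; move: sQ; case: (size Q).
by rewrite leq_pmul2l // leqNgt small.
Qed.

(** From [tau^(M n) = phi_gam] with [n = p^r], raising to the power [H0] gives
    [gam^H0 = bet^(j_t n)]. The multiplicity [e] of [ql] in [gam] then satisfies [e H0 = k j_t n],
    and [H0 = r j_t] turns this into [e r = k p^r]. *)
Theorem frob_contra : (r %| k * p ^ r)%N.
Proof.
have [t Pt0] := ex_t.
have eqX : 'X^(M * H0) = tp Pb (bet ^+ j t) by apply/eqP; rewrite -subr_eq0; apply/eqP.
have H0_gt0 : (0 < H0)%N.
  by apply: leq_trans H0p; rewrite expn_gt0 prime_gt0 // (pcharf_prime chp).
have eH : H0 = (r * j t)%N.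
  have b0 : bet ^+ j t != 0 by rewrite !expf_neq0.
  have [s1 _] := size_tp iota chp sPb b0.
  have := congr1 (fun Q : {poly Om} => size Q) eqX; rewrite size_polyXn s1 sz_bet /= => -[].
  by rewrite mulnCA => /eqP; rewrite eqn_pmul2l // => /eqP.
have ract y : act Pb (bet ^+ j t) y = y ^+ (q ^ (M * H0)) by rewrite actE -eqX evXn.
have itH y : fl r y -> iter H0 s y = act Pt (bet ^+ j t) y.
  move=> hy; have Oy := flO hy; apply: flinj2; [exact: fl_iter|exact: (flag_act chp)|].
  by rewrite f_act // ract (f_iter H0 Oy).2.
(* Both powers of [bet] have degree less than [d], so congruence modulo [pi] forces equality. *)
have ej l : j l = j t.
  have hl : fl l (act Pt (bet ^+ j t - bet ^+ j l) (lam l)).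
    have hl := flag_gen iota Pt lam (leqnn l.+1).
    by rewrite actB -itH; [exact: step_H|apply: flag_gen; exact: ltn_ord].
  have := flag_ind ind hl => dv.
  have e : bet ^+ j t = bet ^+ j l.
    apply/eqP; rewrite -subr_eq0; apply: contraTT dv => nz; apply/negP => /(dvdp_leq nz) le.
    have h e' : (e' <= H0)%N -> (size (bet ^+ e') <= d)%N.
      move=> he; rewrite sz_bet; apply: leq_trans small; rewrite ltnS.
      by apply: leq_trans (leq_pmull _ _) => //; rewrite leq_mul2l he orbT.
    have : (size (bet ^+ j t - bet ^+ j l)%R <= d)%N.
      by apply: leq_trans (size_polyD _ _) _; rewrite size_polyN geq_max !h // jH.
    by move=> le2; have := leq_trans le le2; rewrite /d; have := irr_d_gt0 chp ir; case: (size pi) => // n; rewrite /= ltnn.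
  have := congr1 (fun Q : {poly Fq} => size Q) e; rewrite !sz_bet => -[] /eqP.
  by rewrite eqn_pmul2l // => /eqP.
pose g0 := bet ^+ i t; pose n := (p ^ r)%N.
(* Here the power residue hypothesis [pow] turns the congruence of [H0 i_l] and [H0 i_t] into
   equality of the eigenvalues themselves. *)
have eg l : evq bet x0 ^+ i l = evq bet x0 ^+ i t.
  rewrite /bet evqX -!exprM ![(k * _)%N]mulnC !exprM; congr (_ ^+ _); apply: pow.
  by rewrite !jmod ej.
have stepL l y : fl l.+1 y -> fl l (s y - act Pt g0 y).
  have [le|lt] := leqP r l.
    move=> hy; have hr : fl r y by apply: flag_all hy; exact: leqW.
    apply: (flag_le le); apply: (flagB chp); first exact: fl_s.
    exact: (flag_act chp).
  move=> hy; rewrite /g0 -(@act_bet (i (Ordinal lt))) ?eg //; last exact: flag_le hy.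
  by apply: (fl_step (t := Ordinal lt)).
have nil l y : fl l y -> iter l (fun z => s z - act Pt g0 z) y = 0.
  elim: l y => [|l IH] y hy; first exact: flag_0 hy.
  by rewrite iterSr; apply: IH; exact: stepL.
have nr : (r <= n)%N by apply: ltnW; apply: ltn_expl; exact: prime_gt1 (pcharf_prime chp).
have itn y : fl r y -> iter n s y = act Pt (g0 ^+ n) y.
  move=> hy; apply/eqP; rewrite -subr_eq0 -(frob_unip chp sact); apply/eqP; apply: nil.
  exact: flag_le nr hy.
pose gam := (g0 ^+ n) %% pi.
have sgam : (size gam <= d)%N.
  have := ltn_modp (g0 ^+ n) pi; rewrite pi0 -/gam /d; case: (size pi) => //.
have egam y : fl r y -> act Pt (g0 ^+ n) y = act Pt gam y.
  move=> hy; apply/eqP; rewrite -subr_eq0 -actB; apply/eqP; apply: (dvd_act chp hlam hy).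
  by rewrite {1}(divp_eq (g0 ^+ n) pi) addrK dvdp_mull.
(* [gam] is reduced modulo [pi], so both tau-degrees are below [r d] and agreement on the torsion
   decides. *)
have eqG : 'X^(M * n) = tp Pb gam.
  apply/eqP; rewrite -subr_eq0; apply: contraT => nz.
  have hz y : fl r y -> ev ('X^(M * n) - tp Pb gam) (f y) = 0.
    move=> hy; have Oy := flO hy.
    rewrite evB evXn -(f_iter n Oy).2 (itn _ hy) (egam _ hy) f_act // actE subrr //.
  have := roots_full nz hz.
  have b1 : (size (tp Pb gam) <= (r * d.-1).+1)%N.
    have [->|gn0] := eqVneq gam 0; first by rewrite tp0 size_poly0.
    have [-> _] := size_tp iota chp sPb gn0.
    by rewrite ltnS leq_mul2l /= -!subn1 leq_sub2r.
  have d0 : (0 < d)%N := irr_d_gt0 chp ir.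
  have b2 : (size ('X^(M * n) : {poly Om}) <= r * d)%N.
    rewrite size_polyXn; apply: leq_trans (leq_pmull d (ltn0Sn R)); apply: leq_trans small; rewrite ltnS.
    by apply: leq_trans (leq_pmull _ _) => //; rewrite leq_mul2l H0p orbT.
  have b3 : ((r * d.-1).+1 <= r * d)%N by case: (d) d0 => // d' _; rewrite /= mulnS addSn ltnS leq_addl.
  have : (size ('X^(M * n) - tp Pb gam)%R <= r * d)%N.
    by apply: leq_trans (size_polyD _ _) _; rewrite size_polyN geq_max b2 (leq_trans b1).
  have : (0 < r * d)%N by rewrite muln_gt0 d0.
  by move: (size _) (r * d)%N => z1 z2; case: z1 => [|z1] /= h1 h2 h3; move: h1 h2 h3; rewrite ?ltnNge; lia.
have gact e y : act Pb (gam ^+ e) y = y ^+ (q ^ (M * n * e)).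
  elim: e => [|e IH]; first by rewrite expr0 act1 muln0 expn0 expr1.
  rewrite exprS (actM iota chp) IH actE -eqG evXn -exprM -expnD; congr (_ ^+ (_ ^ _)).
  by rewrite mulnS addnC.
have bact e y : act Pb (bet ^+ (j t * e)) y = y ^+ (q ^ (M * H0 * e)).
  elim: e => [|e IH]; first by rewrite muln0 expr0 act1 muln0 expn0 expr1.
  rewrite mulnS exprD (actM iota chp) IH ract -exprM -expnD; congr (_ ^+ (_ ^ _)).
  by rewrite mulnS addnC.
have eGB : gam ^+ H0 = bet ^+ (j t * n).
  apply/eqP; rewrite -subr_eq0; apply: contraT => nz.
  have [sz _] := size_tp iota chp sPb nz.
  have e : tp Pb (gam ^+ H0 - bet ^+ (j t * n)) = 0.
    have hy y : ev (tp Pb (gam ^+ H0 - bet ^+ (j t * n))) y = ev 0 y.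
      by rewrite -actE actB gact bact ev0 mulnAC subrr.
    exact: (ev_inj iota hy).
  by move: sz; rewrite e size_poly0.
have gn0 : gam != 0.
  by apply/eqP => e; move: eqG; rewrite e tp0 => /eqP; rewrite -size_poly_eq0 size_polyXn.
have [e [c [ec nc]]] := mult_decomp chp irl gn0.
have nc' : ~~ (ql %| c ^+ H0).
  elim: (H0) => [|h IH]; first by rewrite expr0 dvdp1; have := m0; rewrite /m; case: (size ql) => [|[]].
  by rewrite exprS; apply/negP => /(irred_mul irl) /orP [] h1; [rewrite h1 in nc|rewrite h1 in IH].
have eE : (e * H0 = k * (j t * n))%N.
  move: eGB; rewrite ec exprMn /bet -!exprM; set A := (e * H0)%N; set B := (k * _)%N => E1.
  case: (ltngtP A B) => // lt.
  - move: E1; rewrite -(subnKC lt) addSn -addnS exprD => /(mulfI (expf_neq0 _ ql0)) E1.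
    by move: nc'; rewrite E1 exprS dvdp_mulr.
  - have : ql %| 1.
      move: E1; rewrite -(subnKC lt) addSn -addnS exprD -mulrA -[X in _ = X]mulr1 => /(mulfI (expf_neq0 _ ql0)) <-.
      by rewrite exprS -mulrA dvdp_mulr.
    by rewrite dvdp1; have := m0; rewrite /m; case: (size ql) => [|[]].
have jt0 : (0 < j t)%N by move: H0_gt0; rewrite eH muln_gt0 => /andP [].
have e1 : (e * r * j t = k * p ^ r * j t)%N by rewrite -mulnA -eH eE -/n mulnA mulnAC.
by apply/dvdnP; exists e; apply/eqP; rewrite -(eqn_pmul2r jt0) e1.
Qed.
End FrobContra.

Lemma w_exprz (Om : fieldType) (P : place Om) (w : Om -> rat) y (b : int) :
  valn P w -> y != 0 -> w (y ^ b) = b%:~R * w y.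
Proof.
move=> hw y0; case: b => n; first by rewrite -exprnP (wX hw) // -mulr_natl pmulrn.
have e : y ^ Negz n = (y ^+ n.+1)^-1 by [].
by rewrite e (wV hw) ?expf_neq0 // (wX hw) // NegzE rmorphN mulNr -[w y *+ _]mulr_natl.
Qed.

(** * Good reduction above a small prime *)

Section Normalize.
Variables (Fq : finFieldType) (Om : closedFieldType)
          (iota : {rmorphism {fraction {poly Fq}} -> Om}).
Local Notation iA := (iA iota).
Variables (K : sfield Om) (P : place Om) (w : Om -> rat) (e0 : nat) (x : Om) (ql : {poly Fq}).
Hypotheses (KF : forall y, Fsf iota y -> K y) (hw : valn P w) (e0_gt0 : (0 < e0)%N)
  (hK : forall y, K y -> y != 0 -> exists a : int, e0%:R * w y = a%:~R)
  (qP : qplace iota P x) (ql0 : ql != 0) (wql : w (iA ql) = 1).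

(** [D1] quantifies over integer valuations attaining 1 on [K]. The least positive value of [e0 w]
    on [K] generates the value group, by division with remainder, and dividing by it normalises
    [w]. *)
Lemma normalized_place : exists (v : Om -> int) (c : rat),
  [/\ 0 < c, forall y, K y -> y != 0 -> (v y)%:~R = c * w y & finite_place iota K v].
Proof.
have iq0 : iA ql != 0 by rewrite iA_eq0.
pose vals n := (0 < n)%N && `[< exists y, [/\ K y, y != 0 & e0%:R * w y = n%:R] >].
have exv : exists n, vals n.
  exists e0; rewrite /vals e0_gt0 /=; apply/asboolP; exists (iA ql); split => //.
    by apply: KF; exact: F_iA.
  by rewrite wql mulr1.
case: (ex_minnP exv) => n0 /andP [n0_gt0 /asboolP [y0 [Ky0 y00 ey0]]] nmin.
have n0R : n0%:R != 0 :> rat by rewrite pnatr_eq0 -lt0n.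
have e0R : e0%:R != 0 :> rat by rewrite pnatr_eq0 -lt0n.
have Kz (b : int) : K (y0 ^ b).
  by case: b => n; [apply: sfX|rewrite -[y0 ^ _]/((y0 ^+ n.+1)^-1); apply: sfV; apply: sfX].
have dv y : K y -> y != 0 -> exists b : int, e0%:R * w y = b%:~R * n0%:R.
  move=> Ky yn; have [a ea] := hK Ky yn.
  exists (a %/ n0%:Z)%Z; set b := (a %/ n0%:Z)%Z; set rr := (a %% n0%:Z)%Z.
  have ab : a = b * n0%:Z + rr := divz_eq a n0%:Z.
  have r0 : 0 <= rr by apply: modz_ge0; rewrite eqz_nat -lt0n.
  have rlt : rr < n0%:Z by rewrite ltz_pmod.
  have zb : y0 ^ (- b) != 0 by rewrite expfz_neq0.
  have wy : e0%:R * w (y * y0 ^ (- b)) = rr%:~R.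
    rewrite (wM hw) // (w_exprz _ hw) // mulrDr ea mulrCA ey0 ab rmorphN rmorphD rmorphM /= -pmulrn; ring.
  case: rr r0 rlt wy ab => [[|rn]|//] _ rlt wy ab.
    by rewrite ea ab addr0 rmorphM /= -pmulrn.
  have : vals rn.+1.
    rewrite /vals /=; apply/asboolP; exists (y * y0 ^ (- b)); split => //.
      exact: sfM.
    by rewrite mulf_neq0.
  by move/nmin; rewrite leqNgt -ltz_nat rlt.
pose c : rat := e0%:R / n0%:R.
have cpos : 0 < c by rewrite divr_gt0 ?ltr0n.
pose v y := Num.floor (c * w y).
have ev y : K y -> y != 0 -> (v y)%:~R = c * w y.
  move=> Ky yn; have [b eb] := dv y Ky yn.
  have -> : c * w y = b%:~R by rewrite /c mulrAC eb mulfK.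
  by rewrite /v /c mulrAC eb mulfK // intrKfloor.
exists v, c; split => //; split.
- move=> y z Ky Kz' yn zn; apply: (intr_inj (R := rat)).
  by rewrite rmorphD /= !ev ?mulf_neq0 ?(wM hw) ?mulrDr //; exact: sfM.
- move=> y z Ky Kz' yn zn yz.
  have Kyz := sfD Ky Kz'.
  rewrite -(ler_int rat) ev //.
  have [le|lt] := leP (w y) (w z).
    have h : w y <= w (y + z).
      rewrite (wle hw) // mulrDl divff //; apply: pOD; [exact: pO1|exact/(wle hw)].
    by apply: le_trans (_ : (v y)%:~R <= _); [rewrite ler_int ge_min lexx|rewrite ev // ler_pM2l].
  have h : w z <= w (y + z).
    rewrite (wle hw) // mulrDl divff //; apply: pOD; [apply/(wle hw) => //; exact: ltW|exact: pO1].
  by apply: le_trans (_ : (v z)%:~R <= _); [rewrite ler_int ge_min lexx orbT|rewrite ev // ler_pM2l].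
- exists y0; split => //; apply: (intr_inj (R := rat)); rewrite ev // /c mulrAC ey0 divff //.
- move=> a a0; have ia0 : iA a != 0 by rewrite iA_eq0.
  rewrite -(ler_int rat) ev; [|by apply: KF; exact: F_iA|by []].
  apply: mulr_ge0; first exact: ltW.
  by apply/(wO hw) => //; exact: (qP a).1.
Qed.
End Normalize.

Section SmallPrime.
Variables (Fq : finFieldType) (p : nat) (Om : closedFieldType)
          (iota : {rmorphism {fraction {poly Fq}} -> Om}).
Hypotheses (chp : p \in [pchar Fq]) (ac : is_alg_closure iota).
Local Notation q := #|Fq|.
Local Notation iA := (iA iota).
Local Notation kc := (kc iota).
Local Notation ev := (@ev Fq Om).
Local Notation act := (act iota).
Local Notation evq := (evq iota).
Local Notation cP := (cP iota).
Variables (K : sfield Om) (e0 : nat) (R : nat) (c : seq Om) (pi : {poly Fq}) (x0 : Om).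
Hypotheses (aK : algo K) (KF : forall y, Fsf iota y -> K y) (e0_gt0 : (0 < e0)%N)
  (hden : forall P w, valn P w -> (forall c, Fsf iota c -> c != 0 -> exists a : int, w c = a%:~R) ->
     forall y, K y -> y != 0 -> exists a : int, e0%:R * w y = a%:~R)
  (ir : irreducible_poly pi) (r0 : evq pi x0 = 0).
Local Notation r := R.+1.
Hypotheses (hdr : is_drinfeld K r c) (hD1 : D1 iota K c pi) (hD2 : D2 iota K r c pi).
Let d := (size pi).-1.
Let N := (q ^ d).-1.
Let H0 := ((q ^ r)`! * e0)%N.
Let Pt := Poly (iA 'X :: c).
Let Kc' b : K (kc b). Proof. by apply: KF; exact: F_iA. Qed.
Let KT : K (iA 'X). Proof. by apply: KF; exact: F_iA. Qed.
Let sc : size c = r. Proof. by case: hdr. Qed.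
Let lc : last 0 c != 0. Proof. by case: hdr. Qed.
Let Pt_seq : Pt = (iA 'X :: c) :> seq Om.
Proof.
apply: (@PolyK _ 0); rewrite /=.
by case: (c) lc sc => [|y c'] //=.
Qed.
Let sPt : size Pt = R.+2. Proof. by rewrite Pt_seq /= sc. Qed.
Let h0 : Pt`_0 = iA 'X. Proof. by rewrite Pt_seq. Qed.
Let KPt : Lp K Pt.
Proof.
move=> k; rewrite Pt_seq; case: k => [|k] //=.
have [lt|le] := ltnP k (size c); last by rewrite nth_default //; exact: sf0.
by case: hdr => _ h _; apply: h; exact: mem_nth.
Qed.
Let pi0 : pi != 0. Proof. exact: irredp_neq0. Qed.

(** [pi] is a unit at the place, so [D1] applies to the normalised valuation of [K]. *)
Lemma good_twist ql x P : irreducible_poly ql -> evq ql x = 0 -> qplace iota P x -> evq pi x != 0 ->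
  exists u, [/\ K u, u != 0, Op P (tscale Fq u^-1 Pt) & punit P (lead_coef (tscale Fq u^-1 Pt))].
Proof.
move=> irl rl qP pix; have ql0 : ql != 0 by exact: irredp_neq0.
have [w [hw wql wF]] := qplace_val chp ac irl rl qP.
have [v [cc [c0 ev fp]]] := normalized_place KF hw e0_gt0 (hden hw wF) qP ql0 wql.
have ip0 : iA pi != 0 by rewrite iA_eq0.
have nv : ~ (0 < v (iA pi)).
  have up : punit P (iA pi) by split; [exact: (qP pi).1|rewrite (qP pi).2].
  move=> h; have : 0 < (v (iA pi))%:~R :> rat by rewrite ltr0z.
  by rewrite ev ?((wU hw ip0).1 up) ?mulr0 ?ltxx //; apply: KF; exact: F_iA.
have [u [Ku u0 hi hl]] := hD1 fp nv.
have vO y : K y -> v_integral v y -> pO P y.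
  move=> Ky; have [->|yn] := eqVneq y 0; first by move=> _; exact: pO0.
  case=> [/eqP|]; first by rewrite (negPf yn).
  rewrite -(ler_int rat) ev // => h; apply/(wO hw yn); by rewrite -(pmulr_rge0 _ c0).
have ek k : (tscale Fq u^-1 Pt)`_k.+1 = u * c`_k * u^-1 ^+ (qq Fq ^ k.+1).
  by rewrite coef_tscale Pt_seq /= invrK; ring.
have Kck k : K (u * c`_k * u^-1 ^+ (qq Fq ^ k.+1)).
  rewrite -ek coef_tscale; apply: sfM; last by rewrite invrK.
  by apply: sfM; [exact: KPt|apply: sfX; exact: sfV].
exists u; split => //.
- case=> [|k].
    by rewrite coef_tscale h0 expn0 expr1 mulfK ?invr_eq0 //; exact: (qP 'X).1.
  rewrite ek; have [lt|le] := ltnP k (size c); first by apply: vO => //; exact: hi.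
  by rewrite [c`_k]nth_default // mulr0 mul0r; exact: pO0.
- have ul : u * last 0 c * u^-1 ^+ (qq Fq ^ size c) != 0.
    by rewrite !mulf_neq0 ?expf_neq0 ?invr_eq0.
  have el : u * last 0 c * u^-1 ^+ (qq Fq ^ size c) = (tscale Fq u^-1 Pt)`_R.+1.
    by rewrite ek -nth_last sc.
  have sz : size (tscale Fq u^-1 Pt) = R.+2.
    rewrite /tscale -sPt; apply: size_poly_eq; rewrite sPt /= -coef_tscale -el //.
  rewrite lead_coefE sz /= -el; apply/(wU hw ul).
  have := congr1 (fun z : int => z%:~R : rat) hl; rewrite ev //; last by rewrite el ek.
  by move/eqP; rewrite mulf_eq0 gt_eqF //= => /eqP.
Qed.

Let act_phi a y : phi_a iota c a y = act Pt a y. Proof. exact: (phi_act iota chp). Qed.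
Let act_car a y : phi_a iota (carlitz Om) a y = act cP a y. Proof. exact: (phi_act iota chp). Qed.

Theorem small_prime_dvd ql x P (s : {rmorphism Om -> Om}) k :
  irreducible_poly ql -> ql \is monic -> evq ql x = 0 -> qplace iota P x ->
  autL K s -> (0 < k)%N ->
  (forall y, pO P y -> pO P (s y) /\ pf P (s y) = pf P y ^+ (q ^ ((size ql).-1 * k))) ->
  (r * ((size ql).-1 * k * H0) < d)%N -> (p ^ r <= H0)%N ->
  (forall e e', H0 * e = H0 * e' %[mod N] -> evq ql x0 ^+ e = evq ql x0 ^+ e') ->
  (r %| k * p ^ r)%N.
Proof.
move=> irl ml rl qP hs k0 sfr small pH pow.
case: hD2 => i [_ [lam [hlam' _ ind' hG']]].
have hlam l : act Pt pi (lam l) = 0 by rewrite -act_phi.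
have ind : forall a : 'I_r -> {poly Fq}, \sum_l act Pt (a l) (lam l) = 0 -> forall l, pi %| a l.
  by move=> a e; apply: ind'; under eq_bigr do rewrite act_phi.
have hG t : autL K t -> exists b, (forall mu, act cP pi mu = 0 -> t mu = act cP b mu) /\
   exists m : 'I_r -> 'I_r -> {poly Fq}, [/\ forall l, t (lam l) = \sum_u act Pt (m u l) (lam u),
     forall u l : 'I_r, (l < u)%N -> pi %| m u l & forall l, pi %| m l l - b ^+ i l].
  move=> ht; have [b [hb [m [m1 m2 m3]]]] := hG' t ht.
  exists b; split; first by move=> mu; rewrite -!act_car; exact: hb.
  exists m; split => // l; rewrite m1; by under eq_bigr do rewrite act_phi.
have [P0 kP0] := kplace_ex (kap_x0 chp ir r0).
have qP0 := kplace_q kP0.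
have [w0 [hw0 wpi wF]] := qplace_val chp ac ir r0 qP0.
have [mu [mu0 hmu _ _ _]] := carlitz_tors chp ir r0 qP0.
(* Modulo the first [t] vectors of the flag, the image of [lam t] spans a Galois-stable line in the
   torsion of the quotient module, with character the [i t]-th power; [local_bound] applies to
   it. *)
have jex t : exists2 j, (j <= H0)%N & H0 * i t = j %[mod N].
  pose ws := [seq y <- flag_list iota Pt lam pi | `[< flag iota Pt lam t y >]].
  have wsP y : y \in ws <-> flag iota Pt lam t y.
    rewrite mem_filter; split; first by case/andP => /asboolP.
    by move=> h; rewrite (flag_list_mem chp ir hlam h) andbT; apply/asboolP.
  have [e [psi [Ke ker Kpsi spsi [psi0 epsi]]]] : exists e psi, [/\ Lp K e, forall y, ev e y = 0 <-> y \in ws,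
      Lp K psi, size psi = R.+2 & psi`_0 = Pt`_0 /\ forall a y, ev e (act Pt a y) = act psi a (ev e y)].
    apply: (quotient_ex chp aK Kc' KPt sPt).
    - by move=> y /wsP hy; apply: (tors_sep chp Kc' KPt h0 pi0 (flag_tors chp hlam hy)).
    - by apply/wsP; exact: flag0.
    - move=> b y z /wsP hy /wsP hz; apply/wsP; apply: flagD => //.
      by rewrite -(actC iota Pt); exact: (flag_act chp).
    - by move=> y /wsP hy; apply/wsP; rewrite -(actX iota chp); exact: (flag_act chp).
    - move=> g hg y /wsP hy; apply/wsP.
      have [b [_ [m [m1 m2 _]]]] := hG g hg.
      apply: (flag_stable chp hlam _ m1 m2 hy) => a z; exact: (aut_act chp a z Kc' KPt hg).
  have kerP y : ev e y = 0 <-> flag iota Pt lam t y by rewrite ker; exact: wsP.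
  have z0 : ev e (lam t) != 0.
    apply/eqP => /kerP h; have := @flag_ind _ _ _ _ _ _ _ ind t 1; rewrite act1 => /(_ h).
    rewrite dvdp1 => /eqP s1; have := irr_d_gt0 chp ir; by rewrite s1.
  apply: (local_bound (z := ev e (lam t)) chp aK KF ir r0 qP0 hw0 wpi e0_gt0 (hden hw0 wF) Kpsi spsi) => //.
  - by rewrite psi0.
  - by rewrite -epsi hlam (ev_0 iota chp).
  - move=> g hg; have [b [hb [m [m1 m2 m3]]]] := hG g hg.
    exists b; split => //.
    have -> : g (ev e (lam t)) = ev e (g (lam t)).
      by rewrite map_ev; congr (ev _ _); apply/polyP => u; rewrite coef_endo hg.2.
    rewrite -epsi; apply/eqP; rewrite -subr_eq0 -(ev_subx iota chp); apply/eqP/kerP.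
    exact: (flag_diag chp hlam m1 m2 (m3 t)).
have jex' t : exists n, (n <= H0)%N /\ H0 * i t = n %[mod N] by case: (jex t) => n; exists n.
have [j jP] := choice jex'.
have d0 : (0 < d)%N := irr_d_gt0 chp ir.
have H0_gt0 : (0 < H0)%N by rewrite muln_gt0 fact_gt0.
have ql0 : ql != 0 by exact: irredp_neq0.
have ml_d : ((size ql).-1 < d)%N.
  apply: leq_ltn_trans small; move: H0_gt0; generalize H0 => h hp.
  by rewrite mulnC -!mulnA leq_pmulr // !muln_gt0 k0 hp.
have pix : evq pi x != 0.
  apply/eqP => /(evq_eq0 irl rl) dv.
  have /andP [_ dv'] : (ql %= pi) by apply: ir.2 => //; have := irr_d_gt0 chp irl; case: (size ql) => [|[]].
  have := dvdp_leq ql0 dv'; move: ml_d d0; rewrite /d; plia.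
have [u [Ku u0 Ophi lphi]] := good_twist irl rl qP pix.
set phi := tscale Fq u^-1 Pt in Ophi lphi *.
have ui0 : u^-1 != 0 by rewrite invr_eq0.
have aphi a y : act phi a (u * y) = u * act Pt a y.
  by rewrite (act_tscale iota chp) // mulKf // invrK mulrC.
have Kphi : Lp K phi.
  move=> l; rewrite coef_tscale; apply: sfM; last by rewrite invrK.
  by apply: sfM; [exact: KPt|apply: sfX; exact: sfV].
have sphi : size phi = R.+2.
  rewrite /phi /tscale -sPt; apply: size_poly_eq; rewrite -lead_coefE !mulf_neq0 ?invr_eq0 ?expf_neq0 //.
  by rewrite lead_coef_eq0 -size_poly_gt0 sPt.
have hphi0 : phi`_0 = iA 'X by rewrite coef_tscale h0 expn0 expr1 mulfK.
have [b [hb [m [m1 m2 m3]]]] := hG s hs.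
have Omu : pO P mu.
  by apply: (tors_O chp qP (OpcP qP) (size_cP iota) _ pi0 hmu); rewrite lead_cP; exact: punit1.
have frk n : pO P (act cP (ql ^+ n) mu) /\ pf P (act cP (ql ^+ n) mu) = pf P mu ^+ (q ^ ((size ql).-1 * n)).
  elim: n => [|n [o1 o2]]; first by rewrite expr0 act1 muln0 expn0 expr1.
  have [o3 o4] := carlitz_frob chp irl rl qP ml o1.
  by rewrite exprS (actM iota chp) o4 o2 -exprM -expnD mulnS addnC.
(* [b] and [ql^k] act on [mu] with the same reduction at the place above [ql], and reduction is
   injective on [pi]-torsion. *)
have eb : act cP (b - ql ^+ k) mu = 0.
  have [o1 o2] := frk k; have [o3 o4] := sfr mu Omu.
  rewrite actB -hb //; apply: (tors_inj chp qP (OpcP qP) (cP0 iota) pix).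
  - rewrite (act_sub iota chp) (actAC iota chp) hmu (act_0 iota chp) subr0.
    by rewrite -(aut_act chp _ _ Kc' (LpcP KT) hs) hmu rmorph0.
  - exact: pOB.
  - by rewrite pfB // o2 o4 subrr.
have db : pi %| b - ql ^+ k.
  apply: contraT => nd; have := evq_unity chp ir r0 nd; rewrite -/d -evqX => e1.
  have : act cP ((b - ql ^+ k) ^+ (q ^ d).-1) mu = mu.
    by rewrite (act_evq chp ir r0 hmu (b := 1)) ?act1 // evq1.
  rewrite -(prednK (N_gt0 chp ir)) exprSr (actM iota chp) eb (act_0 iota chp) => /esym/eqP.
  by rewrite (negPf mu0).
have ebq : evq b x0 = evq (ql ^+ k) x0.
  by apply/eqP; rewrite -subr_eq0 -evqB; apply/eqP/(evq_eq0 ir r0).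
apply: (@frob_contra _ _ _ _ chp phi R (fun l => u * lam l) pi ql x0 x P s k H0 i j m
   ir r0 irl qP pix Ophi sphi hphi0 lphi) => //.
- by move=> a y; exact: (aut_act chp a y Kc' Kphi hs).
- by move=> l; rewrite aphi hlam mulr0.
- move=> a; under eq_bigr do rewrite aphi; rewrite -mulr_sumr => /eqP.
  by rewrite mulf_eq0 (negPf u0) => /eqP; exact: ind.
- move=> l; rewrite endoM hs.2 // m1 mulr_sumr; by apply: eq_bigr => t _; rewrite aphi.
- move=> l; apply/(evq_eq0 ir r0); rewrite evqB exprM evqX -ebq -evqX -evqB.
  exact/(evq_eq0 ir r0).
- by move=> l; case: (jP l).
- by move=> l; case: (jP l).
Qed.
End SmallPrime.

(** * The constant field extension *)

Section Constants.
Variables (Fq : finFieldType) (p : nat) (Om : closedFieldType)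
          (iota : {rmorphism {fraction {poly Fq}} -> Om}).
Hypotheses (chp : p \in [pchar Fq]) (ac : is_alg_closure iota).
Local Notation q := #|Fq|.
Local Notation iA := (iA iota).
Local Notation T := (iA 'X).
Local Notation kc := (kc iota).
Local Notation kcm := (kcm iota).
Local Notation kap := (kap iota chp).
Local Notation evq := (evq iota).
Implicit Types (x y c : Om) (a b G : {poly Om}).
Let q1 : (1 < q)%N := q_gt1 Fq.

Lemma kap_seq (s : seq Om) : (forall x, x \in s -> kap x) ->
  exists2 e, (0 < e)%N & forall x, x \in s -> x ^+ (q ^ e) = x.
Proof.
elim: s => [|y s IH] h; first by exists 1%N.
have [e e0 he] := IH (fun x xs => h x (mem_behead (s := y :: s) xs)).
have [k k0 hk] := h y (mem_head _ _).
exists (k * e)%N; first by rewrite muln_gt0 k0.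
move=> x; rewrite inE => /orP [/eqP ->|/he hx]; first exact: (Fr_iter _ hk).
by rewrite mulnC; exact: (Fr_iter _ hx).
Qed.

Lemma kap_poly a : Lp kap a -> exists2 e, (0 < e)%N & forall i, a`_i ^+ (q ^ e) = a`_i.
Proof.
move=> ka; have h x : x \in (a : seq Om) -> kap x by move=> /(nthP 0) [i _ <-]; exact: ka.
have [e e0 he] := kap_seq h; exists e => // i.
have [lt|le] := ltnP i (size a); first by apply: he; exact: mem_nth.
by rewrite nth_default // expr0n gtn_eqF // expn_gt0 ltnW.
Qed.

(** A power of Frobenius fixing the coefficients maps roots of [a] to roots; these are finitely
    many, so its iterates on [x] repeat. *)
Lemma kap_closed a x : a != 0 -> Lp kap a -> root a x -> kap x.
Proof.
move=> a0 ka rx; have [e e0 he] := kap_poly ka.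
pose y i := x ^+ (q ^ (e * i)).
have ry i : root a (y i).
  elim: i => [|i IH]; first by rewrite /y muln0 expn0 expr1.
  rewrite /y mulnS addnC expnD exprM -/(y i) /root.
  have -> : a.[y i ^+ (q ^ e)] = a.[y i] ^+ (q ^ e).
    rewrite !horner_coef (Fr_sum iota chp); apply: eq_bigr => k _.
    by rewrite exprMn he exprAC.
  by rewrite (rootP IH) (Fr0 iota chp).
have [i [j [lt eij]]] : exists i j, (i < j)%N /\ y i = y j.
  apply: contrapT => no.
  have u : uniq (mkseq y (size a)).
    rewrite map_inj_uniq ?iota_uniq // => i j eij; apply: contrapT => nij.
    by case: (ltngtP i j) => lt; [apply: no; exists i, j|apply: no; exists j, i|].
  have := max_poly_roots a0 _ u; rewrite size_mkseq ltnn => H.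
  by have : false; [apply: H; apply/allP => _ /mapP [i _ ->]; exact: ry|].
exists (e * (j - i))%N; first by rewrite muln_gt0 e0 subn_gt0.
apply: (Fr_inj iota chp (k := (e * i)%N)); rewrite /= -exprM -expnD -mulnDr subnK ?(ltnW lt) //.
Qed.

Lemma frob_list n : (0 < n)%N -> exists s : seq Om, [/\ uniq s, size s = (q ^ n)%N
  & forall x, x \in s <-> x ^+ (q ^ n) = x].
Proof.
move=> n0; pose e : {poly Om} := 'X^n - 1.
have e0 : e`_0 != 0 by rewrite coefB coefXn coef1 ltn_eqF // sub0r oppr_eq0 oner_neq0.
have sz : size e = n.+1 by rewrite size_polyDl size_polyXn // size_polyN size_poly1 ltnS.
have ne0 : e != 0 by rewrite -size_poly_gt0 sz.
have [s [us szs hs]] := size_ker iota chp e0 ne0; rewrite sz /= in szs.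
have he x : x \in s -> x ^+ (q ^ n) = x.
  by move/hs; rewrite evB evXn ev1 => /eqP; rewrite subr_eq0 => /eqP.
exists s; split => // x; split; first exact: he.
move=> hx; apply: contrapT => /negP nx.
have u : uniq (x :: s) by rewrite /= nx.
have h1 y : y \in x :: s -> ev Fq e y = 0.
  by rewrite inE => /orP [/eqP ->|/hs //]; rewrite evB evXn ev1 hx subrr.
by have := ev_roots ne0 u h1; rewrite sz /= szs ltnn.
Qed.

Lemma kap_avoid G : G != 0 -> exists c, kap c /\ ~~ root G c.
Proof.
move=> G0; have [s [us szs hs]] := frob_list (ltn0Sn (size G)).
have [c cs nr] : exists2 c, c \in s & ~~ root G c.
  apply: contrapT => no; have := max_poly_roots G0 _ us; rewrite szs => H.
  have : ((q ^ (size G).+1)%N < size G)%N.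
    apply: H; apply/allP => x xs; apply: contrapT => /negP nr; apply: no; by exists x.
  by rewrite ltnNge ltnW // ltnW // ltn_expl.
by exists c; split => //; exists (size G).+1 => //; apply/hs.
Qed.

(** The product over the Frobenius orbit of [x] has coefficients fixed by the [q]-th power, hence in
    [F_q]; a divisor with one root in the orbit has all of them. *)
Lemma minpoly_kap x m : (0 < m)%N -> x ^+ (q ^ m) = x ->
  (forall l, (0 < l < m)%N -> x ^+ (q ^ l) != x) ->
  exists ql : {poly Fq}, [/\ ql \is monic, irreducible_poly ql, size ql = m.+1
   & map_poly kcm ql = \prod_(i < m) ('X - (x ^+ (q ^ i))%:P)].
Proof.
move=> m0 xm xl; pose H := \prod_(i < m) ('X - (x ^+ (q ^ i))%:P).
have mH : H \is monic by apply: monic_prod_XsubC.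
have szH : size H = m.+1 by rewrite size_prod_XsubC /index_enum -enumT size_enum_ord.
have inj i j : (i < m)%N -> (j < m)%N -> x ^+ (q ^ i) = x ^+ (q ^ j) -> i = j.
  wlog le : i j / (i <= j)%N.
    by move=> W a b e; case/orP: (leq_total i j) => h; [exact: W|apply/esym; exact: W].
  move=> im jm e; apply/eqP; rewrite eqn_leq le /= leqNgt; apply/negP => lt.
  have : x ^+ (q ^ (j - i)) != x by apply: xl; rewrite subn_gt0 lt /=; apply: leq_ltn_trans (leq_subr _ _) jm.
  move/eqP; apply; apply: (Fr_inj iota chp (k := i)); rewrite /= -exprM -expnD subnK //.
have fH i : H`_i ^+ q = H`_i.
  have h1 : map_poly (fun y : Om => y ^+ q) H = H.
    have [fr hfr] : exists phi : {rmorphism Om -> Om}, forall y, phi y = y ^+ q.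
      have gB (y z : Om) : (y - z) ^+ q = y ^+ q - z ^+ q by have := FrB iota chp 1 y z; rewrite expn1.
      have gM (y z : Om) : (y * z) ^+ q = y ^+ q * z ^+ q by rewrite exprMn.
      by have [g hg] := rmorph_of gB gM (expr1n _ _); exists g => y; rewrite hg.
    have -> : map_poly (fun y : Om => y ^+ q) H = map_poly fr H.
      by apply/polyP => k; rewrite coef_map_id0 ?expr0n ?gtn_eqF ?(ltnW q1) // coef_endo hfr.
    rewrite /H rmorph_prod /=.
    under eq_bigr do rewrite rmorphB /= map_polyX map_polyC /= hfr -exprM -expnSr.
    case: (m) m0 xm => // k _ xk; rewrite big_ord_recr [RHS]big_ord_recl /= xk expn0 expr1 mulrC.
    by congr (_ * _); apply: eq_bigr => l _; rewrite /bump.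
  by rewrite -{2}h1 coef_map_id0 // expr0n gtn_eqF // ltnW.
have hc i : exists c : Fq, H`_i = kc c by apply: Fq_root; exact: fH.
have [cc hcc] := choice hc.
pose ql : {poly Fq} := \poly_(i < m.+1) cc i.
have eql : map_poly kcm ql = H.
  apply/polyP => i; rewrite coef_map coef_poly /=; case: ltnP => h; first by rewrite hcc kcE.
  by rewrite rmorph0 nth_default ?szH.
have szq : size ql = m.+1 by rewrite -szH -eql size_map_poly.
have mql : ql \is monic.
  by rewrite monicE -(inj_eq (fmorph_inj kcm)) -lead_coef_map eql (monicP mH) rmorph1.
exists ql; split => //; split; first by rewrite szq ltnS.
move=> a a1 dv; have ql0 : ql != 0 by exact: monic_neq0.
have a0 : a != 0 by apply: contraNneq ql0 => e; move: dv; rewrite e dvd0p.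
rewrite -dvdp_size_eqp // eqn_leq dvdp_leq //= szq.
have dvH : map_poly kcm a %| H by rewrite -eql dvdp_map.
have [y ry] : exists y, root (map_poly kcm a) y.
  by apply: closed_rootP; rewrite size_map_poly.
have ryH := root_dvd dvH ry.
have [i0 ei0] : exists i0 : 'I_m, y = x ^+ (q ^ i0).
  move: ryH; rewrite /root horner_prod => /prodf_eq0 [i _ /eqP e].
  by exists i; apply/eqP; rewrite -subr_eq0 -hornerXsubC e.
have rfr z : root (map_poly kcm a) z -> root (map_poly kcm a) (z ^+ q).
  by move=> rz; have := evq_Fr iota chp a z 1; rewrite expn1 /evq (rootP rz) expr0n gtn_eqF ?(ltnW q1) // => /esym/rootP.
have rall k : root (map_poly kcm a) (x ^+ (q ^ (i0 + k))).
  elim: k => [|k IH]; first by rewrite addn0 -ei0.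
  by rewrite addnS expnSr exprM; exact: rfr.
have rall' (i : 'I_m) : root (map_poly kcm a) (x ^+ (q ^ i)).
  have -> : x ^+ (q ^ i) = x ^+ (q ^ (i0 + (i + (m - i0)))).
    have -> : (i0 + (i + (m - i0)) = i + m)%N by rewrite addnCA subnKC // ltnW.
    by rewrite addnC expnD exprM xm.
  exact: rall.
have u : uniq [seq x ^+ (q ^ (nat_of_ord i)) | i <- enum 'I_m].
  rewrite map_inj_uniq ?enum_uniq // => i j e; apply: val_inj; exact: inj e.
have ka0 : map_poly kcm a != 0 by rewrite map_poly_eq0.
have := max_poly_roots ka0 _ u; rewrite size_map size_enum_ord size_map_poly; apply.
by apply/allP => _ /mapP [i _ ->].
Qed.

Lemma kap_minpoly x : kap x -> exists m ql, [/\ (0 < m)%N, x ^+ (q ^ m) = x, irreducible_poly ql,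
   size ql = m.+1 & evq ql x = 0].
Proof.
case=> k0 k0_gt0 hk0.
have ex : exists k, (0 < k)%N && (x ^+ (q ^ k) == x) by exists k0; rewrite k0_gt0 hk0 eqxx.
case: (ex_minnP ex) => m /andP [m0 /eqP xm] mmin.
have [|ql [_ iq sq eq]] := minpoly_kap m0 xm.
  move=> l /andP [l0 lm]; apply/negP => e.
  by have := mmin l; rewrite l0 e => /(_ isT); rewrite leqNgt lm.
exists m, ql; split => //; rewrite /evq eq horner_prod (bigD1 (Ordinal m0)) //=.
by rewrite hornerXsubC expn0 expr1 subrr mul0r.
Qed.

Lemma Fsf_res ql x P y : irreducible_poly ql -> evq ql x = 0 -> qplace iota P x ->
  Fsf iota y -> pO P y -> pf P y ^+ (q ^ (size ql).-1) = pf P y.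
Proof.
move=> irl rl qP Fy Oy; have [a [b [b0 ey]]] := F_div Fy.
have q0 : (0 < q ^ (size ql).-1)%N by rewrite expn_gt0 ltnW.
have [a0|a0] := eqVneq a 0.
  by rewrite ey a0 iAmE rmorph0 mul0r pf0 expr0n gtn_eqF.
have [k [a' [ea na]]] := mult_decomp chp irl a0.
have [l [b' [eb nb]]] := mult_decomp chp irl b0.
have ql0 : iA ql != 0 by rewrite iA_eq0; exact: irredp_neq0.
have un (c : {poly Fq}) : ~~ (ql %| c) -> punit P (iA c).
  by move=> nc; split; [exact: (qP c).1|rewrite (qP c).2; apply/negP => /eqP /(evq_eq0 irl rl) h; rewrite h in nc].
have ua := un _ na; have ub := un _ nb.
have iAM (c c' : {poly Fq}) : iA (c * c') = iA c * iA c' by rewrite !iAmE rmorphM.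
have iAX (c : {poly Fq}) n : iA (c ^+ n) = iA c ^+ n by rewrite !iAmE rmorphXn.
have [lk|kl] := leqP l k.
  have -> : y = iA (ql ^+ (k - l) * a') / iA b'.
    rewrite ey ea eb !iAM !iAX -(subnK lk) exprD addnK; field.
    by rewrite expf_neq0 ?ql0 // (punit_neq0 ub).
  set a2 := _ * a'; have u2 := punitV ub.
  rewrite (pfM (qP a2).1 u2.1) (pfV ub.1 ub.2) !(qP _).2 exprMn exprVn.
  by rewrite !(evq_FrN chp irl rl).
exfalso.
have e1 : y * (iA (ql ^+ (l - k) * b') / iA a') = 1.
  rewrite ey ea eb !iAM !iAX -(subnK (ltnW kl)) exprD addnK; field.
  by rewrite !expf_neq0 ?ql0 // (punit_neq0 ub) (punit_neq0 ua).
have u2 := punitV ua.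
have Oz : pO P (iA (ql ^+ (l - k) * b') / iA a') by apply: pOM; [exact: (qP _).1|case: u2].
have := congr1 (pf P) e1; rewrite (pfM Oy Oz) pf1 (pfM (qP _).1 u2.1) (qP _).2 evqM evqX rl expr0n.
by rewrite gtn_eqF ?subn_gt0 // mul0r mul0r mulr0 => /eqP; rewrite eq_sym oner_eq0.
Qed.

(** Rational functions over the algebraic closure of [F_q]: here all points are rational and roots
    of unity are available. *)
Definition KT := adj kap T.
Lemma KT_kap c : kap c -> KT c. Proof. exact: adj_sub. Qed.
Lemma KT_T : KT T. Proof. exact: adj_gen. Qed.
Lemma KT_poly a : Lp kap a -> KT a.[T].
Proof. by move=> ka; apply: Lp_horner; [move=> i; exact: KT_kap|exact: KT_T]. Qed.
Lemma KT_F y : Fsf iota y -> KT y.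
Proof.
case/F_div => a [b [_ ->]]; rewrite (iA_horner iota a) (iA_horner iota b).
have h (u : {poly Fq}) : KT (map_poly kcm u).[T] by apply: KT_poly; exact: Lp_kap_map.
exact: sfM (h a) (sfV (h b)).
Qed.
Lemma algoKT : algo KT. Proof. exact: algo_sub KT_F (algoF ac). Qed.
Lemma KT_div y : KT y -> exists a b, [/\ Lp kap a, Lp kap b, b.[T] != 0 & y = a.[T] / b.[T]].
Proof.
case=> a [b [b0 ->]]; exists (map_poly (sfm kap) a), (map_poly (sfm kap) b).
by split => //; exact: Lp_map.
Qed.

Lemma kap_decomp a x : kap x -> Lp kap a -> a != 0 ->
  exists k b, [/\ a = ('X - x%:P) ^+ k * b, Lp kap b, b.[x] != 0 & (k <= (size a).-1)%N].
Proof.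
move=> kx ka a0; have [a' ea] := Lp_ex ka; have [x' ex] := sft_ex kx.
have [k [b nb eab]] := multiplicity_XsubC a' x'.
have a'0 : a' != 0 by apply: contraNneq a0 => e; rewrite -ea e rmorph0.
have ex' : sfm kap x' = x by rewrite sfmE.
have eab' : a = ('X - x%:P) ^+ k * map_poly (sfm kap) b.
  rewrite -ea eab (rmorphM (map_poly (sfm kap))) (rmorphXn (map_poly (sfm kap))).
  have e1 : map_poly (sfm kap) ('X - x'%:P) = 'X - x%:P.
    apply/polyP => i; rewrite (coef_map (sfm kap)) !coefB !coefX !coefC.
    apply: (etrans (rmorphB (sfm kap) _ _)); congr (_ - _); first exact: (rmorph_nat (sfm kap)).
    by case: eqP => _; [exact: ex'|exact: (rmorph0 (sfm kap))].
  by rewrite [RHS]mulrC; congr (_ * _ ^+ _); exact: e1.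
have b0 : map_poly (sfm kap) b != 0.
  by apply: contraNneq a0 => e; rewrite eab' e mulr0.
exists k, (map_poly (sfm kap) b); split => //.
- exact: Lp_map.
- move: nb; rewrite a'0 /= /root -ex'.
  have -> : (map_poly (sfm kap) b).[sfm kap x'] = sfm kap b.[x'] by exact: horner_map.
  by rewrite fmorph_eq0.
- rewrite eab' size_monicM ?monic_exp ?monicXsubC //.
  rewrite size_exp_XsubC addSn /=; move: b0; rewrite -size_poly_gt0.
  by case: (size _) => // l _; rewrite addnS leq_addr.
Qed.

Section KPlace.
Variables (P : place Om) (x : Om).
Hypotheses (kx : kap x) (kP : kplace iota chp P x).
Local Notation f := (pf P).

Lemma kplace_kap c : kap c -> pO P c /\ f c = c. Proof. exact: (kplace_unit kP). Qed.
Lemma kplace_T : pO P T /\ f T = x.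
Proof. by have := kP (LpX kap); rewrite !hornerX. Qed.

(** An equation over [F_q(t)], divided by its coefficient of least valuation, reduces to a nonzero
    equation with constant coefficients, and [kap_closed] applies. *)
Lemma kplace_res y : pO P y -> kap (f y).
Proof.
move=> Oy; have [m [ql [m0 xm irl sq rl]]] := kap_minpoly kx.
have [h [h0 rh]] := algoF ac y; set h' := map_poly _ h in rh.
have h'0 : h' != 0 by rewrite map_poly_eq0.
have Fh : Lp (Fsf iota) h' by exact: Lp_map.
have [c [cin c0 cmax]] : exists c, [/\ c \in (h' : seq Om), c != 0 & forall z, z \in (h' : seq Om) -> pO P (z / c)].
  apply: max_term; exists (lead_coef h'); last by rewrite lead_coef_eq0.
  by rewrite lead_coefE mem_nth // prednK // size_poly_gt0.
pose g := c^-1 *: h'.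
have gO i : pO P g`_i.
  rewrite coefZ mulrC; have [lt|le] := ltnP i (size h'); first by apply: cmax; exact: mem_nth.
  by rewrite nth_default // mul0r; exact: pO0.
have Fg i : Fsf iota g`_i.
  rewrite coefZ; apply: sfM => //; apply: sfV.
  by case/(nthP 0): cin => k _ <-.
have kg : Lp kap (pfp P g).
  move=> i; rewrite coef_pfp; exists (size ql).-1; first by rewrite sq.
  exact: (Fsf_res irl rl (kplace_q kP)).
have g0 : pfp P g != 0.
  case/(nthP 0): cin => k _ ek; apply/eqP => e.
  have := congr1 (fun u : {poly Om} => u`_k) e; rewrite coef_pfp coefZ coef0 ek mulVf // pf1.
  by move/eqP; rewrite oner_eq0.
apply: (kap_closed g0 kg); apply/rootP; rewrite -pf_horner //.
by rewrite /g hornerZ (rootP rh) mulr0 pf0.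
Qed.

Lemma kplace_val : exists w, [/\ valn P w, w (T - x) = 1,
  forall c, KT c -> c != 0 -> exists a : int, w c = a%:~R
  & forall a, Lp kap a -> a != 0 -> w a.[T] <= (size a).-1%:R].
Proof.
have [OT fT] := kplace_T; have [Ox fx] := kplace_kap kx.
have Tx0 : T - x != 0.
  apply/eqP => e; have := T_transc (a := 'X - x%:P) (LpB (LpX kap) (LpC kx)).
  by rewrite hornerXsubC => /(_ e) /eqP; rewrite polyXsubC_eq0.
have un b : Lp kap b -> b.[x] != 0 -> punit P b.[T].
  by move=> kb bx; have [o1 o2] := kP kb; split => //; rewrite o2.
have [w [hw w1 wK]] : exists w : Om -> rat, [/\ valn P w, w (T - x) = 1
  & forall c, KT c -> c != 0 -> exists a : int, w c = a%:~R].
  apply: (valuation_ex algoKT Tx0); first exact: pOB.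
    by rewrite pfB // fT fx subrr.
  move=> c /KT_div [a [b [ka kb b0 ->]]] c0.
  have a0 : a != 0 by apply: contraNneq c0 => ->; rewrite horner0 mul0r.
  have b0' : b != 0 by apply: contraNneq b0 => ->; rewrite horner0.
  have [k [a' [ea ka' a'x _]]] := kap_decomp kx ka a0.
  have [l [b' [eb kb' b'x _]]] := kap_decomp kx kb b0'.
  exists (k%:Z - l%:Z).
  have ua := un _ ka' a'x; have ub := un _ kb' b'x.
  have -> : a.[T] / b.[T] / (T - x) ^ (k%:Z - l%:Z) = a'.[T] / b'.[T].
    rewrite expfzDr // expzN -!exprnP ea eb !hornerM !horner_exp !hornerXsubC; field.
    by rewrite (punit_neq0 ub) !expf_neq0.
  by apply: punitM => //; exact: punitV.
exists w; split => // a ka a0.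
have [k [b [ea kb bx lek]]] := kap_decomp kx ka a0.
have ub := un _ kb bx.
rewrite ea hornerM horner_exp hornerXsubC (wM hw) ?expf_neq0 ?(punit_neq0 ub) //.
by rewrite (wX hw) // w1 ((wU hw (punit_neq0 ub)).1 ub) addr0 ler_nat -ea.
Qed.
End KPlace.
End Constants.

Lemma adj_span (Om : closedFieldType) (L : sfield Om) z (f : {poly Om}) n : algo L -> Lp L f ->
  size f = n.+1 -> root f z -> forall y, adj L z y ->
  exists cc : nat -> Om, (forall i, L (cc i)) /\ y = \sum_(i < n) cc i * z ^+ i.
Proof.
move=> aL Lf sf rf y /(adj_poly aL) [h ey]; have [f' ef] := Lp_ex Lf.
pose h' := h %% f'.
have f'0 : f' != 0 by rewrite -size_poly_eq0 -(size_map_poly (sfm L)) ef sf.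
have sh : (size (map_poly (sfm L) h') <= n)%N.
  rewrite size_map_poly -ltnS; have := ltn_modp h f'; rewrite f'0.
  by rewrite -(size_map_poly (sfm L) f') ef sf.
exists (fun i => (map_poly (sfm L) h')`_i); split; first by move=> i; exact: Lp_map.
have e3 : map_poly (sfm L) h = map_poly (sfm L) (h %/ f') * map_poly (sfm L) f' + map_poly (sfm L) h'.
  rewrite {1}(divp_eq h f'); apply: etrans (rmorphD (map_poly (sfm L)) _ _) _; congr (_ + _).
  exact: (rmorphM (map_poly (sfm L))).
by rewrite ey e3 ef hornerD hornerM (rootP rf) mulr0 add0r (horner_coef_wide _ sh).
Qed.

(** * A Galois closure of [K0] over the rational functions with constants [kap] *)

Section Primitive.
Variables (Fq : finFieldType) (p : nat) (Om : closedFieldType)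
          (iota : {rmorphism {fraction {poly Fq}} -> Om}).
Hypotheses (chp : p \in [pchar Fq]) (ac : is_alg_closure iota).
Local Notation q := #|Fq|.
Local Notation iA := (iA iota).
Local Notation T := (iA 'X).
Local Notation kc := (kc iota).
Local Notation kcm := (kcm iota).
Local Notation kap := (kap iota chp).
Local Notation KT := (KT iota chp).
Implicit Types (x y z c : Om).

Definition fixes e z (s : {rmorphism Om -> Om}) :=
  [/\ s T = T, s z = z & forall c, c ^+ (q ^ e) = c -> s c = c].

(** [y] is fixed as soon as [T], [z] and enough constants are. This brings membership in [kap(T, z)]
    down to a finite field of constants. *)
Definition late z y := exists2 e, (0 < e)%N & forall s, fixes e z s -> s y = y.

Lemma fixes_dvd e e' z s : fixes (e * e') z s -> fixes e z s.
Proof. by case=> h1 h2 h3; split => // c hc; apply: h3; exact: (Fr_iter _ hc). Qed.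

Lemma late_fin z (ys : seq Om) : (forall y, y \in ys -> late z y) ->
  exists2 e, (0 < e)%N & forall s, fixes e z s -> forall y, y \in ys -> s y = y.
Proof.
elim: ys => [|y ys IH] h; first by exists 1%N.
have [e e0 he] := IH (fun x xs => h x (mem_behead (s := y :: ys) xs)).
have [k k0 hk] := h y (mem_head _ _).
exists (k * e)%N; first by rewrite muln_gt0 k0.
move=> s hs x; rewrite inE => /orP [/eqP ->|xs]; first by apply: hk; exact: fixes_dvd hs.
by apply: he xs; move: hs; rewrite mulnC; exact: fixes_dvd.
Qed.

Section Late.
Variable z : Om.
Lemma late1 : late z 1. Proof. by exists 1%N => // s _; rewrite rmorph1. Qed.
Let late2 x y : late z x -> late z y -> exists2 e, (0 < e)%N & forall s, fixes e z s -> s x = x /\ s y = y.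
Proof.
move=> [e e0 he] [k k0 hk]; exists (e * k)%N; first by rewrite muln_gt0 e0.
move=> s hs; split; first by apply: he; exact: fixes_dvd hs.
by apply: hk; move: hs; rewrite mulnC; exact: fixes_dvd.
Qed.
Lemma lateB x y : late z x -> late z y -> late z (x - y).
Proof. by move=> hx hy; have [e e0 he] := late2 hx hy; exists e => // s /he [h1 h2]; rewrite rmorphB h1 h2. Qed.
Lemma lateM x y : late z x -> late z y -> late z (x * y).
Proof. by move=> hx hy; have [e e0 he] := late2 hx hy; exists e => // s /he [h1 h2]; rewrite rmorphM h1 h2. Qed.
Lemma lateV x : late z x -> late z x^-1.
Proof. by move=> [e e0 he]; exists e => // s /he h; rewrite fmorphV h. Qed.
Definition latef := SField late1 lateB lateM lateV.
Lemma late_kap c : kap c -> late z c.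
Proof. by case=> e e0 hc; exists e => // s [_ _ h]; exact: h. Qed.
Lemma late_adj y : adj KT z y -> late z y.
Proof.
apply: (adj_min (L' := latef)); last by exists 1%N => // s [].
apply: (adj_min (L' := latef)); first exact: late_kap.
by exists 1%N => // s [].
Qed.
End Late.

Lemma conj_list z : exists C : seq Om, uniq C /\ forall y, y \in C <-> exists s, autL KT s /\ y = s z.
Proof.
have [h [h0 rh]] := algoKT chp ac z.
have [r er] := closed_field_poly_normal (map_poly (sfm KT) h).
exists (undup [seq y <- r | `[< exists s, autL KT s /\ y = s z >]]); split; first exact: undup_uniq.
move=> y; rewrite mem_undup mem_filter; split; first by case/andP => /asboolP.
move=> hy; apply/andP; split; first exact/asboolP.
case: hy => s [hs ->]; have := aut_root hs (Lp_map h) rh.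
by rewrite er rootZ ?root_prod_XsubC // lead_coef_eq0 map_poly_eq0.
Qed.

Lemma id_autKT : autL KT idfun.
Proof. by split => //; exists id. Qed.

Lemma KT_den (ys : seq Om) : (forall y, y \in ys -> KT y) ->
  exists D : {poly Om}, [/\ Lp kap D, D.[T] != 0 &
    forall y, y \in ys -> exists a, Lp kap a /\ D.[T] * y = a.[T]].
Proof.
elim: ys => [|y ys IH] h.
  exists 1; split => //; first by move=> i; rewrite coef1; exact: sf_nat.
  by rewrite hornerC oner_neq0.
have [D [kD D0 hD]] := IH (fun x xs => h x (mem_behead (s := y :: ys) xs)).
have [a [b [ka kb b0 ey]]] := KT_div (h y (mem_head _ _)).
exists (D * b); split; first exact: LpM.
  by rewrite hornerM mulf_neq0.
move=> x; rewrite inE => /orP [/eqP ->|/hD [a' [ka' ea']]].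
  exists (D * a); split; first exact: LpM.
  by rewrite !hornerM ey; field.
by exists (a' * b); split; [exact: LpM|rewrite !hornerM -ea' mulrAC].
Qed.

(** [th] is a combination of [S] with the powers of a constant [c] as coefficients. For a self-map
    [v] of the indices, [D v] vanishes at [c] exactly when moving [S] by [v] preserves [th]; [c] is
    chosen off the roots of the nonzero [D v]. *)
Lemma primitive_ex (S : seq Om) : (forall z, z \in S -> sepe KT z) ->
  (forall s z, autL KT s -> z \in S -> s z \in S) ->
  exists th, adjs KT S th /\ forall z, z \in S -> adj KT th z.
Proof.
move=> sS stS; set g := size S.
pose D (v : {ffun 'I_g -> 'I_g}) : {poly Om} :=
  \sum_(k < g) (S`_(v k) - S`_k) *: 'X^k.
pose G := \prod_(v : {ffun 'I_g -> 'I_g}) (if D v == 0 then 1 else D v).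
have G0 : G != 0.
  by apply/prodf_neq0 => v _; case: (altP (D v =P 0)) => // _; exact: oner_neq0.
have [c [kc' nc]] := kap_avoid iota chp G0.
pose th := \sum_(k < g) c ^+ k * S`_k.
have Kth : adjs KT S th.
  apply: sf_sum => k _; apply: sfM; last by apply: adjs_gen; exact: mem_nth.
  by apply: sfX; apply: adjs_sub; exact: KT_kap.
exists th; split => // z zS.
apply: (sep_fixed (S := S) (L := adj KT th)).
- exact: algo_sub (@adj_sub _ KT th) (algoKT chp ac).
- by move=> y yS; apply: sepe_sub (sS y yS); exact: adj_sub.
- by exact: adjs_gen.
move=> s hs; have hs' : autL KT s by apply: autL_sub hs; exact: adj_sub.
have sth : s th = th by apply: hs.2; exact: adj_gen.
have idx (k : 'I_g) : (index (s S`_k)%R S < g)%N.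
  by rewrite index_mem; apply: stS => //; exact: mem_nth.
pose v : {ffun 'I_g -> 'I_g} := [ffun k => Ordinal (idx k)].
have ev k : S`_(v k) = s S`_k by rewrite ffunE /= nth_index // stS // mem_nth.
have rD : (D v).[c] = 0.
  rewrite horner_sum; under eq_bigr do rewrite hornerZ hornerXn ev mulrBl.
  rewrite sumrB; apply/eqP; rewrite subr_eq0; apply/eqP.
  have -> : \sum_(k < g) s S`_k * c ^+ k = s th.
    rewrite endo_sum; apply: eq_bigr => k _; rewrite endoM endoX mulrC.
    by rewrite (hs'.2 c) //; exact: KT_kap.
  by rewrite sth; apply: eq_bigr => k _; rewrite mulrC.
have D0 : D v = 0.
  apply/eqP; apply: contraT => nz; move: nc; rewrite /root horner_prod.
  move/prodf_neq0/(_ v isT); by rewrite (negPf nz) rD eqxx.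
have [k ek] : exists k : 'I_g, z = S`_k.
  have lt : (index z S < g)%N by rewrite index_mem.
  by exists (Ordinal lt); rewrite /= nth_index.
have := congr1 (fun u : {poly Om} => u`_k) D0; rewrite coef_sum coef0.
rewrite (bigD1 k) //= coefZ coefXn eqxx mulr1 big1 ?addr0.
  by rewrite ev -ek => /eqP; rewrite subr_eq0 => /eqP.
move=> l nl; rewrite coefZ coefXn; case: eqP => e; last by rewrite mulr0.
by move: nl; rewrite -val_eqE /= e eqxx.
Qed.

Lemma prod_scale (D : Om) (zs : seq Om) i :
  (\prod_(z <- zs) ('X - (D * z)%:P))`_i * D ^+ i = D ^+ size zs * (\prod_(z <- zs) ('X - z%:P))`_i.
Proof.
elim: zs i => [|z zs IH] i.
  by rewrite !big_nil expr0 mul1r coef1; case: i => [|i]; rewrite ?mulr1 ?mul0r.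
rewrite !big_cons !mulrBl !coefB !coefXM !coefCM /= exprS mulrBr mulrBl.
congr (_ - _); last by rewrite -mulrA IH; ring.
by case: i => [|i] /=; [ring|rewrite exprS mulrCA IH; ring].
Qed.

(** A Galois closure of the compositum of [K0] with [kap(T)], generated by the integral element
    [th ord0] with conjugates [th]. [tA] gives the coefficients of its equation; [tB] and [tD]
    express the conjugates in its powers over a common denominator; [te] is a degree of constants
    sufficient for the equation and for fixing [K0]. *)
Record theta_data (K0 : Om -> Prop) := ThetaData {
  td : nat;
  th : 'I_td.+1 -> Om;
  tA : nat -> {poly Om};
  tD : {poly Om};
  tB : 'I_td.+1 -> nat -> {poly Om};
  te : nat;
  th_inj : injective th;
  kA : forall i, Lp kap (tA i);
  th_prod : \prod_t ('X - (th t)%:P) = 'X^(td.+1) + \sum_(i < td.+1) (tA i).[T] *: 'X^i;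
  th_ind : indep KT (fun i : 'I_td.+1 => th ord0 ^+ i);
  th_aut : forall t, exists s, autL KT s /\ s (th ord0) = th t;
  kD : Lp kap tD;
  D_neq0 : tD.[T] != 0;
  kB : forall t i, Lp kap (tB t i);
  th_exp : forall t, tD.[T] * th t = \sum_(i < td.+1) (tB t i).[T] * th ord0 ^+ i;
  te_gt0 : (0 < te)%N;
  te_A : forall i k, (i < td.+1)%N -> (tA i)`_k ^+ (q ^ te) = (tA i)`_k;
  te_K0 : forall s, fixes te (th ord0) s -> forall y, K0 y -> s y = y }.

Theorem theta_ex (K0 : sfield Om) : (forall y, Fsf iota y -> K0 y) ->
  finite_over_F iota K0 -> separable_over_F iota K0 -> inhabited (theta_data K0).
Proof.
move=> FK [bs [bsK bs_span]] sepK.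
have aKT := algoKT chp ac.
have bs_sep z : z \in bs -> sepe KT z.
  move/bsK/sepK => [f [f0 [sf rf]]]; exists (map_poly iota f); split => //.
    by move=> i; rewrite coef_map; apply: KT_F; exists f`_i.
  by rewrite separable_map.
(* [S] collects all conjugates of the generators of [K0]. *)
have [S [stS bsS sS]] : exists S : seq Om, [/\ forall s z, autL KT s -> z \in S -> s z \in S,
    forall z, z \in bs -> z \in S & forall z, z \in S -> sepe KT z].
  elim: bs bs_sep {bsK bs_span} => [|b bs IH] hb; first by exists [::].
  have [S [h1 h2 h3]] := IH (fun x xs => hb x (mem_behead (s := b :: bs) xs)).
  have [C [_ hC]] := conj_list b; exists (C ++ S); split.
  - move=> s z hs; rewrite !mem_cat => /orP [/hC [t [ht ->]]|zS]; last by rewrite h1 ?orbT.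
    have [u [hu eu]] := aut_comp hs ht.
    by apply/orP; left; apply/hC; exists u; split => //; rewrite eu.
  - move=> z; rewrite inE mem_cat => /orP [/eqP ->|zb]; last by rewrite h2 ?orbT.
    by apply/orP; left; apply/hC; exists idfun; split => //; exact: id_autKT.
  - move=> z; rewrite mem_cat => /orP [/hC [s [hs ->]]|/h3 //].
    have [f [kf sf rf]] := hb b (mem_head _ _); exists f; split => //.
    exact: aut_root hs kf rf.
have [th' [Sth' gen']] := primitive_ex sS stS.
have stM s y : autL KT s -> adjs KT S y -> adjs KT S (s y).
  move=> hs; pose M y := adjs KT S (s y).
  have m1 : M 1 by rewrite /M rmorph1; exact: sf1.
  have mB x z : M x -> M z -> M (x - z) by rewrite /M => h1 h2; rewrite rmorphB; exact: sfB.
  have mM x z : M x -> M z -> M (x * z) by rewrite /M => h1 h2; rewrite rmorphM; exact: sfM.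
  have mV x : M x -> M x^-1 by rewrite /M => h1; rewrite fmorphV; exact: sfV.
  apply: (adjs_min (L' := SField m1 mB mM mV)).
    by move=> x Kx; rewrite /= /M hs.2 //; exact: adjs_sub.
  by move=> x xS; rewrite /= /M; apply: adjs_gen; exact: stS.
have [C0 [uC0 hC0]] := conj_list th'.
have th'C : th' \in C0 by apply/hC0; exists idfun; split => //; exact: id_autKT.
pose C := th' :: rem th' C0.
have uC : uniq C by rewrite -(perm_uniq (perm_to_rem th'C)).
have hC y : y \in C <-> exists s, autL KT s /\ y = s th'.
  by rewrite -(perm_mem (perm_to_rem th'C)).
pose dl := size (rem th' C0).
have szC : size C = dl.+1 by [].
pose f0 := \prod_(z <- C) ('X - z%:P).
have Kf0 : Lp KT f0.
  have Mf0 : Lp (adjs KT S) f0.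
    rewrite /f0; have : forall z, z \in C -> adjs KT S z by move=> z /hC [s [hs ->]]; exact: stM.
    elim: (C) => [|z zs IH] h; first by rewrite big_nil => i; rewrite coef1; exact: sf_nat.
    rewrite big_cons; apply: LpM; last by apply: IH => x xs; apply: h; rewrite inE xs orbT.
    by apply: LpB; [exact: LpX|apply: LpC; apply: h; exact: mem_head].
  move=> i; apply: (sep_fixed aKT sS (Mf0 i)) => s hs.
  have e1 (z : Om) : map_poly s ('X - z%:P) = 'X - (s z)%:P.
    apply/polyP => k; rewrite coef_endo !coefB !coefX !coefC rmorphB rmorph_nat; congr (_ - _).
    by case: eqP => // _; rewrite rmorph0.
  have sub x : x \in map s C -> x \in C.
    case/mapP => y /hC [t [ht ->]] ->; apply/hC.
    by have [u [hu eu]] := aut_comp hs ht; exists u; split => //; rewrite eu.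
  have us : uniq (map s C) by rewrite map_inj_uniq //; exact: fmorph_inj.
  have pm : \prod_(z <- map s C) ('X - z%:P) = f0.
    by apply: perm_big; apply: uniq_perm => //; have [] := uniq_min_size us sub; rewrite ?size_map.
  have pM (P Q : {poly Om}) : map_poly s (P * Q) = map_poly s P * map_poly s Q by exact: rmorphM.
  have p1 : map_poly s 1 = 1 :> {poly Om}.
    by apply/polyP => k; rewrite coef_endo !coef1 rmorph_nat.
  have mp (zs : seq Om) : map_poly s (\prod_(z <- zs) ('X - z%:P)) = \prod_(z <- zs) ('X - (s z)%:P).
    elim: zs => [|z zs IH]; first by rewrite !big_nil p1.
    by rewrite !big_cons pM IH e1.
  have ef : map_poly s f0 = f0 by rewrite -[RHS]pm big_map; exact: mp.
  by rewrite -coef_endo ef.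
have sz_f0 : size f0 = dl.+2 by rewrite size_prod_XsubC.
have minf (h : {poly Om}) : Lp KT h -> (size h <= dl.+1)%N -> root h th' -> h = 0.
  move=> Kh sh rh; apply/eqP; apply: contraT => h0.
  have := max_poly_roots h0 _ uC; rewrite szC ltnNge sh => H; have : false; last by [].
  by apply: H; apply/allP => y /hC [s [hs ->]]; exact: aut_root hs Kh rh.
have kin y : adjs KT S y -> adj KT th' y.
  by apply: adjs_min; [exact: adj_sub|exact: gen'].
have coord y : adj KT th' y -> exists cc : nat -> Om, (forall i, KT (cc i)) /\ y = \sum_(i < dl.+1) cc i * th' ^+ i.
  by apply: (adj_span aKT Kf0 sz_f0); rewrite root_prod_XsubC mem_head.
have [D1 [kD1 D10 hD1]] : exists D : {poly Om}, [/\ Lp kap D, D.[T] != 0 &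
    forall i, exists a, Lp kap a /\ D.[T] * f0`_i = a.[T]].
  have h y : y \in (f0 : seq Om) -> KT y by case/(nthP 0) => i _ <-; exact: Kf0.
  have [D [h1 h2 h3]] := KT_den h; exists D; split => // i.
  have [lt|le] := ltnP i (size f0); first by apply: h3; exact: mem_nth.
  exists 0; split; first by move=> k; rewrite coef0; exact: sf0.
  by rewrite nth_default // mulr0 horner0.
(* Multiplying the generator by a denominator of its equation makes it integral over [kap[T]]. *)
pose E := D1.[T]; pose thf (t : 'I_dl.+1) := E * C`_t.
have KE : KT E by exact: KT_poly.
have E0 : E != 0 by [].
have eth0 : thf ord0 = E * th' by [].
have aux i : exists a, Lp kap a /\ ((i < dl.+1)%N -> (\prod_(z <- C) ('X - (E * z)%:P))`_i = a.[T]).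
  have [lt|le] := ltnP i dl.+1; last by exists 0; split => // k; rewrite coef0; exact: sf0.
  have [a [ka ea]] := hD1 i.
  exists (D1 ^+ (dl - i) * a); split.
    apply: LpM => //; elim: (dl - i)%N => [|n IH]; first by rewrite expr0 => k; rewrite coef1; exact: sf_nat.
    by rewrite exprS; exact: LpM.
  move=> _; apply: (mulIf (x := E ^+ i)); first by rewrite expf_neq0.
  rewrite prod_scale szC hornerM horner_exp -ea -/E -/f0.
  have -> : E ^+ dl.+1 = E ^+ (dl - i) * E * E ^+ i by rewrite -exprSr -exprD addSn subnK.
  by ring.
have [A hA] := choice aux.
have prodE : \prod_t ('X - (thf t)%:P) = \prod_(z <- C) ('X - (E * z)%:P).
  by rewrite [RHS](big_nth 0) szC big_mkord.
have adjE y : adj KT th' y -> adj KT (thf ord0) y.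
  apply: adj_min; first exact: adj_sub.
  have -> : th' = E^-1 * thf ord0 by rewrite eth0 mulKf.
  by apply: sfM; [apply: adj_sub; exact: sfV|exact: adj_gen].
have thK t : adj KT th' (C`_t).
  have [lt|le] := ltnP t (size C); last by rewrite nth_default //; exact: sf0.
  by apply: kin; have /hC [s [hs ->]] := mem_nth 0 lt; exact: stM.
have expand t : exists cc : nat -> Om, (forall i, KT (cc i)) /\ thf t = \sum_(i < dl.+1) cc i * thf ord0 ^+ i.
  have [cc [kcc ec]] := coord _ (thK t).
  exists (fun i => E * cc i / E ^+ i); split.
    by move=> i; apply: sfM; [exact: sfM|apply: sfV; exact: sfX].
  have -> : thf t = E * C`_t by [].
  rewrite ec mulr_sumr; apply: eq_bigr => i _; rewrite eth0 exprMn; field.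
  by rewrite expf_neq0.
have [cc hcc] := choice expand.
have [D2 [kD2 D20 hD2]] : exists D : {poly Om}, [/\ Lp kap D, D.[T] != 0 &
    forall t i, exists a, Lp kap a /\ ((i < dl.+1)%N -> D.[T] * cc t i = a.[T])].
  have h y : y \in [seq cc t (nat_of_ord i) | t <- enum 'I_dl.+1, i <- enum 'I_dl.+1] -> KT y.
    by case/allpairsP => -[t i] [_ _ ->] /=; case: (hcc t) => kcc _; exact: kcc.
  have [D [h1 h2 h3]] := KT_den h; exists D; split => // t i.
  have [lt|le] := ltnP i dl.+1; last by exists 0; split => // k; rewrite coef0; exact: sf0.
  have [|a [ka ea]] := h3 (cc t i); last by exists a.
  by apply/allpairsP; exists (t, Ordinal lt); rewrite !mem_enum.
have [B hB] : exists B : 'I_dl.+1 -> nat -> {poly Om}, forall t i, Lp kap (B t i) /\ ((i < dl.+1)%N -> D2.[T] * cc t i = (B t i).[T]).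
  have h t := choice (hD2 t).
  by exists (fun t => projT1 (h t)) => t; exact: projT2 (h t).
have late_bs y : y \in bs -> late (thf ord0) y.
  by move=> yb; apply: late_adj; apply: adjE; apply: gen'; exact: bsS.
have [e1 e10 he1] := late_fin late_bs.
have [e2 e20 he2] : exists2 e, (0 < e)%N & forall i k, (i < dl.+1)%N -> (A i)`_k ^+ (q ^ e) = (A i)`_k.
  have h y : y \in flatten [seq (A (nat_of_ord i) : seq Om) | i <- enum 'I_dl.+1] -> kap y.
    by case/flattenP => s /mapP [i _ ->] /(nthP 0) [k _ <-]; case: (hA i) => ka _; exact: ka.
  have [e e0 he] := kap_seq h; exists e => // i k lt.
  have [lk|le] := ltnP k (size (A i)); last first.
    by rewrite nth_default // (Fr0 iota chp).
  apply: he; apply/flattenP; exists (polyseq (A i)); last exact: mem_nth.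
  by apply/mapP; exists (Ordinal lt); rewrite ?mem_enum.
constructor; exists dl thf A D2 B (e1 * e2)%N => //.
- move=> t u /(mulfI E0) /eqP; rewrite nth_uniq ?szC // => /eqP; exact: val_inj.
- by move=> i; case: (hA i).
- rewrite prodE; apply/polyP => i; rewrite coefD coefXn coef_sum.
  have szP : size (\prod_(z <- C) ('X - (E * z)%:P)) = dl.+2.
    by rewrite -(big_map (fun z => E * z) xpredT (fun z => 'X - z%:P)) size_prod_XsubC size_map szC.
  have mP : \prod_(z <- C) ('X - (E * z)%:P) \is monic by apply: monic_prod_XsubC.
  case: (ltngtP i dl.+1) => [lt|gt|->].
  + rewrite (bigD1 (Ordinal lt)) //= coefZ coefXn eqxx mulr1 add0r [X in _ + X]big1 ?addr0.
      by have [_ hi] := hA i; exact: hi lt.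
    move=> k nk; rewrite coefZ coefXn; case: eqP => e; last by rewrite mulr0.
    by move: nk; rewrite -val_eqE /= e eqxx.
  + rewrite nth_default ?szP // add0r [RHS]big1 // => k _; rewrite coefZ coefXn gtn_eqF ?mulr0 //.
    exact: ltn_trans (ltn_ord k) gt.
  + rewrite [X in _ + X]big1 ?addr0; first by have := monicP mP; rewrite lead_coefE szP.
    by move=> k _; rewrite coefZ coefXn gtn_eqF ?mulr0.
- move=> cf kcf e i; pose h := \sum_(k < dl.+1) (cf k * E ^+ k) *: 'X^k : {poly Om}.
  have hk (k : 'I_dl.+1) : h`_k = cf k * E ^+ k.
    rewrite coef_sum (bigD1 k) //= coefZ coefXn eqxx mulr1 big1 ?addr0 // => l nl.
    rewrite coefZ coefXn; case: eqP => ee; last by rewrite mulr0.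
    by move: nl; rewrite -val_eqE /= ee eqxx.
  have h0 : h = 0.
    apply: minf.
    - move=> k; rewrite coef_sum; apply: sf_sum => l _; rewrite coefZ coefXn.
      by apply: sfM; [apply: sfM => //; exact: sfX|exact: sf_nat].
    - apply: leq_trans (size_sum _ _ _) _; apply/bigmax_leqP => k _.
      by apply: leq_trans (size_scale_leq _ _) _; rewrite size_polyXn.
    - apply/rootP; rewrite horner_sum -[RHS]e; apply: eq_bigr => k _.
      by rewrite hornerZ hornerXn eth0 exprMn mulrA.
  have := hk i; rewrite h0 coef0 => /esym/eqP; rewrite mulf_eq0 expf_eq0 (negPf E0) andbF orbF.
  by move/eqP.
- move=> t; have /hC [s [hs es]] : C`_t \in C by rewrite mem_nth // szC.
  by exists s; split => //; rewrite eth0 endoM (hs.2 _ KE) /thf es.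
- by move=> t i; case: (hB t i).
- move=> t; rewrite (hcc t).2 mulr_sumr; apply: eq_bigr => i _.
  by rewrite mulrA; case: (hB t i) => _ ->.
- by rewrite muln_gt0 e10.
- by move=> i k lt; rewrite mulnC; apply: (Fr_iter _ (he2 i k lt)).
- move=> s hs y K0y; have [cs ->] := bs_span y K0y.
  have hs1 : fixes e1 (thf ord0) s by exact: fixes_dvd hs.
  have fF z : Fsf iota z -> s z = z.
    case/F_div => a [b [_ ->]]; case: hs => sT _ sk.
    have ha u : s (iA u) = iA u.
      rewrite (iA_horner iota u) !horner_coef endo_sum; apply: eq_bigr => i _.
      rewrite endoM endoX sT; congr (_ * _); apply: sk.
      have -> : (map_poly kcm u)`_i = kc u`_i by rewrite kcE; exact: coef_map.
      exact: Fr_kc.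
    by rewrite endoM fmorphV !ha.
  rewrite endo_sum; apply: eq_bigr => k _; rewrite endoM; congr (_ * _).
    by apply: fF; exists (cs k).
  by apply: he1 hs1 _ _; exact: mem_nth.
Qed.
End Primitive.

(** * Stepanov's method *)

Lemma w_opp (Om : fieldType) (P : place Om) (w : Om -> rat) y : valn P w -> y != 0 -> w (- y) = w y.
Proof.
move=> hw y0; have n1 : (-1 : Om) != 0 by rewrite oppr_eq0 oner_neq0.
rewrite -mulN1r (wM hw) //; have -> : w (-1) = 0; last by rewrite add0r.
apply/(wU hw n1); split; first exact: pON (pO1 P).
by rewrite pfN ?pf1 ?oppr_eq0 ?oner_neq0 //; exact: pO1.
Qed.

Section Stepanov.
Variables (Fq : finFieldType) (p : nat) (Om : closedFieldType)
          (iota : {rmorphism {fraction {poly Fq}} -> Om}).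
Hypotheses (chp : p \in [pchar Fq]) (ac : is_alg_closure iota).
Local Notation q := #|Fq|.
Local Notation iA := (iA iota).
Local Notation T := (iA 'X).
Local Notation kap := (kap iota chp).
Local Notation KT := (KT iota chp).
Variables (I : finType) (i0 : I) (e : I -> Om) (wt : I -> nat) (om : nat).
Hypotheses (e0 : e i0 = 1) (wt0 : wt i0 = 0%N) (wt_om : forall i, (wt i <= om)%N)
  (ind : indep KT e).

(** A substitute for the functions with pole of order at most [n] at infinity. Truncated subtraction
    forces [h i = 0] when [wt i > n]. *)
Definition weighted n z := exists h : I -> {poly Om}, [/\ forall i, Lp kap (h i),
  forall i, (size (h i) <= n.+1 - wt i)%N & z = \sum_i (h i).[T] * e i].
Local Notation Wt := weighted.
Let S m (ik : I * 'I_m) : Om := T ^+ ik.2 * e ik.1.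
Arguments S : clear implicits.

Lemma weightedD n z z' : Wt n z -> Wt n z' -> Wt n (z + z').
Proof.
move=> [h [kh sh ->]] [h' [kh' sh' ->]]; exists (fun i => h i + h' i); split.
- by move=> i; exact: LpD.
- by move=> i; apply: leq_trans (size_polyD _ _) _; rewrite geq_max sh sh'.
- by rewrite -big_split /=; apply: eq_bigr => i _; rewrite hornerD mulrDl.
Qed.
Lemma weighted0 n : Wt n 0.
Proof.
exists (fun=> 0); split; first by move=> i k; rewrite coef0; exact: sf0.
  by move=> i; rewrite size_poly0.
by rewrite big1 // => i _; rewrite horner0 mul0r.
Qed.
Lemma weighted_sum n (J : Type) (r : seq J) (Q : pred J) (E : J -> Om) :
  (forall j, Q j -> Wt n (E j)) -> Wt n (\sum_(j <- r | Q j) E j).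
Proof. by move=> h; apply: big_ind => //; [exact: weighted0|move=> *; exact: weightedD]. Qed.
Lemma weighted_le n n' z : (n <= n')%N -> Wt n z -> Wt n' z.
Proof.
move=> le [h [kh sh ->]]; exists h; split => // i.
by apply: leq_trans (sh i) _; rewrite leq_sub2r.
Qed.
Lemma weighted_gen i a n : Lp kap a -> (size a <= n.+1 - wt i)%N -> Wt n (a.[T] * e i).
Proof.
move=> ka sa; exists (fun j => if j == i then a else 0); split.
- by move=> j; case: eqP => _ //; move=> k; rewrite coef0; exact: sf0.
- by move=> j; case: eqP => [->|_] //; rewrite size_poly0.
- rewrite (bigD1 i) //= eqxx big1 ?addr0 // => j /negPf ->; by rewrite horner0 mul0r.
Qed.
Lemma weighted_poly a n : Lp kap a -> (size a <= n.+1)%N -> Wt n a.[T].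
Proof. by move=> ka sa; rewrite -[a.[T]]mulr1 -e0; apply: weighted_gen => //; rewrite wt0 subn0. Qed.
Lemma weighted_e i : Wt (wt i) (e i).
Proof.
have := @weighted_gen i 1 (wt i); rewrite hornerC mul1r size_poly1; apply.
  by move=> k; rewrite coef1; exact: sf_nat.
by rewrite subSn // subnn.
Qed.
Lemma weighted_kap c n : kap c -> Wt n c.
Proof.
by move=> kc; have := @weighted_poly c%:P n (LpC kc); rewrite hornerC; apply; rewrite (leq_trans (size_polyC_leq1 _)).
Qed.
Lemma weighted_T k : Wt k (T ^+ k).
Proof.
have := @weighted_poly 'X^k k; rewrite hornerXn size_polyXn; apply => //.
by move=> j; rewrite coefXn; exact: sf_nat.
Qed.

Lemma indep_S m : indep kap (S m).
Proof.
move=> c kc hs [i k].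
pose h i : {poly Om} := \poly_(k < m) (if insub k is Some k' then c (i, k') else 0).
have kh j : Lp kap (h j).
  move=> l; rewrite coef_poly; case: ltnP => _; last exact: sf0.
  by case: insubP => [u _ _|_]; [exact: kc|exact: sf0].
have hT j : (h j).[T] = \sum_(l < m) c (j, l) * T ^+ l.
  rewrite (horner_coef_wide T (size_poly _ _)); apply: eq_bigr => l _.
  by rewrite coef_poly ltn_ord valK.
have hz : \sum_j (h j).[T] * e j = 0.
  rewrite -[RHS]hs; transitivity (\sum_j \sum_(l < m) c (j, l) * S m (j, l)).
    by apply: eq_bigr => j _; rewrite hT mulr_suml; apply: eq_bigr => l _; rewrite /S /= mulrA.
  by rewrite pair_bigA; apply: eq_bigr => -[j l] _.
have := ind (fun j => KT_poly (kh j)) hz i => /(T_transc (kh i)) h0.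
have := congr1 (fun u : {poly Om} => u`_k) h0; rewrite coef_poly coef0 ltn_ord valK //.
Qed.

Lemma weighted_span n z : Wt n z -> spans kap (S n.+1) z.
Proof.
move=> [h [kh sh ->]]; exists (fun ik : I * 'I_n.+1 => (h ik.1)`_(nat_of_ord ik.2)); split; first by move=> ik; exact: kh.
rewrite -(pair_bigA _ (fun i (k : 'I_n.+1) => (h i)`_k * S n.+1 (i, k))) /=.
apply: eq_bigr => i _; have le : (size (h i) <= n.+1)%N by apply: leq_trans (sh i) (leq_subr _ _).
by rewrite (horner_coef_wide T le) mulr_suml; apply: eq_bigr => k _; rewrite /S /= mulrA.
Qed.

Lemma weighted_S m ik : Wt (m + om) (S m ik).
Proof.
case: ik => i k; have := @weighted_gen i 'X^k (m + om)%N; rewrite hornerXn size_polyXn; apply.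
  by move=> j; rewrite coefXn; exact: sf_nat.
have := ltn_ord k; have := wt_om i; rewrite /= => h1 h2; lia.
Qed.

Hypothesis Wmul : forall n n' z z', Wt n z -> Wt n' z' -> Wt (n + n') (z * z').

Lemma weightedX n z k : Wt n z -> Wt (k * n) (z ^+ k).
Proof.
move=> h; elim: k => [|k IH]; first by rewrite expr0; apply: weighted_kap; exact: sf1.
by rewrite exprS mulSn; exact: Wmul.
Qed.

Variables (M : sfield Om).
Hypotheses (MK : forall y, KT y -> M y) (Me : forall i, M (e i)) (Msp : forall y, M y -> spans KT e y).
Let G := #|I|.
Let M_S m ik : M (S m ik).
Proof. by apply: sfM => //; apply: sfX; apply: MK; exact: KT_T. Qed.

Section NonVanishing.
Variables (x1 : Om) (P : place Om) (w : Om -> rat).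
Hypotheses (kx1 : kap x1) (kP : kplace iota chp P x1) (hw : valn P w)
  (wK : forall c, KT c -> c != 0 -> exists a : int, w c = a%:~R)
  (wpoly : forall a, Lp kap a -> a != 0 -> w a.[T] <= (size a).-1%:R)
  (Oe : forall i, pO P (e i)).
Let O_S m ik : pO P (S m ik).
Proof. by apply: pOM => //; apply: pOX; exact: (kplace_T kP).1. Qed.

(** By a dimension count some nonzero integral [v'] makes [v' v] a polynomial in [T] of degree at
    most [G (om + n)], in place of the norm of [v]; the valuation of [v] is at most that degree. *)
Lemma valuation_bound n v : Wt n v -> v != 0 -> w v <= (G * (om + n))%:R.
Proof.
(* [k'] is the least value for which the [G k' + N'] unknowns outnumber the [G N'] equations. *)
move=> hv v0; pose k' := ((G - 1) * (om + n)).+1; pose N' := (k' + om + n)%N.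
have G0 : (0 < G)%N by rewrite /G; apply/card_gt0P; exists i0.
pose E (j : (I * 'I_k') + 'I_N') : Om := match j with inl ik => S k' ik * v | inr l => T ^+ l end.
have cnt : (#|{: I * 'I_N'}| < #|{: (I * 'I_k') + 'I_N'}|)%N.
  rewrite card_sum !card_prod !card_ord -/G /N' /k'.
  by case: (G) G0 => // g _; rewrite subn1 /=; nia.
have sp j : spans kap (S N') (E j).
  have -> : N' = (k' + om + n).-1.+1 by [].
  apply: weighted_span; case: j => [[i k]|l] /=.
    have h : Wt (k + wt i) (S k' (i, k)) by apply: Wmul; [exact: weighted_T|exact: weighted_e].
    apply: weighted_le (Wmul h hv).
    have := ltn_ord k; have := wt_om i; rewrite /k'; lia.
  apply: weighted_le (weighted_T l); have := ltn_ord l; rewrite /N' /k'; lia.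
have [c [kc sc [j0 cj0]]] := indep_dep sp cnt.
pose v' := \sum_ik c (inl ik) * S k' ik; pose pol : {poly Om} := \poly_(l < N') (if insub l is Some l' then c (inr l') else 0).
have kpol : Lp kap pol.
  move=> l; rewrite coef_poly; case: ltnP => _; last exact: sf0.
  by case: insubP => [u _ _|_]; [exact: kc|exact: sf0].
have polT : pol.[T] = \sum_(l < N') c (inr l) * T ^+ l.
  rewrite (horner_coef_wide T (size_poly _ _)); apply: eq_bigr => l _.
  by rewrite coef_poly ltn_ord valK.
have e1 : v' * v + pol.[T] = 0.
  rewrite -[RHS]sc big_sumType /= polT; congr (_ + _).
  by rewrite mulr_suml; apply: eq_bigr => ik _; rewrite -mulrA.
have v'0 : v' != 0.
  apply/eqP => z; have cz := indep_S (fun ik => kc (inl ik)) z.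
  have := e1; rewrite z mul0r add0r => /(T_transc kpol) pz.
  case: j0 cj0 => [ik|l]; first by rewrite cz eqxx.
  by have := congr1 (fun u : {poly Om} => u`_l) pz; rewrite coef_poly coef0 ltn_ord valK => ->; rewrite eqxx.
have eq1 : v' * v = - pol.[T] by apply/eqP; rewrite -addr_eq0 e1.
have pol0 : pol != 0.
  apply: contraNneq (mulf_neq0 v'0 v0) => z; by rewrite eq1 z horner0 oppr0.
have polT0 : pol.[T] != 0 by apply/eqP => /(T_transc kpol) /eqP; rewrite (negPf pol0).
have wN : w (- pol.[T]) = w pol.[T] by exact: (w_opp hw).
have := congr1 w eq1; rewrite (wM hw) // wN => e2.
have w1 : 0 <= w v'.
  apply/(wO hw v'0); apply: pO_sum => ik _; apply: pOM => //.
  exact: (kplace_unit kP (kc _)).1.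
have := wpoly kpol pol0; rewrite -e2 => le.
have le2 : (size pol).-1%:R <= (G * (om + n))%:R :> rat.
  rewrite ler_nat; have := size_poly N' (fun l => if insub l is Some l' then c (inr l') else 0).
  rewrite -/pol; case: (size _) => //= s; rewrite /N' /k'.
  by case: (G) G0 => // g _; rewrite subn1 /=; nia.
by apply: le_trans le2; apply: le_trans le; rewrite lerDr.
Qed.

Variables (s a : nat).
Hypothesis big : (G`! * (G * (om + (a + om))) < q ^ s)%N.

(* Dividing by the largest y_l and replacing the quotients by their residues changes the
   sum by terms of valuation at least q^s / G!, beyond what a nonzero combination of low
   weight can reach. *)
Lemma power_indep (y : I * 'I_a -> Om) : (forall l, M (y l)) ->
  \sum_l S a l * y l ^+ (q ^ s) = 0 -> forall l, y l = 0.
Proof.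
move=> My sy l1; apply: contrapT => /eqP yl1.
have [y0 [yin y00 ymax]] : exists z, [/\ z \in map y (enum {: I * 'I_a}), z != 0
    & forall t, t \in map y (enum {: I * 'I_a}) -> pO P (t / z)].
  by apply: max_term; exists (y l1) => //; apply/mapP; exists l1; rewrite ?mem_enum.
have [l0 _ el0] := mapP yin.
have Oy l : pO P (y l / y0) by apply: ymax; apply/mapP; exists l; rewrite ?mem_enum.
pose c l := pf P (y l / y0).
have kc l : kap (c l) by exact: (kplace_res ac kx1 kP (Oy l)).
pose v := \sum_l c l ^+ (q ^ s) * S a l.
have v0 : v != 0.
  apply/eqP => z; have := indep_S (fun l => sfX (q ^ s) (kc l)) z l0.
  by rewrite /c -el0 divff // pf1 expr1n => /eqP; rewrite oner_eq0.
have wv : Wt (a + om) v.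
  apply: weighted_sum => l _; rewrite -[(a + om)%N]add0n; apply: Wmul; last exact: weighted_S.
  by apply: weighted_kap; exact: sfX.
have ev : v = \sum_l - (S a l * (y l / y0 - c l) ^+ (q ^ s)).
  have : \sum_l S a l * (y l / y0) ^+ (q ^ s) = 0.
    rewrite -[RHS](mul0r (y0 ^+ (q ^ s))^-1) -[in RHS]sy mulr_suml; apply: eq_bigr => l _.
    by rewrite expr_div_n mulrA.
  move=> h; rewrite -[LHS]subr0 -[X in _ - X]h -sumrB; apply: eq_bigr => l _.
  by rewrite (FrB iota chp); ring.
have G0 : 0 < (G`!)%:R :> rat by rewrite ltr0n fact_gt0.
have wge : ((q ^ s)%:R / (G`!)%:R : rat) <= w v.
  rewrite ev; apply: (w_ge_sum hw); last by rewrite -ev.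
  move=> l _; rewrite oppr_eq0 mulf_eq0 negb_or => /andP [sl zl].
  set z := y l / y0 - c l in zl *.
  have z0 : z != 0 by apply: contraNneq zl => ->; rewrite expr0n gtn_eqF // expn_gt0 q_gt0.
  have Mz : M z.
    apply: sfB; first by apply: sfM => //; apply: sfV; rewrite el0.
    by apply: MK; exact: KT_kap.
  have [Ok fk] := kplace_unit kP (kc l).
  have fz : pO P z /\ pf P z = 0.
    by split; [exact: pOB|rewrite pfB // fk subrr].
  have wz : 0 < w z by apply/(wgt0 hw z0).
  have [aa eaa] := denom hw wK (fun x n => @sfX _ M x n) Msp Mz z0; rewrite -/G in eaa.
  have aa1 : (1 : rat) <= aa%:~R.
    have : (0 : rat) < aa%:~R by rewrite -eaa mulr_gt0.
    by rewrite ltr0z -[1]/(1%:~R) ler_int.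
  have wz1 : (G`!)%:R^-1 <= w z by rewrite -(ler_pM2l G0) divff ?gt_eqF // eaa.
  have -> : w (- (S a l * z ^+ (q ^ s))) = w (S a l) + w z *+ (q ^ s).
    have zB : z ^+ (q ^ s) != 0 by rewrite expf_neq0.
    by rewrite (w_opp hw (mulf_neq0 sl zB)) (wM hw sl zB) (wX hw _ z0).
  have ws : 0 <= w (S a l) by apply/(wO hw sl).
  rewrite -[w z *+ _]mulr_natl; apply: le_trans (_ : (q ^ s)%:R * w z <= _); last by rewrite lerDr.
  by rewrite ler_wpM2l ?ler0n.
have := le_trans wge (valuation_bound wv v0).
by rewrite ler_pdivrMr // -natrM ler_nat leqNgt mulnC big.
Qed.
End NonVanishing.

Lemma kap_root c s : kap c -> exists2 d, kap d & d ^+ (q ^ s) = c.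
Proof.
move=> kc; case: (kc) => k k0 hk; exists (c ^+ (q ^ (k * s - s))); first exact: sfX.
rewrite -exprM -expnD subnK ?leq_pmull //; exact: (Fr_iter _ hk).
Qed.

Variables (C : finType) (cj : C -> I -> Om) (Den : Om) (cD s a b : nat) (X : seq Om).
Hypotheses (Den0 : Den != 0) (hcj : forall t i, Wt (wt i + cD) (Den * cj t i))
  (uX : uniq X) (kX : forall x, x \in X -> kap x) (frX : forall x, x \in X -> x ^+ (q ^ (s + s)) = x)
  (hX : forall x P, x \in X -> kplace iota chp P x -> (forall i, pO P (e i)) /\
     exists t, forall i, pO P (cj t i) /\ pf P (cj t i) = pf P (e i) ^+ (q ^ (s + s)))
  (hV : forall x (h : I -> {poly Om}), x \in X -> (forall i, Lp kap (h i)) ->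
     (forall P, kplace iota chp P x -> pf P (\sum_i (h i).[T] * e i) = 0) -> forall i, (h i).[x] = 0)
  (nv : forall y : I * 'I_a -> Om, (forall l, M (y l)) ->
     \sum_l S a l * y l ^+ (q ^ s) = 0 -> forall l, y l = 0)
  (c1 : (G * (q ^ s * a + q ^ s * om + b + om + cD).+1 < (G * a) * (G * b))%N)
  (c3 : (#|C| * (a + om + q ^ s * (b + om)) < size X)%N).

(** By the count [c1] there is a linear relation among products of [q^s]-th powers of the [S a] with
    conjugates [cj t]. On points of the class these conjugates are [q^(2s)]-th powers of the [e i],
    so a [q^s]-th root of the relation is a function [Psi] vanishing there. Its weight involves only
    [q^s], and [nv] keeps it nonzero. *)
Let psi_ex (t : C) : exists Psi, [/\ Wt (a + om + q ^ s * (b + om)) Psi, Psi != 0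
  & forall x P, x \in X -> kplace iota chp P x -> pO P Psi /\
     ((forall i, pO P (cj t i) /\ pf P (cj t i) = pf P (e i) ^+ (q ^ (s + s))) -> pf P Psi = 0)].
Proof.
pose N1 := (q ^ s * a + q ^ s * om + b + om + cD)%N.
pose tj (l : I * 'I_b) := T ^+ l.2 * cj t l.1.
pose E (l : (I * 'I_a) * (I * 'I_b)) := Den * (S a l.1 ^+ (q ^ s) * tj l.2).
have cnt : (#|{: I * 'I_N1.+1}| < #|{: (I * 'I_a) * (I * 'I_b)}|)%N.
  by rewrite !card_prod !card_ord -/G.
have sp l : spans kap (S N1.+1) (E l).
  case: l => -[i k] [i' k']; apply: weighted_span; rewrite /E /tj /=.
  have -> : Den * (S a (i, k) ^+ (q ^ s) * (T ^+ k' * cj t i')) = S a (i, k) ^+ (q ^ s) * (T ^+ k' * (Den * cj t i')) by ring.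
  apply: weighted_le (Wmul (weightedX _ (weighted_S (i, k))) (Wmul (weighted_T k') (hcj t i'))).
  rewrite /N1 mulnDr; have := wt_om i'; have := ltn_ord k'.
  move: (q ^ s * a)%N (q ^ s * om)%N (wt i') => u1 u2 u3; lia.
have [c [kc sc [l0 cl0]]] := indep_dep sp cnt.
have rt l : exists d, kap d /\ d ^+ (q ^ (s + s)) = c l.
  by have [d kd ed] := kap_root (s + s) (kc l); exists d.
have [ep hep] := choice rt.
pose y l := \sum_l' ep (l, l') * S b l'.
have My l : M (y l).
  apply: sf_sum => l' _; apply: sfM => //; apply: MK; apply: KT_kap; exact: (hep _).1.
exists (\sum_l S a l * y l ^+ (q ^ s)); split.
- apply: weighted_sum => l _; apply: Wmul; first exact: weighted_S.
  apply: weightedX; apply: weighted_sum => l' _; rewrite -[(b + om)%N]add0n; apply: Wmul; last exact: weighted_S.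
  by apply: weighted_kap; exact: (hep _).1.
- apply/eqP => /(nv My) yz; case: l0 cl0 => l l' /eqP; apply.
  rewrite -(hep _).2 (indep_S (fun l'' => (hep (l, l'')).1) (yz l)) expr0n gtn_eqF // expn_gt0 q_gt0 //.
move=> x P xX kP; have [Oe _] := hX xX kP; have [OT fT] := kplace_T kP.
have OS m ik : pO P (S m ik) by apply: pOM => //; exact: pOX.
have Oep l : pO P (ep l) by exact: (kplace_unit kP (hep l).1).1.
have fep l : pf P (ep l) = ep l by exact: (kplace_unit kP (hep l).1).2.
have Oy l : pO P (y l) by apply: pO_sum => l' _; exact: pOM.
have OPsi : pO P (\sum_l S a l * y l ^+ (q ^ s)).
  by apply: pO_sum => l _; apply: pOM => //; exact: pOX.
split => // hc.
have Otj l : pO P (tj l) by apply: pOM; [exact: pOX|exact: (hc _).1].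
have ftj l : pf P (S b l) ^+ (q ^ (s + s)) = pf P (tj l).
  rewrite /S /tj (pfM (pOX _ OT) (Oe _)) (pfM (pOX _ OT) (hc _).1) (hc _).2 exprMn (pfX _ OT) fT.
  by rewrite exprAC (frX xX).
have fy l : pf P (y l) ^+ (q ^ (s + s)) = pf P (\sum_l' c (l, l') * tj l').
  rewrite /y pf_sum; last by move=> l' _; exact: pOM.
  rewrite (Fr_sum iota chp) pf_sum; last first.
    by move=> l' _; apply: pOM => //; exact: (kplace_unit kP (kc _)).1.
  apply: eq_bigr => l' _; rewrite (pfM (Oep _) (OS _ _)) exprMn ftj fep (hep _).2.
  have [o1 o2] := kplace_unit kP (kc (l, l')).
  by rewrite (pfM o1 (Otj _)) o2.
have Osum l : pO P (\sum_l' c (l, l') * tj l').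
  by apply: pO_sum => l' _; apply: pOM => //; exact: (kplace_unit kP (kc _)).1.
apply: (Fr_inj iota chp (k := s)); rewrite /= (Fr0 iota chp).
rewrite pf_sum; last by move=> l _; apply: pOM => //; exact: pOX.
rewrite (Fr_sum iota chp).
transitivity (pf P (\sum_l S a l ^+ (q ^ s) * \sum_l' c (l, l') * tj l')).
  rewrite [RHS]pf_sum; last by move=> l _; apply: pOM => //; exact: pOX.
  apply: eq_bigr => l _; rewrite (pfM (OS _ _) (pOX _ (Oy l))) (pfM (pOX _ (OS _ _)) (Osum l)).
  by rewrite exprMn (pfX _ (OS _ _)) (pfX _ (Oy l)) -exprM -expnD fy.
have -> : \sum_l S a l ^+ (q ^ s) * \sum_l' c (l, l') * tj l' = 0; last exact: pf0.
apply: (mulfI Den0); rewrite mulr0 -[RHS]sc mulr_sumr.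
transitivity (\sum_l \sum_l' c (l, l') * E (l, l')).
  by apply: eq_bigr => l _; rewrite !mulr_sumr; apply: eq_bigr => l' _; rewrite /E /=; ring.
by rewrite pair_bigA; apply: eq_bigr => -[l l'] _.
Qed.

(** The product of the auxiliary functions reduces to 0 at every point of [X]; by [hV] so does each
    coefficient polynomial, whose degree is below [size X] by [c3]. *)
Theorem stepanov : False.
Proof.
have [Psi hPsi] := choice psi_ex.
pose n1 := (a + om + q ^ s * (b + om))%N.
pose H := \prod_t Psi t.
have H0 : H != 0 by apply/prodf_neq0 => t _; case: (hPsi t).
have WH : Wt (#|C| * n1) H.
  rewrite /H -sum1_card big_distrl /=.
  elim/big_rec2: _ => [|t n z _ IH]; first by apply: weighted_kap; exact: sf1.
  by rewrite mul1n; apply: Wmul => //; case: (hPsi t).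
have [h [kh sh eH]] := WH.
have hz i : h i = 0.
  apply/eqP; apply: contraT => nz; have := max_poly_roots nz _ uX.
  have le : (size (h i) <= (#|C| * n1).+1)%N by apply: leq_trans (sh i) (leq_subr _ _).
  move=> Hm; have : (size X < size (h i))%N.
    apply: Hm; apply/allP => x xX; apply/rootP; apply: (hV xX kh) => P kP; rewrite -eH.
    have [Oe [t ht]] := hX xX kP.
    have OPsi t' : pO P (Psi t') by case: (hPsi t') => _ _ h'; case: (h' x P xX kP).
    rewrite /H pf_prod // (bigD1 t) //=.
    by have [_ _ h'] := hPsi t; have [_ ->] := h' x P xX kP; rewrite ?mul0r.
  by rewrite ltnNge (leq_trans le) // ltnW.
by move: H0; rewrite eH big1 ?eqxx // => i _; rewrite hz horner0 mul0r.
Qed.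
End Stepanov.

Lemma periodic_prod (R : comNzRingType) (h : nat -> R) N n : (forall m, h (m + N)%N = h m) ->
  \prod_(m < N) h (m + n)%N = \prod_(m < N) h m.
Proof.
move=> per; elim: n => [|n <-]; first by apply: eq_bigr => m _; rewrite addn0.
case: N per => [|N] per; first by rewrite !big_ord0.
rewrite big_ord_recr [RHS]big_ord_recl /= mulrC; congr (_ * _).
  by rewrite add0n -(per n); congr h; lia.
by apply: eq_bigr => m _; rewrite /bump /= addSnnS; congr h; lia.
Qed.

Lemma poly_vanish (R : idomainType) n (c pts : 'I_n -> R) : injective pts ->
  (forall l, \sum_j c j * pts l ^+ j = 0) -> forall j, c j = 0.
Proof.
move=> inj h j; pose P : {poly R} := \poly_(k < n) (if insub k is Some k' then c k' else 0).
have P0 : P = 0.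
  apply/eqP; apply: contraT => nz.
  have u : uniq (map pts (enum 'I_n)) by rewrite map_inj_uniq ?enum_uniq.
  have := max_poly_roots nz _ u; rewrite size_map size_enum_ord => H.
  have : (n < size P)%N.
    apply: H; apply/allP => _ /mapP [l _ ->]; apply/rootP; rewrite -[RHS](h l).
    rewrite (horner_coef_wide _ (size_poly _ _)); apply: eq_bigr => k _.
    by rewrite coef_poly ltn_ord valK.
  by rewrite ltnNge size_poly.
by have := congr1 (fun u : {poly R} => u`_j) P0; rewrite coef_poly coef0 ltn_ord valK.
Qed.

Lemma place_comp (Om : fieldType) (P : place Om) (s : {rmorphism Om -> Om}) :
  exists P' : place Om, forall y, (pO P' y <-> pO P (s y)) /\ pf P' y = pf P (s y).
Proof.
have h1 : pO P (s 1) by rewrite rmorph1; exact: pO1.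
have h2 : pf P (s 1) = 1 by rewrite rmorph1 pf1.
have h3 x y : pO P (s x) -> pO P (s y) -> pO P (s (x - y)) by rewrite rmorphB; exact: pOB.
have h4 x y : pO P (s x) -> pO P (s y) -> pf P (s (x - y)) = pf P (s x) - pf P (s y).
  by rewrite rmorphB; exact: pfB.
have h5 x y : pO P (s x) -> pO P (s y) -> pO P (s (x * y)) by rewrite rmorphM; exact: pOM.
have h6 x y : pO P (s x) -> pO P (s y) -> pf P (s (x * y)) = pf P (s x) * pf P (s y).
  by rewrite rmorphM; exact: pfM.
have h7 x : ~ pO P (s x) -> pO P (s x^-1) by rewrite fmorphV; exact: pOV.
have h8 x : ~ pO P (s x) -> pf P (s x^-1) = 0 by rewrite fmorphV; exact: pfV0.
by exists (Place h1 h2 h3 h4 h5 h6 h7 h8).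
Qed.

(** * Points where the conjugates stay distinct *)

Section Good.
Variables (Fq : finFieldType) (p : nat) (Om : closedFieldType)
          (iota : {rmorphism {fraction {poly Fq}} -> Om}).
Hypotheses (chp : p \in [pchar Fq]) (ac : is_alg_closure iota).
Local Notation q := #|Fq|.
Local Notation iA := (iA iota).
Local Notation T := (iA 'X).
Local Notation kap := (kap iota chp).
Local Notation KT := (KT iota chp).
Implicit Types (x y z : Om).

Lemma T_sub_neq0 x : kap x -> T - x != 0.
Proof.
move=> kx; apply/eqP => e; have := T_transc (a := 'X - x%:P) (LpB (LpX kap) (LpC kx)).
by rewrite hornerXsubC => /(_ e) /eqP; rewrite polyXsubC_eq0.
Qed.

(** [b] is the leading coefficient of an equation of [z^-1]; if [z] reduced to 0, that equation
    multiplied by a power of [z] would reduce to [b(x) = 0]. *)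
Lemma nonvanish_ex z : z != 0 -> exists b, [/\ Lp kap b, b != 0
  & forall x P, kap x -> kplace iota chp P x -> pO P z -> b.[x] != 0 -> pf P z != 0].
Proof.
move=> z0; have [h [h0 rh]] := algoKT chp ac z^-1.
pose h' := map_poly (sfm KT) h; pose n := (size h').-1.
have h'0 : h' != 0 by rewrite map_poly_eq0.
have sh : size h' = n.+1 by rewrite /n prednK // size_poly_gt0.
have Kh y : y \in (h' : seq Om) -> KT y by case/(nthP 0) => k _ <-; exact: Lp_map.
have [D [kD D0 hD]] := KT_den Kh.
have hD' i : exists a, Lp kap a /\ D.[T] * h'`_i = a.[T].
  have [lt|le] := ltnP i (size h'); first by apply: hD; exact: mem_nth.
  exists 0; split; first by move=> k; rewrite coef0; exact: sf0.
  by rewrite nth_default // mulr0 horner0.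
have [a ha] := choice hD'.
have an0 : a n != 0.
  apply/eqP => e; have := (ha n).2; rewrite e horner0 => /eqP; rewrite mulf_eq0 (negPf D0) /=.
  by rewrite -[n]/((size h').-1) -lead_coefE lead_coef_eq0 (negPf h'0).
have rel : \sum_(i < n.+1) (a i).[T] * z ^+ (n - i) = 0.
  have : D.[T] * z ^+ n * h'.[z^-1] = 0 by rewrite (rootP rh) mulr0.
  rewrite (horner_coef_wide _ (eq_leq sh)) mulr_sumr => e; rewrite -[RHS]e; apply: eq_bigr => i _.
  have en : z ^+ n = z ^+ (n - i) * z ^+ i by rewrite -exprD subnK // -ltnS.
  have gen (a1 a2 a3 a4 : Om) : a4 != 0 -> a1 * (a3 * a4) * (a2 * a4^-1) = a1 * a2 * a3.
    by move=> a40; field.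
  by rewrite -(ha i).2 en exprVn gen ?expf_neq0.
exists (a n); split => //; first exact: (ha n).1.
move=> x P kx kP Oz bx; apply/eqP => fz.
have := congr1 (pf P) rel; rewrite pf0 pf_sum; last first.
  by move=> i _; apply: pOM; [exact: (kP _ (ha i).1).1|exact: pOX].
rewrite big_ord_recr /= subnn expr0 mulr1 big1 ?add0r => [|i _].
  by rewrite (kP _ (ha n).1).2 => /eqP; rewrite (negPf bx).
rewrite (pfM (kP _ (ha i).1).1 (pOX _ Oz)) (pfX _ Oz) fz expr0n subn_eq0 leqNgt ltn_ord mulr0 //.
Qed.

Lemma good_ex m (th : 'I_m -> Om) : injective th -> exists b, [/\ Lp kap b, b != 0
  & forall x P, kap x -> kplace iota chp P x -> (forall t, pO P (th t)) -> b.[x] != 0 ->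
    injective (fun t => pf P (th t))].
Proof.
move=> inj.
have h (tt : 'I_m * 'I_m) : exists b, [/\ Lp kap b, b != 0 & forall x P, kap x -> kplace iota chp P x ->
    (forall t, pO P (th t)) -> b.[x] != 0 -> tt.1 != tt.2 -> pf P (th tt.1) != pf P (th tt.2)].
  have [e|ne] := eqVneq tt.1 tt.2.
    by exists 1; split; [move=> k; rewrite coef1; exact: sf_nat|exact: oner_neq0|move=> *; rewrite e eqxx].
  have z0 : th tt.1 - th tt.2 != 0 by rewrite subr_eq0 (inj_eq inj).
  have [b [kb b0 hb]] := nonvanish_ex z0; exists b; split => // x P kx kP Ot bx _.
  by rewrite -subr_eq0 -pfB //; apply: (hb x) => //; exact: pOB.
have [b hb] := choice h.
exists (\prod_tt b tt); split.
- elim/big_rec: _ => [|tt y _ IH]; first by move=> k; rewrite coef1; exact: sf_nat.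
  by apply: LpM => //; case: (hb tt).
- by apply/prodf_neq0 => tt _; case: (hb tt).
- move=> x P kx kP Ot; rewrite horner_prod => /prodf_neq0 bx t t' e.
  apply/eqP; apply: contraT => ne; have [_ _ /(_ x P kx kP Ot (bx (t, t') isT) ne)] := hb (t, t').
  by rewrite /= e eqxx.
Qed.

Section Unramified.
Variables (m : nat) (th : 'I_m.+1 -> Om) (A : nat -> {poly Om}) (x : Om) (P : place Om) (w : Om -> rat).
Hypotheses (kA : forall i, Lp kap (A i))
  (th_prod : \prod_t ('X - (th t)%:P) = 'X^(m.+1) + \sum_(i < m.+1) (A i).[T] *: 'X^i)
  (kx : kap x) (kP : kplace iota chp P x) (hw : valn P w) (wT : w (T - x) = 1)
  (wK : forall c, KT c -> c != 0 -> exists a : int, w c = a%:~R).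

Lemma th_O t : pO P (th t).
Proof.
have OT := (kplace_T kP).1.
have sz : (size (\sum_(i < m.+1) (A i).[T] *: 'X^i : {poly Om})%R < m.+2)%N.
  rewrite ltnS; apply: leq_trans (size_sum _ _ _) _; apply/bigmax_leqP => i _.
  by apply: leq_trans (size_scale_leq _ _) _; rewrite size_polyXn.
apply: (@pO_root _ P ('X^(m.+1) + \sum_(i < m.+1) (A i).[T] *: 'X^i)).
- move=> k; rewrite coefD coefXn coef_sum; apply: pOD.
    by case: eqP => _; [exact: pO1|exact: pO0].
  apply: pO_sum => i _; rewrite coefZ coefXn; apply: pOM; first exact: (kP (kA i)).1.
  by case: eqP => _; [exact: pO1|exact: pO0].
- by rewrite lead_coefDl ?size_polyXn // lead_coefXn pf1 oner_neq0.
- rewrite -th_prod /root horner_prod; apply/prodf_eq0; exists t => //.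
  by rewrite hornerXsubC subrr.
Qed.

Hypothesis (inj : injective (fun t => pf P (th t))).
Let Tx0 : T - x != 0. Proof. exact: T_sub_neq0. Qed.

(* a is a root of the product of Y - th t to the order w (th 0 - a), an integer *)
Let w_int a : Lp kap a -> a.[T] != th ord0 -> pf P a.[T] = pf P (th ord0) ->
  exists n : int, w (th ord0 - a.[T]) = n%:~R.
Proof.
move=> ka ne fe; have Oa := (kP ka).1.
pose V := a.[T] ^+ m.+1 + \sum_(i < m.+1) (A i).[T] * a.[T] ^+ i.
have eV : \prod_t (a.[T] - th t) = V.
  have := congr1 (fun u : {poly Om} => u.[a.[T]]) th_prod.
  rewrite horner_prod hornerD hornerXn horner_sum; under eq_bigr do rewrite hornerXsubC.
  by move=> ->; congr (_ + _); apply: eq_bigr => i _; rewrite hornerZ hornerXn.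
have KV : KT V.
  apply: sfD; first by apply: sfX; exact: KT_poly.
  by apply: sf_sum => i _; apply: sfM; [exact: KT_poly|apply: sfX; exact: KT_poly].
rewrite (bigD1 ord0) //= in eV.
have un : punit P (\prod_(t | t != ord0) (a.[T] - th t)).
  elim/big_rec: _ => [|t y nt IH]; first exact: punit1.
  apply: punitM => //; split; first by apply: pOB => //; exact: th_O.
  rewrite pfB // ?fe ?subr_eq0; last exact: th_O.
  by apply: contra nt => /eqP e; rewrite (inj e).
have ne' : a.[T] - th ord0 != 0 by rewrite subr_eq0.
have V0 : V != 0 by rewrite -eV mulf_neq0 // (punit_neq0 un).
have [n en] := wK KV V0; exists n; rewrite -en -eV (wM hw) ?(punit_neq0 un) //.
by rewrite ((wU hw (punit_neq0 un)).1 un) addr0 -(w_opp hw ne') opprB.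
Qed.

(** A Hensel argument: by [w_int] the order of the error is an integer, so removing the residue of
    the error over [(T - x)^k] raises the order by a full unit. In effect [th ord0] is a power
    series in [T - x]. *)
Lemma th_approx n : exists a, Lp kap a /\ (th ord0 != a.[T] -> n%:R <= w (th ord0 - a.[T])).
Proof.
have Oth := th_O ord0.
have step a k : Lp kap a -> th ord0 != a.[T] -> pf P a.[T] = pf P (th ord0) -> (0 < k)%N ->
    k%:R <= w (th ord0 - a.[T]) -> exists a', [/\ Lp kap a', pf P a'.[T] = pf P (th ord0)
      & th ord0 != a'.[T] -> k.+1%:R <= w (th ord0 - a'.[T])].
  move=> ka ne fe k0 le; have Tk : (T - x) ^+ k != 0 by rewrite expf_neq0.
  have ne' : th ord0 - a.[T] != 0 by rewrite subr_eq0.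
  have Oz : pO P ((th ord0 - a.[T]) / (T - x) ^+ k).
    by apply/(wle hw Tk ne'); rewrite (wX hw) // wT.
  set z := _ / _ in Oz; pose c := pf P z.
  have kc : kap c by exact: (kplace_res ac kx kP Oz).
  pose a' := a + c *: ('X - x%:P) ^+ k.
  have ka' : Lp kap a'.
    apply: LpD => // i; rewrite coefZ; apply: sfM => //.
    have : Lp kap (('X - x%:P) ^+ k); last by apply.
    elim: (k) => [|l IH]; first by rewrite expr0 => j; rewrite coef1; exact: sf_nat.
    by rewrite exprS; apply: LpM => //; apply: LpB; [exact: LpX|exact: LpC].
  have [Oc fc] := kplace_unit kP kc.
  have ea' : a'.[T] = a.[T] + c * (T - x) ^+ k by rewrite hornerD hornerZ horner_exp hornerXsubC.
  have [OT fT] := kplace_T kP; have [Ox fx] := kplace_unit kP kx.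
  have fTx : pO P (T - x) /\ pf P (T - x) = 0 by split; [exact: pOB|rewrite pfB // fT fx subrr].
  have fa' : pf P a'.[T] = pf P (th ord0).
    rewrite ea' pfD ?fe //; [|exact: (kP ka).1|by apply: pOM => //; apply: pOX; case: fTx].
    rewrite (pfM Oc (pOX _ fTx.1)) (pfX _ fTx.1) fTx.2 expr0n gtn_eqF // mulr0 addr0 //.
  exists a'; split => // na; have na2 : a'.[T] != th ord0 by rewrite eq_sym.
  have [nn enn] := w_int ka' na2 fa'.
  have na' : th ord0 - a'.[T] != 0 by rewrite subr_eq0.
  have gt : k%:R < w (th ord0 - a'.[T]).
    have := (wlt hw Tk na').2; rewrite (wX hw) // wT; apply.
    have -> : (th ord0 - a'.[T]) / (T - x) ^+ k = z - c by rewrite ea' /z; field.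
    by split; [exact: pOB|rewrite pfB // fc subrr].
  by move: gt; rewrite enn !pmulrn ltr_int ler_int; lia.
suff H k : (0 < k)%N -> exists a, [/\ Lp kap a, pf P a.[T] = pf P (th ord0)
    & th ord0 != a.[T] -> k%:R <= w (th ord0 - a.[T])].
  have [a [ka _ ha]] := H n.+1 isT; exists a; split => // ne.
  by apply: le_trans (ha ne); rewrite ler_nat.
elim: k => // -[|k] IH _.
  pose c := pf P (th ord0); have kc : kap c := kplace_res ac kx kP Oth.
  have [Oc fc] := kplace_unit kP kc.
  exists c%:P; rewrite hornerC; split => //; first exact: LpC.
  move=> ne; have ne1 : (c%:P).[T] != th ord0 by rewrite hornerC eq_sym.
  have fe1 : pf P (c%:P).[T] = pf P (th ord0) by rewrite hornerC fc.
  have [nn enn] := w_int (LpC kc) ne1 fe1.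
  have ne' : th ord0 - c != 0 by rewrite subr_eq0.
  have gt : 0 < w (th ord0 - c).
    by apply/(wgt0 hw ne'); split; [exact: pOB|rewrite pfB // fc subrr].
  move: enn gt; rewrite hornerC => ->; by rewrite ltr0z -[1%:R]/(1%:~R) ler_int.
have [a [ka fa ha]] := IH isT.
have [e|ne] := eqVneq (th ord0) a.[T]; first by exists a; split => //; rewrite e eqxx.
have [a2 [b1 b2 b3]] := step a k.+1 ka ne fa isT (ha ne).
by exists a2; split.
Qed.

(** [th ord0] is replaced by a polynomial in [T] so close to it that the valuation of the value of
    [H] does not change; on [KT] valuations are integers. *)
Theorem unramified (H : {poly Om}) : Lp KT H -> H.[th ord0] != 0 -> exists n : int, w H.[th ord0] = n%:~R.
Proof.
move=> KH y0; set y := H.[th ord0] in y0 *.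
have bnd : exists n : nat, forall i, (i < size H)%N -> H`_i != 0 -> w y - w H`_i < n%:R.
  elim: (size H) => [|k [n hn]]; first by exists 0%N.
  exists (n + Num.bound `|(w y - w H`_k)%R|%R)%N => i; rewrite ltnS leq_eqVlt => /orP [/eqP ->|lt] ni.
    rewrite natrD; apply: le_lt_trans (ler_norm _) _.
    by apply: lt_le_trans (archi_boundP (normr_ge0 _)) _; rewrite lerDr ler0n.
  by apply: lt_le_trans (hn i lt ni) _; rewrite ler_nat leq_addr.
have [n hn] := bnd; have [a [ka ha]] := th_approx n.
have Ka : KT H.[a.[T]] by apply: Lp_horner => //; exact: KT_poly.
have Oth := th_O ord0; have Oa := (kP ka).1.
have [e|ne] := eqVneq (th ord0) a.[T]; first by apply: wK => //; rewrite /y e.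
have ne' : th ord0 - a.[T] != 0 by rewrite subr_eq0.
pose z := H.[a.[T]] - y.
have ez : z = \sum_(i < size H) H`_i * (a.[T] ^+ i - th ord0 ^+ i).
  by rewrite /z /y !horner_coef -sumrB; apply: eq_bigr => i _; rewrite mulrBr.
have term (i : 'I_(size H)) : pO P (H`_i * (a.[T] ^+ i - th ord0 ^+ i) / y) /\
    pf P (H`_i * (a.[T] ^+ i - th ord0 ^+ i) / y) = 0.
  have [->|nz] := eqVneq (H`_i * (a.[T] ^+ i - th ord0 ^+ i)) 0.
    by rewrite mul0r pf0; split => //; exact: pO0.
  apply/(wlt hw y0 nz); move: nz; rewrite mulf_eq0 negb_or => /andP [Hi di].
  rewrite (wM hw Hi di) -ltrBlDl; apply: lt_le_trans (hn i (ltn_ord i) Hi) _.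
  apply: le_trans (ha ne) _; apply/(wle hw ne' di).
  rewrite subrXX; set S0 := \sum_(_ < _) _.
  have -> : (a.[T] - th ord0) * S0 / (th ord0 - a.[T]) = - S0 by field.
  apply: pON.
  by apply: pO_sum => k _; apply: pOM; exact: pOX.
have wz : z != 0 -> w y < w z.
  move=> z0; apply/(wlt hw y0 z0); rewrite ez mulr_suml; split.
    by apply: pO_sum => i _; exact: (term i).1.
  rewrite pf_sum; last by move=> i _; exact: (term i).1.
  by apply: big1 => i _; exact: (term i).2.
have := wD_eq hw y0 wz; rewrite /z addrC subrK => -[h1 h2].
by rewrite -h2; exact: wK.
Qed.
End Unramified.
End Good.

(** * The Kummer extension *)

Section Kummer.
Variables (Fq : finFieldType) (p : nat) (Om : closedFieldType)
          (iota : {rmorphism {fraction {poly Fq}} -> Om}).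
Hypotheses (chp : p \in [pchar Fq]) (ac : is_alg_closure iota).
Local Notation q := #|Fq|.
Local Notation iA := (iA iota).
Local Notation T := (iA 'X).
Local Notation kap := (kap iota chp).
Local Notation KT := (KT iota chp).
Local Notation evq := (evq iota).
Implicit Types (x y z : Om).
Let q1 : (1 < q)%N := q_gt1 Fq.
Variables (pi : {poly Fq}) (x0 : Om) (g n : nat).
Hypotheses (ir : irreducible_poly pi) (r0 : evq pi x0 = 0) (dE : (size pi).-1 = (g * n)%N).
Let d := (size pi).-1.
Let d0 : (0 < d)%N. Proof. exact: (irr_d_gt0 chp ir). Qed.
Let g0 : (0 < g)%N. Proof. by move: d0; rewrite /d dE muln_gt0 => /andP []. Qed.
Let n0 : (0 < n)%N. Proof. by move: d0; rewrite /d dE muln_gt0 => /andP []. Qed.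
Definition kexp := (q ^ g).-1.
Local Notation kk := kexp.
Definition xj j := x0 ^+ (q ^ (g * j)).
(* the norm of pi_1(X) = prod_j (X - x0^(q^(g j))), viewed over F_(q^g), down to F_q,
   with the Frobenius twists moved to the variable *)
Definition DD : {poly Om} := \prod_(i < g) \prod_(j < n) ('X^(q ^ i) - (xj j)%:P).

Let xj_per j : xj (j + n) = xj j.
Proof. by rewrite /xj mulnDr addnC expnD exprM -dE (x0_Fr chp ir r0). Qed.
Let kxj j : kap (xj j). Proof. by apply: sfX; exact: (kap_x0 chp ir r0). Qed.
Lemma kk_gt0 : (0 < kk)%N.
Proof. by rewrite /kexp -subn1 subn_gt0 -[1%N](expn0 q) ltn_exp2l. Qed.
Lemma kk_S : kk.+1 = (q ^ g)%N. Proof. by rewrite prednK // expn_gt0 ltnW. Qed.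

Lemma kDD : Lp kap DD.
Proof.
rewrite /DD; elim/big_rec: _ => [|i a _ IH]; first by move=> k; rewrite coef1; exact: sf_nat.
apply: LpM => //; elim/big_rec: _ => [|j b _ IHb]; first by move=> k; rewrite coef1; exact: sf_nat.
by apply: LpM => //; apply: LpB; [move=> k; rewrite coefXn; exact: sf_nat|exact: LpC].
Qed.

Lemma DD_horner y : DD.[y] = \prod_(i < g) \prod_(j < n) (y ^+ (q ^ i) - xj j).
Proof.
rewrite /DD horner_prod; apply: eq_bigr => i _; rewrite horner_prod; apply: eq_bigr => j _.
by rewrite hornerD hornerN hornerXn hornerC.
Qed.

Let size_prod_bound (J : finType) (F : J -> {poly Om}) (W : J -> nat) :
  (forall j, size (F j) <= (W j).+1)%N -> (size (\prod_j F j)%R <= (\sum_j W j).+1)%N.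
Proof.
move=> h; elim/big_rec2: _ => [|j a b _ IH]; first by rewrite size_poly1.
apply: leq_trans (size_polyMleq _ _) _; have := h j; move: IH.
move: (size (F j)) (size b) (W j) => u1 u2 u3; lia.
Qed.

(** The degree [n (q^g - 1) / (q - 1)] is weakened to [d * kk], the form in which [u] receives
    weight [d]. *)
Lemma size_DD : (size DD <= (d * kk).+1)%N.
Proof.
apply: leq_trans (@size_prod_bound _ _ (fun i : 'I_g => (n * q ^ i)%N) _) _.
  move=> i; apply: leq_trans (@size_prod_bound _ _ (fun _ : 'I_n => (q ^ i)%N) _) _.
    move=> j; apply: leq_trans (size_polyD _ _) _; rewrite size_polyN size_polyXn geq_max leqnn /=.
    by apply: leq_trans (size_polyC_leq1 _) _.
  by rewrite sum_nat_const card_ord.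
rewrite ltnS -big_distrr /= /kexp predn_exp; apply: leq_mul.
  by rewrite /d dE leq_pmull.
by rewrite leq_pmull // -subn1 subn_gt0.
Qed.

Let x0_inj a b : x0 ^+ (q ^ a) = x0 ^+ (q ^ b) -> a = b %[mod d].
Proof.
have red c : x0 ^+ (q ^ c) = x0 ^+ (q ^ (c %% d)).
  have xd : x0 ^+ (q ^ d) = x0 := x0_Fr chp ir r0.
  by rewrite {1}(divn_eq c d) expnD exprM mulnC (Fr_iter _ xd).
rewrite (red a) (red b); have := ltn_pmod a d0; have := ltn_pmod b d0.
move: (a %% d)%N (b %% d)%N => u v.
wlog le : u v / (u <= v)%N.
  by move=> W h1 h2 e; case/orP: (leq_total u v) => h; [exact: W|apply/esym; exact: W].
move=> vd ud e; apply/eqP; rewrite eqn_leq le /= leqNgt; apply/negP => lt.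
have : x0 ^+ (q ^ (v - u)) != x0.
  by apply: (x0_order chp ir r0); rewrite subn_gt0 lt /=; apply: leq_ltn_trans (leq_subr _ _) vd.
move/eqP; apply; apply: (Fr_inj iota chp (k := u)).
by rewrite /= -exprM -expnD subnK // ltnW.
Qed.

(** Since [x0] has degree [d = g n], the equality of [x0^(q^i)] and [x0^(q^(g j))] with [i < g] and
    [j < n] forces [i = j = 0]. The simple zero makes the Kummer extension totally ramified at
    [x0]. *)
Lemma DD_simple : exists R, [/\ Lp kap R, DD = ('X - x0%:P) * R & R.[x0] != 0].
Proof.
pose i0 := Ordinal g0; pose j0 := Ordinal n0.
have xj0 : xj j0 = x0 by rewrite /xj muln0 expn0 expr1.
pose R := (\prod_(j < n | j != j0) ('X^(q ^ i0) - (xj j)%:P)) *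
   \prod_(i < g | i != i0) \prod_(j < n) ('X^(q ^ i) - (xj j)%:P).
exists R; split.
- have h i j : Lp kap ('X^(q ^ i) - (xj j)%:P).
    by apply: LpB; [move=> k; rewrite coefXn; exact: sf_nat|exact: LpC].
  have h1 : Lp kap 1 by move=> k; rewrite coef1; exact: sf_nat.
  apply: LpM; elim/big_rec: _ => // i a _ IH; apply: LpM => //.
  by elim/big_rec: _ => // j b _ IHb; exact: LpM.
- by rewrite /DD (bigD1 i0) //= (bigD1 j0) //= expn0 expr1 xj0 mulrA.
- have key i j : ((i : nat) != 0%N) || ((j : nat) != 0%N) -> (i < g)%N -> (j < n)%N -> x0 ^+ (q ^ i) - xj j != 0.
    move=> hij ig jn; rewrite subr_eq0; apply/eqP => /x0_inj e.
    have gj : (g * j < d)%N by rewrite /d dE ltn_pmul2l.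
    have id' : (i < d)%N by apply: leq_trans ig _; rewrite /d dE leq_pmulr.
    rewrite !modn_small // in e; case: (posnP j) hij => [j0'|jp] hij.
      by move: hij; rewrite e j0' muln0.
    have : (g <= i)%N by rewrite e leq_pmulr.
    by rewrite leqNgt ig.
  rewrite hornerM !horner_prod mulf_neq0 //; apply/prodf_neq0.
    by move=> j nj; rewrite hornerD hornerN hornerXn hornerC; apply: key => //; rewrite -val_eqE /= in nj; rewrite nj orbT.
  move=> i ni; rewrite horner_prod; apply/prodf_neq0 => j _.
  by rewrite hornerD hornerN hornerXn hornerC; apply: key => //; rewrite -val_eqE /= in ni; rewrite ni.
Qed.

(* both sides are products over the pairs of conjugates of x and x0 *)
Lemma DD_reciprocity x m' (ql : {poly Fq}) : (2 %| g * m')%N ->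
  map_poly (kcm iota) ql = \prod_(k < g * m') ('X - (x ^+ (q ^ k))%:P) ->
  evq ql x0 ^+ (\sum_(j < n) (q ^ g) ^ j) = DD.[x] ^+ (\sum_(l < m') (q ^ g) ^ l).
Proof.
move=> ev eql.
have DDl l : DD.[x] ^+ ((q ^ g) ^ l) = \prod_(i < g) \prod_(j < n) (x ^+ (q ^ (g * l + i)) - xj j).
  rewrite DD_horner -expnM -prodrXl; apply: eq_bigr => i _; rewrite -prodrXl.
  rewrite -(periodic_prod (h := fun j => x ^+ (q ^ (g * l + i)) - xj j) l); last by move=> j; rewrite xj_per.
  apply: eq_bigr => j _; rewrite (FrB iota chp) -exprM -expnD addnC; congr (_ - _).
  by rewrite /xj -exprM -expnD -mulnDr.
have -> : DD.[x] ^+ (\sum_(l < m') (q ^ g) ^ l) = \prod_(k < g * m') \prod_(j < n) (x ^+ (q ^ k) - xj j).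
  elim: (m') => [|l IH]; first by rewrite big_ord0 expr0 muln0 big_ord0.
  rewrite big_ord_recr /= exprD IH DDl mulnS addnC big_split_ord /=; congr (_ * _).
have -> : evq ql x0 ^+ (\sum_(j < n) (q ^ g) ^ j) = \prod_(j < n) \prod_(k < g * m') (xj j - x ^+ (q ^ k)).
  have el j : evq ql x0 ^+ ((q ^ g) ^ j) = \prod_(k < g * m') (xj j - x ^+ (q ^ k)).
    rewrite -expnM (evq_Fr iota chp) -/(xj j) /evq eql horner_prod.
    by apply: eq_bigr => k _; rewrite hornerXsubC.
  elim: (n) => [|l IH]; first by rewrite !big_ord0 expr0.
  by rewrite !big_ord_recr /= exprD IH el.
rewrite [RHS]exchange_big; apply: eq_bigr => j _.
transitivity (\prod_(k < g * m') - (x ^+ (q ^ k) - xj j)); first by apply: eq_bigr => k _; rewrite opprB.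
rewrite prodrN card_ord; have -> : (-1) ^+ (g * m') = 1 :> Om; last by rewrite mul1r.
by case/dvdnP: ev => c ->; rewrite mulnC exprM sqrrN !expr1n.
Qed.

Section Root.
Variables (m : nat) (th : 'I_m.+1 -> Om) (A : nat -> {poly Om}) (u : Om).
Hypotheses (kA : forall i, Lp kap (A i))
  (th_prod : \prod_t ('X - (th t)%:P) = 'X^(m.+1) + \sum_(i < m.+1) (A i).[T] *: 'X^i)
  (th_aut : forall t, exists s, autL KT s /\ s (th ord0) = th t)
  (hu : u ^+ kk = DD.[T])
  (good0 : forall P, kplace iota chp P x0 -> injective (fun t => pf P (th t))).
Local Notation th0 := (th ord0).

(* at x0 the extension by th is unramified while the valuation of u has denominator kk *)
Lemma kummer_indep (y : 'I_kk -> Om) : (forall j, adj KT th0 (y j)) ->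
  \sum_j y j * u ^+ j = 0 -> forall j, y j = 0.
Proof.
move=> Ky sy j1; apply: contrapT => /eqP yj1.
have kx0 := kap_x0 chp ir r0; have [P kP] := kplace_ex kx0.
have [w [hw wT wK _]] := kplace_val ac kx0 kP.
have un := unramified ac kA th_prod kx0 kP hw wT wK (good0 kP).
have wy j : y j != 0 -> exists nn : int, w (y j) = nn%:~R.
  move=> yj; have [H eH] := adj_poly (algoKT chp ac) (Ky j).
  by rewrite eH in yj *; apply: un => //; exact: Lp_map.
have [R [kR eR Rx]] := DD_simple.
have uR : punit P R.[T] by have [o1 o2] := kP R kR; split => //; rewrite o2.
have wD : w DD.[T] = 1.
  rewrite eR hornerM hornerXsubC (wM hw) ?(T_sub_neq0 kx0) ?(punit_neq0 uR) //.
  by rewrite wT ((wU hw (punit_neq0 uR)).1 uR) addr0.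
have u0 : u != 0.
  apply/eqP => e; move: hu; rewrite e expr0n gtn_eqF ?kk_gt0 // => /esym/eqP.
  rewrite eR hornerM hornerXsubC mulf_eq0 (negPf (T_sub_neq0 kx0)) /=.
  by rewrite (negPf (punit_neq0 uR)).
have wu : kk%:R * w u = 1 by rewrite mulr_natl -(wX hw) // hu.
have [|a [b [ab Ea Eb uab _]]] := two_max P (E := fun j : 'I_kk => y j * u ^+ j) _ sy.
  by exists j1; rewrite mulf_neq0 ?expf_neq0.
have ya : y a != 0 by move: Ea; rewrite mulf_eq0 negb_or => /andP [].
have yb : y b != 0 by move: Eb; rewrite mulf_eq0 negb_or => /andP [].
have [na ena] := wy a ya; have [nb enb] := wy b yb.
have := (weq hw Ea Eb).2 uab.
rewrite (wM hw ya) ?expf_neq0 // (wM hw yb) ?expf_neq0 // !(wX hw) // ena enb => e1.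
have e2 : (kk%:Z * na + (a : nat)%:Z)%:~R = (kk%:Z * nb + (b : nat)%:Z)%:~R :> rat.
  rewrite !intrD !intrM -!pmulrn.
  transitivity (kk%:R * (na%:~R + w u *+ a)).
    by rewrite mulrDr -[w u *+ a]mulr_natr mulrA wu mul1r.
  by rewrite e1 mulrDr -[w u *+ b]mulr_natr mulrA wu mul1r.
move/eqP: e2; rewrite eqr_int => /eqP e2.
have e3 : (a : nat) = b %[mod kk].
  apply/eqP; rewrite -eqz_nat -!modz_nat; apply/eqP.
  by rewrite -(modzMDl na (a : nat)%:Z) -(modzMDl nb (b : nat)%:Z) ![_ * kk%:Z]mulrC e2.
by move: ab; rewrite -val_eqE /= => /eqP; apply; move: e3; rewrite !modn_small.
Qed.

(** Independence of the powers of [u] makes ['X^kk - DD(T)] its minimal polynomial over the field of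
    [th ord0]. *)
Lemma kummer_aut z : z ^+ kk = DD.[T] -> exists s, autL (adj KT th0) s /\ s u = z.
Proof.
move=> hz; have aL := algo_sub (@adj_sub _ KT th0) (algoKT chp ac).
have LD : adj KT th0 DD.[T] by apply: adj_sub; apply: KT_poly; exact: kDD.
have [D' eD'] := sft_ex LD.
pose mu : {poly sft (adj KT th0)} := 'X^kk - D'%:P.
have rm v : root (map_poly (sfm (adj KT th0)) mu) v = (v ^+ kk == DD.[T]).
  have -> : map_poly (sfm (adj KT th0)) mu = 'X^kk - (DD.[T])%:P.
    apply/polyP => k; rewrite (coef_map (sfm (adj KT th0))) !coefB !coefXn !coefC.
    apply: (etrans (rmorphB (sfm (adj KT th0)) _ _)); congr (_ - _).
      exact: (rmorph_nat (sfm (adj KT th0))).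
    by case: eqP => _; [exact: eD'|exact: (rmorph0 (sfm (adj KT th0)))].
  by rewrite /root hornerD hornerN hornerXn hornerC subr_eq0.
apply: (iso_ext (m := mu)) => //; last by rewrite rm hz.
have smu : size mu = kk.+1.
  by rewrite size_polyDl size_polyXn // size_polyN (leq_ltn_trans (size_polyC_leq1 _)) // ltnS kk_gt0.
have mu0 : mu != 0 by rewrite -size_poly_gt0 smu.
move=> h rh; pose h' := h %% mu.
have rmu : root (map_poly (sfm (adj KT th0)) mu) u by rewrite rm hu.
have e3 : map_poly (sfm (adj KT th0)) h = map_poly (sfm (adj KT th0)) (h %/ mu) * map_poly (sfm (adj KT th0)) mu
    + map_poly (sfm (adj KT th0)) h'.
  rewrite {1}(divp_eq h mu); apply: etrans (rmorphD (map_poly (sfm (adj KT th0))) _ _) _; congr (_ + _).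
  exact: (rmorphM (map_poly (sfm (adj KT th0)))).
have rh' : (map_poly (sfm (adj KT th0)) h').[u] = 0.
  by move/rootP: rh; rewrite e3 hornerD hornerM (rootP rmu) mulr0 add0r.
have sh' : (size h' <= kk)%N by rewrite -ltnS -smu ltn_modp.
have sh2 : (size (map_poly (sfm (adj KT th0)) h') <= kk)%N by rewrite size_map_poly.
rewrite (horner_coef_wide _ sh2) in rh'.
have z0 := kummer_indep (fun j : 'I_kk => Lp_map h' j) rh'.
have : map_poly (sfm (adj KT th0)) h' = 0.
  apply/polyP => k; rewrite coef0; have [lt|le] := ltnP k kk; first exact: (z0 (Ordinal lt)).
  by rewrite nth_default // (leq_trans sh2).
by move/eqP; rewrite map_poly_eq0 => /eqP e; rewrite /dvdp -/h' e.
Qed.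

Hypothesis (th_ind : indep KT (fun i : 'I_m.+1 => th0 ^+ i)).
Definition eb (ij : 'I_m.+1 * 'I_kk) := th0 ^+ ij.1 * u ^+ ij.2.

Lemma eb_indep : indep KT eb.
Proof.
move=> c kc e [i j].
have sy : \sum_(j < kk) (\sum_i c (i, j) * th0 ^+ i) * u ^+ j = 0.
  rewrite -[RHS]e; under eq_bigr do rewrite mulr_suml; rewrite exchange_big pair_bigA /=.
  by apply: eq_bigr => -[a b] _; rewrite /eb /= mulrA.
have := kummer_indep _ sy j; move=> /(_ _)/(th_ind (fun i => kc (i, j))) h; apply: h => l.
apply: sf_sum => k _; apply: sfM; first by apply: adj_sub; exact: kc.
by apply: sfX; exact: adj_gen.
Qed.

(** Composing a place over [x] with automorphisms yields every pair formed of the residue of a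
    conjugate [th t] and of a [kk]-th root of unity times the residue of [u]. Two Vandermonde
    arguments then kill the coefficients. *)
Lemma eb_vanish x (h : 'I_m.+1 * 'I_kk -> {poly Om}) : kap x -> (forall ij, Lp kap (h ij)) ->
  (forall P, kplace iota chp P x -> injective (fun t => pf P (th t))) -> DD.[x] != 0 ->
  (forall P, kplace iota chp P x -> pf P (\sum_ij (h ij).[T] * eb ij) = 0) -> forall ij, (h ij).[x] = 0.
Proof.
move=> kx kh inj Dx hz [i1 j1]; have [P kP] := kplace_ex kx.
have Oth := th_O kA th_prod kP.
have Ou : pO P u.
  by apply: (pO_root_exp kk_gt0); rewrite hu; exact: (kP _ kDD).1.
have fu0 : pf P u != 0.
  apply: contraNneq Dx => e; rewrite -(kP _ kDD).2 -hu (pfX _ Ou) e expr0n gtn_eqF ?kk_gt0 //.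
have uT : u != 0 by apply: contraNneq fu0 => ->; rewrite pf0.
have [zs [uzs szs hzs]] : exists zs : seq Om, [/\ uniq zs, size zs = (q ^ g)%N & forall c, c \in zs <-> c ^+ (q ^ g) = c].
  exact: (frob_list iota chp g0).
pose zr := rem 0 zs.
have z0in : 0 \in zs by apply/hzs; exact: (Fr0 iota chp g).
have szr : size zr = kk by rewrite size_rem // szs.
have uzr : uniq zr by exact: rem_uniq.
have zk (l : 'I_kk) : zr`_l ^+ kk = 1 /\ kap zr`_l.
  have lin : zr`_l \in zr by apply: mem_nth; rewrite szr.
  have nz : zr`_l != 0 by move: lin; rewrite mem_rem_uniq // inE => /andP [].
  have /hzs e : zr`_l \in zs by apply: mem_rem lin.
  split; last by exists g.
  by apply: (mulfI nz); rewrite -exprS kk_S e mulr1.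
have val t (l : 'I_kk) : \sum_ij (h ij).[x] * (pf P (th t) ^+ ij.1 * (zr`_l * pf P u) ^+ ij.2) = 0.
  have [s1 [hs1 es1]] := th_aut t.
  pose xi := s1 u / u.
  have s1u : s1 u = xi * u by rewrite divfK.
  have kDT : KT DD.[T] by apply: KT_poly; exact: kDD.
  have xik : xi ^+ kk = 1.
    have DT0 : DD.[T] != 0 by rewrite -hu expf_neq0.
    by rewrite /xi expr_div_n -endoX hu hs1.2 // divff.
  have xi0 : xi != 0 by apply/eqP => e; move: xik; rewrite e expr0n gtn_eqF ?kk_gt0 // => /eqP; rewrite eq_sym oner_eq0.
  have kxi : kap xi.
    by exists g => //; rewrite -kk_S exprS xik mulr1.
  have [|s2 [hs2 es2]] := @kummer_aut (zr`_l / xi * u).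
    by rewrite exprMn expr_div_n (zk l).1 xik divr1 mul1r hu.
  have hs2' : autL KT s2 by apply: autL_sub hs2; exact: adj_sub.
  have [s [hs es]] := aut_comp hs1 hs2'.
  have sth : s th0 = th t by rewrite es /= hs2.2 //; exact: adj_gen.
  have kz := (zk l).2.
  have su : s u = zr`_l * u.
    have KTz c : kap c -> s1 c = c by move=> kc; apply: hs1.2; exact: KT_kap.
    by rewrite es /= es2 !endoM fmorphV (KTz _ kz) (KTz _ kxi) s1u mulrA divfK.
  have [P' hP'] := place_comp P s.
  have kP' : kplace iota chp P' x.
    move=> a ka; have sa : s a.[T] = a.[T] by apply: hs.2; exact: KT_poly.
    by have [h1 ->] := hP' a.[T]; rewrite h1 sa; exact: kP.
  have := hz P' kP'; rewrite (hP' _).2 endo_sum.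
  have Oz : pO P (zr`_l * u) by apply: pOM => //; exact: (kplace_unit kP kz).1.
  have tm ij : pO P (s ((h ij).[T] * eb ij)) /\ pf P (s ((h ij).[T] * eb ij)) =
      (h ij).[x] * (pf P (th t) ^+ ij.1 * (zr`_l * pf P u) ^+ ij.2).
    have e1 : s ((h ij).[T] * eb ij) = (h ij).[T] * (th t ^+ ij.1 * (zr`_l * u) ^+ ij.2).
      by rewrite /eb !endoM !endoX sth su hs.2 //; exact: KT_poly.
    have [o1 o2] := kP _ (kh ij).
    have o3 := pOX ij.1 (Oth t); have o4 := pOX ij.2 Oz.
    have [k1 k2] := kplace_unit kP kz.
    rewrite e1; split; first by apply: pOM => //; exact: pOM.
    by rewrite (pfM o1 (pOM o3 o4)) o2 (pfM o3 o4) !pfX // (pfM k1 Ou) k2.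
  rewrite pf_sum; last by move=> ij _; exact: (tm ij).1.
  by move=> e; rewrite -[RHS]e; apply: eq_bigr => ij _; rewrite (tm ij).2.
have injz : injective (fun l : 'I_kk => zr`_l * pf P u).
  by move=> a b /(mulIf fu0) /eqP; rewrite nth_uniq ?szr // => /eqP; exact: val_inj.
have step t j : \sum_i (h (i, j)).[x] * pf P (th t) ^+ i = 0.
  apply: (poly_vanish (c := fun j => \sum_i (h (i, j)).[x] * pf P (th t) ^+ i) injz) => l.
  rewrite -[RHS](val t l); under eq_bigr do rewrite mulr_suml; rewrite exchange_big pair_bigA /=.
  by apply: eq_bigr => -[a b] _; rewrite /= mulrA.
exact: (poly_vanish (c := fun i => (h (i, j1)).[x]) (inj P kP) (fun t => step t j1)).
Qed.
End Root.
End Kummer.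

(** * Completely split primes that are power residues *)

Section Split.
Variables (Fq : finFieldType) (p : nat) (Om : closedFieldType)
          (iota : {rmorphism {fraction {poly Fq}} -> Om}).
Hypotheses (chp : p \in [pchar Fq]) (ac : is_alg_closure iota).
Local Notation q := #|Fq|.
Local Notation iA := (iA iota).
Local Notation T := (iA 'X).
Local Notation kap := (kap iota chp).
Local Notation KT := (KT iota chp).
Local Notation evq := (evq iota).
Let q1 : (1 < q)%N := q_gt1 Fq.
Variables (K0 : Om -> Prop) (t0 : theta_data iota chp K0).
Local Notation dl := (td t0).
Local Notation th := (th (t0 := t0)).
Local Notation A := (tA t0).
Local Notation B := (tB (t0 := t0)).
Local Notation th0 := (th ord0).

(* the weight of th, and the excess weight of the conjugates of the basis elements *)
Definition thw := (\sum_(i < dl.+1) size (A i))%N.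
Definition thB := (\sum_(t < dl.+1) \sum_(i < dl.+1) size (B t i) + thw * dl.+1)%N.
Definition thC := (dl.+1 * (size (tD t0) + thB))%N.

Variables (pi : {poly Fq}) (x0 : Om) (g n : nat) (Bd : {poly Om}).
Hypotheses (ir : irreducible_poly pi) (r0 : evq pi x0 = 0) (dE : (size pi).-1 = (g * n)%N)
  (Bd0 : Bd != 0)
  (hBd : forall x P, kap x -> kplace iota chp P x -> (forall t, pO P (th t)) -> Bd.[x] != 0 ->
    injective (fun t => pf P (th t))) (Bdx0 : Bd.[x0] != 0).
Let d := (size pi).-1.
Local Notation kk := (kexp Fq g).
Local Notation DD := (DD Fq x0 g n).
Variable u : Om.
Hypothesis hu : u ^+ kk = DD.[T].
Local Notation I := ('I_dl.+1 * 'I_kk)%type.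
Local Notation e := (@eb Fq Om g dl th u).
(** [u] counts for [d] because [u^kk] is a polynomial in [T] of degree at most [d kk]. *)
Let wt (ij : I) := (thw * ij.1 + d * ij.2)%N.
Definition om := (thw * dl.+1 + d * kk)%N.
Local Notation Wt := (weighted iota chp e wt).
Let kk0 : (0 < kk)%N := kk_gt0 chp ir dE.
Let i0 : I := (ord0, Ordinal kk0).
Let e0 : e i0 = 1. Proof. by rewrite /eb /= !expr0 mulr1. Qed.
Let wt0 : wt i0 = 0%N. Proof. by rewrite /wt /= !muln0. Qed.
Let wt_om i : (wt i <= om)%N.
Proof. by apply: leq_add; rewrite leq_mul2l ltnW ?orbT. Qed.
Let kD0 : Lp kap DD := kDD chp g n ir r0.
Let good P : kplace iota chp P x0 -> injective (fun t => pf P (th t)).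
Proof.
move=> kP; apply: (hBd (kap_x0 chp ir r0) kP _ Bdx0).
exact: (th_O (@kA _ _ _ _ _ _ t0) (th_prod t0) kP).
Qed.
Let ind : indep KT e := eb_indep ac ir r0 dE (@kA _ _ _ _ _ _ t0) (th_prod t0) hu good (th_ind (t0:=t0)).

Let size_A (i : 'I_dl.+1) : (size (A i) <= thw)%N.
Proof. by rewrite /thw (bigD1 i) //= leq_addr. Qed.

Let th_rel : th0 ^+ dl.+1 = - \sum_(i < dl.+1) (A i).[T] * th0 ^+ i.
Proof.
have := congr1 (fun P : {poly Om} => P.[th0]) (th_prod t0).
rewrite horner_prod (bigD1 ord0) //= hornerXsubC subrr mul0r hornerD hornerXn horner_sum => /esym/eqP.
rewrite addr_eq0 => /eqP ->; congr (- _); apply: eq_bigr => i _.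
by rewrite hornerZ hornerXn.
Qed.

Let mulT k N a z : Lp kap a -> (size a <= k.+1)%N -> Wt N z -> Wt (N + k) (a.[T] * z).
Proof.
move=> ka sa [h [kh sh ->]]; exists (fun i => a * h i); split; first by move=> i; exact: LpM.
  move=> i; have [->|hi] := eqVneq (h i) 0; first by rewrite mulr0 size_poly0.
  apply: leq_trans (size_polyMleq _ _) _; have := sh i; move: hi; rewrite -size_poly_gt0.
  by move: (size a) (size (h i)) (wt i) sa => s1 s2 s3; lia.
by rewrite mulr_sumr; apply: eq_bigr => i _; rewrite hornerM mulrA.
Qed.

Let mulN N z : Wt N z -> Wt N (- z).
Proof.
move=> h; have := @mulT 0 N (-1)%:P z; rewrite addn0 hornerC mulN1r; apply => //.
- by apply: LpC; apply: sfN; exact: sf1.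
- exact: size_polyC_leq1.
Qed.

Let gen N (a : {poly Om}) (i j : nat) (hi : (i < dl.+1)%N) (hj : (j < kk)%N) : Lp kap a ->
  (size a <= N.+1 - (thw * i + d * j))%N -> Wt N (a.[T] * (th0 ^+ i * u ^+ j)).
Proof. by move=> ka sa; apply: (weighted_gen e (i := (Ordinal hi, Ordinal hj))). Qed.

Let multh N z : Wt N z -> Wt (N + thw) (th0 * z).
Proof.
move=> [h [kh sh ->]]; rewrite mulr_sumr; apply: weighted_sum => -[i j] _ /=.
have := sh (i, j); rewrite /wt /= => shij; have := kh (i, j) => kij; move: (h (i, j)) shij kij => a sa ka.
rewrite /eb /=; have [hi|hi] := ltnP i.+1 dl.+1.
  have -> : th0 * (a.[T] * (th0 ^+ i * u ^+ j)) = a.[T] * (th0 ^+ i.+1 * u ^+ j) by rewrite exprS; ring.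
  apply: gen => //; apply: leq_trans sa _; rewrite mulnS.
  by move: (thw * i)%N (d * j)%N => s1 s2; lia.
have ei : (i : nat) = dl by apply/eqP; rewrite eqn_leq -ltnS ltn_ord /=; exact: hi.
have [->|a0] := eqVneq a 0; first by rewrite horner0 mul0r mulr0; exact: weighted0.
have -> : th0 * (a.[T] * (th0 ^+ i * u ^+ j)) = - \sum_(k < dl.+1) ((a * A k).[T] * (th0 ^+ k * u ^+ j)).
  transitivity (a.[T] * u ^+ j * th0 ^+ dl.+1); first by rewrite ei exprS; ring.
  rewrite th_rel mulrN mulr_sumr; congr (- _); apply: eq_bigr => k _; rewrite hornerM; ring.
apply: mulN; apply: weighted_sum => k _; apply: gen => //; first by apply: LpM => //; exact: kA.
apply: leq_trans (size_polyMleq _ _) _.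
have := size_A k; have := ltn_ord k; rewrite ltnS => kd; rewrite ei in sa.
have [s hs] : exists s, (dl = k + s)%N by exists (dl - k)%N; rewrite subnKC.
have e3 : (thw * dl = thw * k + thw * s)%N by rewrite -mulnDr -hs.
move: sa a0; rewrite -size_poly_gt0 e3.
by move: (size a) (size (A k)) (thw * k)%N (thw * s)%N (d * j)%N => s1 s2 s3 s4 s5; lia.
Qed.

Let mulu N z : Wt N z -> Wt (N + d) (u * z).
Proof.
move=> [h [kh sh ->]]; rewrite mulr_sumr; apply: weighted_sum => -[i j] _ /=.
have := sh (i, j); rewrite /wt /= => shij; have := kh (i, j) => kij; move: (h (i, j)) shij kij => a sa ka.
rewrite /eb /=; have [hj|hj] := ltnP j.+1 kk.
  have -> : u * (a.[T] * (th0 ^+ i * u ^+ j)) = a.[T] * (th0 ^+ i * u ^+ j.+1) by rewrite exprS; ring.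
  apply: gen => //; apply: leq_trans sa _; rewrite mulnS.
  by move: (thw * i)%N (d * j)%N => s1 s2; lia.
have ej : (j.+1 : nat) = kk by apply/eqP; rewrite eqn_leq ltn_ord /=; exact: hj.
have [->|a0] := eqVneq a 0; first by rewrite horner0 mul0r mulr0; exact: weighted0.
have -> : u * (a.[T] * (th0 ^+ i * u ^+ j)) = (a * DD).[T] * (th0 ^+ i * u ^+ 0).
  rewrite hornerM -hu -{2}ej exprS expr0; ring.
apply: gen => //; first exact: LpM.
apply: leq_trans (size_polyMleq _ _) _.
have e3 : (d * kk = d * j.+1)%N by congr (_ * _)%N; rewrite ej.
have := size_DD chp x0 ir dE; rewrite -/d e3 mulnS muln0 addn0.
move: sa a0; rewrite -size_poly_gt0.
by move: (size a) (size DD) (thw * i)%N (d * j)%N => s1 s2 s3 s4; lia.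
Qed.

Let multhX N z k : Wt N z -> Wt (N + thw * k) (th0 ^+ k * z).
Proof.
move=> h; elim: k => [|k IH]; first by rewrite muln0 addn0 expr0 mul1r.
by rewrite exprS -mulrA mulnS addnCA addnC; exact: multh.
Qed.
Let muluX N z k : Wt N z -> Wt (N + d * k) (u ^+ k * z).
Proof.
move=> h; elim: k => [|k IH]; first by rewrite muln0 addn0 expr0 mul1r.
by rewrite exprS -mulrA mulnS addnCA addnC; exact: mulu.
Qed.

(** Passing beyond the top exponent of [th0] or [u] uses their defining equations, whose
    coefficients are paid for by the weights of [th0] and [u]. *)
Lemma eb_mul N N' z z' : Wt N z -> Wt N' z' -> Wt (N + N') (z * z').
Proof.
move=> [h [kh sh ->]] hz'; rewrite mulr_suml; apply: weighted_sum => -[i j] _ /=.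
have := sh (i, j); rewrite /wt /= => shij; have := kh (i, j) => kij; move: (h (i, j)) shij kij => a sa ka.
have [->|a0] := eqVneq a 0; first by rewrite horner0 !mul0r; exact: weighted0.
rewrite /eb /= -!mulrA.
have h1 := multhX i (muluX j hz').
have sa' : (size a <= (size a).-1.+1)%N by rewrite prednK // size_poly_gt0.
apply: weighted_le (mulT ka sa' h1).
move: a0 sa; rewrite -size_poly_gt0.
by move: (size a) (thw * i)%N (d * j)%N => s1 s2 s3; lia.
Qed.

Let Mf := adj (adj KT th0) u.
Let Msp y : Mf y -> spans KT e y.
Proof.
have aKT := algoKT chp ac; have aL := algo_sub (@adj_sub _ KT th0) aKT.
have LD : adj KT th0 DD.[T] by apply: adj_sub; exact: KT_poly.
pose f1 : {poly Om} := 'X^kk - (DD.[T])%:P.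
have s1 : size f1 = kk.+1.
  by rewrite size_polyDl size_polyXn // size_polyN (leq_ltn_trans (size_polyC_leq1 _)).
have Lf1 : Lp (adj KT th0) f1 by apply: LpB; [move=> k; rewrite coefXn; exact: sf_nat|exact: LpC].
have r1 : root f1 u by rewrite /root hornerD hornerN hornerXn hornerC hu subrr.
case/(adj_span aL Lf1 s1 r1) => cc [kcc ->].
have Lf0 : Lp KT (\prod_t ('X - (th t)%:P)).
  rewrite th_prod => k; rewrite coefD coefXn coef_sum; apply: sfD; first exact: sf_nat.
  apply: sf_sum => i _; rewrite coefZ coefXn; apply: sfM; last exact: sf_nat.
  by apply: KT_poly; exact: kA.
have s0 : size (\prod_t ('X - (th t)%:P)) = dl.+2.
  by rewrite size_prod_XsubC /index_enum -enumT size_enum_ord.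
have rt0 : root (\prod_t ('X - (th t)%:P)) th0.
  by rewrite /root horner_prod; apply/prodf_eq0; exists ord0 => //; rewrite hornerXsubC subrr.
have h2 j := adj_span aKT Lf0 s0 rt0 (kcc j).
have [c hc] := choice h2.
exists (fun ij : I => c ij.2 ij.1); split; first by move=> [i j] /=; case: (hc j) => h _; exact: h.
rewrite -(pair_bigA _ (fun i j => c (nat_of_ord j) (nat_of_ord i) * e (i, j))) /= exchange_big /=.
by apply: eq_bigr => j _; rewrite {1}(hc j).2 mulr_suml; apply: eq_bigr => i _; rewrite /eb /= mulrA.
Qed.
Let Me i : Mf (e i).
Proof.
by apply: sfM; apply: sfX; [apply: adj_sub; exact: adj_gen|exact: adj_gen].
Qed.
Let MK y : KT y -> Mf y.
Proof. by move=> h; apply: adj_sub; exact: adj_sub. Qed.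

Variables (m s : nat) (a b : nat).
Hypotheses (ms : m = (s + s)%N) (s0 : (0 < s)%N) (tem : (te t0 %| m)%N) (gm : (g %| m)%N) (md : (m < d)%N).
Local Notation G := (dl.+1 * kk)%N.
Hypotheses
  (num1 : (G * (q ^ s * a + q ^ s * om + b + om + thC).+1 < (G * a) * (G * b))%N)
  (num2 : (G`! * (G * (om + (a + om))) < q ^ s)%N)
  (num3 : ((G - 1) * (a + om + q ^ s * (b + om)) + (size Bd + q * q ^ s) < q ^ m)%N).
Let m0 : (0 < m)%N. Proof. by rewrite ms addn_gt0 s0. Qed.

(** An element of the field with [q^m] elements of degree less than [m] has degree at most
    [s = m / 2], so it is a root of the second factor of [R]; fewer than [size R] points are
    discarded. *)
Let Xex : exists X : seq Om, [/\ uniq X, (q ^ m <= size X + (size Bd + q * q ^ s))%N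
  & forall x, x \in X -> [/\ x ^+ (q ^ m) = x, forall l, (0 < l < m)%N -> x ^+ (q ^ l) != x & Bd.[x] != 0]].
Proof.
have [zs [uzs szs hzs]] := frob_list iota chp m0.
pose R := Bd * \prod_(l < s) ('X^(q ^ l.+1) - 'X).
have sf l : size ('X^(q ^ l.+1) - 'X : {poly Om}) = (q ^ l.+1).+1.
  have ql1 : (1 < q ^ l.+1)%N by rewrite -[1%N](expn0 q) ltn_exp2l.
  by rewrite size_polyDl size_polyXn // size_polyN size_polyX ltnS.
have R0 : R != 0.
  rewrite mulf_neq0 //; apply/prodf_neq0 => l _; by rewrite -size_poly_gt0 sf.
have sR : (size R <= size Bd + q * q ^ s)%N.
  have h : (size (\prod_(l < s) ('X^(q ^ l.+1) - 'X : {poly Om}))%R <= (\sum_(l < s) q ^ l.+1).+1)%N.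
    elim/big_rec2: _ => [|l k y _ IH]; first by rewrite size_poly1.
    apply: leq_trans (size_polyMleq _ _) _; rewrite sf; move: IH.
    by move: (size y) (q ^ l.+1)%N => u1 u2; lia.
  have h2 : (\sum_(l < s) q ^ l.+1 <= q * q ^ s)%N.
    rewrite (eq_bigr (fun l : 'I_s => (q * q ^ l)%N)); last by move=> l _; rewrite expnS.
    rewrite -big_distrr /= leq_mul2l; apply/orP; right.
    apply: leq_trans (leq_pred _); rewrite predn_exp leq_pmull // -subn1 subn_gt0 //.
  have nat_le (a1 a2 a3 a4 : nat) : (a2 <= a3.+1 -> a3 <= a4 -> (a1 + a2).-1 <= a1 + a4)%N by lia.
  by apply: leq_trans (size_polyMleq _ _) _; exact: nat_le h h2.
exists [seq x <- zs | ~~ root R x]; split.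
- exact: filter_uniq.
- have h : (size [seq x <- zs | root R x] < size R)%N.
    apply: max_poly_roots => //; last exact: filter_uniq.
    by apply/allP => x; rewrite mem_filter => /andP [].
  have := count_predC (root R) zs; rewrite -!size_filter szs => <-.
  have nat_le (a1 a2 a3 a4 : nat) : (a1 < a3 -> a3 <= a4 -> a1 + a2 <= a2 + a4)%N by lia.
  exact: nat_le h sR.
move=> x; rewrite mem_filter => /andP [nR /hzs xm].
move: nR; rewrite /R /root hornerM horner_prod mulf_eq0 negb_or => /andP [hb /prodf_neq0 hp].
split => // l /andP [l0 lm]; apply/negP => /eqP xl.
have ex : exists k, (0 < k)%N && (x ^+ (q ^ k) == x) by exists l; rewrite l0 xl eqxx.
case: (ex_minnP ex) => k /andP [k0 /eqP xk] kmin.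
have km : (k %| m)%N.
  rewrite /dvdn; apply: contraT; rewrite -lt0n => r1.
  have : (k <= m %% k)%N.
    apply: kmin; rewrite r1 /=; apply/eqP; rewrite -{2}xm {2}(divn_eq m k) expnD exprM mulnC.
    by rewrite (Fr_iter _ xk).
  by rewrite leqNgt ltn_pmod.
have kl : (k <= l)%N by apply: kmin; rewrite l0 xl eqxx.
have ks : (k.-1 < s)%N.
  case/dvdnP: km => c ec; have c1 : (1 < c)%N.
    case: c ec => [|[|c]] // ec; first by move: m0; rewrite ec.
    by move: lm; rewrite ec mul1n ltnNge kl.
  by move: ec c1 k0; rewrite ms; clear; nia.
have := hp (Ordinal ks) isT; rewrite /= prednK // hornerD hornerN hornerXn hornerX xk subrr.
by rewrite eqxx.
Qed.

Theorem split_prime : exists ql x P (s : {rmorphism Om -> Om}),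
  [/\ ql \is monic, irreducible_poly ql, size ql = m.+1, evq ql x = 0 & qplace iota P x] /\
  [/\ bijective s, forall y, K0 y -> s y = y, forall y, Fsf iota y -> s y = y,
      forall y, pO P y -> pO P (s y) /\ pf P (s y) = pf P y ^+ (q ^ m)
    & evq ql x0 ^+ (\sum_(j < n) (q ^ g) ^ j) = 1].
Proof.
have [X [uX sX hX]] := Xex; apply: contrapT => no.
have kX x : x \in X -> kap x by case/hX => xm _ _; exists m.
(* A zero of [DD] would put [x0] in the field with [q^m] elements, against [m < d]. *)
have DX x : x \in X -> DD.[x] != 0.
  case/hX => xm xl _; rewrite DD_horner; apply/prodf_neq0 => i _; apply/prodf_neq0 => j _.
  rewrite subr_eq0; apply/eqP => ex.
  have : x0 ^+ (q ^ m) != x0 by apply: (x0_order chp ir r0); rewrite m0.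
  move/eqP; apply; apply: (Fr_inj iota chp (k := (g * j)%N)); rewrite /= -/(xj Fq x0 g j).
  by rewrite exprAC -/(xj Fq x0 g j) -ex -exprM mulnC exprM xm.
have [m' em] : exists m', m = (g * m')%N by case/dvdnP: gm => c ->; exists c; rewrite mulnC.
have g0 : (0 < g)%N by move: m0; rewrite em muln_gt0 => /andP [].
have [zs [uzs szs hzs]] := frob_list iota chp g0.
have z0in : 0 \in zs by apply/hzs; exact: (Fr0 iota chp g).
pose zr := rem 0 zs.
have szr : size zr = kk by rewrite size_rem // szs.
have zrP c : c \in zr <-> c ^+ kk = 1.
  rewrite mem_rem_uniq // inE /=; split.
    case/andP => nz /hzs hc; by apply: (mulfI nz); rewrite -exprS kk_S hc mulr1.
  move=> hc; apply/andP; split; last by apply/hzs; rewrite -kk_S exprS hc mulr1.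
  by apply/eqP => ec; move: hc; rewrite ec expr0n gtn_eqF // => /eqP; rewrite eq_sym oner_eq0.
have zk (l : 'I_kk) : zr`_l ^+ kk = 1 /\ kap zr`_l.
  have /zrP h : zr`_l \in zr by apply: mem_nth; rewrite szr.
  by split => //; exists g => //; rewrite -kk_S exprS h mulr1.
pose cj (tl : 'I_dl.+1 * 'I_kk) (ij : I) := th tl.1 ^+ ij.1 * (zr`_tl.2 * u) ^+ ij.2.
(* All pairs of a conjugate of [th0] and a [kk]-th root of unity, except the pair of the
   identity. *)
pose C := {tl : 'I_dl.+1 * 'I_kk | (tl.1 != ord0) || (zr`_tl.2 != 1)}.
have cardC : (#|{: C}| <= G - 1)%N.
  have [l1 el1] : exists l1 : 'I_kk, zr`_l1 = 1.
    have /(nthP 0) [l lk el] : 1 \in zr by apply/zrP; rewrite expr1n.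
    by rewrite szr in lk; exists (Ordinal lk).
  rewrite card_sig; have := cardC1 (ord0 : 'I_dl.+1, l1); rewrite card_prod !card_ord -subn1 => <-.
  apply: subset_leq_card; apply/fintype.subsetP => -[t l]; rewrite !inE /=.
  by apply: contraTneq => -[-> ->]; rewrite el1 !eqxx.
have Oth P x (kP : kplace iota chp P x) := th_O (@kA _ _ _ _ _ _ t0) (th_prod t0) kP.
have Ou P x : kplace iota chp P x -> pO P u.
  by move=> kP; apply: (pO_root_exp kk0); rewrite hu; exact: (kP _ kD0).1.
have xjP j : xj Fq x0 g j ^+ (q ^ m) = xj Fq x0 g (j + m').
  by rewrite /xj -exprM -expnD em -mulnDr.
have xj_per j : xj Fq x0 g (j + n) = xj Fq x0 g j.
  by rewrite /xj mulnDr addnC expnD exprM -dE (x0_Fr chp ir r0).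
have cls x P : x \in X -> kplace iota chp P x -> exists t : C, forall i, pO P (cj (val t) i) /\
    pf P (cj (val t) i) = pf P (e i) ^+ (q ^ m).
  move=> xX kP; have kx := kX x xX; have [xm xl _] := hX x xX.
  have [ql [mq iq sq eq]] := minpoly_kap iota chp m0 xm xl.
  have rq : evq ql x = 0.
    rewrite /evq eq horner_prod; apply/eqP/prodf_eq0; exists (Ordinal m0) => //.
    by rewrite expn0 expr1 hornerXsubC subrr.
  have qm1 : (1 < q ^ m)%N by rewrite -[1%N](expn0 q) ltn_exp2l.
  have fL y : Fsf iota y -> pO P y -> pf P y ^+ (q ^ m) = pf P y.
    by move=> Fy Oy; have := Fsf_res chp iq rq (kplace_q kP) Fy Oy; rewrite sq.
  have [s1 [hs1 fs1]] := frob_lift (pchar_Om iota chp) (algoF ac) (qpnat iota chp m) qm1 fL.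
  have sF y : Fsf iota y -> s1 y = y by exact: hs1.2.
  have sT : s1 T = T by apply: sF; exact: F_iA.
  have sk c : kap c -> s1 c = c ^+ (q ^ m).
    move=> kc; have kc' : kap (s1 c) by case: kc => k k0 hk; exists k => //; rewrite -endoX hk.
    have [oc fc] := kplace_unit kP kc; have [_ <-] := kplace_unit kP kc'.
    by rewrite (fs1 c oc).2 fc.
  have skm c : c ^+ (q ^ m) = c -> s1 c = c by move=> hc; rewrite sk ?hc //; exists m.
  have te_m (c : Om) : c ^+ (q ^ te t0) = c -> c ^+ (q ^ m) = c.
    by move=> hc; case/dvdnP: tem => k ->; rewrite mulnC; exact: Fr_iter.
  have sA (i : 'I_dl.+1) : s1 (A i).[T] = (A i).[T].
    rewrite horner_coef endo_sum; apply: eq_bigr => k _; rewrite endoM endoX sT; congr (_ * _).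
    by apply: skm; apply: te_m; exact: te_A.
  have [t et] : exists t, s1 th0 = th t.
    have h : (\prod_t ('X - (th t)%:P)).[s1 th0] = 0.
      rewrite th_prod hornerD hornerXn horner_sum -endoX th_rel rmorphN endo_sum addrC.
      apply/eqP; rewrite subr_eq0; apply/eqP; apply: eq_bigr => i _.
      by rewrite hornerZ hornerXn endoM endoX sA.
    move/eqP: h; rewrite horner_prod => /prodf_eq0 [t _]; rewrite hornerXsubC subr_eq0 => /eqP et.
    by exists t.
  have sD : s1 DD.[T] = DD.[T].
    have sprod (N : nat) (F : 'I_N -> Om) : s1 (\prod_i F i) = \prod_i s1 (F i) by exact: rmorph_prod.
    rewrite DD_horner sprod; apply: eq_bigr => i _; rewrite sprod.
    rewrite -(periodic_prod (h := fun j => T ^+ (q ^ i) - xj Fq x0 g j) m'); last by move=> j; rewrite xj_per.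
    apply: eq_bigr => j _; rewrite rmorphB endoX sT; congr (_ - _).
    by rewrite sk ?xjP //; apply: sfX; exact: (kap_x0 chp ir r0).
  have fD : pf P u ^+ kk = DD.[x] by rewrite -(pfX kk (Ou P x kP)) hu (kP _ kD0).2.
  have fu0 : pf P u != 0.
    by apply: contraNneq (DX x xX) => e1; rewrite -fD e1 expr0n gtn_eqF.
  have u0 : u != 0 by apply: contraNneq fu0 => ->; rewrite pf0.
  have /zrP : (s1 u / u) ^+ kk = 1.
    by rewrite expr_div_n -endoX hu sD divff // -hu expf_neq0.
  case/(nthP 0) => l0 l0k el; rewrite szr in l0k; pose l := Ordinal l0k.
  have su : s1 u = zr`_l * u by rewrite /= el divfK.
  have [tr|nt] := boolP ((t != ord0) || (zr`_l != 1)).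
    exists (exist _ (t, l) tr) => ij; rewrite /cj /=.
    have oe : pO P (e ij) by apply: pOM; apply: pOX; [exact: (Oth P x kP)|exact: (Ou P x kP)].
    have := fs1 _ oe; rewrite {1 2}/eb endoM !endoX et su => -[h1 h2]; split => //.
  (* In the trivial class Frobenius fixes [u], so [DD(x)] is a [kk]-th power in the field with [q^m]
     elements; reciprocity turns this into the power residue property of [ql]. *)
  exfalso; apply: no; move: nt; rewrite negb_or !negbK => /andP [/eqP t0' /eqP z1].
  exists ql, x, P, s1; split.
    by split; [exact: mq|exact: iq|exact: sq|exact: rq|exact: (kplace_q kP)].
  split => //; first exact: hs1.1.
    move=> y Ky; apply: (te_K0 (t0 := t0) (s := s1)) => //; split => //; first by rewrite et t0'.
    by move=> c hc; apply: skm; exact: te_m.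
  have su1 : s1 u = u by rewrite su z1 mul1r.
  have ev2 : (2 %| g * m')%N by rewrite -em ms addnn -mul2n dvdn_mulr.
  rewrite em in eq; rewrite (DD_reciprocity chp ir r0 dE ev2 eq) -fD -exprM /kexp -predn_exp -expnM -em.
  have fq : pf P u ^+ (q ^ m) = pf P u by rewrite -(fs1 u (Ou P x kP)).2 su1.
  by apply: (mulfI fu0); rewrite -exprS prednK ?expn_gt0 ?(ltnW q1) // fq mulr1.
have wD t : Wt thB ((tD t0).[T] * th t).
  rewrite th_exp; apply: weighted_sum => i _.
  have := @gen thB (B t i) i 0 (ltn_ord i) kk0 (kB t i); rewrite expr0 mulr1 muln0 addn0; apply.
  apply: leq_trans (_ : (\sum_(t < dl.+1) \sum_(i < dl.+1) size (B t i)).+1 <= _)%N.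
    apply: leqW; rewrite (bigD1 t) //=; apply: leq_trans (leq_addr _ _).
    by rewrite (bigD1 i) //= leq_addr.
  rewrite /thB; have : (thw * i <= thw * dl.+1)%N by rewrite leq_mul2l ltnW ?orbT.
  by move: (\sum_(_ < _) _)%N (thw * i)%N (thw * dl.+1)%N => u1 u2 u3; lia.
have wX := weightedX e0 wt0 eb_mul.
(* The power [dl.+1] of the denominator clears all powers of [th t] that occur in the basis. *)
have hcj (t : C) (ij : I) : Wt (wt ij + thC) ((tD t0).[T] ^+ dl.+1 * cj (val t) ij).
  case: (val t) => t1 l1; case: ij => i j; rewrite /cj /=.
  have -> : (tD t0).[T] ^+ dl.+1 * (th t1 ^+ i * (zr`_l1 * u) ^+ j) =
     zr`_l1 ^+ j * ((tD t0).[T] ^+ (dl.+1 - i) * (u ^+ j * ((tD t0).[T] * th t1) ^+ i)).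
    have -> : (tD t0).[T] ^+ dl.+1 = (tD t0).[T] ^+ (dl.+1 - i) * (tD t0).[T] ^+ i.
      by rewrite -exprD subnK // ltnW.
    by rewrite !exprMn; ring.
  have h1 : Wt (size (tD t0)) (tD t0).[T].
    by apply: (weighted_poly e0 wt0) => //; exact: kD.
  have h2 := wX _ _ (dl.+1 - i)%N h1.
  have h3 := muluX j (wX _ _ i (wD t1)).
  have h4 := weighted_kap e0 wt0 0 (sfX j (zk l1).2).
  apply: weighted_le (eb_mul h4 (eb_mul h2 h3)).
  rewrite /wt /thC /= add0n; have : (i <= dl.+1)%N by rewrite ltnW.
  move: (size (tD t0)) thB (d * j)%N (thw * i)%N => sD sB u2 u3 ile.
  have e1 : ((dl.+1 - i) * sD <= dl.+1 * sD)%N by rewrite leq_mul2r leq_subr orbT.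
  have e2 : (i * sB <= dl.+1 * sB)%N by rewrite leq_mul2r ile orbT.
  by rewrite mulnDr; move: e1 e2; move: ((dl.+1 - i) * sD)%N (i * sB)%N (dl.+1 * sD)%N (dl.+1 * sB)%N; lia.
have cG : #|{: I}| = G by rewrite card_prod !card_ord.
(* The nonvanishing of combinations needs just one place; the point 0 will do, as the basis is
   integral above every point. *)
have k0' : kap 0 := sf0 kap.
have [P1 kP1] := kplace_ex k0'.
have [w [hw wT wK wp]] := kplace_val ac k0' kP1.
have Oe1 i : pO P1 (e i) by apply: pOM; apply: pOX; [exact: (Oth P1 0 kP1)|exact: (Ou P1 0 kP1)].
have num2' : ((#|{: I}|)`! * (#|{: I}| * (om + (a + om))) < q ^ s)%N by rewrite cG.
have nv := power_indep ac e0 wt0 wt_om ind eb_mul MK Msp k0' kP1 hw wK wp Oe1 num2'.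
apply: (stepanov (C := C) (cj := fun t => cj (val t)) (X := X) e0 wt0 wt_om ind eb_mul MK Me _ hcj uX _ _ _ nv).
- by rewrite expf_neq0 //; exact: D_neq0.
- by move=> x /hX [xm _ _]; rewrite -ms.
- move=> x P xX kP; split; last by rewrite -ms; exact: cls xX kP.
  by move=> i; apply: pOM; apply: pOX; [exact: (Oth P x kP)|exact: (Ou P x kP)].
- move=> x h xX kh hz; apply: (eb_vanish ac ir r0 dE (@kA _ _ _ _ _ _ t0) (th_prod t0) (th_aut (t0 := t0)) hu good (kX x xX) kh _ (DX x xX) hz).
  by move=> P kP; apply: (hBd (kX x xX) kP (Oth P x kP)); case: (hX x xX).
- rewrite cG; exact: num1.
- have h1 : (#|{: C}| * (a + om + q ^ s * (b + om)) <= (G - 1) * (a + om + q ^ s * (b + om)))%N.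
    by rewrite leq_mul2r cardC orbT.
  move: h1 num3 sX; move: (#|{: C}| * _)%N ((G - 1) * _)%N (size Bd + _)%N (q ^ m)%N (size X) => u1 u2 u3 u4 u5; lia.
Qed.
End Split.

(** * Numerical choices and conclusion *)

Lemma lin_lt_exp K : exists k1, forall k, (k1 <= k)%N -> (K * k.+1 < 2 ^ k)%N.
Proof.
exists (4 * K + 4)%N => k; elim: k => [|k IH]; first by rewrite addn4.
rewrite leq_eqVlt => /orP [/eqP <-|]; last first.
  rewrite ltnS => /[dup] hk /IH; rewrite expnS => h.
  have : (1 <= 2 ^ k)%N by rewrite expn_gt0.
  by move: h; move: (2 ^ k)%N => v h v1; have := leq_mul2l K 1 k.+1; nia.
have h1 v : (v.+1 <= 2 ^ v)%N by exact: ltn_expl.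
have := h1 (2 * K + 1)%N; have := h1 (2 * K + 1)%N.
have -> : (4 * K + 4 = (2 * K + 1) + (2 * K + 1) + 2)%N by lia.
rewrite !expnD; move: (2 ^ (2 * K + 1))%N => v; nia.
Qed.

(** [Q] is [q^s]. The unknowns outnumber the equations when [b] is slightly above [Q / G], and the
    zeros outnumber the weight when [(G - 1) b] is below [Q]; [b] close to [(1 + 1 / (4 G)) Q / G]
    meets both, with [a] large against [G om] to absorb the weights of the basis. *)
Lemma stepanov_numerics (G Q om th sB q : nat) :
  let a := (4 * G * om + 6)%N in let b := (((4 * G + 1) * Q) %/ (4 * G * G)).+1 in (0 < G)%N ->
  (G`! * (G * (om + (a + om))) + 4 * G * (om + th + 2) + 2 * G * (G * (1 + a + 2 * om) + sB + q) < Q)%N ->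
  [/\ (G * (Q * a + Q * om + b + om + th).+1 < (G * a) * (G * b))%N,
      (G`! * (G * (om + (a + om))) < Q)%N
    & ((G - 1) * (a + om + Q * (b + om)) + (sB + q * Q) < Q * Q)%N].
Proof.
move=> a b G0 hQ.
have GG : (0 < 4 * G * G)%N by rewrite !muln_gt0 G0.
have hb1 : ((4 * G + 1) * Q < 4 * G * G * b)%N.
  by rewrite mulnC; have := ltn_ceil ((4 * G + 1) * Q) GG; rewrite -/b mulnC [(4 * G * G * b)%N]mulnC.
have hb2 : (4 * G * G * b <= (4 * G + 1) * Q + 4 * G * G)%N.
  by rewrite /b mulnS addnC leq_add2r mulnC leq_divM.
have h2 : (4 * G * (om + th + 2) <= Q)%N.
  by move: hQ; move: (G`! * _)%N (4 * _ * _)%N (2 * _ * _)%N => v1 v2 v3; lia.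
have h3 : (2 * G * (G * (1 + a + 2 * om) + sB + q) <= Q)%N.
  by move: hQ; move: (G`! * _)%N (4 * _ * _)%N (2 * _ * _)%N => v1 v2 v3; lia.
split; last 1 first.
- have Q0 : (0 < Q)%N by apply: leq_ltn_trans hQ.
  move: a b {hb1 h2 hQ} hb2 h3 => a b hb2 h3; rewrite -(ltn_pmul2l GG).
  case: G G0 GG hb2 h3 => // H _ _; rewrite subSS subn0; set G := H.+1; set S := (_ + sB + q)%N => hb2 h3.
  have e1 : (H * (a + om + Q * (b + om)) + (sB + q * Q) + H * Q <= H * Q * b + S * Q)%N.
    have -> : (H * Q * b + S * Q = (H * (a + om) + sB) * Q + (H * Q * b + H * Q * om + q * Q + H * Q) + Q * (1 + a + 2 * om))%N.
      by rewrite /S /G; ring.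
    have h : (H * (a + om) + sB <= (H * (a + om) + sB) * Q)%N by rewrite leq_pmulr.
    have -> : (H * (a + om + Q * (b + om)) + (sB + q * Q) + H * Q = (H * (a + om) + sB) + (H * Q * b + H * Q * om + q * Q + H * Q))%N.
      by ring.
    by apply: leq_trans (leq_addr _ _); rewrite leq_add2r.
  have e3 : (H * Q * (4 * G * G * b) <= H * Q * ((4 * G + 1) * Q + 4 * G * G))%N by rewrite leq_mul2l hb2 orbT.
  have e4 : (2 * G * Q * (2 * G * S) <= 2 * G * Q * Q)%N by rewrite leq_mul2l h3 orbT.
  have e5 : (0 < Q * Q)%N by rewrite muln_gt0 Q0.
  have e6 : (4 * G * G * (H * (a + om + Q * (b + om)) + (sB + q * Q) + H * Q) <= 4 * G * G * (H * Q * b + S * Q))%N.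
    by rewrite leq_mul2l e1 orbT.
  move: e6 e3 e4; move: (H * (a + om + Q * (b + om)) + (sB + q * Q))%N => L e6 e3 e4.
  have e7 : (4 * G * G * L + 4 * G * G * (H * Q) <= H * Q * ((4 * G + 1) * Q + 4 * G * G) + 2 * G * Q * Q)%N by lia.
  have e8 : (H * Q * ((4 * G + 1) * Q + 4 * G * G) + 2 * G * Q * Q + G * (Q * Q) + Q * Q = 4 * G * G * (Q * Q) + 4 * G * G * (H * Q))%N.
    by rewrite /G; ring.
  by move: e7 e8 e5; lia.
- rewrite -mulnA ltn_pmul2l // -(ltn_pmul2l (_ : 0 < 4 * G)%N) ?muln_gt0 ?G0 //.
  have e1 : (a * ((4 * G + 1) * Q).+1 <= a * (4 * G * G * b))%N by rewrite leq_mul2l hb1 orbT.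
  have e2 : (4 * G * b <= 5 * Q + 4 * G)%N.
    rewrite -(leq_pmul2l G0); apply: leq_trans (_ : (4 * G + 1) * Q + 4 * G * G <= _)%N.
      by apply: leq_trans hb2; rewrite [(G * _)%N]mulnC -!mulnA [(b * G)%N]mulnC.
    by move: G0; clear; nia.
  apply: leq_trans (_ : a * (4 * G * G * b) <= _)%N; last by rewrite -!mulnA; lia.
  apply: leq_trans e1; move: e2 h2; rewrite /a; move: (b) => b'; clear; nia.
- by move: hQ; move: (G`! * _)%N (4 * _ * _)%N (2 * _ * _)%N => v1 v2 v3; lia.
Qed.

(** With [u h = v d + g], divisibility passes from [q^h - 1] to [q^g - 1]; cancelling this factor of
    [q^d - 1] leaves the cofactor, written as a geometric sum. *)
Lemma dvdn_pred_exp_cofactor (q c H h d D : nat) : (1 < q)%N -> (0 < d)%N -> (0 < h)%N -> (H %| (q ^ h).-1)%N ->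
  coprime (q ^ d).-1 c -> ((q ^ d).-1 %| c * H * D)%N ->
  (\sum_(j < d %/ gcdn h d) (q ^ gcdn h d) ^ j %| D)%N.
Proof.
move=> q1 d0 h0 Hh cop; rewrite -mulnA Gauss_dvdr // => NHD.
have N1 : ((q ^ d).-1 %| (q ^ h).-1 * D)%N by apply: dvdn_trans NHD _; rewrite dvdn_mul.
have [u v e _] := egcdnP d h0.
have dvX k l : ((q ^ k).-1 %| (q ^ (l * k)).-1)%N by rewrite mulnC expnM [((q ^ k) ^ l).-1]predn_exp dvdn_mulr.
have N2 : ((q ^ d).-1 %| (q ^ (u * h)).-1 * D)%N by apply: dvdn_trans N1 _; rewrite dvdn_mul.
set g := gcdn h d in e *.
have g0 : (0 < g)%N by rewrite gcdn_gt0 h0.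
have N3 : ((q ^ d).-1 %| (q ^ g).-1 * D)%N.
  have e2 : ((q ^ (u * h)).-1 = q ^ g * (q ^ (v * d)).-1 + (q ^ g).-1)%N.
    rewrite e expnD; have : (0 < q ^ g)%N by rewrite expn_gt0 ltnW.
    have : (0 < q ^ (v * d))%N by rewrite expn_gt0 ltnW.
    by move: (q ^ g)%N (q ^ (v * d))%N => [|x] [|y] //= _ _; rewrite mulnS; lia.
  move: N2; rewrite e2 mulnDl dvdn_addr //; apply: dvdn_mulr; exact: dvdn_mull.
have ed : d = (g * (d %/ g))%N by rewrite mulnC divnK // dvdn_gcdr.
move: N3; rewrite {1}ed expnM predn_exp dvdn_pmul2l // -subn1 subn_gt0.
by rewrite -[1%N](expn0 q) ltn_exp2l.
Qed.

(** For fixed [G] every term is at most linear in [om], so a bound [om <= W v] passes through; [v]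
    will grow with the degree of [pi]. *)
Lemma leq_numerics (G0 W G om v th sB q : nat) : (0 < v)%N -> (G <= G0)%N -> (om <= W * v)%N ->
  (G`! * (G * (om + (4 * G * om + 6 + om))) + 4 * G * (om + th + 2) +
     2 * G * (G * (1 + (4 * G * om + 6) + 2 * om) + sB + q) <=
   (G0`! * (G0 * (W + (4 * G0 * W + 6 + W))) + 4 * G0 * (W + th + 2) +
     2 * G0 * (G0 * (1 + (4 * G0 * W + 6) + 2 * W) + sB + q)) * v)%N.
Proof.
move=> v0 hG hom.
have a1 : (4 * G * om + 6 <= (4 * G0 * W + 6) * v)%N.
  rewrite mulnDl leq_add ?leq_pmulr // -!mulnA leq_mul2l /= leq_mul // .
have hc c : (c <= c * v)%N by rewrite leq_pmulr.
move: (4 * G * om + 6)%N (4 * G0 * W + 6)%N a1 => a a0 ha.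
have m2 c : (c * G <= c * G0)%N by rewrite leq_mul2l hG orbT.
rewrite [leqRHS]mulnDl [X in (_ <= X + _)%N]mulnDl; apply: leq_add; first apply: leq_add.
- rewrite -[leqRHS]mulnA; apply: leq_mul; first exact: leq_fact.
  by rewrite -[leqRHS]mulnA; apply: leq_mul => //; rewrite !mulnDl; do 2?apply: leq_add.
- rewrite -[leqRHS]mulnA; apply: leq_mul => //; rewrite !mulnDl.
  by apply: leq_add => //; apply: leq_add.
- rewrite -[leqRHS]mulnA; apply: leq_mul => //; rewrite [leqRHS]mulnDl.
  apply: leq_add => //; rewrite [leqRHS]mulnDl; apply: leq_add => //.
  rewrite -[leqRHS]mulnA; apply: leq_mul => //; rewrite !mulnDl.
  apply: leq_add; first by apply: leq_add.
  by move: hom; clear; lia.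
Qed.

Lemma subfield_sfield (Fq : finFieldType) (Om : closedFieldType)
    (iota : {rmorphism {fraction {poly Fq}} -> Om}) (K : Om -> Prop) :
  is_subfield iota K -> exists L : sfield Om, sf_pred L = K.
Proof.
case=> Ki KD KN KM KV.
have K1 : K 1 by rewrite -(rmorph1 iota).
have KB x y : K x -> K y -> K (x - y) by move=> hx hy; apply: KD => //; exact: KN.
have KV' x : K x -> K x^-1.
  by move=> hx; have [->|x0] := eqVneq x 0; [rewrite invr0 -(rmorph0 iota)|exact: KV].
by exists (SField K1 KB KM KV').
Qed.

Lemma iter_frob (Om : closedFieldType) (P : place Om) (s : {rmorphism Om -> Om}) N k :
  (forall y, pO P y -> pO P (s y) /\ pf P (s y) = pf P y ^+ N) ->
  forall y, pO P y -> pO P (iter k s y) /\ pf P (iter k s y) = pf P y ^+ (N ^ k).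
Proof.
move=> hs y Oy; elim: k => [|k [IO If]]; first by rewrite expn0 expr1.
by have [h1 h2] := hs _ IO; split => //=; rewrite h2 If -exprM expnSr.
Qed.

Section Final.
Variables (Fq : finFieldType) (p : nat) (Om : closedFieldType)
          (iota : {rmorphism {fraction {poly Fq}} -> Om}).
Hypotheses (chp : p \in [pchar Fq]) (ac : is_alg_closure iota).
Local Notation q := #|Fq|.
Local Notation evq := (evq iota).
Local Notation kap := (kap iota chp).
Let q1 : (1 < q)%N := q_gt1 Fq.

(** Keeps [x0], whose degree is large, off the excluded points. *)
Lemma roots_constants (B : {poly Om}) : B != 0 -> Lp kap B ->
  exists2 e, (0 < e)%N & forall x, B.[x] = 0 -> x ^+ (q ^ e) = x.
Proof.
move=> B0 kB; have [zs eB] := closed_field_poly_normal B.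
have rz x : B.[x] = 0 -> x \in zs.
  move/eqP; rewrite eB hornerZ mulf_eq0 lead_coef_eq0 (negPf B0) /= => h.
  by rewrite -root_prod_XsubC.
have kz x : x \in zs -> kap x.
  move=> xz; apply: kap_closed B0 kB _.
  by rewrite /root eB hornerZ mulf_eq0 -/(root _ x) root_prod_XsubC xz orbT.
by have [e e0 he] := kap_seq kz; exists e => // x /rz /he.
Qed.

Lemma p_dvd_q : (p %| q)%N.
Proof. by have [e e0 ->] := q_pow chp; exact: dvdn_exp. Qed.

(** [H0] is split into its [p]-part, prime to [q^d - 1], and a factor dividing [q^h - 1] by Euler.
    An exponent whose product with [H0] is divisible by [q^d - 1] is then a multiple of
    [(q^d - 1) / (q^g - 1)] with [g = gcd(h, d)]; so a Kummer exponent bounded in terms of [H0]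
    suffices. *)
Lemma evq_pow_eq (H0 d h : nat) (y : Om) : (0 < H0)%N -> (0 < d)%N ->
  h = totient (H0`_p^')%N -> y ^+ (\sum_(j < d %/ gcdn h d) (q ^ gcdn h d) ^ j) = 1 ->
  forall e e', H0 * e = H0 * e' %[mod (q ^ d).-1] -> y ^+ e = y ^+ e'.
Proof.
move=> H00 d0 eh hy.
have pp : prime p := pcharf_prime chp.
have h0 : (0 < h)%N by rewrite eh totient_gt0 part_gt0.
have copq : coprime q (H0`_p^')%N.
  have [f _ ->] := q_pow chp; apply: coprimeXl.
  by apply: (@pnat_coprime p); rewrite ?pnat_id ?part_pnat.
have Hh : (H0`_p^' %| (q ^ h).-1)%N.
  rewrite -subn1 -eqn_mod_dvd ?expn_gt0 ?(ltnW q1) // eh; apply/eqP; exact: Euler_exp_totient.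
have cop : coprime (q ^ d).-1 H0`_p.
  rewrite p_part; apply: coprimeXr.
  apply: (@coprime_dvdr p (q ^ d)); first by rewrite (dvdn_trans p_dvd_q) // dvdn_exp.
  by rewrite coprime_sym coprimenP // expn_gt0 ltnW.
have le e e' : (e <= e')%N -> H0 * e = H0 * e' %[mod (q ^ d).-1] -> y ^+ e = y ^+ e'.
  move=> lee /esym/eqP; rewrite eqn_mod_dvd ?leq_mul2l ?lee ?orbT // -mulnBr.
  rewrite -{1}(partnC p H00) => /(dvdn_pred_exp_cofactor q1 d0 h0 Hh cop) /dvdnP [c ec].
  by rewrite -(subnK lee) exprD ec mulnC exprM hy expr1n mul1r.
move=> e e' ee; have [l|/ltnW l] := leqP e e'; [exact: le|by apply/esym; apply: le].
Qed.

Theorem large_degree (K0 : sfield Om) (n r1 l : nat) : (forall y, Fsf iota y -> K0 y) ->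
  finite_over_F iota K0 -> separable_over_F iota K0 -> (0 < n)%N -> prime l ->
  exists C : nat, (0 < C)%N /\ forall (pi : {poly Fq}) (K : sfield Om), irreducible_poly pi ->
    (C < (size pi).-1)%N -> ext_degree K0 K n -> forall c, in_D iota K r1.+1 pi c ->
    exists k, [/\ (0 < k)%N, (logn l k <= logn l n)%N & (r1.+1 %| k * p ^ r1.+1)%N].
Proof.
move=> FK0 finK0 sepK0 n0 pl.
have pp : prime p := pcharf_prime chp.
have [t0] := theta_ex chp ac FK0 finK0 sepK0.
have [Bd [kBd Bd0 hBd]] := good_ex chp ac (th_inj (t0 := t0)).
have [eB eB0 heB] := roots_constants Bd0 kBd.
have [sK0 [sK0K sK0s]] := finK0.
(* Clears denominators on [K] of valuations integral on [F]: [K] is spanned over [F] by products of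
   a basis over [K0] with generators of [K0]. *)
pose e0 := (#|{: 'I_n * 'I_(size sK0)}|)`!%N.
pose H0 := ((q ^ r1.+1)`! * e0)%N.
have H00 : (0 < H0)%N by rewrite muln_gt0 !fact_gt0.
pose h := totient (H0`_p^')%N.
have h0 : (0 < h)%N by rewrite totient_gt0 part_gt0.
pose m1 := (te t0 * h)%N.
have m10 : (0 < m1)%N by rewrite muln_gt0 te_gt0.
(* For [m = 2 m1 k], [A2 k] is the quantity [r n H0 m] to be kept below [d]; [m1] makes [m]
   divisible by [te t0] and by every divisor of [h]. *)
pose A2 := (r1.+1 * n * H0 * (m1 + m1))%N.
have rnH : (0 < r1.+1 * n * H0)%N by rewrite muln_gt0 H00 muln_gt0 n0.
have A20 : (0 < A2)%N by rewrite muln_gt0 rnH addn_gt0 m10.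
pose G0 := ((td t0).+1 * q ^ h)%N.
pose W := (thw t0 * (td t0).+1 + A2 * q ^ h)%N.
pose Kc := (G0`! * (G0 * (W + (4 * G0 * W + 6 + W))) + 4 * G0 * (W + thC t0 + 2) +
     2 * G0 * (G0 * (1 + (4 * G0 * W + 6) + 2 * W) + size Bd + q))%N.
have [k1 hk1] := lin_lt_exp Kc.
(* The first summand makes [k] large enough for the Stepanov estimates, the second keeps [x0] away
   from the zeros of [Bd]. *)
exists (A2 * k1.+1 + eB)%N; split; first by rewrite addn_gt0 eB0 orbT.
move=> pi K ir dC extK c [hdr hD1 hD2]; set d := (size pi).-1 in dC *.
have d0 : (0 < d)%N by apply: leq_ltn_trans dC.
have [x0 r0] := evq_root_ex iota ir.
have Bdx0 : Bd.[x0] != 0.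
  apply/eqP => /heB; apply/eqP; apply: (x0_order chp ir r0); rewrite eB0 /=.
  by apply: leq_ltn_trans dC; exact: leq_addl.
pose g := gcdn h d.
have g0 : (0 < g)%N by rewrite gcdn_gt0 h0.
have dE : d = (g * (d %/ g))%N by rewrite mulnC divnK // dvdn_gcdr.
have gh : (g <= h)%N by rewrite dvdn_leq // dvdn_gcdl.
have kk0 := kk_gt0 chp ir dE.
have [u hu] := nth_root_ex (DD Fq x0 g (d %/ g)).[iA iota 'X] kk0.
(* With this choice the weights are bounded linearly in [k], whereas [q^s] is exponential in [k]. *)
pose k := (d.-1 %/ A2)%N.
have kd1 : (A2 * k <= d.-1)%N by rewrite mulnC leq_divM.
have kd2 : (d <= A2 * k.+1)%N.
  by rewrite -(prednK d0); have := ltn_ceil d.-1 A20; rewrite -/k mulnC.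
have k1k : (k1.+1 <= k)%N.
  rewrite /k leq_divRL //; rewrite mulnC -ltnS prednK //.
  by apply: leq_ltn_trans dC; exact: leq_addr.
pose s := (m1 * k)%N.
have kks : (kexp Fq g <= q ^ h)%N.
  apply: leq_trans (leq_pred _) _; by rewrite leq_exp2l.
have omW : (om t0 pi g <= W * k.+1)%N.
  rewrite /om /W mulnDl; apply: leq_add; first by rewrite leq_pmulr.
  rewrite mulnAC; exact: leq_mul.
pose G := ((td t0).+1 * kexp Fq g)%N.
have GG0 : (G <= G0)%N by rewrite leq_mul2l kks orbT.
have G_gt0 : (0 < G)%N by rewrite muln_gt0 kk0.
have Qbig : (Kc * k.+1 < q ^ s)%N.
  apply: leq_trans (hk1 k (ltnW k1k)) _; apply: leq_trans (_ : q ^ k <= _)%N.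
    by rewrite leq_exp2r // (leq_trans _ k1k).
  by rewrite leq_exp2l // leq_pmull.
have [num1 num2 num3] := stepanov_numerics G_gt0
   (leq_ltn_trans (leq_numerics (thC t0) (size Bd) q (ltn0Sn k) GG0 omW) Qbig).
have k0 : (0 < k)%N by apply: leq_trans k1k.
have s0 : (0 < s)%N by rewrite muln_gt0 m10.
have te_s : (te t0 %| s + s)%N by rewrite dvdn_add // /s /m1 -mulnA dvdn_mulr.
have g_s : (g %| s + s)%N by rewrite dvdn_add // /s /m1 mulnAC dvdn_mull // dvdn_gcdl.
have A2s : (r1.+1 * n * H0 * (s + s) < d)%N.
  rewrite -(prednK d0) ltnS; apply: leq_trans kd1.
  by rewrite /A2 /s -mulnDl mulnA.
have sd : (s + s < d)%N.
  by apply: leq_ltn_trans A2s; rewrite leq_pmull.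
rewrite -expnD in num3.
have [ql [x [P [s1 [[ml il sl rl qP] [bs1 K0s1 Fs1 fs1 pw]]]]]] :=
  split_prime ac ir r0 dE Bd0 hBd Bdx0 hu erefl s0 te_s g_s sd num1 num2 num3.
have aK0 : algo K0 := algo_sub FK0 (algoF ac).
have degK : degr K0 K n.
  by case: extK => K0K [b [bK [sb ib]]]; split => //; exists b; split.
(* The conjugate of [K] under [g1] is fixed by [s1^k']. Conjugating back, [s3] fixes [K], and the
   place is composed with [g1] accordingly. *)
have [g1 [k' [g1a /andP [k'0 k'n] logk hk']]] := orbit_conj pl aK0 degK (conj bs1 K0s1).
exists k'; split => //.
have [g1' [g1'a cg1 cg2]] := aut_inv g1a.
have [st [sta est]] := aut_iter k' (conj bs1 K0s1 : autL K0 s1).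
have [s2 [s2a es2]] := aut_comp sta g1a.
have [s3 [s3a es3]] := aut_comp g1'a s2a.
have [P' hP'] := place_comp P g1.
have K0K : forall y, K0 y -> K y by case: extK.
have FK y : Fsf iota y -> K y by move/FK0/K0K.
have g1F y : Fsf iota y -> g1 y = y by move/FK0; exact: g1a.2.
have es3' y : s3 y = g1' (iter k' s1 (g1 y)) by rewrite es3 /= es2 /= est.
have s3K : autL K s3.
  by split; [exact: s3a.1|move=> y Ky; rewrite es3' hk' // cg1].
have qP' : qplace iota P' x.
  move=> a; have [h1 h2] := qP a; have [h3 h4] := hP' (iA iota a).
  by rewrite h4; split; first apply/h3; rewrite g1F //; exact: F_iA.
have hden (P0 : place Om) (w : Om -> rat) : valn P0 w ->
   (forall c, Fsf iota c -> c != 0 -> exists a : int, w c = a%:~R) ->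
   forall y, K y -> y != 0 -> exists a : int, e0%:R * w y = a%:~R.
  move=> hw iE0.
  case: degK => _ [b [Kb sb _]].
  apply: (@denom Om P0 w (Fsf iota) hw iE0 K _ (fun ki : 'I_n * 'I_(size sK0) => sK0`_ki.2 * b ki.1)).
    by move=> y N; exact: sfX.
  move=> y /sb [cc [Kcc ->]].
  have [cf hcf] := choice (fun i => sK0s (cc i) (Kcc i)).
  exists (fun ki => iota (cf ki.1 (nat_of_ord ki.2))); split; first by move=> ki; exists (cf ki.1 ki.2).
  rewrite -(pair_bigA _ (fun (i : 'I_n) (j : 'I_(size sK0)) => iota (cf i j) * (sK0`_j * b i))) /=.
  by apply: eq_bigr => i _; rewrite {1}hcf mulr_suml; apply: eq_bigr => j _; rewrite mulrA.
have aK : algo K := algo_sub K0K aK0.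
have fs3 y : pO P' y -> pO P' (s3 y) /\ pf P' (s3 y) = pf P' y ^+ (q ^ ((size ql).-1 * k')).
  move=> /(hP' y).1 Oy; rewrite sl /= expnM.
  have [h1 h2] := iter_frob k' fs1 Oy; have [h3 h4] := hP' (s3 y).
  split; first by apply/h3; rewrite es3' cg2.
  by rewrite h4 (hP' y).2 -h2 es3' cg2.
apply: (small_prime_dvd chp ac aK FK (fact_gt0 _) hden ir r0 hdr hD1 hD2 il ml rl qP' s3K k'0 fs3).
- rewrite sl /=; apply: leq_ltn_trans A2s; rewrite -/e0 -/H0.
  have -> : (r1.+1 * n * H0 * (s + s) = r1.+1 * ((s + s) * n * H0))%N by ring.
  by rewrite leq_mul2l leq_mul2r leq_mul2l k'n !orbT.
- apply: leq_trans (leq_pmulr _ (fact_gt0 _)); apply: leq_trans (fact_geq _).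
  by rewrite leq_exp2r // dvdn_leq ?p_dvd_q // ltnW.
- exact: (evq_pow_eq H00 d0 erefl pw).
Qed.

End Final.

Theorem theorem4p10
  (Fq : finFieldType) (p : nat) (Om : closedFieldType)
  (iota : {rmorphism {fraction {poly Fq}} -> Om})
  (K0 : Om -> Prop) (n r r0 nu : nat) :
  prime p -> p \in [pchar Fq] ->
  is_alg_closure iota ->
  is_subfield iota K0 -> finite_over_F iota K0 -> separable_over_F iota K0 ->
  (0 < n)%N -> r = (r0 * p ^ nu)%N -> (1 < r0)%N -> coprime r0 p ->
  ~~ (r0 %| n)%N ->
  exists C : nat, (0 < C)%N /\
    forall (pi : {poly Fq}) (K : Om -> Prop),
      pi \is monic -> irreducible_poly pi -> (C < (size pi).-1)%N ->
      is_subfield iota K -> ext_degree K0 K n ->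
      forall c : seq Om, ~ in_D iota K r pi c.
Proof.
move=> pp chp ac hK0 finK0 sepK0 n0 er r01 cop ndvd.
have r00 : (0 < r0)%N by exact: ltnW.
(* A prime witnessing that [r0] does not divide [n]: a [k] divisible by [r0] has larger [l]-adic
   valuation than [n]. *)
have [l [pl ltl]] : exists l, prime l /\ (logn l n < logn l r0)%N.
  apply: contrapT => no; move/negP: ndvd; apply.
  apply/(dvdn_partP _ r00) => l; rewrite mem_primes => /and3P [pl _ _].
  rewrite p_part pfactor_dvdn // leqNgt; apply/negP => lt.
  by apply: no; exists l.
have rpos : (0 < r)%N by rewrite er muln_gt0 r00 expn_gt0 prime_gt0.
have FK0 y : Fsf iota y -> K0 y by case=> f ->; case: hK0.
have [L0 eL0] := subfield_sfield hK0.
rewrite -(prednK rpos) in er *; move: r.-1 er => r1 er {r rpos}; subst K0.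
have [C [C0 hC]] := large_degree chp ac r1 FK0 finK0 sepK0 n0 pl.
exists C; split => // pi K _ ir dC hK extK c; have [L eL] := subfield_sfield hK; subst K.
move=> inD; have [k [k0 logk dvd]] := hC pi L ir dC extK c inD.
(* [r0] is prime to [p], so the [p]-power coming from the unipotent part drops out. *)
have : (r0 %| k)%N.
  rewrite -(@Gauss_dvdl r0 k (p ^ r1.+1)) ?coprimeXr //.
  by apply: dvdn_trans dvd; rewrite er dvdn_mulr.
move/(dvdn_leq_log l k0); apply/negP; rewrite -ltnNge.
exact: leq_ltn_trans logk ltl.
Qed.
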